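(* Let $k_\alpha>0$ for all $\alpha\in R$. For each $a_i\in\sigma(\tilde H_0)$ there exists $p_i>0$ such that for all $p$ with $-p_i<p<p_i$, the (total) dimension of the eigenspaces of $\tilde T(p)$ belonging to eigenvalues $\zeta$ with $|\zeta-a_i|\le W_{\max}(p)$ is equal to the dimension $m$ of the eigenspace of $\tilde H_0$ with eigenvalue $a_i$. Moreover these eigenvalues and eigenfunctions depend on $p$ real-holomorphically: there are real-analytic functions $E_1,\dots,E_m:(-p_i,p_i)\to\mathbb R$ and real-analytic maps $\phi_1,\dots,\phi_m:(-p_i,p_i)\to L^2(T,\Delta^2d\mu)^W$ such that for every $p\in(-p_i,p_i)$ one has $\tilde T(p)\phi_l(p)=E_l(p)\phi_l(p)$ and $\phi_1(p),\dots,\phi_m(p)$ is a basis of the sum of the eigenspaces of $\tilde T(p)$ belonging to eigenvalues $\zeta$ with $|\zeta-a_i|\le W_{\max}(p)$.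
   Context: Let $R$ be a reduced crystallographic root system in the Euclidean space $\mathfrak h_{\mathbb R}^*$ dual to $\mathfrak h_{\mathbb R}$, with pairing $\langle\cdot,\cdot\rangle$, Weyl-invariant inner product $(\cdot|\cdot)$, $|\alpha|^2=(\alpha|\alpha)$, positive roots $R_+$, Weyl group $W$, coroot lattice $Q^\vee$, weight lattice $P$, dominant weights $P_+$, and $Q_+$ the $\mathbb Z_{\ge0}$-span of $R_+$. Let $T=\mathfrak h_{\mathbb R}/2\pi Q^\vee$ with normalized Haar measure $\mu$. The coupling constants $k_\alpha$ are real and $W$-invariant. Put $\Delta(h)=\prod_{\alpha\in R_+}|\sin(\langle\alpha,h\rangle/2)|^{k_\alpha}$, $\rho(k)=\frac12\sum_{\alpha\in R_+}k_\alpha\alpha$, $e_0=\frac1{12}\sum_{\alpha\in R_+}k_\alpha(k_\alpha-1)|\alpha|^2$. The Hilbert space is $L^2(T,\Delta^2d\mu)^W$ ($W$-invariant functions) with $(f,g)_\Delta=\int_T\overline f g\,\Delta^2d\mu$. Let $e^\lambda(h)=e^{\sqrt{-1}\langle\lambda,h\rangle}$ ($\lambda\in P$), $\mathbb C[P]$ their span, $\mathbb C[P]^W$ the $W$-invariants, $m_\lambda=\sum_{\nu\in W\lambda}e^\nu$. The Jacobi polynomials $J_\lambda$ ($\lambda\in P_+$) are the basis of $\mathbb C[P]^W$ with $J_\lambda=m_\lambda+\sum_{\nu\prec\lambda}u_{\lambda\nu}m_\nu$ (where $\nu\preceq\lambda$ iff $\lambda-\nu\in Q_+$) and $(J_\lambda,J_\nu)_\Delta=0$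 for $\lambda\ne\nu$. Let $\mathcal H_T=-L+\sum_{\alpha\in R_+}k_\alpha(k_\alpha-1)|\alpha|^2\bigl(\frac1{4\sin^2(\langle\alpha,h\rangle/2)}-\frac1{12}\bigr)$ with $L$ the Laplacian on $T$, and $H_0=\Delta^{-1}\mathcal H_T\Delta$ with domain $\mathbb C[P]^W$; it satisfies $H_0J_\lambda=E_\lambda J_\lambda$ with $E_\lambda=(\lambda+\rho(k)|\lambda+\rho(k))-e_0$. Let $\wp$ be the Weierstrass function with periods $2\pi,2\pi\tau$, $p=e^{2\pi\sqrt{-1}\tau}$, and let $W(p)$ be multiplication by $$\sum_{\alpha\in R_+}k_\alpha(k_\alpha-1)|\alpha|^2\Bigl(\wp(\langle\alpha,h\rangle)-\tfrac1{4\sin^2(\langle\alpha,h\rangle/2)}+\tfrac1{12}\Bigr)=-2\sum_{\alpha\in R_+}k_\alpha(k_\alpha-1)|\alpha|^2\sum_{n\ge1}\frac{np^n}{1-p^n}(\cos n\langle\alpha,h\rangle-1),$$ a bounded operator, with $W(0)=0$. Put $T(p)=H_0+W(p)$ on $\mathbb C[P]^W$ (the gauge-transformed elliptic Calogero–Moser Hamiltonian); $\tilde T(p)$ denotes its closure and $\tilde H_0=\tilde T(0)$, whose spectrum is the discrete set $\sigma(\tilde H_0)=\{E_\lambda:\lambda\in P_+\}$. For $-1<p<1$, $\tilde T(p)$ is self-adjoint. Finally $$W_{\max}(p)=4\sum_{n\ge1}\frac{n|p|^n}{1-|p|^n}\cdot\sum_{\alpha\in R_+}|k_\alpha(k_\alpha-1)|\,|\alpha|^2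 .$$ *)

(* Defs.v *)
From HB Require Import structures.
From mathcomp Require Import all_boot all_order all_algebra.
From mathcomp Require Import finmap.
From mathcomp Require Import all_classical all_reals all_analysis.
From mathcomp Require Import complex.

Set Implicit Arguments.
Unset Strict Implicit.
Unset Printing Implicit Defensive.

Import Order.TTheory GRing.Theory Num.Theory.
Import numFieldNormedType.Exports.

Local Open Scope classical_set_scope.
Local Open Scope ring_scope.
Local Open Scope complex_scope.

(* The n-fold power of the uniform probability on [0, 1]. *)
Section cube.
Context (R : realType).
Local Notation mR := (measurableTypeR R).

Definition tcons n (x : mR * n.-tuple mR) : n.+1.-tuple mR :=
  [the n.+1.-tuple mR of x.1 :: x.2].

Lemma measurable_tcons n : measurable_fun [set: mR * n.-tuple mR] (@tcons n).
Proof. by apply: measurable_cons; [exact: measurable_fst|exact: measurable_snd]. Qed.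

HB.instance Definition _ n :=
  isMeasurableFun.Build _ _ _ _ (@tcons n) (@measurable_tcons n).

Fixpoint cube n : probability (n.-tuple mR) R :=
  match n with
  | 0 => dirac [tuple of [::]]
  | m.+1 => distribution (uniform_prob (@ltr01 R) \x cube m)%E (@tcons m)
  end.

End cube.

(* An n-dimensional Euclidean space h_R^* is 'rV[R]_n with a Gram matrix G,
   its dual h_R is 'cV[R]_n, and the pairing is the matrix product. *)
Section root_systems.
Context (R : realType) (n : nat) (G : 'M[R]_n).
Implicit Types (l a : 'rV[R]_n) (h : 'cV[R]_n) (Phi : {fset 'rV[R]_n}).

Definition pairing l h : R := (l *m h) 0 0.

Definition dotp l1 l2 : R := (l1 *m G *m l2^T) 0 0.

Definition inner_product :=
  G^T = G /\ forall l, l != 0 -> 0 < dotp l l.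

(* <l, coroot a> = 2 (l|a) / (a|a) *)
Definition coroot a : 'cV[R]_n := (2 / dotp a a) *: (G *m a^T).

(* This matrix acts on h_R by h |-> h - <a, h> a^v (left multiplication) and
   on h_R^* by l |-> l - <l, a^v> a (right multiplication). *)
Definition reflection a : 'M[R]_n := 1%:M - coroot a *m a.

Definition weyl_group Phi : set 'M[R]_n :=
  [set w | exists2 s : seq 'rV[R]_n, {subset s <= Phi} &
             w = \big[mulmx/1%:M]_(a <- s) reflection a].

Definition root_system Phi :=
  [/\ 0 \notin Phi,
      forall l, exists c : 'rV[R]_n -> R, l = \sum_(a <- Phi) c a *: a,
      forall a b, a \in Phi -> b \in Phi -> a *m reflection b \in Phi,
      forall a b, a \in Phi -> b \in Phi -> pairing a (coroot b) \is a Num.int &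
      forall a (c : R), a \in Phi -> c *: a \in Phi -> c = 1 \/ c = -1].

Definition positive_system Phi (Phi_plus : {fset 'rV[R]_n}) :=
  exists h : 'cV[R]_n,
    (forall a, a \in Phi -> pairing a h != 0) /\
    (forall a, (a \in Phi_plus) = (a \in Phi) && (0 < pairing a h)).

Definition coroot_lattice Phi : set 'cV[R]_n :=
  [set q | exists c : 'rV[R]_n -> int, q = \sum_(a <- Phi) (c a)%:~R *: coroot a].

Definition weight_lattice Phi : set 'rV[R]_n :=
  [set l | forall a, a \in Phi -> pairing l (coroot a) \is a Num.int].

Definition lattice_basis (B : 'M[R]_n) (Q : set 'cV[R]_n) :=
  B \in unitmx /\
  forall q, Q q <-> exists z : 'cV[int]_n, q = B *m map_mx intr z.

End root_systems.

(* cm_basis is any Z-basis of the coroot lattice; it only serves to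
   parametrize the torus T = h_R / 2 pi Q^v, see torus_pt. *)
Record cm_data (R : realType) (n : nat) := CMData {
  cm_gram : 'M[R]_n;
  cm_gramP : inner_product cm_gram;
  cm_roots : {fset 'rV[R]_n};
  cm_rootsP : root_system cm_gram cm_roots;
  cm_pos_roots : {fset 'rV[R]_n};
  cm_pos_rootsP : positive_system cm_roots cm_pos_roots;
  cm_coupling : 'rV[R]_n -> R;
  cm_couplingP : forall a w, a \in cm_roots -> weyl_group cm_gram cm_roots w ->
    cm_coupling (a *m w) = cm_coupling a;
  cm_basis : 'M[R]_n;
  cm_basisP : lattice_basis cm_basis (coroot_lattice cm_gram cm_roots)
}.

Section calogero_moser.
Context (R : realType) (n : nat) (D : cm_data R n).

Local Notation C := R[i].
Local Notation hR := 'cV[R]_n.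
Local Notation fn := (hR -> C).
Local Notation Phi := (cm_roots D).
Local Notation Phi_plus := (cm_pos_roots D).
Local Notation k := (cm_coupling D).
Local Notation sqnorm a := (dotp (cm_gram D) a a).

Implicit Types (f g u : fn) (h : hR) (p : R) (z : C).

(* Functions on T are functions on h_R periodic under 2 pi Q^v. *)
Definition torus_fun f :=
  forall h q, coroot_lattice (cm_gram D) Phi q -> f (h + (2 * pi) *: q) = f h.

Definition weyl_invariant f :=
  forall w h, weyl_group (cm_gram D) Phi w -> f (w *m h) = f h.

Definition torus_pt (x : n.-tuple (measurableTypeR R)) : hR :=
  (2 * pi) *: (cm_basis D *m \col_i tnth x i).

Definition Delta h : R :=
  \prod_(a <- Phi_plus) (`|sin (pairing a h / 2)| `^ k a).

(* (f, f)_Delta, the normalized Haar measure of T being the image of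
   cube n under torus_pt. *)
Definition L2_sqnorm f : \bar R :=
  (\int[cube R n]_x (Normc.normc (f (torus_pt x)) ^+ 2 * Delta (torus_pt x) ^+ 2)%:E)%E.

(* Representatives of the elements of L^2(T, Delta^2 dmu)^W. Two of them
   represent the same element when L2_sqnorm (f - g) = 0; the notions below
   are all compatible with this identification. *)
Definition L2W : set fn := [set f |
  [/\ torus_fun f, weyl_invariant f,
      measurable_fun setT (fun x => complex.Re (f (torus_pt x))),
      measurable_fun setT (fun x => complex.Im (f (torus_pt x))) &
      (L2_sqnorm f < +oo)%E]].

Definition L2_cvg (u : nat -> fn) f :=
  L2_sqnorm (u j - f) @[j --> \oo] --> 0%E.

Definition expw (l : 'rV[R]_n) : fn :=
  fun h => cos (pairing l h) +i* sin (pairing l h).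

(* C[P]^W *)
Definition CPW : set fn := [set f | weyl_invariant f /\
  exists (s : seq 'rV[R]_n) (c : 'rV[R]_n -> C),
    (forall l, l \in s -> weight_lattice (cm_gram D) Phi l) /\
    f = (fun h => \sum_(l <- s) c l * expw l h)].

(* The Gram matrix of h_R^* is the inverse of the metric of h_R, so that this
   is the Laplacian of h_R: it maps expw l to - (l|l) expw l. *)
Definition laplacian_re (F : hR -> R) h : R :=
  \sum_i \sum_j cm_gram D i j *
    'D_(delta_mx i 0 : hR) (fun y => 'D_(delta_mx j 0 : hR) F y) h.

Definition laplacian f : fn := fun h =>
  laplacian_re (fun y => complex.Re (f y)) h +i*
  laplacian_re (fun y => complex.Im (f y)) h.

Definition strength (a : 'rV[R]_n) : R := k a * (k a - 1) * sqnorm a.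

Definition trig_potential h : R :=
  \sum_(a <- Phi_plus)
     strength a * ((4 * sin (pairing a h / 2) ^+ 2)^-1 - 12^-1).

Definition H_T f : fn := fun h => - laplacian f h + (trig_potential h)%:C * f h.

(* On the walls, a null set, Delta vanishes and so does the value of H_0 f. *)
Definition H_0 f : fn := fun h =>
  ((Delta h)^-1)%:C * H_T (fun y => (Delta y)%:C * f y) h.

(* Fourier expansion, valid for |p| < 1 with p = 0 included, of the sum over
   positive roots a of strength a * (wp(<a,h>) - 1/(4 sin^2(<a,h>/2)) + 1/12),
   where wp is the Weierstrass function of periods 2 pi and 2 pi tau,
   p = e^(2 pi i tau). *)
Definition W_potential p h : R :=
  - 2 * \sum_(a <- Phi_plus) strength a *
    limn (fun N => \sum_(1 <= j < N)
      j%:R * p ^+ j / (1 - p ^+ j) * (cos (j%:R * pairing a h) - 1)).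

Definition W_max p : R :=
  4 * limn (fun N => \sum_(1 <= j < N) j%:R * `|p| ^+ j / (1 - `|p| ^+ j)) *
  \sum_(a <- Phi_plus) `|k a * (k a - 1)| * sqnorm a.

Definition T_op p f : fn := fun h => H_0 f h + (W_potential p h)%:C * f h.

(* Graph of the closure of T(p) with domain C[P]^W; since elements of L^2 are
   handled through representatives, the graph contains (f, g) together with
   all pairs equal to it almost everywhere. *)
Definition T_closure p : set (fn * fn) := [set fg |
  [/\ L2W fg.1, L2W fg.2 & exists u : nat -> fn,
    [/\ forall j, CPW (u j), L2_cvg u fg.1 &
        L2_cvg (fun j => T_op p (u j)) fg.2]]].

(* z is in the resolvent set when (closure of T(p)) - z maps its domain onto
   L^2 with a bounded inverse; the bound entails injectivity. *)
Definition T_resolvent_set p : set C := [set z |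
  (forall g, L2W g -> exists2 f, L2W f &
     T_closure p (f, (fun h => g h + z * f h))) /\
  exists K : R, forall f g, T_closure p (f, g) ->
    (L2_sqnorm f <= K%:E * L2_sqnorm (fun h => (g h - z * f h)%R))%E].

Definition T_spectrum p : set C := ~` T_resolvent_set p.

Definition T_eigenspace p z : set fn :=
  [set f | T_closure p (f, (fun h => z * f h))].

(* Sum of the eigenspaces belonging to eigenvalues in the disk |z - a| <= d. *)
Definition eigenspaces_near p (a : C) (d : R) : set fn := [set f |
  exists (N : nat) (z : 'I_N -> C) (v : 'I_N -> fn),
    [/\ forall i, `|z i - a| <= d%:C, forall i, T_eigenspace p (z i) (v i) &
        f = (fun h => \sum_i v i h)]].

Definition is_basis m (e : 'I_m -> fn) (S : set fn) :=
  [/\ forall i, S (e i),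
      forall c : 'I_m -> C,
        L2_sqnorm (fun h => \sum_i c i * e i h) = 0%E -> forall i, c i = 0 &
      forall f, S f -> exists c : 'I_m -> C,
        L2_sqnorm (fun h => f h - \sum_i c i * e i h) = 0%E].

Definition has_dim (S : set fn) (m : nat) := exists e : 'I_m -> fn, is_basis e S.

Definition real_analytic (r : R) (E : R -> R) :=
  forall p, - r < p < r -> exists (c : nat -> R) (eps : R), 0 < eps /\
    forall q, `|q - p| < eps ->
      (\sum_(0 <= j < N) (q - p) ^+ j * c j) @[N --> \oo] --> E q.

Definition L2W_analytic (r : R) (phi : R -> fn) :=
  (forall p, - r < p < r -> L2W (phi p)) /\
  forall p, - r < p < r -> exists (c : nat -> fn) (eps : R),
    [/\ 0 < eps, forall j, L2W (c j) & forall q, - r < q < r -> `|q - p| < eps ->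
      L2_cvg (fun N h => \sum_(0 <= j < N) ((q - p) ^+ j)%:C * c j h) (phi q)].

End calogero_moser.

(* Main.v *)
(* The potential [W(p)] is a power series in [p] of bounded multiplication operators, so
   the problem is analytic perturbation theory for an isolated eigenvalue [a] of finite
   multiplicity.  On trigonometric polynomials [H_0] is symmetric (Green's formula with the
   weight [Delta^2]) and preserves the span of the orbit sums of bounded norm, hence it is
   diagonalized by finite-dimensional linear algebra, with a gap around [a] and a bounded
   reduced resolvent.  A Riccati equation then gives, as a convergent power series, the
   graph [u + X p] of the perturbed eigenspace over the unperturbed one.  The operator
   restricted to that graph is an analytic family of matrices that is self-adjoint for an
   analytic inner product, which Rellich's theorem diagonalizes analytically.  The gap
   localizes the remaining spectrum, away from the disk of radius [W_max p] about [a]. *)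

Require Import Defs.
From HB Require Import structures.
From mathcomp Require Import all_boot all_order all_algebra finmap.
From mathcomp Require Import all_classical all_reals all_analysis complex.
From mathcomp Require Import measurable_realfun.
From mathcomp Require Import ring lra zify.

Set Implicit Arguments.
Unset Strict Implicit.
Unset Printing Implicit Defensive.

Import Order.TTheory GRing.Theory Num.Theory.
Import numFieldNormedType.Exports.

Local Open Scope classical_set_scope.
Local Open Scope ring_scope.
Local Open Scope complex_scope.

Import Normc.
Local Notation Re := complex.Re.
Local Notation Im := complex.Im.

(** * Power series with values in a normed space *)

(** Neither the Jacobi polynomials nor the values E_lambda are constructed. What is used of H_0 is
    its symmetry, the invariance of the filtration by the norm of the weights, and the fact that an
    eigenvalue at most b confines the eigenvector to weights with |l|^2 <= b - kc. Positivity of the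
    couplings enters there (the diagonal entry at a weight of maximal norm is at least |l|^2 + kc),
    in the bound Delta <= 1, and in Green's formula, where Delta^2 has to vanish on the walls. Since
    Delta^2 is not a polynomial for general k, integration by parts is done on polynomials only,
    with weights exp(g_N) that tend to Delta^2 and are themselves limits of partial sums. There are
    no contour integrals: convergence comes from majorants, and every remainder is controlled by a
    geometric bound. The disc of radius W_max(p) leaves no room for a constant: the eigenvalues have
    to move by at most the bound of W(p) itself. This comes from splitting an eigenvector
    orthogonally along the unperturbed eigenspace rather than from a resolvent estimate. *)

Section big_nat_aux.
Variable V : zmodType.

Lemma sum_triangle (F : nat -> nat -> V) N :
  \sum_(K < N) \sum_(j < K.+1) F j (K - j)%N =
  \sum_(j < N) \sum_(i < N - j) F j i.
Proof.
elim: N => [|N IH]; first by rewrite !big_ord0.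
rewrite big_ord_recr/= IH [RHS]big_ord_recr/= subSnn big_ord1.
under [in RHS]eq_bigr => j _ do rewrite subSn ?(ltnW (ltn_ord j))// big_ord_recr/=.
by rewrite big_split/= -addrA [in LHS]big_ord_recr/= subnn.
Qed.

End big_nat_aux.

Lemma ler_exp (R : realType) n (x y : R) : 0 <= x -> x <= y -> x ^+ n <= y ^+ n.
Proof. by move=> x0 xy; rewrite lerXn2r ?nnegrE// (le_trans x0). Qed.

(** * Weighted partial sums, the majorants of the convergence proofs *)

Section wsum.
Variable R : realType.
Implicit Types (a b : nat -> R) (r : R).

Definition wsum r a N : R := \sum_(j < N) a j * r ^+ j.

Lemma wsum_ge0 r a N : 0 <= r -> (forall j, 0 <= a j) -> 0 <= wsum r a N.
Proof. by move=> r0 a0; apply: sumr_ge0 => j _; rewrite mulr_ge0// exprn_ge0. Qed.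

Lemma ler_wsum r a b N : 0 <= r -> (forall j, (j < N)%N -> a j <= b j) ->
  wsum r a N <= wsum r b N.
Proof.
by move=> r0 ab; apply: ler_sum => j _; rewrite ler_wpM2r ?exprn_ge0 ?ab.
Qed.

Lemma wsumD r a b N : wsum r (fun j => a j + b j) N = wsum r a N + wsum r b N.
Proof. by rewrite -big_split; apply: eq_bigr => j _; rewrite mulrDl. Qed.

Lemma wsumZ r a N c : wsum r (fun j => c * a j) N = c * wsum r a N.
Proof. by rewrite /wsum mulr_sumr; apply: eq_bigr => j _; rewrite mulrA. Qed.

(** The left side sums the products of degree [j + i < N], a triangle inside the square summed on
    the right, and all terms are nonnegative. This makes the weighted sum behave like the norm of a
    Banach algebra. *)
Lemma wsum_conv r a b N : 0 <= r -> (forall j, 0 <= a j) -> (forall j, 0 <= b j) ->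
  wsum r (fun K => \sum_(j < K.+1) a j * b (K - j)%N) N <= wsum r a N * wsum r b N.
Proof.
move=> r0 a0 b0.
rewrite /wsum (_ : \sum_(j < N) _ * r ^+ j =
  \sum_(j < N) \sum_(i < N - j) (a j * r ^+ j) * (b i * r ^+ i)); last first.
  rewrite -(sum_triangle (fun j i => (a j * r ^+ j) * (b i * r ^+ i))).
  apply: eq_bigr => K _; rewrite mulr_suml; apply: eq_bigr => j _.
  have -> : r ^+ K = r ^+ j * r ^+ (K - j).
    by rewrite -exprD subnKC// -ltnS.
  ring.
rewrite mulr_suml ler_sum// => j _; rewrite mulr_sumr.
rewrite -(big_mkord predT (fun i => (a j * r ^+ j) * (b i * r ^+ i))).
rewrite -(big_mkord predT (fun i => (a j * r ^+ j) * (b i * r ^+ i))).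
rewrite [leRHS](@big_cat_nat _ _ _ (N - j))//= ?leq_subr// lerDl.
by rewrite sumr_ge0// => i _; rewrite !mulr_ge0 ?exprn_ge0.
Qed.

Lemma wsum_geo M rho r N : 0 <= M -> 0 <= rho -> 0 <= r -> rho * r <= 1/2 ->
  wsum r (fun j => if j is 0 then 0 else M * rho ^+ j) N <= 2 * M * (rho * r).
Proof.
move=> M0 rho0 r0 h.
have x0 : 0 <= rho * r by rewrite mulr_ge0.
(* The subtracted power is what lets the induction close for ratios up to 1/2. *)
have H K : \sum_(j < K) (rho * r) ^+ j.+1 <= 2 * (rho * r) - 2 * (rho * r) ^+ K.+1.
  elim: K => [|K IH]; first by rewrite big_ord0 expr1 subrr.
  rewrite big_ord_recr/=; apply: (le_trans (lerD IH (lexx _))).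
  rewrite -subr_ge0 [X in 0 <= X](_ : _ = (rho * r) ^+ K.+1 * (1 - 2 * (rho * r))).
    by rewrite mulr_ge0 ?exprn_ge0//; lra.
  by rewrite ![(rho * r) ^+ _.+1]exprS; ring.
case: N => [|N]; first by rewrite /wsum big_ord0 !mulr_ge0.
rewrite /wsum big_ord_recl/= mul0r add0r.
rewrite (_ : \sum_(i < N) _ = M * \sum_(i < N) (rho * r) ^+ i.+1).
  rewrite [2 * M]mulrC -mulrA ler_wpM2l//.
  by apply: (le_trans (H N)); rewrite gerBl mulr_ge0 ?exprn_ge0.
by rewrite mulr_sumr; apply: eq_bigr => i _; rewrite /= exprMn mulrA.
Qed.

End wsum.

(** * Analytic germs with values in a complex vector space *)

Section vnorm.
Variables (R : realType) (E : lmodType R[i]) (nrm : E -> R).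

(** The norm is a bare function with a predicate, so that the same results serve matrices, finite
    families of vectors and the Hilbert space of classes. Nonnegativity follows from the triangle
    inequality, see [vnorm_ge0]. *)
Definition is_vnorm :=
  [/\ forall x, nrm x = 0 -> x = 0,
      forall x y, nrm (x + y) <= nrm x + nrm y &
      forall a x, nrm (a *: x) = normc a * nrm x].

Definition vcomplete := forall u : nat -> E,
  (forall e : R, 0 < e -> exists N, forall i j, (N <= i)%N -> (N <= j)%N ->
     nrm (u i - u j) <= e) ->
  exists x, forall e : R, 0 < e -> exists N, forall i, (N <= i)%N -> nrm (u i - x) <= e.

Definition pser (c : nat -> E) N (p : R) : E := \sum_(j < N) (p ^+ j)%:C *: c j.

(* [c] is the sequence of Taylor coefficients of [f] at 0: the geometric bound on
   the remainders, for all N at once, encodes convergence without any limit. *)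
Definition anac (c : nat -> E) (f : R -> E) := exists M rho : R,
  [/\ 0 <= M, 0 < rho & forall p N, rho * `|p| <= 1/2 ->
     nrm (f p - pser c N p) <= M * (rho * `|p|) ^+ N].

Hypothesis nrmP : is_vnorm.

Lemma vnorm_eq0 x : nrm x = 0 -> x = 0. Proof. by case: nrmP => + _ _; apply. Qed.
Lemma vnormD x y : nrm (x + y) <= nrm x + nrm y. Proof. by case: nrmP. Qed.
Lemma vnormZ a x : nrm (a *: x) = normc a * nrm x. Proof. by case: nrmP. Qed.
Lemma vnorm0 : nrm 0 = 0.
Proof. by rewrite -(scale0r 0) vnormZ normc0 mul0r. Qed.
Lemma normc_ge0 (a : R[i]) : 0 <= normc a.
Proof. by case: a => x y; exact: sqrtr_ge0. Qed.
Lemma normc_real (a : R) : normc (a%:C) = `|a|.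
Proof. by rewrite /= expr0n addr0 sqrtr_sqr. Qed.
Lemma vnormZR (a : R) x : nrm (a%:C *: x) = `|a| * nrm x.
Proof. by rewrite vnormZ normc_real. Qed.
Lemma vnormN x : nrm (- x) = nrm x.
Proof. by rewrite -scaleN1r -(rmorph1 (real_complex R)) -rmorphN vnormZR normrN1 mul1r. Qed.
Lemma vnorm_ge0 x : 0 <= nrm x.
Proof. by have := vnormD x (- x); rewrite subrr vnorm0 vnormN; lra. Qed.
Lemma vnormB x y : nrm (x - y) <= nrm x + nrm y.
Proof. by rewrite -(vnormN y) vnormD. Qed.
Lemma vnormBC x y : nrm (x - y) = nrm (y - x).
Proof. by rewrite -vnormN opprB. Qed.
Lemma vnorm_le x y : nrm x <= nrm (x - y) + nrm y.
Proof. by rewrite -{1}(subrK y x) vnormD. Qed.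
Lemma vnorm_tri y x z : nrm (x - z) <= nrm (x - y) + nrm (y - z).
Proof. by rewrite -{1}(subrK y x) -addrA vnormD. Qed.
Lemma vnorm_sum (I : Type) (r : seq I) (P : pred I) (F : I -> E) :
  nrm (\sum_(i <- r | P i) F i) <= \sum_(i <- r | P i) nrm (F i).
Proof.
elim/big_rec2: _ => [|i y1 y2 _ H]; first by rewrite vnorm0.
by apply: (le_trans (vnormD _ _)); rewrite lerD2l.
Qed.

Lemma geometric_small (K x e : R) : 0 <= x <= 1/2 -> 0 < e ->
  exists N, forall i, (N <= i)%N -> K * x ^+ i <= e.
Proof.
move=> /andP[x0 x1] e0; have : (K * x ^+ i) @[i --> \oo] --> K * 0.
  by apply: cvgM; [exact: cvg_cst|apply: cvg_expr; rewrite ger0_norm; lra].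
rewrite mulr0 => /cvgrPdist_le /(_ e e0) [N _ hN]; exists N => i /hN /=.
by rewrite sub0r normrN; apply: le_trans; exact: ler_norm.
Qed.

Lemma le_pow_eq0 (x M y : R) : 0 <= x <= 1/2 -> 0 <= y ->
  (forall N, y <= M * x ^+ N) -> y = 0.
Proof.
move=> hx y0 H; apply/eqP; rewrite eq_le y0 andbT; apply/ler_addgt0Pl => e e0; rewrite addr0.
by have [N hN] := geometric_small M hx e0; apply: le_trans (H N) (hN N (leqnn N)).
Qed.

(** Every pair of large enough constants works, so two germs can be compared with one common [M]
    serving both as factor and as rate. *)
Lemma anac_weaken c f : anac c f -> exists K : R, 0 < K /\ forall M rho : R, K <= M -> K <= rho ->
  forall p N, rho * `|p| <= 1/2 -> nrm (f p - pser c N p) <= M * (rho * `|p|) ^+ N.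
Proof.
move=> [M0 [r0 [hM hr H]]]; exists (Num.max M0 r0); split; first by rewrite lt_max hr orbT.
move=> M rho; rewrite !ge_max => /andP[h1 h2] /andP[h3 h4] p N h.
apply: le_trans (H p N _) _; first by apply: le_trans h; rewrite ler_wpM2r.
have xy : r0 * `|p| <= rho * `|p| by rewrite ler_wpM2r.
have x0 : 0 <= r0 * `|p| by rewrite mulr_ge0// ltW.
rewrite ler_pM ?exprn_ge0// lerXn2r// nnegrE//; exact: le_trans xy.
Qed.

Lemma eq_anac c f g : anac c f -> (exists2 r : R, 0 < r & forall p, `|p| < r -> f p = g p) ->
  anac c g.
Proof.
move=> /anac_weaken[K [K0 H]] [r r0 fg].
(* With a rate at least [r^-1], the condition on [p] in [anac] already forces [|p| < r]. *)
exists K, (Num.max K r^-1); split; [exact: ltW|by rewrite lt_max K0|].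
move=> p N hp; rewrite -fg; first by apply: H => //; rewrite le_max lexx.
have : r^-1 * `|p| <= 1/2 by apply: le_trans hp; rewrite ler_wpM2r// le_max lexx orbT.
rewrite ler_pdivrMl// => h; apply: (le_lt_trans h); lra.
Qed.

Lemma eq_coef_anac c d f : anac c f -> c =1 d -> anac d f.
Proof. by move=> H /funext <-. Qed.

Lemma anac_inj c f g : anac c f -> anac c g ->
  exists2 r : R, 0 < r & forall p, `|p| < r -> f p = g p.
Proof.
move=> /anac_weaken[K [K0 Hf]] /anac_weaken[L [L0 Hg]].
pose M := Num.max K L; have M0 : 0 < M by rewrite lt_max K0.
have KM : K <= M by rewrite le_max lexx.
have LM : L <= M by rewrite le_max lexx orbT.
exists (1/2 / M); first by rewrite divr_gt0.
move=> p hp; apply/subr0_eq/vnorm_eq0.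
have hp2 : M * `|p| <= 1/2 by rewrite mulrC -ler_pdivlMr// ltW.
apply: (@le_pow_eq0 (M * `|p|) (M + M)); [by rewrite hp2 mulr_ge0// ltW|exact: vnorm_ge0|].
move=> N; apply: (le_trans (vnorm_tri (pser c N p) _ _)).
by rewrite mulrDl lerD//; [apply: Hf|rewrite vnormBC; apply: Hg].
Qed.

Lemma pserS c N p : pser c N.+1 p = pser c N p + (p ^+ N)%:C *: c N.
Proof. by rewrite /pser big_ord_recr. Qed.

Lemma pser0 c p : pser c 0 p = 0. Proof. by rewrite /pser big_ord0. Qed.

(** The N-th term is the difference of the remainders of orders N and N + 1; it is evaluated at the
    single point [p = (2 * rho)^-1], the largest one allowed. *)
Lemma coef_bound c f M rho : 0 <= M -> 0 < rho ->
  (forall p N, rho * `|p| <= 1/2 -> nrm (f p - pser c N p) <= M * (rho * `|p|) ^+ N) ->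
  forall N, nrm (c N) <= 2 * M * rho ^+ N.
Proof.
move=> M0 r0 H N; pose p := (2 * rho)^-1.
have p0 : 0 < p by rewrite invr_gt0; lra.
have xp : rho * `|p| = 1/2 by rewrite gtr0_norm// /p invfM mulrCA mulfV ?gt_eqF// mulr1 mul1r.
have h1 := H p N; have h2 := H p N.+1; rewrite xp in h1 h2.
have := vnormB (f p - pser c N p) (f p - pser c N.+1 p).
rewrite opprB addrC addrA subrK {1}pserS addrAC subrr add0r vnormZR.
move/le_trans => /(_ _ (lerD (h1 (lexx _)) (h2 (lexx _)))).
rewrite normrX gtr0_norm// => h.
have pN : p ^+ N * rho ^+ N = (1/2) ^+ N.
  by rewrite -exprMn; congr (_ ^+ _); rewrite -xp gtr0_norm// mulrC.
have rN : 0 < rho ^+ N by rewrite exprn_gt0.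
have PN : 0 < p ^+ N by rewrite exprn_gt0.
rewrite -(ler_pM2l PN); apply: (le_trans h).
rewrite mulrCA pN exprS.
have : 0 <= (1/2 : R) ^+ N by rewrite exprn_ge0//; lra.
move=> q0; nra.
Qed.

Lemma anac_coef c f : anac c f -> exists K rho : R, [/\ 0 < K, 0 < rho & forall N, nrm (c N) <= K * rho ^+ N].
Proof.
move=> [M [rho [M0 r0 H]]]; exists (2 * M + 1), rho; split => //; first lra.
move=> N; apply: (le_trans (coef_bound M0 r0 H N)).
by rewrite ler_wpM2r ?exprn_ge0 ?ltW// ltrDl.
Qed.

Lemma anac0E c f : anac c f -> f 0 = c 0%N.
Proof.
move=> [M [rho [M0 r0 H]]]; apply/subr0_eq/vnorm_eq0.
have := H 0 1; rewrite normr0 mulr0 expr1 mulr0 => /(_ _) h.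
have {}h := h ltac:(lra).
rewrite /pser big_ord1 expr0 rmorph1 scale1r in h.
by apply/eqP; rewrite eq_le h vnorm_ge0.
Qed.

Lemma anac_lip c f : anac c f -> exists K r : R, [/\ 0 < K, 0 < r &
  forall p, `|p| < r -> nrm (f p - c 0%N) <= K * `|p|].
Proof.
move=> [M [rho [M0 r0 H]]]; exists (M * rho + 1), (1/2 / rho); split.
- by rewrite ltr_wpDl// mulr_ge0// ltW.
- by rewrite divr_gt0.
move=> p hp; have hp2 : rho * `|p| <= 1/2 by rewrite mulrC -ler_pdivlMr// ltW.
have := H p 1 hp2; rewrite /pser big_ord1 expr0 rmorph1 scale1r expr1 => h.
by apply: (le_trans h); rewrite mulrA ler_wpM2r// lerDl.
Qed.

Lemma anac_cst x : anac (fun j => if j is 0 then x else 0) (fun _ => x).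
Proof.
exists (nrm x), 1; split; rewrite ?vnorm_ge0// => p [|N] _.
  by rewrite pser0 subr0 expr0 mulr1.
rewrite /pser big_ord_recl/= expr0 rmorph1 scale1r big1 ?addr0 ?subrr ?vnorm0.
  by rewrite mulr_ge0 ?vnorm_ge0// exprn_ge0// mul1r.
by move=> i _; rewrite scaler0.
Qed.

Lemma pserD c d N p : pser (fun j => c j + d j) N p = pser c N p + pser d N p.
Proof. by rewrite -big_split; apply: eq_bigr => j _; rewrite scalerDr. Qed.

Lemma anacD c d f g : anac c f -> anac d g ->
  anac (fun j => c j + d j) (fun p => f p + g p).
Proof.
move=> /anac_weaken[K [K0 Hf]] /anac_weaken[L [L0 Hg]].
pose M := Num.max K L; have M0 : 0 < M by rewrite lt_max K0.
have KM : K <= M by rewrite le_max lexx.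
have LM : L <= M by rewrite le_max lexx orbT.
exists (M + M), M; split => // [|p N hp]; first by rewrite addr_ge0 ?ltW.
rewrite pserD opprD addrACA mulrDl.
by apply: (le_trans (vnormD _ _)); rewrite lerD ?Hf ?Hg.
Qed.

Lemma anacZ c f a : anac c f -> anac (fun j => a *: c j) (fun p => a *: f p).
Proof.
move=> [M [rho [M0 r0 H]]]; exists (normc a * M), rho; split => //.
  by rewrite mulr_ge0// normc_ge0.
move=> p N hp; rewrite -mulrA.
have -> : pser (fun j => a *: c j) N p = a *: pser c N p.
  by rewrite /pser scaler_sumr; apply: eq_bigr => i _; rewrite !scalerA mulrC.
rewrite -scalerBr vnormZ ler_wpM2l ?normc_ge0//; exact: H.
Qed.

Lemma anacN c f : anac c f -> anac (fun j => - c j) (fun p => - f p).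
Proof.
move=> /(@anacZ _ _ (-1)); under eq_fun do rewrite scaleN1r.
by under [X in anac _ X]eq_fun do rewrite scaleN1r.
Qed.

Lemma anacB c d f g : anac c f -> anac d g ->
  anac (fun j => c j - d j) (fun p => f p - g p).
Proof. by move=> hf /anacN; exact: anacD. Qed.

Lemma power_series_sum c (K rho : R) : vcomplete -> 0 <= K -> 0 <= rho -> (forall N, nrm (c N) <= K * rho ^+ N) ->
  exists f, forall p N, rho * `|p| <= 1/2 -> nrm (f p - pser c N p) <= 2 * K * (rho * `|p|) ^+ N.
Proof.
move=> cplt K0 r0 H.
have x0 (p : R) : 0 <= rho * `|p| by rewrite mulr_ge0.
have tail (p : R) N L : rho * `|p| <= 1/2 ->
    nrm (pser c (N + L) p - pser c N p) <= 2 * K * (rho * `|p|) ^+ N.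
  move=> hp.
  (* The bound on the tail is sharpened to a telescoping difference, which is stable under adding
     one term. *)
  suff : nrm (pser c (N + L) p - pser c N p) <=
     2 * K * ((rho * `|p|) ^+ N - (rho * `|p|) ^+ (N + L)).
    by move/le_trans; apply; rewrite ler_wpM2l// ?gerBl ?exprn_ge0// mulr_ge0.
  elim: L => [|L IH]; first by rewrite addn0 !subrr vnorm0 mulr0.
  rewrite addnS pserS addrAC; apply: (le_trans (vnormD _ _)).
  apply: (le_trans (lerD IH (lexx _))).
  rewrite vnormZR normrX.
  have h1 : `|p| ^+ (N + L) * nrm (c (N + L)%N) <= K * (rho * `|p|) ^+ (N + L).
    by rewrite exprMn mulrA [leRHS]mulrC ler_wpM2l ?exprn_ge0.
  apply: (le_trans (lerD (lexx _) h1)); rewrite exprS.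
  have : 0 <= (rho * `|p|) ^+ (N + L) by rewrite exprn_ge0.
  move: (rho * `|p|) hp ((rho * `|p|) ^+ (N + L)) ((rho * `|p|) ^+ N) => x h1x y z y0.
  have : K * y * x <= K * y * (1/2) by rewrite ler_wpM2l// mulr_ge0.
  nra.
(* The existence is unconditional and the property conditional, so that [choice] gives a function on
   all of [R], with value 0 outside the disc. *)
have lim (p : R) : exists x, rho * `|p| <= 1/2 ->
    forall e : R, 0 < e -> exists N, forall i, (N <= i)%N -> nrm (pser c i p - x) <= e.
  have [hp|] := boolP (rho * `|p| <= 1/2); last by exists 0.
  suff [x hx] : exists x, forall e : R, 0 < e ->
      exists N, forall i, (N <= i)%N -> nrm (pser c i p - x) <= e by exists x.
  apply: cplt => e e0.
  have [N0 hN] := @geometric_small (2 * K) (rho * `|p|) (e / 2) ltac:(by rewrite x0) ltac:(lra).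
  exists N0 => i j hi hj.
  apply: (le_trans (vnorm_tri (pser c N0 p) _ _)); rewrite [X in _ + X]vnormBC.
  have := tail p N0 (i - N0)%N hp; have := tail p N0 (j - N0)%N hp; rewrite !subnKC//.
  have := hN N0 (leqnn _); lra.
have [f hf] := @choice _ _ _ lim.
exists f => p N hp; apply/ler_addgt0Pl => e e0.
have [N0 hN0] := hf p hp e e0.
have h1 := vnorm_tri (pser c (N + N0) p) (f p) (pser c N p).
have h2 := hN0 (N + N0)%N (leq_addl _ _); rewrite vnormBC in h2.
have h3 := tail p N N0 hp.
by apply: (le_trans h1); rewrite addrC [leRHS]addrC lerD.
Qed.

Lemma anac_exists c : vcomplete ->
  (exists K rho : R, [/\ 0 < K, 0 < rho & forall N, nrm (c N) <= K * rho ^+ N]) ->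
  exists f, anac c f.
Proof.
move=> cplt [K [rho [/ltW K0 r0 H]]]; have [f hf] := power_series_sum cplt K0 (ltW r0) H.
by exists f, (2 * K), rho; split => //; rewrite mulr_ge0.
Qed.

(** Division by [p ^+ k], needed in [rellich]. The quotient is the sum of the shifted coefficients,
    and the two sides are compared through their remainders, so p = 0 is not a special case. *)
Lemma anac_shift c f k : vcomplete -> anac c f -> (forall j, (j < k)%N -> c j = 0) ->
  exists2 g, anac (fun j => c (j + k)%N) g & exists2 r : R, 0 < r &
    forall p, `|p| < r -> f p = (p ^+ k)%:C *: g p.
Proof.
move=> cplt fc c0; have [K [rho [K0 r0 Hc]]] := anac_coef fc.
have [g gc] : exists g, anac (fun j => c (j + k)%N) g.
  apply: anac_exists => //; exists (K * rho ^+ k), rho; split; rewrite ?mulr_gt0 ?exprn_gt0// => N.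
  by rewrite -mulrA -exprD addnC.
exists g => //; have [K1 [K10 Hf]] := anac_weaken fc; have [K2 [K20 Hg]] := anac_weaken gc.
pose M := Num.max (Num.max K1 K2) 1.
have [M1 M2 M3] : [/\ 1 <= M, K1 <= M & K2 <= M] by rewrite /M !le_max !lexx !orbT.
exists (1/2 / M) => [|p hp]; first by rewrite divr_gt0//; lra.
have hp2 : M * `|p| <= 1/2 by rewrite mulrC -ler_pdivlMr ?(ltW hp)//; lra.
have p1 : `|p| <= 1 by have := ler_wpM2r (normr_ge0 p) M1; lra.
have x0 : 0 <= M * `|p| by rewrite mulr_ge0//; lra.
apply/subr0_eq/vnorm_eq0; apply: (@le_pow_eq0 (M * `|p|) (M + M)); rewrite ?x0 ?vnorm_ge0// => N.
have ps : pser c (k + N) p = (p ^+ k)%:C *: pser (fun j => c (j + k)%N) N p.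
  rewrite /pser big_split_ord/= big1 ?add0r; last by move=> i _; rewrite c0 ?scaler0.
  rewrite scaler_sumr; apply: eq_bigr => i _.
  by rewrite scalerA -rmorphM -exprD [in c _]addnC.
apply: (le_trans (vnorm_tri (pser c (k + N) p) _ _)); rewrite mulrDl lerD//.
  apply: (le_trans (Hf M M M2 M2 p (k + N)%N hp2)); rewrite ler_wpM2l//; first lra.
  by apply: ler_wiXn2l => //; [lra|exact: leq_addl].
rewrite ps -scalerBr vnormZR vnormBC; apply: le_trans (Hg M M M3 M3 p N hp2).
by rewrite ler_piMl ?vnorm_ge0// normrX exprn_ile1.
Qed.

End vnorm.

(** * Operator-valued series applied to vector-valued ones *)

Section opana.
Variables (R : realType) (E1 E2 : lmodType R[i]) (n1 : E1 -> R) (n2 : E2 -> R).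
Hypotheses (n1P : is_vnorm n1) (n2P : is_vnorm n2).

(** Only real scalars are required: the parameter is real, and adjoints as well as the first
    argument of an inner product are conjugate-linear. *)
Definition rlin (g : E1 -> E2) :=
  (forall x y, g (x + y) = g x + g y) /\ forall (a : R) x, g (a%:C *: x) = a%:C *: g x.

Definition opana (w : nat -> E1 -> E2) (W : R -> E1 -> E2) := exists M rho : R,
  [/\ 0 <= M, 0 < rho & forall p N v, rho * `|p| <= 1/2 ->
     n2 (W p v - \sum_(j < N) (p ^+ j)%:C *: w j v) <= M * (rho * `|p|) ^+ N * n1 v].

Definition conv (w : nat -> E1 -> E2) (c : nat -> E1) N : E2 :=
  \sum_(j < N.+1) w j (c (N - j)%N).

Lemma rlin0 g : rlin g -> g 0 = 0.
Proof. by case=> _ /(_ 0 0); rewrite rmorph0 !scale0r. Qed.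

Lemma rlinN g x : rlin g -> g (- x) = - g x.
Proof.
by case=> _ /(_ (-1) x); rewrite rmorphN rmorph1 !scaleN1r.
Qed.

Lemma rlinB g x y : rlin g -> g (x - y) = g x - g y.
Proof. by move=> gP; case: (gP) => + _ => ->; rewrite rlinN. Qed.

Lemma rlin_sum g (I : Type) (r : seq I) (P : pred I) F : rlin g ->
  g (\sum_(i <- r | P i) F i) = \sum_(i <- r | P i) g (F i).
Proof.
move=> gP; elim/big_rec2: _ => [|i y1 y2 _ <-]; first exact: rlin0.
by case: gP => ->.
Qed.

(** The product of the two partial sums differs from the partial sum of the Cauchy product by at
    most N^2 terms of degree at least N, each of size x^N. As N^2 <= 4^N, the rate [4 * rho] absorbs
    their number. The 7 is 3 from truncating the two factors plus 4 from these terms. *)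
Lemma anac_op w W c f : (forall j, rlin (w j)) -> (forall p, rlin (W p)) ->
  opana w W -> anac n1 c f -> anac n2 (conv w c) (fun p => W p (f p)).
Proof.
move=> wP WP [M1 [r1 [M10 r10 HW]]] /anac_weaken [L [L0 Hf]].
pose M := Num.max M1 L; pose rho := Num.max r1 L.
have M0 : 0 <= M by rewrite le_max M10.
have r0 : 0 < rho by rewrite lt_max r10.
have {}Hf p N : rho * `|p| <= 1/2 -> n1 (f p - pser c N p) <= M * (rho * `|p|) ^+ N.
  by apply: Hf; rewrite le_max lexx orbT.
have {}HW p N v : rho * `|p| <= 1/2 ->
    n2 (W p v - \sum_(j < N) (p ^+ j)%:C *: w j v) <= M * (rho * `|p|) ^+ N * n1 v.
  move=> hp.
  have h : r1 * `|p| <= rho * `|p| by rewrite ler_wpM2r// le_max lexx.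
  apply: (le_trans (HW p N v (le_trans h hp))).
  rewrite ler_wpM2r ?vnorm_ge0// ler_pM ?exprn_ge0 ?mulr_ge0 ?(ltW r10)//.
    by rewrite le_max lexx.
  by rewrite lerXn2r// nnegrE mulr_ge0// ltW.
have wb j v : n2 (w j v) <= 2 * (M * n1 v) * rho ^+ j.
  apply: (@coef_bound _ _ _ n2P (fun j => w j v) (W^~ v)) => //.
    by rewrite mulr_ge0// vnorm_ge0.
  by move=> p N hp; rewrite mulrAC; apply: HW.
have cb j : n1 (c j) <= 2 * M * rho ^+ j by apply: (@coef_bound _ _ _ n1P c f).
exists (7 * M ^+ 2), (4 * rho); split; first by rewrite mulr_ge0// exprn_ge0.
  by rewrite mulr_gt0.
move=> p N hp.
set x := rho * `|p|.
have x0 : 0 <= x by rewrite /x mulr_ge0// ltW.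
have hx : x <= 1/8 by rewrite /x; lra.
have hp2 : rho * `|p| <= 1/2 by rewrite -/x; lra.
have xN : 0 <= x ^+ N by rewrite exprn_ge0.
have x4 : x ^+ N <= (4 * x) ^+ N by rewrite lerXn2r// ?nnegrE; lra.
have fN := Hf p N hp2; rewrite -/x in fN.
have f0 : n1 (f p) <= M by have := Hf p 0%N hp2; rewrite pser0 subr0 expr0 mulr1.
have pN : n1 (pser c N p) <= 2 * M.
  apply: (le_trans (vnorm_le n1P _ (f p))); rewrite vnormBC//.
  have : M * x ^+ N <= M by rewrite ler_piMr// exprn_ile1//; lra.
  move=> h; apply: le_trans (lerD fN f0) _; lra.
have W0 v : n2 (W p v) <= M * n1 v.
  by have := HW p 0%N v hp2; rewrite big_ord0 subr0 expr0 mulr1.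
pose A := \sum_(j < N) (p ^+ j)%:C *: w j (pser c N p).
apply: (le_trans (vnorm_tri n2P A _ _)).
have h1 : n2 (W p (f p) - A) <= 3 * M ^+ 2 * (4 * x) ^+ N.
  apply: (le_trans (vnorm_tri n2P (W p (pser c N p)) _ _)).
  rewrite -rlinB//.
  have := W0 (f p - pser c N p).
  have := HW p N (pser c N p) hp2; rewrite -/A -/x => k1 k2.
  have k3 : M * x ^+ N * n1 (pser c N p) <= M * x ^+ N * (2 * M) by rewrite ler_wpM2l// mulr_ge0.
  have k4 : M * n1 (f p - pser c N p) <= M * (M * x ^+ N) by rewrite ler_wpM2l.
  have k5 : M ^+ 2 * x ^+ N <= M ^+ 2 * (4 * x) ^+ N by rewrite ler_wpM2l// exprn_ge0.
  rewrite expr2 in k5 *; lra.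
have h2 : n2 (A - pser (conv w c) N p) <= 4 * M ^+ 2 * (4 * x) ^+ N.
  have -> : A = \sum_(j < N) \sum_(i < N) (p ^+ (j + i))%:C *: w j (c i).
    apply: eq_bigr => j _; rewrite rlin_sum// scaler_sumr; apply: eq_bigr => i _.
    by case: (wP j) => _ ->; rewrite scalerA -rmorphM -exprD.
  have -> : pser (conv w c) N p = \sum_(j < N) \sum_(i < N - j) (p ^+ (j + i))%:C *: w j (c i).
    rewrite -(sum_triangle (fun j i => (p ^+ (j + i))%:C *: w j (c i))).
    apply: eq_bigr => K _; rewrite scaler_sumr; apply: eq_bigr => j _.
    by rewrite subnKC// -ltnS.
  rewrite -sumrB; apply: (le_trans (vnorm_sum n2P _ _ _)).
  have hN : (N ^ 2)%:R * x ^+ N <= (4 * x) ^+ N.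
    rewrite (exprMn _ 4 x) ler_wpM2r// -natrX ler_nat.
    by rewrite (_ : 4 = 2 ^ 2)%N// -expnM mulnC expnM leq_exp2r// ltnW// ltn_expl.
  apply: (@le_trans _ _ (\sum_(j < N) (N%:R * (4 * M ^+ 2 * x ^+ N)))); last first.
    rewrite sumr_const card_ord [leLHS](_ : _ = 4 * M ^+ 2 * ((N ^ 2)%:R * x ^+ N)); last first.
      by rewrite -[LHS]mulr_natl natrX; ring.
    by rewrite ler_wpM2l// mulr_ge0// exprn_ge0.
  apply: ler_sum => j _.
  rewrite -(big_mkord predT (fun i => (p ^+ (j + i))%:C *: w j (c i))).
  rewrite -(big_mkord predT (fun i => (p ^+ (j + i))%:C *: w j (c i))).
  rewrite (@big_cat_nat _ _ _ (N - j) 0 N)//= ?leq_subr// addrAC subrr add0r.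
  apply: (le_trans (vnorm_sum n2P _ _ _)).
  apply: (@le_trans _ _ (\sum_(N - j <= i < N) 4 * M ^+ 2 * x ^+ N)); last first.
    rewrite sumr_const_nat -[leLHS]mulr_natl; apply: ler_wpM2r.
      by rewrite mulr_ge0 ?mulr_ge0 ?exprn_ge0.
    by rewrite ler_nat leq_subr.
  rewrite big_nat_cond [leRHS]big_nat_cond; apply: ler_sum => i; rewrite andbT => /andP[i1 i2].
  rewrite vnormZR// normrX.
  apply: (@le_trans _ _ (`|p| ^+ (j + i) * (2 * (M * (2 * M * rho ^+ i)) * rho ^+ j))).
    rewrite ler_wpM2l ?exprn_ge0//; apply: (le_trans (wb _ _)).
    apply: ler_wpM2r; first by rewrite exprn_ge0// ltW.
    by apply: ler_wpM2l => //; apply: ler_wpM2l.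
  rewrite [leLHS](_ : _ = 4 * M ^+ 2 * x ^+ (j + i)); last first.
    by rewrite /x exprMn [rho ^+ (j + i)]exprD; ring.
  rewrite ler_wpM2l ?mulr_ge0 ?exprn_ge0//.
  by apply: ler_wiXn2l => //; [lra|clear -i1; lia].
have -> : 4 * rho * `|p| = 4 * x by rewrite /x mulrA.
by apply: (le_trans (lerD h1 h2)); rewrite -mulrDl; apply: ler_wpM2r; [rewrite exprn_ge0// mulr_ge0|lra].
Qed.

End opana.

(** * Formal fixed points and recentring of power series *)

Section fixpoint.
Variables (R : realType) (E : lmodType R[i]) (nrm : E -> R).
Hypothesis nrmP : is_vnorm nrm.

(* Majorant method: a formal series x = Phi x, where the N-th coefficient of Phi x only
   involves the earlier coefficients of x, converges as soon as Phi is bounded in the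
   weighted l^1 norm of some radius r in terms of the quadratic (1 + s)^2. *)
Lemma series_fixpoint (Phi : (nat -> E) -> nat -> E) (r : R) :
  (forall x y N, (forall i, (i < N)%N -> x i = y i) -> Phi x N = Phi y N) ->
  0 < r ->
  (forall x N, wsum r (fun j => nrm (Phi x j)) N <=
     1/4 * (1 + wsum r (fun j => nrm (x j)) N) ^+ 2) ->
  exists x, (forall N, x N = Phi x N) /\
    exists K rho : R, [/\ 0 < K, 0 < rho & forall N, nrm (x N) <= K * rho ^+ N].
Proof.
move=> ext r0 HPhi.
pose y := fix y (n : nat) : nat -> E := if n is m.+1 then Phi (y m) else (fun _ => 0).
have stab n m N : (N < n)%N -> (n <= m)%N -> y m N = y n N.
  elim: n m N => // n IH [//|m] N Nn nm /=; apply: ext => i iN.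
  by apply: IH => //; apply: leq_trans iN _; rewrite -ltnS.
(* By [ext], the N-th coefficient is final after N + 1 iterations of [Phi], so this diagonal is a
   fixed point. *)
pose x N := y N.+1 N.
have xE N : x N = Phi x N.
  rewrite {1}/x /=; apply: ext => i iN; rewrite /x; exact: (stab i.+1 N i).
(* The value 1 is the fixed point of s |-> (1 + s)^2 / 4. Truncating [x] below degree N turns the
   bound at N + 1 into the induction hypothesis at N. *)
have S1 N : wsum r (fun j => nrm (x j)) N <= 1.
  elim: N => [|N IH]; first by rewrite /wsum big_ord0.
  pose x' j := if (j < N)%N then x j else 0.
  have xx j : (j < N.+1)%N -> x j = Phi x' j.
    rewrite xE => jN; apply: ext => i ij; rewrite /x' (leq_trans ij)//.
  apply: (@le_trans _ _ (wsum r (fun j => nrm (Phi x' j)) N.+1)).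
    by apply: ler_wsum => [|j jN]; [exact: ltW|rewrite xx].
  apply: (le_trans (HPhi _ _)).
  have -> : wsum r (fun j => nrm (x' j)) N.+1 = wsum r (fun j => nrm (x j)) N.
    rewrite /wsum big_ord_recr/= {2}/x' ltnn vnorm0// mul0r addr0.
    by apply: eq_bigr => i _; rewrite /x' ltn_ord.
  have S0 : 0 <= wsum r (fun j => nrm (x j)) N by apply: wsum_ge0 => [|j]; [exact: ltW|exact: vnorm_ge0].
  move: (wsum _ _ _) S0 IH => s s0 s1; rewrite expr2; nra.
exists x; split => //; exists 1, r^-1; split; rewrite ?invr_gt0// => N.
rewrite mul1r exprVn.
have rN : 0 < r ^+ N by rewrite exprn_gt0.
rewrite -[leRHS]mul1r ler_pdivlMr//; apply: le_trans (S1 N.+1).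
rewrite /wsum big_ord_recr/= lerDr; apply: sumr_ge0 => i _.
by rewrite mulr_ge0 ?vnorm_ge0// exprn_ge0// ltW.
Qed.

Hypothesis cplt : vcomplete nrm.

(* One step of Horner's scheme at [p]: [s] are the coefficients of the quotient by [q - p]. *)
Lemma synthetic_division c (K rho p : R) : 0 <= K -> 0 <= rho -> rho * `|p| <= 1/2 ->
  (forall N, nrm (c N) <= K * rho ^+ N) ->
  exists s : nat -> E, (forall a, nrm (s a) <= 2 * K * rho ^+ a) /\
    forall a, c a = s a - p%:C *: s a.+1.
Proof.
move=> K0 r0 hp Hc.
have /choice[s hs] a : exists v, forall N,
    nrm (v - pser (fun j => c (a + j)%N) N p) <= 2 * (K * rho ^+ a) * (rho * `|p|) ^+ N.
  have [f hf] := @power_series_sum _ _ _ nrmP (fun j => c (a + j)%N) (K * rho ^+ a) rho cplt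
    ltac:(by rewrite mulr_ge0 ?exprn_ge0) r0 ltac:(by move=> N; rewrite -mulrA -exprD).
  by exists (f p) => N; exact: hf.
have x0 : 0 <= rho * `|p| by rewrite mulr_ge0.
exists s; split=> a.
  by have := hs a 0; rewrite pser0 subr0 expr0 mulr1 mulrA.
apply/subr0_eq/(vnorm_eq0 nrmP)/(@le_pow_eq0 _ (rho * `|p|) (4 * K * rho ^+ a)); rewrite ?x0 ?vnorm_ge0// => N.
have ps : pser (fun j => c (a + j)%N) N.+1 p = c a + p%:C *: pser (fun j => c (a.+1 + j)%N) N p.
  rewrite /pser big_ord_recl /= expr0 scale1r addn0; congr (_ + _); rewrite scaler_sumr.
  by apply: eq_bigr => i _; rewrite scalerA -rmorphM -exprS addnS.
have -> : c a - (s a - p%:C *: s a.+1) = - (s a - pser (fun j => c (a + j)%N) N.+1 p) +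
    p%:C *: (s a.+1 - pser (fun j => c (a.+1 + j)%N) N p).
  rewrite ps scalerBr !opprB; set u := _ *: s _; set w := _ *: pser _ _ _.
  by rewrite [c a + w - _]addrAC -[RHS]addrA [w + _]addrC subrK addrA addrAC.
apply: (le_trans (vnormD nrmP _ _)); rewrite vnormN// vnormZR//.
have := hs a N.+1; have := ler_wpM2l (normr_ge0 p) (hs a.+1 N).
have := ler_wiXn2l x0 ltac:(lra) (leqnSn N); rewrite !exprS.
have : 0 <= (rho * `|p|) ^+ N by rewrite exprn_ge0.
move: (nrm _) (nrm _) => u v.
have : 0 <= K * rho ^+ a by rewrite mulr_ge0// exprn_ge0.
move: (rho ^+ a) => y; move: ((rho * `|p|) ^+ N) => z y0 z0 h1 h2 h3.
have : K * y * z * (rho * `|p|) <= K * y * z * (1/2) by rewrite ler_wpM2l// mulr_ge0.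
nra.
Qed.

(* Iterating [synthetic_division] at [p] yields the Taylor coefficients at [p]; no binomial sums. *)
Lemma anac_recenter c f : anac nrm c f -> exists2 r : R, 0 < r &
  forall p, `|p| < r -> exists d : nat -> E, forall q, `|q - p| < r ->
    exists2 K : R, 0 < K & forall N,
    nrm (f q - \sum_(j < N) ((q - p) ^+ j)%:C *: d j) <= K * (1/2) ^+ N.
Proof.
move=> fc; have [K1 [rho1 [K10 rho10 Hc]]] := anac_coef nrmP fc.
have [K2 [K20 Hf]] := anac_weaken fc.
pose rho := Num.max rho1 K2; have [r1 r2] : rho1 <= rho /\ K2 <= rho by rewrite /rho !le_max !lexx orbT.
have rho0 : 0 < rho by apply: lt_le_trans r2.
pose good (K : R) (c : nat -> E) := 0 <= K /\ forall N, nrm (c N) <= K * rho ^+ N.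
have {Hc} gc : good K1 c.
  split=> [|N]; first exact: ltW.
  by apply: (le_trans (Hc N)); rewrite ler_wpM2l ?(ltW K10)// lerXn2r// nnegrE ltW.
(* This radius keeps [rho * |q| <= 1/2], where the original series is controlled, and makes
   [2 * rho * |q - p| <= 1/2], the ratio of the new one. *)
exists (1/4 / rho) => [|p hp]; first by rewrite divr_gt0.
have hp4 : rho * `|p| <= 1/4 by rewrite mulrC -ler_pdivlMr// ltW.
have /choice[S hS] (cK : (nat -> E) * R) : exists s : nat -> E, good cK.2 cK.1 ->
    (forall a, nrm (s a) <= 2 * cK.2 * rho ^+ a) /\ forall a, cK.1 a = s a - p%:C *: s a.+1.
  have [[g1 g2]|] := pselect (good cK.2 cK.1); last by exists (fun=> 0).
  by have [s hs] := @synthetic_division cK.1 cK.2 rho p g1 (ltW rho0) ltac:(lra) g2; exists s.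
(* The k-th quotient with the constant of its geometric bound: each division multiplies the constant
   by [2 * rho] and keeps the rate [rho]. *)
pose T k := iter k (fun cK => (fun a => S cK a.+1, 2 * rho * cK.2)) (c, K1).
have gT k : good (T k).2 (T k).1.
  elim: k => [|k IH] //=; have [h1 _] := hS _ IH; split=> [|N]; first by rewrite !mulr_ge0 ?(ltW rho0)//; case: IH.
  by apply: (le_trans (h1 _)); rewrite exprS le_eqVlt; apply/orP; left; apply/eqP; ring.
have TK k : (T k).2 = (2 * rho) ^+ k * K1.
  by elim: k => [|k IH]; rewrite ?expr0 ?mul1r//= IH exprS mulrA.
exists (fun k => S (T k) 0%N) => q hq; exists (2 * K1) => [|N]; first by rewrite mulr_gt0.
have hq4 : rho * `|q - p| <= 1/4 by rewrite mulrC -ler_pdivlMr// ltW.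
have hq2 : rho * `|q| <= 1/2.
  have : rho * `|q| <= rho * (`|q - p| + `|p|) by rewrite ler_pM2l// -{1}(subrK p q) ler_normD.
  by rewrite mulrDr; lra.
have x0 : 0 <= rho * `|q| by rewrite mulr_ge0// ltW.
have /choice[F hF] k : exists v, forall N, nrm (v - pser (T k).1 N q) <= 2 * (T k).2 * (rho * `|q|) ^+ N.
  have [g1 g2] := gT k; have [g hg] := power_series_sum nrmP cplt g1 (ltW rho0) g2.
  by exists (g q) => M; exact: hg.
have F0 : F 0%N = f q.
  apply/subr0_eq/(vnorm_eq0 nrmP)/(@le_pow_eq0 _ (rho * `|q|) (2 * K1 + rho)); rewrite ?x0 ?vnorm_ge0// => M.
  apply: (le_trans (vnorm_tri nrmP (pser c M q) _ _)); rewrite [leRHS]mulrDl; apply: lerD; first exact: hF 0%N M.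
  by rewrite vnormBC//; exact: Hf.
(* [F k] is the value at [q] of the k-th quotient. Iterating this identity gives Taylor's formula at
   [p] with remainder [(q - p) ^+ N] times [F N]. *)
have FS k : F k = S (T k) 0%N + (q - p)%:C *: F k.+1.
  pose s := S (T k); have [h1 h2] := hS _ (gT k).
  have ps M : pser (T k).1 M q = s 0%N + (q - p)%:C *: pser (T k.+1).1 M q - (q ^+ M)%:C *: s M.
    elim: M => [|M IH]; first by rewrite !pser0 scaler0 addr0 expr0 scale1r subrr.
    rewrite !pserS IH h2 -/s -[(T k.+1).1 M]/(s M.+1) [_ *: (s M - _)]scalerBr subrKA scalerDr addrA -[RHS]addrA.
    congr (_ + _); rewrite !scalerA -!rmorphM -scalerBl -rmorphB -scaleNr -rmorphN.
    by congr (_%:C *: _); rewrite exprS; ring.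
  apply/subr0_eq/(vnorm_eq0 nrmP).
  apply: (@le_pow_eq0 _ (rho * `|q|) (2 * (T k).2 + `|q - p| * (2 * (T k.+1).2) + 2 * (T k).2)); rewrite ?x0 ?vnorm_ge0// => M.
  have -> : F k - (s 0%N + (q - p)%:C *: F k.+1) = (F k - pser (T k).1 M q) -
      (q - p)%:C *: (F k.+1 - pser (T k.+1).1 M q) - (q ^+ M)%:C *: s M.
    rewrite ps scalerBr; move: (_ *: F _) (_ *: pser _ _ _) (_ *: s M) => u v w.
    rewrite -[RHS]addrA -opprD -[RHS]addrA -opprD; congr (_ - _).
    by rewrite addrACA addNr addr0 -addrA [v + _]addrC subrK.
  apply: (le_trans (vnormB nrmP _ _)).
  rewrite [leRHS](_ : _ = 2 * (T k).2 * (rho * `|q|) ^+ M + `|q - p| * (2 * (T k.+1).2 * (rho * `|q|) ^+ M)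
    + 2 * (T k).2 * (rho * `|q|) ^+ M); last by ring.
  apply: lerD.
    apply: (le_trans (vnormB nrmP _ _)); apply: lerD; first exact: hF.
    by rewrite vnormZR// ler_wpM2l//; exact: hF.
  rewrite vnormZR// normrX; apply: (le_trans (ler_wpM2l _ (h1 M))); first by rewrite exprn_ge0.
  by rewrite exprMn le_eqVlt; apply/orP; left; apply/eqP; ring.
have -> : f q - \sum_(j < N) ((q - p) ^+ j)%:C *: S (T j) 0%N = ((q - p) ^+ N)%:C *: F N.
  rewrite -F0; elim: (N) => [|M IH]; first by rewrite big_ord0 subr0 expr0 scale1r.
  rewrite big_ord_recr /= opprD addrA IH FS scalerDr addrAC subrr add0r scalerA -rmorphM.
  by rewrite exprSr.
rewrite vnormZR// normrX; have := hF N 0%N; rewrite pser0 subr0 expr0 mulr1 TK => h.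
apply: (le_trans (ler_wpM2l _ h)); first by rewrite exprn_ge0.
have -> : `|q - p| ^+ N * (2 * ((2 * rho) ^+ N * K1)) = 2 * K1 * (2 * (rho * `|q - p|)) ^+ N.
  by rewrite !exprMn; ring.
by rewrite ler_wpM2l ?mulr_ge0 ?(ltW K10)//; apply: ler_exp; [rewrite !mulr_ge0// ltW|lra].
Qed.

End fixpoint.

Section real_complete.
Variable R : realType.
Local Open Scope classical_set_scope.

Lemma real_complete (u : nat -> R) :
  (forall e : R, 0 < e -> exists N, forall i j, (N <= i)%N -> (N <= j)%N -> `|u i - u j| <= e) ->
  exists x, forall e : R, 0 < e -> exists N, forall i, (N <= i)%N -> `|u i - x| <= e.
Proof.
move=> H.
have /cauchy_cvgP/cvg_ex[x ux] : cauchy (u @ \oo).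
  apply/cauchy_exP => e e0.
  have [N hN] := H (e / 2) ltac:(lra).
  exists (u N); exists N => // i /= Ni; rewrite /ball/=.
  by have := hN N i (leqnn _) Ni; lra.
exists x => e e0; move/cvgrPdist_le : ux => /(_ e e0)[N _ hN].
by exists N => i Ni; rewrite distrC; exact: hN.
Qed.

End real_complete.

(** * The entrywise l^1 norm of complex matrices *)

Section matrix_norm.
Variable R : realType.
Local Notation C := R[i].

Definition mxn m n (A : 'M[C]_(m, n)) : R := \sum_i \sum_j normc (A i j).

Lemma mxn_entry m n (A : 'M[C]_(m, n)) i j : normc (A i j) <= mxn A.
Proof.
rewrite /mxn (bigD1 i)//= (bigD1 j)//= -addrA lerDl addr_ge0//.
  by apply: sumr_ge0 => *; exact: normc_ge0.
by apply: sumr_ge0 => *; apply: sumr_ge0 => *; exact: normc_ge0.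
Qed.

Lemma mxnP m n : is_vnorm (@mxn m n).
Proof.
split=> [A A0|A B|a A].
- apply/matrixP => i j; rewrite mxE; apply: eq0_normc; apply/eqP.
  by rewrite eq_le normc_ge0 -A0 mxn_entry.
- rewrite /mxn -big_split; apply: ler_sum => i _; rewrite -big_split.
  by apply: ler_sum => j _; rewrite mxE; exact: le_normcD.
- rewrite /mxn mulr_sumr; apply: eq_bigr => i _; rewrite mulr_sumr.
  by apply: eq_bigr => j _; rewrite mxE normcM.
Qed.

Lemma normc_sum (I : Type) (r : seq I) (P : pred I) (F : I -> C) :
  normc (\sum_(i <- r | P i) F i) <= \sum_(i <- r | P i) normc (F i).
Proof.
elim/big_rec2: _ => [|i y1 y2 _ H]; first by rewrite normc0.
by apply: (le_trans (le_normcD _ _)); rewrite lerD2l.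
Qed.

Lemma mxnM m n k (A : 'M[C]_(m, n)) (B : 'M[C]_(n, k)) : mxn (A *m B) <= mxn A * mxn B.
Proof.
rewrite {1}/mxn.
apply: (@le_trans _ _ (\sum_i \sum_j \sum_l normc (A i l) * normc (B l j))).
  apply: ler_sum => i _; apply: ler_sum => j _; rewrite mxE.
  apply: (le_trans (normc_sum _ _ _)); apply: ler_sum => l _.
  by rewrite normcM.
rewrite {1}/mxn mulr_suml; apply: ler_sum => i _.
rewrite exchange_big/= mulr_suml; apply: ler_sum => l _.
rewrite -mulr_sumr ler_wpM2l ?normc_ge0//.
rewrite /mxn [leRHS](bigD1 l)//= lerDl.
by apply: sumr_ge0 => *; apply: sumr_ge0 => *; exact: normc_ge0.
Qed.

Definition adj m n (A : 'M[C]_(m, n)) : 'M[C]_(n, m) := map_mx (@conjc R) A^T.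

Lemma normcJ_real (x : C) : normc (conjc x) = normc x.
Proof. by case: x => a b /=; rewrite sqrrN. Qed.

Lemma mxn_adj m n (A : 'M[C]_(m, n)) : mxn (adj A) = mxn A.
Proof.
rewrite /mxn exchange_big/=; apply: eq_bigr => i _; apply: eq_bigr => j _.
by rewrite !mxE normcJ_real.
Qed.

Lemma adjM m n k (A : 'M[C]_(m, n)) (B : 'M[C]_(n, k)) : adj (A *m B) = adj B *m adj A.
Proof. by rewrite /adj trmx_mul map_mxM. Qed.
Lemma adjK m n (A : 'M[C]_(m, n)) : adj (adj A) = A.
Proof. by apply/matrixP => i j; rewrite !mxE conjcK. Qed.
Lemma adjD m n (A B : 'M[C]_(m, n)) : adj (A + B) = adj A + adj B.
Proof. by apply/matrixP => i j; rewrite !mxE rmorphD. Qed.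
Lemma adjB m n (A B : 'M[C]_(m, n)) : adj (A - B) = adj A - adj B.
Proof. by apply/matrixP => i j; rewrite !mxE rmorphB. Qed.
Lemma adjZr m n (a : R) (A : 'M[C]_(m, n)) : adj (a%:C *: A) = a%:C *: adj A.
Proof. by apply/matrixP => i j; rewrite !mxE rmorphM/= oppr0. Qed.
Lemma adj1 n : adj 1%:M = 1%:M :> 'M[C]_n.
Proof. by apply/matrixP => i j; rewrite !mxE eq_sym rmorph_nat. Qed.

Lemma rlin_mull m n k (A : 'M[C]_(m, n)) : rlin (fun B : 'M[C]_(n, k) => A *m B).
Proof. by split=> [x y|a x]; [rewrite mulmxDr|rewrite scalemxAr]. Qed.
Lemma rlin_mulr m n k (A : 'M[C]_(n, k)) : rlin (fun B : 'M[C]_(m, n) => B *m A).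
Proof. by split=> [x y|a x]; [rewrite mulmxDl|rewrite scalemxAl]. Qed.
Lemma rlin_adj m n : rlin (@adj m n).
Proof. by split=> [x y|a x]; [rewrite adjD|rewrite adjZr]. Qed.

Lemma vcomplete_normc : vcomplete (E := C^o) (@normc R).
Proof.
have ReC (z : C) : `|Re z| <= normc z.
  case: z => x y /=; rewrite -sqrtr_sqr ler_wsqrtr// lerDl sqr_ge0//.
have ImC (z : C) : `|Im z| <= normc z.
  case: z => x y /=; rewrite -sqrtr_sqr ler_wsqrtr// lerDr sqr_ge0//.
have leC (z : C) : normc z <= `|Re z| + `|Im z|.
  case: z => x y /=; rewrite -(ler_pXn2r (n := 2))// ?nnegrE ?sqrtr_ge0 ?addr_ge0//.
  rewrite sqr_sqrtr ?addr_ge0 ?sqr_ge0// sqrrD !real_normK ?num_real//.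
  by rewrite lerD2r lerDl mulrn_wge0// mulr_ge0.
move=> u H.
have ReB (z w : C) : Re (z - w) = Re z - Re w by case: z; case: w.
have ImB (z w : C) : Im (z - w) = Im z - Im w by case: z; case: w.
have [|x hx] := @real_complete R (fun i => Re (u i)).
  move=> e e0; have [N hN] := H e e0; exists N => i j Ni Nj.
  by rewrite -ReB; apply: le_trans (ReC _) (hN i j Ni Nj).
have [|y hy] := @real_complete R (fun i => Im (u i)).
  move=> e e0; have [N hN] := H e e0; exists N => i j Ni Nj.
  by rewrite -ImB; apply: le_trans (ImC _) (hN i j Ni Nj).
exists (x +i* y) => e e0.
have [N1 h1] := hx (e / 2) ltac:(lra); have [N2 h2] := hy (e / 2) ltac:(lra).
exists (N1 + N2)%N => i Ni; apply: (le_trans (leC _)).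
have := h1 i ltac:(lia); have := h2 i ltac:(lia).
case: (u i) => a b /=; lra.
Qed.

Lemma mxn_complete m n : vcomplete (@mxn m n).
Proof.
move=> u H.
have lim (ij : 'I_m * 'I_n) : exists x, forall e : R, 0 < e -> exists N, forall k, (N <= k)%N ->
    normc (u k ij.1 ij.2 - x) <= e.
  apply: (@vcomplete_normc (fun k => u k ij.1 ij.2)) => e e0.
  have [N hN] := H e e0; exists N => i j Ni Nj.
  apply: le_trans (hN i j Ni Nj); have := mxn_entry (u i - u j) ij.1 ij.2.
  by rewrite !mxE.
have [f hf] := @choice _ _ _ lim.
exists (\matrix_(i, j) f (i, j)) => e e0.
have e1 : 0 < e / ((m * n)%:R + 1) by rewrite divr_gt0// ltr_wpDl.
have [N hN] := @choice _ _ _ (fun ij => hf ij _ e1).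
exists (\sum_ij N ij)%N => k Nk.
apply: (@le_trans _ _ (\sum_(i < m) \sum_(j < n) e / ((m * n)%:R + 1))).
  apply: ler_sum => i _; apply: ler_sum => j _; rewrite !mxE.
  apply: (hN (i, j)); apply: leq_trans Nk; rewrite (bigD1 (i, j))//=; exact: leq_addr.
rewrite sumr_const card_ord sumr_const card_ord -!mulrnA -[leLHS]mulr_natl mulrCA.
rewrite -[leRHS]mulr1; apply: ler_wpM2l; first exact: ltW.
rewrite mulnC ler_pdivrMr ?ltr_wpDl// mul1r; lra.
Qed.

End matrix_norm.

(** * Stability of analytic germs under linear maps and products *)

Section anac_extra.
Variables (R : realType).

Lemma anac_lin (E1 E2 : lmodType R[i]) (n1 : E1 -> R) (n2 : E2 -> R) (g : E1 -> E2) K c f :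
  is_vnorm n1 -> rlin g -> (forall x, n2 (g x) <= K * n1 x) -> anac n1 c f ->
  anac n2 (fun j => g (c j)) (fun p => g (f p)).
Proof.
move=> n1P gP gK [M [rho [M0 r0 H]]].
exists (`|K| * M), rho; split => //; first by rewrite mulr_ge0.
move=> p N hp.
have -> : pser (fun j => g (c j)) N p = g (pser c N p).
  rewrite (rlin_sum _ _ _ gP); apply: eq_bigr => j _.
  by case: gP => _ ->.
rewrite -rlinB//; apply: (le_trans (gK _)); rewrite -mulrA.
apply: (@le_trans _ _ (`|K| * n1 (f p - pser c N p))).
  by rewrite ler_wpM2r ?vnorm_ge0// ler_norm.
by rewrite ler_wpM2l// H.
Qed.

(** The germ is Lipschitz at 0, so its value there is a limit of values at small nonzero [p]. It
    recovers at p = 0 the identities obtained after division by a power of [p]. *)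
Lemma anac_near0 (E : lmodType R[i]) (n : E -> R) c f (r : R) : is_vnorm n -> anac n c f ->
  0 < r -> (forall p, 0 < `|p| < r -> f p = 0) -> f 0 = 0.
Proof.
move=> nP fc r0 f0; rewrite (anac0E nP fc).
have [K [s [K0 s0 H]]] := anac_lip fc.
apply: (vnorm_eq0 nP); apply/eqP; rewrite eq_le vnorm_ge0// andbT.
apply/ler_addgt0Pl => e e0; rewrite addr0.
pose q := Num.min (Num.min r s / 2) (e / K).
have m0 : 0 < Num.min r s by rewrite lt_min r0.
have q0 : 0 < q by rewrite lt_min !divr_gt0.
have qm : q < Num.min r s.
  have : q <= Num.min r s / 2 by rewrite ge_min lexx.
  lra.
move: qm; rewrite lt_min => /andP[qr qs].
have := H q; rewrite gtr0_norm// => /(_ qs).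
rewrite f0 ?gtr0_norm ?q0// sub0r vnormN// => /le_trans; apply.
by rewrite mulrC -ler_pdivlMr// ge_min lexx orbT.
Qed.

Lemma anac_mulp (E : lmodType R[i]) (n : E -> R) c f : is_vnorm n -> anac n c f ->
  anac n (fun j => if j is j'.+1 then c j' else 0) (fun p => p%:C *: f p).
Proof.
move=> nP /anac_weaken[K [K0 H]].
pose M := Num.max K 1.
have M1 : 1 <= M by rewrite le_max lexx orbT.
have KM : K <= M by rewrite le_max lexx.
exists M, M; split; [lra|lra|] => p [|N] hp.
  rewrite pser0 subr0 expr0 mulr1 vnormZR//.
  have := H M M KM KM p 0%N hp; rewrite pser0 subr0 expr0 mulr1 => h.
  rewrite -[leRHS]mul1r; apply: ler_pM => //; first exact: vnorm_ge0.
  have : `|p| <= M * `|p| by rewrite ler_peMl.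
  lra.
rewrite /pser big_ord_recl/= scaler0 add0r.
under eq_bigr => i _ do rewrite /bump/= add1n exprS rmorphM -scalerA.
rewrite -scaler_sumr -scalerBr vnormZR//.
have := H M M KM KM p N hp; rewrite /pser => h.
apply: (@le_trans _ _ (`|p| * (M * (M * `|p|) ^+ N))); first by rewrite ler_wpM2l.
rewrite exprS mulrCA; apply: ler_wpM2l; first lra.
apply: ler_wpM2r; first by rewrite exprn_ge0// mulr_ge0//; lra.
by rewrite ler_peMl.
Qed.

Lemma anac_mulpX (E : lmodType R[i]) (n : E -> R) k c f : is_vnorm n -> anac n c f ->
  exists c', anac n c' (fun p => (p ^+ k)%:C *: f p).
Proof.
move=> nP fc; elim: k => [|k [c' IH]].
  by exists c; apply: eq_anac fc _; exists 1 => // p _; rewrite expr0 rmorph1 scale1r.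
eexists; apply: eq_anac (anac_mulp nP IH) _; exists 1 => // p _.
by rewrite scalerA -rmorphM -exprS.
Qed.

Lemma anac_mulmx m n k (A : nat -> 'M[R[i]]_(m, n)) a (B : nat -> 'M[R[i]]_(n, k)) b :
  anac (@mxn R _ _) A a -> anac (@mxn R _ _) B b ->
  anac (@mxn R _ _) (conv (fun j => mulmx (A j)) B) (fun p => a p *m b p).
Proof.
move=> hA hB; apply: (@anac_op _ _ _ _ _ (@mxnP R _ _) (@mxnP R _ _)
  (fun j => mulmx (A j)) (fun p => mulmx (a p))) hB.
- by move=> j; exact: rlin_mull.
- by move=> p; exact: rlin_mull.
have [M [rho [M0 r0 H]]] := hA; exists M, rho; split => // p N v hp.
have -> : a p *m v - \sum_(j < N) (p ^+ j)%:C *: (A j *m v) = (a p - pser A N p) *m v.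
  rewrite mulmxBl; congr (_ - _); rewrite /pser mulmx_suml.
  by apply: eq_bigr => j _; rewrite scalemxAl.
apply: (le_trans (mxnM _ _)); apply: ler_wpM2r; last exact: H.
exact: (vnorm_ge0 (@mxnP R _ _)).
Qed.

End anac_extra.

(** * Rellich's theorem *)

Section rellich.
Variable R : realType.
Local Notation C := R[i].

Definition manac m n (A : R -> 'M[C]_(m, n)) := exists a, anac (@mxn R m n) a A.

Lemma manac_cst m n (A : 'M[C]_(m, n)) : manac (fun=> A).
Proof. by eexists; apply: anac_cst; exact: mxnP. Qed.
Lemma manacD m n (A B : R -> 'M[C]_(m, n)) :
  manac A -> manac B -> manac (fun p => A p + B p).
Proof. by move=> [a ha] [b hb]; eexists; apply: anacD ha hb; exact: mxnP. Qed.
Lemma manacB m n (A B : R -> 'M[C]_(m, n)) :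
  manac A -> manac B -> manac (fun p => A p - B p).
Proof. by move=> [a ha] [b hb]; eexists; apply: anacB ha hb; exact: mxnP. Qed.
Lemma manacM m n k (A : R -> 'M[C]_(m, n)) (B : R -> 'M[C]_(n, k)) :
  manac A -> manac B -> manac (fun p => A p *m B p).
Proof. by move=> [a ha] [b hb]; eexists; exact: anac_mulmx ha hb. Qed.
Lemma manac_adj m n (A : R -> 'M[C]_(m, n)) : manac A -> manac (fun p => adj (A p)).
Proof.
move=> [a ha]; eexists; apply: (anac_lin (K := 1) _ _ _ ha).
- exact: mxnP.
- exact: rlin_adj.
- by move=> x; rewrite mxn_adj mul1r.
Qed.
Lemma manac_mulpX m n k (A : R -> 'M[C]_(m, n)) : manac A -> manac (fun p => (p ^+ k)%:C *: A p).
Proof. by move=> [a ha]; apply: anac_mulpX ha; exact: mxnP. Qed.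

Lemma mxn_le m n (A : 'M[C]_(m, n)) b : (forall i j, normc (A i j) <= b) ->
  mxn A <= (m * n)%:R * b.
Proof.
move=> H; apply: (@le_trans _ _ (\sum_(i < m) \sum_(j < n) b)).
  by apply: ler_sum => i _; apply: ler_sum => j _; exact: H.
by rewrite !sumr_const !card_ord -mulrnA mulnC -[leLHS]mulr_natl.
Qed.

(** A nonzero left kernel [K] of [A] satisfies K = - K (A - 1), which contradicts
    submultiplicativity when A - 1 has norm below 1. *)
Lemma mxn_unit m (A : 'M[C]_m) : mxn (A - 1%:M) < 1 -> A \in unitmx.
Proof.
move=> A1; rewrite -row_free_unit -kermx_eq0; apply/negPn/negP => K0.
have KE : kermx A = - (kermx A *m (A - 1%:M)).
  by rewrite mulmxBr mulmx_ker mulmx1 sub0r opprK.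
have := mxnM (kermx A) (A - 1%:M).
rewrite -(vnormN (@mxnP R _ _)) -KE => h.
have k0 : 0 < mxn (kermx A).
  rewrite lt_neqAle vnorm_ge0 ?andbT; last exact: mxnP.
  by apply: contra K0 => /eqP /esym /(vnorm_eq0 (@mxnP R _ _)) ->.
by move: h; rewrite leNgt gtr_pMr// A1.
Qed.

Lemma manac_unit m (A : R -> 'M[C]_m) : manac A -> A 0 = 1%:M ->
  exists2 r : R, 0 < r & forall p, `|p| < r -> A p \in unitmx.
Proof.
move=> [a ha] A0; have a0 := anac0E (@mxnP R _ _) ha; rewrite A0 in a0.
have [K [r [K0 r0 H]]] := anac_lip ha.
exists (Num.min r K^-1); first by rewrite lt_min r0 invr_gt0.
move=> p; rewrite lt_min => /andP[p1 p2]; apply: mxn_unit; rewrite a0.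
by apply: (le_lt_trans (H p p1)); rewrite mulrC -ltr_pdivlMr// div1r.
Qed.

Lemma hermitian_diag m (B : 'M[C]_m) : adj B = B ->
  exists U (d : 'I_m -> R), [/\ adj U *m U = 1%:M, U *m adj U = 1%:M &
    B *m U = U *m diag_mx (\row_i (d i)%:C)].
Proof.
move=> BH.
have Bh : B \is hermsymmx by apply/is_hermitianmxP; rewrite expr0 scale1r.
have Bn := hermitian_normalmx Bh.
have /orthomx_spectralP BE := Bn.
have Pu := spectral_unitarymx B.
have PU : spectralmx B *m adj (spectralmx B) = 1%:M by exact/unitarymxP.
have UP := mulmx1C PU.
have dr := hermitian_spectral_diag_real Bh.
exists (adj (spectralmx B)), (fun i => Re (spectral_diag B 0 i)).
split; rewrite ?adjK//.
have -> : \row_i (Re (spectral_diag B 0 i))%:C = spectral_diag B.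
  apply/rowP => i; rewrite mxE RRe_real//; exact: (mxOverP dr).
rewrite {1}BE invmx_unitary//; rewrite -!mulmxA; congr (_ *m _).
by rewrite PU mulmx1.
Qed.

(** * Block diagonalization for a partition of the indices into [P] and its complement *)

Section blocks.
Variables (m : nat) (P : pred 'I_m).
Implicit Types A B : 'M[C]_m.

Definition dgp A := \matrix_(i, j) (if P i == P j then A i j else 0).
Definition offp A := \matrix_(i, j) (if P i == P j then 0 else A i j).
Definition isdg A := forall i j, P i != P j -> A i j = 0.
Definition isoff A := forall i j, P i == P j -> A i j = 0.

Lemma dgp_offp A : dgp A + offp A = A.
Proof. by apply/matrixP => i j; rewrite !mxE; case: ifP; rewrite ?addr0 ?add0r. Qed.
Lemma isdg_dgp A : isdg (dgp A).
Proof. by move=> i j /negbTE h; rewrite mxE h. Qed.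
Lemma isoff_offp A : isoff (offp A).
Proof. by move=> i j h; rewrite mxE h. Qed.
Lemma isdgD A B : isdg A -> isdg B -> isdg (A + B).
Proof. by move=> ha hb i j h; rewrite mxE ha// hb// addr0. Qed.
Lemma isdgB A B : isdg A -> isdg B -> isdg (A - B).
Proof. by move=> ha hb i j h; rewrite !mxE ha// hb// subr0. Qed.
Lemma isoffD A B : isoff A -> isoff B -> isoff (A + B).
Proof. by move=> ha hb i j h; rewrite mxE ha// hb// addr0. Qed.
Lemma isoffN A : isoff A -> isoff (- A).
Proof. by move=> ha i j h; rewrite mxE ha// oppr0. Qed.
Lemma isdg_offM A B : isdg A -> isoff B -> isoff (A *m B).
Proof.
move=> ha hb i j /eqP h; rewrite mxE big1// => k _.
by have [e|e] := boolP (P i == P k); [rewrite hb ?mulr0// -h eq_sym|rewrite ha ?mul0r].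
Qed.
Lemma isoff_dgM A B : isoff A -> isdg B -> isoff (A *m B).
Proof.
move=> ha hb i j /eqP h; rewrite mxE big1// => k _.
by have [e|e] := boolP (P i == P k); [rewrite ha ?mul0r|rewrite hb ?mulr0// -h eq_sym].
Qed.
Lemma isoff_offM A B : isoff A -> isoff B -> isdg (A *m B).
Proof.
move=> ha hb i j h; rewrite mxE big1// => k _.
have [e|e] := boolP (P i == P k); first by rewrite ha ?mul0r.
by rewrite hb ?mulr0//; move: h e; case: (P i); case: (P j); case: (P k).
Qed.

Variable d : 'I_m -> C.
(** The inverse, on matrices with zero diagonal blocks, of the commutator with the diagonal matrix
    of the [d i], see [sylvE]. *)
Definition sylv A := \matrix_(i, j) (if P i == P j then 0 else A i j / (d i - d j)).

Lemma rlin_dgp : rlin dgp.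
Proof.
by split=> *; apply/matrixP => i j; rewrite !mxE; case: ifP => _; rewrite ?addr0 ?mulr0.
Qed.
Lemma rlin_offp : rlin offp.
Proof.
by split=> *; apply/matrixP => i j; rewrite !mxE; case: ifP => _; rewrite ?addr0 ?mulr0.
Qed.
Lemma rlin_sylv : rlin sylv.
Proof.
split=> *; apply/matrixP => i j; rewrite !mxE; case: ifP => _; rewrite ?addr0 ?mulr0//.
  by rewrite mulrDl.
by rewrite mulrA.
Qed.
Lemma mxn_dgp A : mxn (dgp A) <= 1 * mxn A.
Proof.
rewrite mul1r; apply: ler_sum => i _; apply: ler_sum => j _; rewrite mxE.
by case: ifP => _//; rewrite normc0 normc_ge0.
Qed.
Lemma mxn_offp A : mxn (offp A) <= 1 * mxn A.
Proof.
rewrite mul1r; apply: ler_sum => i _; apply: ler_sum => j _; rewrite mxE.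
by case: ifP => _//; rewrite normc0 normc_ge0.
Qed.
(** A bound for the norm of [sylv]. Entries with [d i = d j] contribute 0 by the convention on the
    inverse of 0; the added 1 makes it positive. *)
Definition sylvK : R := 1 + mxn (\matrix_(i, j) (d i - d j)^-1).
Lemma sylvK_gt0 : 0 < sylvK.
Proof.
rewrite /sylvK ltr_pwDl//; exact: (vnorm_ge0 (@mxnP R _ _)).
Qed.
Lemma mxn_sylv A : mxn (sylv A) <= sylvK * mxn A.
Proof.
rewrite /mxn mulr_sumr; apply: ler_sum => i _; rewrite mulr_sumr; apply: ler_sum => j _.
rewrite mxE; case: ifP => _.
  by rewrite normc0 mulr_ge0 ?normc_ge0// ltW// sylvK_gt0.
rewrite normcM mulrC; apply: ler_wpM2r; first exact: normc_ge0.
have := mxn_entry (\matrix_(i, j) (d i - d j)^-1) i j; rewrite mxE => /le_trans; apply.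
by rewrite lerDr.
Qed.

Hypothesis dP : forall i j, P i != P j -> d i != d j.

Lemma sylvE A Z : isoff A -> Z = sylv A ->
  diag_mx (\row_i d i) *m Z - Z *m diag_mx (\row_i d i) = A.
Proof.
move=> offA ->; apply/matrixP => i j.
rewrite mul_diag_mx mul_mx_diag !mxE.
case: ifP => [h|/negbT h]; first by rewrite mulr0 mul0r subr0 offA.
rewrite mulrC -mulrBr mulfVK// subr_eq0; exact: dP.
Qed.

Lemma wsum_conv_mx r (x y : nat -> 'M[C]_m) N : 0 <= r ->
  wsum r (fun j => mxn (conv (fun j => mulmx (x j)) y j)) N <=
  wsum r (fun j => mxn (x j)) N * wsum r (fun j => mxn (y j)) N.
Proof.
move=> r0; have ge0 (A : 'M[C]_m) : 0 <= mxn A by exact: (vnorm_ge0 (@mxnP R _ _)).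
apply: le_trans (wsum_conv _ _ _ _) => //.
apply: ler_wsum => // j _; apply: (le_trans (vnorm_sum (@mxnP R _ _) _ _ _)).
by apply: ler_sum => i _; exact: mxnM.
Qed.

Lemma conv_mx_ext (x x' y y' : nat -> 'M[C]_m) N :
  (forall j, (j <= N)%N -> x j = x' j) -> x 0%N = 0 ->
  (forall j, (j < N)%N -> y j = y' j) ->
  conv (fun j => mulmx (x j)) y N = conv (fun j => mulmx (x' j)) y' N.
Proof.
move=> xx x0 yy; apply: eq_bigr => -[[|j] jN] _ /=.
  by rewrite -xx// x0 !mul0mx.
by rewrite xx// yy//; rewrite ltnS in jN; clear -jN; lia.
Qed.

Lemma conv_mx_extl (x x' y : nat -> 'M[C]_m) N : y 0%N = 0 ->
  (forall j, (j < N)%N -> x j = x' j) ->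
  conv (fun j => mulmx (x j)) y N = conv (fun j => mulmx (x' j)) y N.
Proof.
move=> y0 xx; apply: eq_bigr => -[j jN] _ /=.
rewrite ltnS leq_eqVlt in jN; case/orP: jN => [/eqP->|jN]; last by rewrite xx.
by rewrite subnn y0 !mulmx0.
Qed.

(* [1 + Z] block diagonalizes [beta] when the off-diagonal blocks [Z] solve a Riccati
   equation, which the gaps between the [d i] make solvable by [series_fixpoint]. *)
Lemma matrix_riccati (b : nat -> 'M[C]_m) beta :
  anac (@mxn R m m) b beta -> b 0%N = diag_mx (\row_i d i) ->
  exists Z L : R -> 'M[C]_m, [/\ manac Z, manac L, Z 0 = 0 & exists2 r : R, 0 < r &
    forall p, `|p| < r -> isdg (L p) /\
      beta p *m (1%:M + Z p) = (1%:M + Z p) *m L p].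
Proof.
move=> hb b0.
have nP := @mxnP R m m.
have ge0 (A : 'M[C]_m) : 0 <= mxn A by exact: (vnorm_ge0 nP).
pose bo j := offp (b j).
pose bd j := if j is 0 then 0 else dgp (b j).
have bo0 : bo 0%N = 0.
  apply/matrixP => i j; rewrite /bo b0 !mxE; case: ifP => // /negbT h.
  by have [e|ne] := eqVneq i j; [rewrite e eqxx in h|rewrite mulr0n].
have dg0 : dgp (b 0%N) = b 0%N.
  apply/matrixP => i j; rewrite b0 !mxE; case: ifP => // /negbT h.
  by have [e|ne] := eqVneq i j; [rewrite e eqxx in h|rewrite mulr0n].
(* In [beta (1 + Z) = (1 + Z) L] the diagonal blocks force L = Bd + Bo Z, with Bd and Bo the
   diagonal and off-diagonal blocks of [beta]. The off-diagonal blocks then give Bo + Bd Z = Z Bd +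
   Z Bo Z; the constant term of Bd is moved to the left and inverted by [sylv]. *)
pose Phi z N := sylv (- bo N - conv (fun j => mulmx (bd j)) z N
  + conv (fun j => mulmx (z j)) bd N
  + conv (fun j => mulmx (conv (fun j => mulmx (z j)) bo j)) z N).
have [K [rho [K0 rho0 bK]]] := anac_coef nP hb.
have sK0 := sylvK_gt0.
have cb z : conv (fun j => mulmx (z j)) bo 0%N = 0 by rewrite /conv big_ord1 bo0 mulmx0.
have [z [zE zK]] : exists z, (forall N, z N = Phi z N) /\
    exists K rho : R, [/\ 0 < K, 0 < rho & forall N, mxn (z N) <= K * rho ^+ N].
  (* The 2 gives [rho * r <= 1/2], as [wsum_geo] asks; the 8 gives [sylvK * w <= 1/4], the constant
     of [series_fixpoint]. *)
  pose r := (rho * (2 + 8 * sylvK * K))^-1.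
  have den : 0 < 2 + 8 * sylvK * K by rewrite ltr_pwDl// !mulr_ge0// ltW.
  have r0 : 0 < r by rewrite invr_gt0 mulr_gt0.
  have rr : rho * r = (2 + 8 * sylvK * K)^-1 by rewrite /r invfM mulrA divff ?mul1r// gt_eqF.
  have rr2 : rho * r <= 1/2.
    rewrite rr -[leLHS]mul1r ler_pdivrMr//.
    have : 0 <= sylvK * K by rewrite mulr_ge0// ltW.
    lra.
  pose w := 2 * K * (rho * r).
  have w0 : 0 <= w by rewrite /w !mulr_ge0// ltW.
  have sw : sylvK * w <= 1/4.
    rewrite /w rr !mulrA ler_pdivrMr//.
    have : 0 <= sylvK * K by rewrite mulr_ge0// ltW.
    lra.
  apply: (series_fixpoint nP (r := r)) => // [x y N xy|x N].
    rewrite /Phi; congr sylv; congr (_ + _).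
      congr (_ - _ + _).
        by apply: conv_mx_ext.
      by apply: conv_mx_extl.
    apply: conv_mx_ext => [j jN||//]; last exact: cb.
    by apply: conv_mx_extl => // i ij; apply: xy; apply: leq_trans ij jN.
  pose s := wsum r (fun j => mxn (x j)) N; rewrite -/s.
  have s0 : 0 <= s by apply: wsum_ge0 => [|j]; [exact: ltW|exact: ge0].
  have hbo : wsum r (fun j => mxn (bo j)) N <= w.
    apply: le_trans (wsum_geo N (ltW K0) (ltW rho0) (ltW r0) rr2).
    apply: ler_wsum => [|[|j] _]; [exact: ltW|by rewrite bo0 (vnorm0 nP)|].
    by apply: (le_trans (mxn_offp _)); rewrite mul1r.
  have hbd : wsum r (fun j => mxn (bd j)) N <= w.
    apply: le_trans (wsum_geo N (ltW K0) (ltW rho0) (ltW r0) rr2).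
    apply: ler_wsum => [|[|j] _]; [exact: ltW|by rewrite (vnorm0 nP)|].
    by apply: (le_trans (mxn_dgp _)); rewrite mul1r.
  have hd0 : 0 <= wsum r (fun j => mxn (bd j)) N by apply: wsum_ge0 => [|j]; [exact: ltW|exact: ge0].
  have ho0 : 0 <= wsum r (fun j => mxn (bo j)) N by apply: wsum_ge0 => [|j]; [exact: ltW|exact: ge0].
  pose c1 := conv (fun j => mulmx (bd j)) x.
  pose c2 := conv (fun j => mulmx (x j)) bd.
  pose c0 := conv (fun j => mulmx (x j)) bo.
  pose c3 := conv (fun j => mulmx (c0 j)) x.
  have h1 : wsum r (fun j => mxn (c1 j)) N <= w * s.
    apply: (le_trans (wsum_conv_mx _ _ _ (ltW r0))); exact: ler_wpM2r.
  have h2 : wsum r (fun j => mxn (c2 j)) N <= s * w.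
    apply: (le_trans (wsum_conv_mx _ _ _ (ltW r0))); exact: ler_wpM2l.
  have h0 : wsum r (fun j => mxn (c0 j)) N <= s * w.
    apply: (le_trans (wsum_conv_mx _ _ _ (ltW r0))); exact: ler_wpM2l.
  have h3 : wsum r (fun j => mxn (c3 j)) N <= s * w * s.
    apply: (le_trans (wsum_conv_mx _ _ _ (ltW r0))); exact: ler_wpM2r.
  apply: (@le_trans _ _ (wsum r (fun j => sylvK * (mxn (bo j) + mxn (c1 j) + mxn (c2 j) + mxn (c3 j))) N)).
    apply: ler_wsum => [|j _]; first exact: ltW.
    apply: (le_trans (mxn_sylv _)); apply: ler_wpM2l; first exact: ltW.
    apply: (le_trans (vnormD nP _ _)); rewrite lerD2r.
    apply: (le_trans (vnormD nP _ _)); rewrite lerD2r.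
    by apply: (le_trans (vnormB nP _ _)); rewrite vnormN.
  rewrite wsumZ !wsumD.
  apply: (@le_trans _ _ (sylvK * (w * (1 + s) ^+ 2))).
    apply: ler_wpM2l; first exact: ltW.
    have -> : w * (1 + s) ^+ 2 = w + w * s + s * w + s * w * s by ring.
    by rewrite !lerD.
  by rewrite mulrA; apply: ler_wpM2r => //; rewrite exprn_ge0// addr_ge0.
have [Z hZ] := anac_exists nP (@mxn_complete R m m) zK.
have hbo : anac (@mxn R m m) bo (fun p => offp (beta p)).
  exact: (anac_lin nP rlin_offp mxn_offp hb).
have hbd : anac (@mxn R m m) bd (fun p => dgp (beta p) - b 0%N).
  apply: eq_coef_anac; first exact: (anacB nP (anac_lin nP rlin_dgp mxn_dgp hb) (anac_cst nP (b 0%N))).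
  by case=> [|j]; rewrite /= ?dg0 ?subrr ?subr0.
have hH := anac_lin nP rlin_sylv mxn_sylv (anacD nP (anacD nP (anacB nP (anacN nP hbo)
  (anac_mulmx hbd hZ)) (anac_mulmx hZ hbd)) (anac_mulmx (anac_mulmx hZ hbo) hZ)).
have hZ' := eq_coef_anac hZ zE.
have [r r0 ZH] := anac_inj nP hZ' hH.
exists Z, (fun p => dgp (beta p) + offp (beta p) *m Z p); split.
- by exists z.
- apply: manacD; first by eexists; exact: (anac_lin nP rlin_dgp mxn_dgp hb).
  by apply: manacM; [exists bo|exists z].
- rewrite (anac0E nP hZ) zE /Phi bo0 /conv !big_ord1/= bo0 !(mul0mx, mulmx0, subr0, oppr0, addr0).
  by apply/matrixP => i j; rewrite !mxE mul0r; case: ifP.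
exists r => // p hp.
have offZ : isoff (Z p) by rewrite ZH// => i j h; rewrite !mxE h.
have offB := isoff_offp (beta p); have dgB := isdg_dgp (beta p).
have dgb0 : isdg (b 0%N) by rewrite -dg0; exact: isdg_dgp.
split; first by apply: isdgD => //; exact: isoff_offM.
have := sylvE _ (ZH p hp); rewrite -b0 => /(_ _) E.
have {}E := E ltac:(by apply: isoffD; [apply: isoffD; [apply: isoffD; [exact: isoffN|
  apply: isoffN; apply: isdg_offM => //; exact: isdgB]|apply: isoff_dgM => //; exact: isdgB]|
  rewrite -mulmxA; apply: isoff_dgM => //; exact: isoff_offM]).
set Zp := Z p in E *; set Bd := dgp (beta p) in E *; set Bo := offp (beta p) in E *.
have E' : Bo + Bd *m Zp = Zp *m Bd + Zp *m Bo *m Zp.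
  move/eqP: E; rewrite mulmxBl mulmxBr -subr_eq0 => /eqP E; apply/subr0_eq.
  rewrite -[RHS]E; move: (b 0%N *m Zp) (Zp *m b 0%N) (Bd *m Zp) (Zp *m Bd) (Zp *m Bo *m Zp) => *.
  by apply/matrixP => i j; rewrite !mxE; ring.
rewrite -{1}(dgp_offp (beta p)) -/Bd -/Bo mulmxDr mulmx1 mulmxDl.
rewrite mul1mx mulmxDr [(Bd + Bo) *m Zp]mulmxDl mulmxA.
have -> : Bd + Bo + (Bd *m Zp + Bo *m Zp) = Bd + Bo *m Zp + (Bo + Bd *m Zp) by rewrite [Bd *m Zp + _]addrC addrACA.
by rewrite E'.
Qed.

End blocks.

(** * Splitting a matrix into two blocks and gluing them back *)

Definition sel m (P : pred 'I_m) : 'M[C]_(m, #|P|) := \matrix_(i, a) (i == enum_val a)%:R.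

Section selection.
Variables (m : nat) (P : pred 'I_m).
Let Q : pred 'I_m := predC P.
Implicit Types A : 'M[C]_m.

Lemma adj_sel (S : pred 'I_m) : adj (sel S) = (sel S)^T.
Proof. by apply/matrixP => i j; rewrite !mxE rmorph_nat. Qed.

Lemma trsel_mul (S : pred 'I_m) n (A : 'M[C]_(m, n)) a j :
  ((sel S)^T *m A) a j = A (enum_val a) j.
Proof.
rewrite mxE (bigD1 (enum_val a))//= !mxE eqxx mul1r big1 ?addr0// => i /negbTE h.
by rewrite !mxE h mul0r.
Qed.

Lemma mul_sel (S : pred 'I_m) n (A : 'M[C]_(n, m)) i a : (A *m sel S) i a = A i (enum_val a).
Proof.
rewrite mxE (bigD1 (enum_val a))//= !mxE eqxx mulr1 big1 ?addr0// => k /negbTE h.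
by rewrite !mxE h mulr0.
Qed.

Lemma sel_tr_sel (S : pred 'I_m) : (sel S)^T *m sel S = 1%:M.
Proof.
by apply/matrixP => a b; rewrite trsel_mul !mxE (inj_eq enum_val_inj).
Qed.

Lemma sel_orth : (sel P)^T *m sel Q = 0.
Proof.
apply/matrixP => a b; rewrite trsel_mul !mxE; case: eqP => // e.
have h1 : P (enum_val a) := enum_valP a.
have h2 : ~~ P (enum_val b) := enum_valP b.
by rewrite -e h1 in h2.
Qed.

Lemma sel_orth' : (sel Q)^T *m sel P = 0.
Proof. by apply: trmx_inj; rewrite trmx_mul trmxK sel_orth trmx0. Qed.

Lemma sel_mul_tr (S : pred 'I_m) : sel S *m (sel S)^T = \matrix_(i, j) ((i == j) && S i)%:R.
Proof.
apply/matrixP => i j; rewrite !mxE.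
have [Si|nSi] := boolP (S i).
  rewrite andbT (bigD1 (enum_rank_in Si i))//= !mxE enum_rankK_in// eqxx mul1r.
  rewrite big1 ?addr0 1?eq_sym// => a /eqP h; rewrite !mxE.
  by case: eqP => [e|]; rewrite ?mul0r//; case: h; subst i; rewrite enum_valK_in.
rewrite andbF big1// => a _; rewrite !mxE; case: eqP => [e|]; rewrite ?mul0r//.
by have := enum_valP a; rewrite -e => h; move: nSi; rewrite -[S i]/(i \in S) h.
Qed.

Lemma sel_sum : sel P *m (sel P)^T + sel Q *m (sel Q)^T = 1%:M.
Proof.
rewrite !sel_mul_tr; apply/matrixP => i j; rewrite !mxE /Q/=.
by case: (i == j); case: (P i); rewrite /= ?addr0 ?add0r.
Qed.

Definition glue (X : 'M[C]_#|P|) (Y : 'M[C]_#|Q|) : 'M[C]_m :=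
  sel P *m X *m (sel P)^T + sel Q *m Y *m (sel Q)^T.

Lemma glueM X Y X' Y' : glue X Y *m glue X' Y' = glue (X *m X') (Y *m Y').
Proof.
rewrite /glue mulmxDl !mulmxDr !mulmxA.
rewrite -(mulmxA (sel P *m X) (sel P)^T (sel P)) sel_tr_sel mulmx1.
rewrite -(mulmxA (sel P *m X) (sel P)^T (sel Q)) sel_orth mulmx0 !mul0mx addr0.
rewrite -(mulmxA (sel Q *m Y) (sel Q)^T (sel P)) sel_orth' mulmx0 !mul0mx add0r.
by rewrite -(mulmxA (sel Q *m Y) (sel Q)^T (sel Q)) sel_tr_sel mulmx1.
Qed.

Lemma glue1 : glue 1%:M 1%:M = 1%:M.
Proof. by rewrite /glue !mulmx1 sel_sum. Qed.

Lemma glue_unit X Y : X \in unitmx -> Y \in unitmx -> glue X Y \in unitmx.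
Proof.
move=> hX hY; have h : glue X Y *m glue (invmx X) (invmx Y) = 1%:M.
  by rewrite glueM (mulmxV hX) (mulmxV hY) glue1.
exact: (mulmx1_unit h).1.
Qed.

Lemma sel_diag (S : pred 'I_m) (D : 'M[C]_#|S|) : is_diag_mx D ->
  is_diag_mx (sel S *m D *m (sel S)^T).
Proof.
move=> /is_diag_mxP dD; apply/is_diag_mxP => i j ij; rewrite mxE big1// => a _.
rewrite [X in X * _]mxE mulr_suml big1// => b _; rewrite !mxE.
case: (i =P enum_val b) => [e1|]; last by rewrite !mul0r.
case: (j =P enum_val a) => [e2|]; last by rewrite mulr0.
rewrite dD ?mulr0 ?mul0r//; apply: contra ij => /eqP h; rewrite e1 e2.
by rewrite (val_inj h).
Qed.

Lemma glue_diag X Y : is_diag_mx X -> is_diag_mx Y -> is_diag_mx (glue X Y).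
Proof.
move=> /sel_diag /is_diag_mxP hX /sel_diag /is_diag_mxP hY.
by apply/is_diag_mxP => i j ij; rewrite mxE hX// hY// addr0.
Qed.

Lemma isdg_sel (S : pred 'I_m) A : (forall i j, S i != S j -> A i j = 0) ->
  sel S *m (sel S)^T *m A *m sel S = A *m sel S.
Proof.
move=> hA; apply/matrixP => i a; rewrite -!mulmxA [RHS]mul_sel.
rewrite mxE (eq_bigr (fun b => (i == enum_val b)%:R * A (enum_val b) (enum_val a))); last first.
  by move=> b _; rewrite mxE trsel_mul mul_sel.
have Sa : S (enum_val a) by exact: enum_valP.
have [Si|nSi] := boolP (S i).
  rewrite (bigD1 (enum_rank_in Si i))//= enum_rankK_in// eqxx mul1r.
  rewrite big1 ?addr0// => b /eqP h.
  by case: eqP => [e|]; rewrite ?mul0r//; case: h; subst i; rewrite enum_valK_in.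
rewrite hA ?Sa ?(negbTE nSi)// big1// => b _; case: eqP => [e|]; rewrite ?mul0r//.
have := enum_valP b; rewrite -e => h.
by move: nSi; rewrite -[S i]/(i \in S) h.
Qed.

Lemma glue_isdg A : isdg P A ->
  A = glue ((sel P)^T *m A *m sel P) ((sel Q)^T *m A *m sel Q).
Proof.
move=> hA; rewrite /glue !mulmxA !isdg_sel//; last first.
  by move=> i j h; apply: hA; move: h; rewrite /Q/=; case: (P i); case: (P j).
by rewrite -!mulmxA -mulmxDr sel_sum mulmx1.
Qed.

(** Since [A] preserves the coordinates in [S], compressing to [S] commutes with multiplication by
    [A], and the symmetry of [A] for the form [G] passes to the compressed pair. *)
Lemma isdg_self_adj (S : pred 'I_m) A G : (forall i j, S i != S j -> A i j = 0) ->
  G *m A = adj A *m G ->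
  ((sel S)^T *m G *m sel S) *m ((sel S)^T *m A *m sel S) =
  adj ((sel S)^T *m A *m sel S) *m ((sel S)^T *m G *m sel S).
Proof.
move=> hA h.
have E1 : (sel S)^T *m G *m sel S *m ((sel S)^T *m A *m sel S) =
    (sel S)^T *m (G *m A) *m sel S.
  by rewrite -!mulmxA; congr (_ *m (_ *m _)); rewrite !mulmxA isdg_sel.
have E2 : adj ((sel S)^T *m A *m sel S) *m ((sel S)^T *m G *m sel S) =
    (sel S)^T *m (adj A *m G) *m sel S.
  rewrite !adjM -!adj_sel adjK.
  have := congr1 (@adj R _ _) (isdg_sel hA); rewrite -adj_sel !adjM adjK !mulmxA => e.
  by rewrite ?mulmxA e.
by rewrite E1 E2 h.
Qed.

End selection.

Lemma card_lt m (P : pred 'I_m) i : ~~ P i -> (#|P| < m)%N.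
Proof.
move=> h; rewrite -[X in (_ < X)%N]card_ord; apply: proper_card.
by rewrite properE subset_predT; apply/subsetPn; exists i.
Qed.

Lemma scal_adj m (t : R) : adj ((t%:C)%:M : 'M[C]_m) = (t%:C)%:M.
Proof. by apply/matrixP => i j; rewrite !mxE eq_sym rmorphMn/= oppr0. Qed.

(* Rellich's theorem.  After removing the scalar part and the largest power of p that
   divides the rest, the value at 0 is Hermitian and not scalar, so the matrix splits
   into smaller analytic blocks. *)
Theorem rellich m (A G : R -> 'M[C]_m) : manac A -> manac G -> G 0 = 1%:M ->
  (exists2 r : R, 0 < r & forall p, `|p| < r -> G p *m A p = adj (A p) *m G p) ->
  exists X D : R -> 'M[C]_m, [/\ manac X, manac D & exists2 r : R, 0 < r &
    forall p, `|p| < r -> [/\ X p \in unitmx, is_diag_mx (D p) & A p *m X p = X p *m D p]].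
Proof.
have [n] := ubnP m; elim: n m A G => // n IH m A G mn hA hG G0 [r r0 GA].
have nP := @mxnP R m m.
have ge0 (M : 'M[C]_m) : 0 <= mxn M by exact: (vnorm_ge0 nP).
(* Taking the real part makes [T (A p)] a real scalar, self-adjoint for every form, so that
   subtracting it keeps the symmetry of [A p]. *)
pose tr (M : 'M[C]_m) : R := Re (\tr M) / m%:R.
pose T (M : 'M[C]_m) : 'M[C]_m := ((tr M)%:C)%:M.
have RT : rlin T.
  split=> [M N|a M]; rewrite /T /tr.
    by rewrite mxtraceD raddfD/= mulrDl rmorphD raddfD.
  rewrite mxtraceZ (_ : Re (a%:C * \tr M) = a * Re (\tr M)).
    by rewrite -mulrA rmorphM scale_scalar_mx.
  by case: (\tr M) => x y /=; rewrite mul0r subr0.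
have TK M : mxn (T M) <= (m * m)%:R * m%:R * mxn M.
  rewrite -mulrA; apply: mxn_le => i j; rewrite mxE.
  apply: (@le_trans _ _ `|tr M|).
    by case: (i == j); [rewrite mulr1n normc_real lexx|rewrite mulr0n normc0 normr_ge0].
  have h1 : `|Re (\tr M)| <= m%:R * mxn M.
    apply: (@le_trans _ _ (normc (\tr M))).
      by case: (\tr M) => x y /=; rewrite -sqrtr_sqr ler_wsqrtr// lerDl sqr_ge0.
    apply: (le_trans (normc_sum _ _ _)).
    apply: (@le_trans _ _ (\sum_(k < m) mxn M)).
      by apply: ler_sum => k _; exact: mxn_entry.
    by rewrite sumr_const card_ord -[leLHS]mulr_natl.
  rewrite /tr normrM normfV (ger0_norm (ler0n R m)).
  have [m0|m0] := posnP m.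
    have e : m%:R = 0 :> R by rewrite m0.
    by rewrite e invr0 mulr0 mul0r.
  rewrite ler_pdivrMr ?ltr0n//; apply: (le_trans h1).
  by rewrite ler_peMr ?mulr_ge0// ler1n.
have [a ha] := hA.
have hB := anacB nP ha (anac_lin nP RT TK ha).
set b := (fun j => _ - _) in hB.
have [b0|] := pselect (forall j, b j = 0).
  have h0 : anac (@mxn R m m) b (fun=> 0).
    by apply: eq_coef_anac (anac_cst nP 0) _; case=> [|j]; rewrite b0.
  have [s s0 H] := anac_inj nP hB h0.
  exists (fun=> 1%:M), A; split => //; first exact: manac_cst.
  exists s => // p hp; split; rewrite ?unitmx1 ?mulmx1 ?mul1mx//.
  by have /subr0_eq -> := H p hp; exact: scalar_mx_is_diag.
move=> /existsNP[k1 /eqP bk1].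
have [k bk kmin] := ex_minnP (ex_intro (fun j => b j != 0) k1 bk1).
have {}kmin j : (j < k)%N -> b j = 0.
  by move=> jk; apply/eqP; apply: contraTT jk => h; rewrite -leqNgt kmin.
have [B hB' [s s0 Bk]] := anac_shift nP (@mxn_complete R m m) hB kmin.
set b' := (fun j => _) in hB'.
have AE p : `|p| < s -> A p = T (A p) + (p ^+ k)%:C *: B p.
  by move=> /Bk <-; rewrite addrC subrK.
have B0 : B 0 = b k by rewrite (anac0E nP hB') /b' add0n.
have mpos : (0 < m)%N.
  case: (posnP m) bk => // m0; rewrite (_ : b k = 0) ?eqxx//.
  apply/matrixP => i; exfalso; have h : (0 < m)%N := leq_ltn_trans (leq0n i) (ltn_ord i).
  by clear -m0 h; lia.
have TT M : T (M - T M) = 0.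
  suff h : tr (M - T M) = 0 by rewrite {1}/T h raddf0.
  rewrite {1}/tr raddfB/= mxtrace_scalar.
  rewrite (_ : Re (_ - _) = Re (\tr M) - tr M *+ m); last first.
    by rewrite raddfB/= raddfMn.
  by rewrite /tr -[X in _ - X]mulr_natr mulfVK ?subrr ?mul0r// pnatr_eq0 -lt0n.
have TB0 : T (B 0) = 0 by rewrite B0 /b; exact: TT.
(* B p is self-adjoint for the form G p, first for p <> 0, then at 0 by continuity *)
have GB : exists2 t : R, 0 < t & forall p, `|p| < t -> G p *m B p = adj (B p) *m G p.
  pose F p := G p *m B p - adj (B p) *m G p.
  have hF : manac F.
    have hB2 : manac B by exists b'.
    by apply: manacB; apply: manacM => //; exact: manac_adj.
  have F0 p : 0 < `|p| < Num.min r s -> F p = 0.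
    rewrite lt_min normr_gt0 => /and3P[p0 pr ps].
    have pk : (p ^+ k)%:C != 0 :> C by rewrite fmorph_eq0 expf_neq0.
    apply: (scalerI pk); rewrite scaler0 /F scalerBr scalemxAr scalemxAl.
    have eB : (p ^+ k)%:C *: B p = A p - T (A p) by rewrite {1}AE// addrAC subrr add0r.
    have eB2 : (p ^+ k)%:C *: adj (B p) = adj (A p) - T (A p) by rewrite -adjZr eB adjB /T scal_adj.
    rewrite eB eB2 mulmxBr mulmxBl GA// /T mul_mx_scalar mul_scalar_mx.
    by rewrite subrr.
  exists (Num.min r s); first by rewrite lt_min r0.
  move=> p hp; apply/subr0_eq; have [->|p0] := eqVneq p 0; last by apply: F0; rewrite normr_gt0 p0.
  have [f hf] := hF; apply: (anac_near0 (r := Num.min r s) nP hf) => //.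
  by rewrite lt_min r0.
have [t t0 {}GB] := GB.
have BH : adj (B 0) = B 0.
  by have := GB 0; rewrite normr0 G0 mul1mx mulmx1 => /(_ t0).
have [U [d [UU1 UU2 BU]]] := hermitian_diag BH.
(* Otherwise the Hermitian matrix [B 0] would be a scalar of trace 0, hence 0, against the choice of
   [k]. *)
have [i0 [j0 dij]] : exists i0 j0, d i0 != d j0.
  apply: contrapT => /forallNP h; case/negP: bk; rewrite -B0; apply/eqP.
  have dc i j : d i = d j by apply/eqP; apply/negPn/negP => hh; apply: (h i); exists j.
  have BE : B 0 = ((d (Ordinal mpos))%:C)%:M.
    rewrite -[B 0]mulmx1 -UU2 mulmxA BU.
    rewrite (_ : diag_mx _ = ((d (Ordinal mpos))%:C)%:M); last first.
      by apply/matrixP => i j; rewrite !mxE (dc i (Ordinal mpos)).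
    by rewrite mul_mx_scalar -scalemxAl UU2 scalemx1.
  rewrite BE; move: TB0; rewrite BE /T /tr mxtrace_scalar raddfMn/=.
  by rewrite -[_ *+ m]mulr_natr mulfK// pnatr_eq0 -lt0n.
pose P : pred 'I_m := fun i => d i == d i0.
pose dC i := (d i)%:C.
have dP i j : P i != P j -> dC i != dC j.
  apply: contra_neq => /complexI e; by rewrite /P e.
pose beta p := adj U *m B p *m U.
have hbeta : anac (@mxn R m m) (fun j => adj U *m b' j *m U) beta.
  apply: (anac_lin (K := mxn U) nP (rlin_mulr _ U)) => [x|].
    by rewrite mulrC; exact: mxnM.
  apply: (anac_lin (K := mxn (adj U)) nP (rlin_mull _ (adj U))) hB' => x.
  exact: mxnM.
have beta0 : adj U *m b' 0%N *m U = diag_mx (\row_i dC i).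
  by rewrite /b' add0n -B0 -mulmxA BU mulmxA UU1 mul1mx.
have [Z [L [hZ hL Z0 [u u0 ZL]]]] := matrix_riccati dP hbeta beta0.
pose Y p := 1%:M + Z p.
have hY : manac Y by apply: manacD => //; exact: manac_cst.
have Y0 : Y 0 = 1%:M by rewrite /Y Z0 addr0.
(* The form [G] transported by the change of basis [U *m Y p]: the block diagonal matrix [L p] is
   self-adjoint for it, and it is the identity at p = 0, as the induction requires. *)
pose G1 p := adj (Y p) *m (adj U *m G p *m U) *m Y p.
have hG1 : manac G1.
  apply: manacM => //; apply: manacM; first exact: manac_adj.
  by apply: manacM; [apply: manacM => //; exact: manac_cst|exact: manac_cst].
have G10 : G1 0 = 1%:M by rewrite /G1 Y0 adj1 mul1mx mulmx1 G0 mulmx1 UU1.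
pose q := Num.min t u.
have q0 : 0 < q by rewrite lt_min t0.
have GL p : `|p| < q -> G1 p *m L p = adj (L p) *m G1 p.
  rewrite lt_min => /andP[pt pu].
  have [_ E] := ZL p pu; rewrite -/(Y p) in E.
  have e1 : G1 p *m L p = adj (Y p) *m adj U *m (G p *m B p) *m U *m Y p.
    rewrite /G1 -[X in X = _]mulmxA -E /beta !mulmxA.
    by rewrite -[_ *m U *m adj U]mulmxA UU2 mulmx1.
  have e2 : adj (L p) *m G1 p = adj (Y p) *m adj U *m (adj (B p) *m G p) *m U *m Y p.
    have := congr1 (@adj R _ _) E; rewrite /beta !adjM adjK => e.
    rewrite /G1 !mulmxA -e !mulmxA.
    by rewrite -[_ *m U *m adj U]mulmxA UU2 mulmx1.
  by rewrite e1 e2 (GB p pt).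
have sub (S : pred 'I_m) (j : 'I_m) : ~~ S j ->
    (forall M, isdg P M -> forall i j, S i != S j -> M i j = 0) ->
    exists X D : R -> 'M[C]_#|S|, [/\ manac X, manac D & exists2 r : R, 0 < r &
    forall p, `|p| < r -> [/\ X p \in unitmx, is_diag_mx (D p) &
      ((sel S)^T *m L p *m sel S) *m X p = X p *m D p]].
  move=> Sj SP; apply: (IH _ _ (fun p => (sel S)^T *m G1 p *m sel S)).
  - exact: (leq_trans (card_lt Sj)).
  - by apply: manacM; [apply: manacM => //; exact: manac_cst|exact: manac_cst].
  - by apply: manacM; [apply: manacM => //; exact: manac_cst|exact: manac_cst].
  - by rewrite G10 mulmx1 sel_tr_sel.
  exists q => // p pq; apply: isdg_self_adj; last exact: GL.
  by apply: SP; move: pq; rewrite lt_min => /andP[_ pu]; case: (ZL p pu).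
have [X1 [D1 [hX1 hD1 [r1 r10 H1]]]] := sub P j0 ltac:(by rewrite /P eq_sym) (fun M h => h).
have [X2 [D2 [hX2 hD2 [r2 r20 H2]]]] := sub (predC P) i0 ltac:(by rewrite /= /P eqxx)
  (fun M h i j (e : predC P i != predC P j) => h i j ltac:(by move: e => /=; case: (P i); case: (P j))).
have [y y0 hYu] := manac_unit hY Y0.
have hglue (X : R -> 'M[C]_#|P|) (X' : R -> 'M[C]_#|predC P|) : manac X -> manac X' ->
    manac (fun p => glue (X p) (X' p)).
  by move=> h1 h2; apply: manacD; apply: manacM; try apply: manacM => //; exact: manac_cst.
exists (fun p => U *m Y p *m glue (X1 p) (X2 p)),
  (fun p => T (A p) + (p ^+ k)%:C *: glue (D1 p) (D2 p)); split.
- by apply: manacM; [apply: manacM => //; exact: manac_cst|exact: hglue].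
- apply: manacD; first by eexists; exact: (anac_lin nP RT TK ha).
  by apply: manac_mulpX; exact: hglue.
exists (Num.min (Num.min s u) (Num.min y (Num.min r1 r2))).
  by rewrite !lt_min s0 u0 y0 r10 r20.
move=> p; rewrite !lt_min => /andP[/andP[ps pu] /andP[py /andP[p1 p2]]].
have [Ldg E] := ZL p pu; rewrite -/(Y p) in E.
have [X1u D1d E1] := H1 p p1; have [X2u D2d E2] := H2 p p2.
have [_ Uu] := mulmx1_unit UU1.
split.
- by rewrite !unitmx_mul Uu hYu//= glue_unit.
- have /is_diag_mxP gd := glue_diag D1d D2d.
  apply/is_diag_mxP => i j ij; rewrite mxE [X in _ + X]mxE gd// mulr0 addr0 /T mxE.
  by rewrite (negbTE (ij : i != j)).
rewrite {1}AE// [LHS]mulmxDl [RHS]mulmxDr /T mul_scalar_mx mul_mx_scalar; congr (_ + _).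
rewrite -scalemxAl -scalemxAr; congr (_ *: _).
have -> : B p *m (U *m Y p *m glue (X1 p) (X2 p)) =
    U *m (beta p *m Y p) *m glue (X1 p) (X2 p).
  by rewrite /beta !mulmxA UU2 mul1mx.
have Lg : L p *m glue (X1 p) (X2 p) = glue (X1 p) (X2 p) *m glue (D1 p) (D2 p).
  by rewrite {1}(glue_isdg Ldg) !glueM E1 E2.
by rewrite E [U *m (Y p *m L p)]mulmxA -[LHS]mulmxA Lg mulmxA.
Qed.

End rellich.

(** * Symmetric operators on a Hilbert space *)

Section inner_product_space.
Variables (R : realType) (V : lmodType R[i]) (ip : V -> V -> R[i]).
Local Notation C := R[i].

Definition is_ip :=
  [/\ forall x y z, ip x (y + z) = ip x y + ip x z,
      forall x a y, ip x (a *: y) = a * ip x y,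
      forall x y, ip y x = conjc (ip x y),
      forall x, 0 <= Re (ip x x) &
      forall x, Re (ip x x) = 0 -> x = 0].

Definition ipn x : R := Num.sqrt (Re (ip x x)).

Hypothesis ipP : is_ip.

Lemma ipDr x y z : ip x (y + z) = ip x y + ip x z. Proof. by case: ipP. Qed.
Lemma ipZr x a y : ip x (a *: y) = a * ip x y. Proof. by case: ipP. Qed.
Lemma ipJ x y : ip y x = conjc (ip x y). Proof. by case: ipP. Qed.
Lemma ipDl x y z : ip (x + y) z = ip x z + ip y z.
Proof. by rewrite ipJ ipDr rmorphD/= -!ipJ. Qed.
Lemma ipZl x a y : ip (a *: x) y = conjc a * ip x y.
Proof. by rewrite ipJ ipZr rmorphM/= -ipJ. Qed.
Lemma ip0r x : ip x 0 = 0. Proof. by rewrite -(scale0r 0) ipZr mul0r. Qed.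
Lemma ip0l x : ip 0 x = 0. Proof. by rewrite ipJ ip0r rmorph0. Qed.
Lemma ipNr x y : ip x (- y) = - ip x y.
Proof. by rewrite -scaleN1r ipZr mulN1r. Qed.
Lemma ipNl x y : ip (- x) y = - ip x y.
Proof. by rewrite ipJ ipNr rmorphN/= -ipJ. Qed.
Lemma ipBr x y z : ip x (y - z) = ip x y - ip x z. Proof. by rewrite ipDr ipNr. Qed.
Lemma ipBl x y z : ip (x - y) z = ip x z - ip y z. Proof. by rewrite ipDl ipNl. Qed.
Lemma ip_sumr x (I : Type) (r : seq I) (P : pred I) F :
  ip x (\sum_(i <- r | P i) F i) = \sum_(i <- r | P i) ip x (F i).
Proof. by elim/big_rec2: _ => [|i y1 y2 _ <-]; rewrite ?ip0r ?ipDr. Qed.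
Lemma ip_suml x (I : Type) (r : seq I) (P : pred I) F :
  ip (\sum_(i <- r | P i) F i) x = \sum_(i <- r | P i) ip (F i) x.
Proof. by elim/big_rec2: _ => [|i y1 y2 _ <-]; rewrite ?ip0l ?ipDl. Qed.

Lemma ipn_ge0 x : 0 <= ipn x. Proof. exact: sqrtr_ge0. Qed.
Lemma ipn_sqr x : ipn x ^+ 2 = Re (ip x x).
Proof. by rewrite sqr_sqrtr//; case: ipP. Qed.
Lemma ipxx x : ip x x = (ipn x ^+ 2)%:C.
Proof.
rewrite ipn_sqr; have := ipJ x x; case: (ip x x) => u v /= [h].
by congr (_ +i* _); lra.
Qed.
Lemma ipn_eq0 x : ipn x = 0 -> x = 0.
Proof.
by move=> h; case: ipP => _ _ _ _; apply; rewrite -ipn_sqr h expr0n.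
Qed.

Lemma normc_sqr (z : C) : normc z ^+ 2 = Re z ^+ 2 + Im z ^+ 2.
Proof. by case: z => x y /=; rewrite sqr_sqrtr// addr_ge0 ?sqr_ge0. Qed.

Lemma Re_le_normc (z : C) : `|Re z| <= normc z.
Proof. by case: z => x y /=; rewrite -sqrtr_sqr ler_wsqrtr// lerDl sqr_ge0. Qed.

Lemma conjc_mul (z : C) : conjc z * z = (normc z ^+ 2)%:C.
Proof.
rewrite normc_sqr; case: z => x y /=; apply/eqP; rewrite eq_complex /=.
by apply/andP; split; apply/eqP; ring.
Qed.

Lemma cauchy_schwarz x y : normc (ip x y) <= ipn x * ipn y.
Proof.
have [->|y0] := eqVneq y 0.
  by rewrite ip0r normc0 mulr_ge0 ?ipn_ge0.
have ny0 : 0 < ipn y.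
  by rewrite lt_neqAle ipn_ge0 andbT eq_sym; apply: contra y0 => /eqP/ipn_eq0 ->.
set z := ip x y.
rewrite -(ler_pXn2r (n := 2))// ?nnegrE ?mulr_ge0 ?ipn_ge0 ?normc_ge0//.
pose a : C := - (((ipn y ^+ 2)^-1)%:C * conjc z).
have : 0 <= Re (ip (x + a *: y) (x + a *: y)) by case: ipP.
rewrite ipDr !ipDl !ipZl !ipZr (ipJ x y) -/z !ipxx.
set s := ipn y ^+ 2; have s0 : 0 < s by rewrite exprn_gt0.
set N := ipn x ^+ 2.
have aE : conjc a = - ((s^-1)%:C * z) by rewrite /a rmorphN rmorphM/= conjcK oppr0.
have ws : (s^-1)%:C * s%:C = 1 :> C by rewrite -rmorphM mulVf ?rmorph1// gt_eqF.
rewrite [X in 0 <= Re X -> _](_ : _ = (N - s^-1 * normc z ^+ 2)%:C); last first.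
  have -> : (N - s^-1 * normc z ^+ 2)%:C = N%:C - (s^-1)%:C * (conjc z * z) :> C.
    by rewrite conjc_mul; apply/eqP; rewrite eq_complex/=; apply/andP; split; apply/eqP; ring.
  rewrite aE /a -/s.
  transitivity (N%:C - 2 * (s^-1)%:C * (conjc z * z) + (s^-1)%:C * (conjc z * z) * ((s^-1)%:C * s%:C)).
    ring.
  by rewrite ws; ring.
rewrite /= subr_ge0 ler_pdivrMl// => h.
by rewrite exprMn mulrC.
Qed.

Lemma ipn_vnorm : is_vnorm ipn.
Proof.
split; first exact: ipn_eq0.
  move=> x y; rewrite -(ler_pXn2r (n := 2))// ?nnegrE ?addr_ge0 ?ipn_ge0//.
  rewrite ipn_sqr ipDr !ipDl (ipJ x y) sqrrD !ipn_sqr !raddfD/=.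
  have -> : Re (conjc (ip x y)) = Re (ip x y) by case: (ip x y).
  have := cauchy_schwarz x y; have := Re_le_normc (ip x y).
  have := ler_norm (Re (ip x y)).
  rewrite mulr2n; lra.
move=> a x; apply/eqP; rewrite -(eqrXn2 (n := 2))// ?mulr_ge0 ?ipn_ge0 ?normc_ge0//.
rewrite exprMn !ipn_sqr ipZl ipZr mulrA conjc_mul.
by case: (ip x x) => u v /=; rewrite mul0r subr0.
Qed.

Definition vcvg (u : nat -> V) x :=
  forall e : R, 0 < e -> exists N, forall i, (N <= i)%N -> ipn (u i - x) <= e.

Lemma vcvg_cst x : vcvg (fun=> x) x.
Proof. by move=> e e0; exists 0%N => i _; rewrite subrr (vnorm0 ipn_vnorm) ltW. Qed.

Lemma vcvgD u v x y : vcvg u x -> vcvg v y -> vcvg (fun j => u j + v j) (x + y).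
Proof.
move=> hu hv e e0; have e2 : 0 < e / 2 by lra.
have [N hN] := hu _ e2; have [M hM] := hv _ e2; exists (N + M)%N => i hi.
rewrite opprD addrACA; apply: (le_trans (vnormD ipn_vnorm _ _)).
have := hN i (leq_trans (leq_addr _ _) hi); have := hM i (leq_trans (leq_addl _ _) hi); lra.
Qed.

Lemma vcvg_op (g : V -> V) K u x : (forall y z, g (y - z) = g y - g z) ->
  (forall y, ipn (g y) <= K * ipn y) -> vcvg u x -> vcvg (fun j => g (u j)) (g x).
Proof.
move=> gB gK hu e e0.
have K1 : 0 < `|K| + 1 by rewrite ltr_wpDl.
have [N hN] := hu _ (divr_gt0 e0 K1); exists N => i hi.
rewrite -gB; apply: (le_trans (gK _)).
apply: (@le_trans _ _ ((`|K| + 1) * ipn (u i - x))).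
  by apply: ler_wpM2r; [exact: ipn_ge0|have := ler_norm K; lra].
by rewrite mulrC -ler_pdivlMr// hN.
Qed.

Lemma vcvgZ a u x : vcvg u x -> vcvg (fun j => a *: u j) (a *: x).
Proof.
apply: (vcvg_op (K := normc a)) => [y z|y]; first exact: scalerBr.
by rewrite (vnormZ ipn_vnorm).
Qed.

Lemma vcvgN u x : vcvg u x -> vcvg (fun j => - u j) (- x).
Proof. by move=> /(vcvgZ (-1)); rewrite scaleN1r; under eq_fun do rewrite scaleN1r. Qed.

Lemma vcvgB u v x y : vcvg u x -> vcvg v y -> vcvg (fun j => u j - v j) (x - y).
Proof. by move=> hu /vcvgN; exact: vcvgD. Qed.

Lemma vcvg_le u v x y K : 0 <= K -> vcvg u x -> vcvg v y ->
  (forall j, ipn (u j) <= K * ipn (v j)) -> ipn x <= K * ipn y.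
Proof.
move=> K0 hu hv H; apply/ler_addgt0Pl => e e0.
have K1 : 0 < K + 1 by rewrite ltr_wpDl.
have [N hN] := hu _ (ltac:(lra) : 0 < e / 2).
have e1 : 0 < e / 2 / (K + 1) by rewrite divr_gt0// divr_gt0.
have [M hM] := hv _ e1.
have h1 := hN _ (leq_addr M N); have h2 := hM _ (leq_addl N M).
have h3 := vnorm_le ipn_vnorm x (u (N + M)%N).
have h4 := vnorm_le ipn_vnorm (v (N + M)%N) y.
have h5 := H (N + M)%N.
rewrite (vnormBC ipn_vnorm) in h3.
have h6 : K * ipn (v (N + M)%N) <= K * (ipn (v (N + M)%N - y) + ipn y) by exact: ler_wpM2l.
have h7 : K * ipn (v (N + M)%N - y) <= e / 2.
  apply: (@le_trans _ _ (K * (e / 2 / (K + 1)))); first exact: ler_wpM2l.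
  rewrite mulrCA -[leRHS]mulr1; apply: ler_wpM2l; first lra.
  by rewrite ler_pdivrMr// mul1r lerDl.
rewrite mulrDr in h6; lra.
Qed.

Lemma vcvg_cauchy u x : vcvg u x ->
  forall e : R, 0 < e -> exists N, forall i j, (N <= i)%N -> (N <= j)%N -> ipn (u i - u j) <= e.
Proof.
move=> hu e e0; have [N hN] := hu _ (ltac:(lra) : 0 < e / 2).
exists N => i j hi hj; apply: (le_trans (vnorm_tri ipn_vnorm x _ _)).
by have := hN i hi; have := hN j hj; rewrite (vnormBC ipn_vnorm (u j)); lra.
Qed.

Lemma vcvg_ip u v x y : vcvg u x -> vcvg v y ->
  forall e : R, 0 < e -> exists N, forall i, (N <= i)%N -> normc (ip (u i) (v i) - ip x y) <= e.
Proof.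
move=> hu hv e e0.
pose K := ipn x + ipn y + 1.
have K1 : 0 < K by rewrite /K ltr_wpDl ?addr_ge0 ?ipn_ge0.
pose d := Num.min 1 (e / (2 * K)).
have d0 : 0 < d by rewrite lt_min ltr01 divr_gt0// mulr_gt0.
have d1 : d <= 1 by rewrite ge_min lexx.
have dK : d * (2 * K) <= e by rewrite -ler_pdivlMr ?mulr_gt0// ge_min lexx orbT.
have [N hN] := hu _ d0; have [M hM] := hv _ d0; exists (N + M)%N => i hi.
have h1 := hN i (leq_trans (leq_addr _ _) hi); have h2 := hM i (leq_trans (leq_addl _ _) hi).
have -> : ip (u i) (v i) - ip x y = ip (u i - x) (v i - y) + ip (u i - x) y + ip x (v i - y).
  by rewrite !ipBr !ipBl; ring.
apply: (le_trans (le_normcD _ _)); apply: (le_trans (lerD (le_normcD _ _) (lexx _))).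
have c1 := cauchy_schwarz (u i - x) (v i - y).
have c2 := cauchy_schwarz (u i - x) y.
have c3 := cauchy_schwarz x (v i - y).
have := ipn_ge0 x; have := ipn_ge0 y; have := ipn_ge0 (u i - x); have := ipn_ge0 (v i - y).
move=> B0 A0 Y0 X0.
have q1 : ipn (u i - x) * ipn (v i - y) <= d * 1 by apply: ler_pM => //; lra.
have q2 : ipn (u i - x) * ipn y <= d * ipn y by exact: ler_wpM2r.
have q3 : ipn x * ipn (v i - y) <= ipn x * d by exact: ler_wpM2l.
have q4 : 0 <= d * ipn y by rewrite mulr_ge0// ltW.
have q5 : 0 <= ipn x * d by rewrite mulr_ge0// ltW.
rewrite /K in dK; lra.
Qed.

Definition spn (s : seq V) v := exists c : nat -> C, v = \sum_(i < size s) c i *: s`_i.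

Definition subspace (P : V -> Prop) :=
  [/\ P 0, forall x y, P x -> P y -> P (x + y) & forall a x, P x -> P (a *: x)].

Lemma subspace_sum (P : V -> Prop) (I : Type) (r : seq I) (S : pred I) (F : I -> V) :
  subspace P -> (forall i, S i -> P (F i)) -> P (\sum_(i <- r | S i) F i).
Proof. by move=> [P0 PD _] PF; elim/big_rec: _ => // i x Si Px; apply: PD => //; exact: PF. Qed.

Lemma spn_min (P : V -> Prop) s v : subspace P ->
  (forall i, (i < size s)%N -> P s`_i) -> spn s v -> P v.
Proof.
move=> PP Ps [c ->]; apply: subspace_sum => // i _.
by case: PP => _ _; apply; apply: Ps.
Qed.

Lemma spn_subspace s : subspace (spn s).
Proof.
split.
- by exists (fun=> 0); rewrite big1// => i _; rewrite scale0r.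
- move=> _ _ [c ->] [d ->]; exists (fun i => c i + d i).
  by rewrite -big_split; apply: eq_bigr => i _; rewrite scalerDl.
- move=> a _ [c ->]; exists (fun i => a * c i).
  by rewrite scaler_sumr; apply: eq_bigr => i _; rewrite scalerA.
Qed.

Lemma spnD s x y : spn s x -> spn s y -> spn s (x + y).
Proof. by case: (spn_subspace s) => _ + _; apply. Qed.
Lemma spnZ s a x : spn s x -> spn s (a *: x).
Proof. by case: (spn_subspace s) => _ _; apply. Qed.

Lemma spn_mem s i : (i < size s)%N -> spn s s`_i.
Proof.
move=> hi; exists (fun j => (j == i)%:R); rewrite (bigD1 (Ordinal hi))//= eqxx scale1r.
by rewrite big1 ?addr0// => j; rewrite -val_eqE/= => /negbTE ->; rewrite scale0r.
Qed.

Lemma spn_cons s x v : spn s v -> spn (x :: s) v.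
Proof.
apply: spn_min; first exact: spn_subspace.
by move=> i hi; exact: (@spn_mem (x :: s) i.+1).
Qed.

Definition orthon (s : seq V) := forall i j, (i < size s)%N -> (j < size s)%N ->
  ip s`_i s`_j = (i == j)%:R.

Lemma orthon_expand s v : orthon s -> spn s v -> v = \sum_(i < size s) ip s`_i v *: s`_i.
Proof.
move=> os [c ->]; apply: eq_bigr => i _; congr (_ *: _).
rewrite ip_sumr (bigD1 i)//= ipZr os// eqxx mulr1 big1 ?addr0// => j ji.
by rewrite ipZr os// eq_sym (negbTE (ji : (j != i :> nat))) mulr0.
Qed.

Lemma gram_schmidt s : exists e, [/\ orthon e, forall i, (i < size e)%N -> spn s e`_i &
  forall i, (i < size s)%N -> spn e s`_i].
Proof.
elim: s => [|x s [e [oe es se]]]; first by exists [::]; split.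
pose y := x - \sum_(i < size e) ip e`_i x *: e`_i.
have yo i : (i < size e)%N -> ip e`_i y = 0.
  move=> hi; rewrite /y ipBr ip_sumr (bigD1 (Ordinal hi))//= ipZr oe// eqxx mulr1.
  rewrite big1 ?addr0 ?subrr// => j ji; rewrite ipZr oe//.
  by rewrite eq_sym (negbTE (ji : (j != Ordinal hi :> nat))) mulr0.
have xy : x = y + \sum_(i < size e) ip e`_i x *: e`_i by rewrite subrK.
have sums : spn s (\sum_(i < size e) ip e`_i x *: e`_i).
  apply: subspace_sum; first exact: spn_subspace.
  by move=> i _; case: (spn_subspace s) => _ _; apply; exact: es.
have [y0|y0] := eqVneq y 0.
  exists e; split => //; first by move=> i hi; apply: spn_cons; exact: es.
  case=> [_|i] /=; last exact: se.
  rewrite xy y0 add0r; apply: subspace_sum; first exact: spn_subspace.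
  by move=> i _; case: (spn_subspace e) => _ _; apply; exact: spn_mem.
have n0 : 0 < ipn y.
  by rewrite lt_neqAle ipn_ge0 andbT eq_sym; apply: contra y0 => /eqP/ipn_eq0 ->.
pose z := ((ipn y)^-1)%:C *: y.
have zz : ip z z = 1.
  rewrite /z ipZl ipZr ipxx conjc_real -!rmorphM/= mulrA expr2.
  by rewrite -[LHS]/((_)%:C) mulrACA mulVf ?mulr1 ?rmorph1// gt_eqF.
have ez i : (i < size e)%N -> ip e`_i z = 0 by move=> hi; rewrite ipZr yo// mulr0.
exists (z :: e); split.
- move=> [|i] [|j] //= hi hj.
  + by rewrite ipJ ez// rmorph0.
  + by rewrite ez.
  + by rewrite oe.
- case=> [_|i] /=; last by move=> hi; apply: spn_cons; exact: es.
  apply: spnZ; apply: spnD; first exact: (@spn_mem (x :: s) 0).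
  by rewrite -scaleN1r; apply: spnZ; exact: spn_cons.
- case=> [_|i] /=; last by move=> hi; apply: spn_cons; exact: se.
  rewrite xy; apply: spnD.
    have -> : y = ((ipn y)%:C) *: z.
      by rewrite /z scalerA -rmorphM/= mulfV ?rmorph1 ?scale1r// gt_eqF.
    by apply: spnZ; exact: (@spn_mem (z :: e) 0).
  apply: spn_cons; apply: subspace_sum; first exact: spn_subspace.
  by move=> i _; case: (spn_subspace e) => _ _; apply; exact: spn_mem.
Qed.

Variables (Dom : V -> Prop) (H0 : V -> V).
Hypotheses (DomP : subspace Dom)
  (H0D : forall x y, Dom x -> Dom y -> H0 (x + y) = H0 x + H0 y)
  (H0Z : forall a x, Dom x -> H0 (a *: x) = a *: H0 x)
  (H0Dom : forall x, Dom x -> Dom (H0 x))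
  (H0sym : forall x y, Dom x -> Dom y -> ip (H0 x) y = ip x (H0 y)).

Lemma DomD x y : Dom x -> Dom y -> Dom (x + y). Proof. by case: DomP => _ + _; apply. Qed.
Lemma DomZ a x : Dom x -> Dom (a *: x). Proof. by case: DomP => _ _; apply. Qed.
Lemma Dom0 : Dom 0. Proof. by case: DomP. Qed.
Lemma DomN x : Dom x -> Dom (- x).
Proof. by rewrite -scaleN1r; exact: DomZ. Qed.
Lemma DomB x y : Dom x -> Dom y -> Dom (x - y).
Proof. by move=> hx hy; apply: DomD => //; exact: DomN. Qed.
Lemma H00 : H0 0 = 0. Proof. by rewrite -(scale0r 0) H0Z ?scale0r//; exact: Dom0. Qed.
Lemma H0B x y : Dom x -> Dom y -> H0 (x - y) = H0 x - H0 y.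
Proof. move=> hx hy; rewrite -scaleN1r H0D//; last exact: DomZ.
by rewrite H0Z// scaleN1r. Qed.
Lemma H0_sum (I : Type) (r : seq I) (S : pred I) (F : I -> V) :
  (forall i, Dom (F i)) -> H0 (\sum_(i <- r | S i) F i) = \sum_(i <- r | S i) H0 (F i).
Proof.
move=> DF; elim: r => [|i r IH]; first by rewrite !big_nil H00.
rewrite !big_cons; case: ifP => // _; rewrite H0D ?IH//.
by apply: subspace_sum => // j _; exact: DF.
Qed.

Definition eigenbasis d (e : 'I_d -> V) (l : 'I_d -> R) :=
  [/\ forall i, Dom (e i), forall i j, ip (e i) (e j) = (i == j)%:R &
      forall i, H0 (e i) = (l i)%:C *: e i].

(** In an orthonormal basis of the invariant span the matrix of [H0] is Hermitian, and its unitary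
    diagonalization rotates the basis into eigenvectors. Completeness is expressed by the expansion
    of every vector of the span. *)
Lemma finite_spectral s : (forall i, (i < size s)%N -> Dom s`_i) ->
  (forall i, (i < size s)%N -> spn s (H0 s`_i)) ->
  exists d (e : 'I_d -> V) l, eigenbasis e l /\
    forall v, spn s v -> v = \sum_i ip (e i) v *: e i.
Proof.
move=> sD sH; have [e0 [oe es se]] := gram_schmidt s.
have spe v : spn s v -> spn e0 v by apply: spn_min => //; exact: spn_subspace.
have eD i : (i < size e0)%N -> Dom e0`_i by move=> hi; apply: spn_min (es i hi).
have eH i : (i < size e0)%N -> spn e0 (H0 e0`_i).
  move=> hi; apply: spe; have [c ->] := es i hi.
  have -> : \sum_(j < size s) c j *: s`_j = \sum_(j < size s) c j *: s`_j by [].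
  rewrite H0_sum; last first.
    by move=> j; apply: DomZ; exact: sD.
  apply: subspace_sum; first exact: spn_subspace.
  by move=> j _; rewrite H0Z; [apply: spnZ; exact: sH|exact: sD].
pose d := size e0; pose M : 'M[C]_d := \matrix_(i, j) ip e0`_i (H0 e0`_j).
have MH : adj M = M.
  apply/matrixP => i j; rewrite !mxE -ipJ; apply: H0sym; exact: eD.
have [U [l [UU1 UU2 MU]]] := hermitian_diag MH.
pose e (j : 'I_d) := \sum_i U i j *: e0`_i.
have eD' j : Dom (e j).
  by apply: subspace_sum => // i _; apply: DomZ; exact: eD.
have UUE i j : \sum_k U i k * conjc (U j k) = (i == j)%:R.
  have := congr1 (fun X : 'M[C]_d => X i j) UU2; rewrite !mxE => <-.
  by apply: eq_bigr => k _; rewrite !mxE.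
exists d, e, l; split; first split => //.
- move=> i j; rewrite /e ip_suml.
  under eq_bigr => k _ do rewrite ipZl ip_sumr.
  have -> : (i == j)%:R = (adj U *m U) i j by rewrite UU1 mxE.
  rewrite mxE; apply: eq_bigr => k _; rewrite !mxE; congr (_ * _).
  rewrite (bigD1 k)//= ipZr oe// eqxx mulr1 big1 ?addr0// => k' kk.
  by rewrite ipZr oe// eq_sym (negbTE (kk : (k' != k :> nat))) mulr0.
- move=> j; rewrite /e H0_sum; last by move=> i; apply: DomZ; exact: eD.
  have -> : \sum_(i < d) H0 (U i j *: e0`_i) =
     \sum_(i < d) \sum_(k < d) (U i j * M k i) *: e0`_k.
    apply: eq_bigr => i _; rewrite H0Z; last exact: eD.
    rewrite {1}(orthon_expand oe (eH i (ltn_ord i))) scaler_sumr.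
    by apply: eq_bigr => k _; rewrite scalerA mxE.
  rewrite exchange_big scaler_sumr; apply: eq_bigr => k _.
  rewrite -scaler_suml scalerA; congr (_ *: _).
  have := congr1 (fun X : 'M[C]_d => X k j) MU; rewrite mul_mx_diag !mxE mulrC => <-.
  by apply: eq_bigr => i _; rewrite mulrC.
move=> v /spe hv; rewrite {1}(orthon_expand oe hv).
under [RHS]eq_bigr => j _ do rewrite /e ip_suml scaler_sumr.
rewrite exchange_big; apply: eq_bigr => k _.
under eq_bigr => j _ do rewrite scalerA mulr_suml.
rewrite -scaler_suml exchange_big/=; congr (_ *: _).
rewrite (bigD1 k)//= [X in _ + X]big1 => [|k' kk].
  rewrite addr0; transitivity (\sum_(i < d) ip e0`_k v * (U k i * conjc (U k i))).
    by rewrite -mulr_sumr UUE eqxx mulr1.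
  by apply: eq_bigr => i _; rewrite ipZl; ring.
transitivity (\sum_(i < d) ip e0`_k' v * (U k i * conjc (U k' i))).
  by apply: eq_bigr => i _; rewrite ipZl; ring.
by rewrite -mulr_sumr UUE eq_sym (negbTE kk) mulr0.
Qed.

End inner_product_space.

Lemma subr_subACA (V : zmodType) (x y z t : V) : (x - y) - (z - t) = (x - z) - (y - t).
Proof. by rewrite !opprB addrACA [RHS]addrACA [- y - z]addrC. Qed.

(** * Closure of a symmetric operator filtered by finite-dimensional invariant subspaces *)

Section operator_closure.
Variables (R : realType) (V : lmodType R[i]) (ip : V -> V -> R[i]).
Local Notation C := R[i].
Local Notation nr := (ipn ip).
Hypotheses (ipP : is_ip ip) (cplt : vcomplete nr).
Let nP := ipn_vnorm ipP.
Variables (Dom : V -> Prop) (H0 : V -> V) (fs : R -> seq V).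
Hypotheses (DomP : subspace Dom)
  (H0D : forall x y, Dom x -> Dom y -> H0 (x + y) = H0 x + H0 y)
  (H0Z : forall a x, Dom x -> H0 (a *: x) = a *: H0 x)
  (H0Dom : forall x, Dom x -> Dom (H0 x))
  (H0sym : forall x y, Dom x -> Dom y -> ip (H0 x) y = ip x (H0 y))
  (Dense : forall v (e : R), 0 < e -> exists2 x, Dom x & nr (v - x) <= e)
  (fsD : forall b i, (i < size (fs b))%N -> Dom (fs b)`_i)
  (fsH : forall b i, (i < size (fs b))%N -> spn (fs b) (H0 (fs b)`_i))
  (fsE : forall b v (l : R), Dom v -> H0 v = l%:C *: v -> l <= b -> spn (fs b) v)
  (fsX : forall v, Dom v -> exists b, spn (fs b) v).

Let DomZ' := @DomZ _ _ _ DomP.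
Let DomD' := @DomD _ _ _ DomP.
Let DomB' := @DomB _ _ _ DomP.
Let H0B' := @H0B _ _ _ _ DomP H0D H0Z.
Let H0sum := @H0_sum _ _ _ _ DomP H0D H0Z.

Lemma Dom_sum (I : Type) (r : seq I) (S : pred I) (F : I -> V) :
  (forall i, Dom (F i)) -> Dom (\sum_(i <- r | S i) F i).
Proof. by move=> DF; apply: subspace_sum => // i _; exact: DF. Qed.

Lemma finite_min d (x : 'I_d -> R) :
  exists delta : R, [/\ 0 < delta, delta <= 1 & forall i, 0 < x i -> delta <= x i].
Proof.
elim: d x => [|d IH] x; first by exists 1; split => // -[].
have [dl [d0 d1 dx]] := IH (fun i => x (lift ord0 i)).
have [x0|x0] := ltP 0 (x ord0).
  exists (Num.min dl (x ord0)); split; first by rewrite lt_min d0.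
    by rewrite ge_min d1.
  move=> i; case: (unliftP ord0 i) => [j ->|->] xi; rewrite ge_min ?lexx ?orbT//.
  by rewrite dx.
exists dl; split => // i; case: (unliftP ord0 i) => [j ->|->]; first exact: dx.
by rewrite ltNge x0.
Qed.

Lemma orthonormal_norm d (e : 'I_d -> V) (c : 'I_d -> C) :
  (forall i j, ip (e i) (e j) = (i == j)%:R) ->
  nr (\sum_i c i *: e i) ^+ 2 = \sum_i normc (c i) ^+ 2.
Proof.
move=> eo; apply: (@complexI R); rewrite -(ipxx ipP) rmorph_sum (ip_suml ipP)/=.
apply: eq_bigr => i _; rewrite (ipZl ipP) (ip_sumr ipP) (bigD1 i)//= (ipZr ipP) eo eqxx mulr1.
rewrite big1 ?addr0 => [|j ji]; first exact: conjc_mul.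
by rewrite (ipZr ipP) eo eq_sym (negbTE ji) mulr0.
Qed.

Lemma eigen_orth x y (k l : R) : Dom x -> Dom y -> H0 x = k%:C *: x -> H0 y = l%:C *: y ->
  k != l -> ip x y = 0.
Proof.
move=> Dx Dy hx hy kl; have := H0sym Dx Dy.
rewrite hx hy (ipZl ipP) (ipZr ipP) conjc_real => /eqP.
rewrite -subr_eq0 -mulrBl mulf_eq0 -rmorphB fmorph_eq0 subr_eq0 (negbTE kl)/=.
by move/eqP.
Qed.

(** The eigenvalues up to [Re a + 1] are carried by one finite list, hence finitely many, and all
    others are at distance more than 1 from [a]: the least nonzero distance in the list, cut at 1,
    is a gap for the whole operator. A given [f] lies in a finite-dimensional invariant subspace,
    where the estimate and the solution are read off an eigenbasis. The case m = 0 is included. *)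
Lemma spectral_gap (a : C) : exists m (u : 'I_m -> V) (dl : R),
  [/\ 0 < dl, forall i, Dom (u i), forall i j, ip (u i) (u j) = (i == j)%:R,
      forall i, H0 (u i) = a *: u i &
      forall f, Dom f -> (forall i, ip (u i) f = 0) ->
        dl * nr f <= nr (H0 f - a *: f) /\
        exists g, [/\ Dom g, forall i, ip (u i) g = 0 & H0 g - a *: g = f]].
Proof.
pose b := Re a + 1.
have [d [e [l [[eD eo eH] eX]]]] := finite_spectral ipP DomP H0D H0Z H0sym (@fsD b) (@fsH b).
pose P : pred 'I_d := fun i => (l i)%:C == a.
pose u (k : 'I_#|P|) := e (enum_val k).
have [dl [d0 d1 dx]] := finite_min (fun i => normc ((l i)%:C - a)).
have normc_gt0 (z : C) : z != 0 -> 0 < normc z.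
  move=> z0; rewrite lt_neqAle normc_ge0 andbT eq_sym.
  by apply: contra z0 => /eqP/eq0_normc ->.
have uH k : H0 (u k) = a *: u k by rewrite /u eH (eqP (enum_valP k : P _)).
have areal (k : 'I_#|P|) : a = (Re a)%:C.
  by have h : P (enum_val k) := enum_valP k; move/eqP: h => <-.
have uo i j : ip (u i) (u j) = (i == j)%:R by rewrite /u eo (inj_eq enum_val_inj).
have uD k : Dom (u k) by exact: eD.
have zero_eig v (k : R) : Dom v -> H0 v = k%:C *: v -> k%:C = a -> (forall i, ip (u i) v = 0) -> v = 0.
  move=> Dv Hv ka vu.
  have kb : k <= b by rewrite /b -ka/= lerDl.
  rewrite (eX v (fsE Dv Hv kb)) big1// => i _.
  have [Pi|nPi] := boolP (P i).
    by have := vu (enum_rank_in Pi i); rewrite /u enum_rankK_in// => ->; rewrite scale0r.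
  rewrite (eigen_orth (eD i) Dv (eH i) Hv) ?scale0r//.
  by apply: contra nPi => /eqP h; rewrite /P h ka.
have eig_gap v (k : R) : Dom v -> H0 v = k%:C *: v -> v != 0 -> k%:C != a ->
    dl <= normc (k%:C - a).
  move=> Dv Hv v0 ka; have [kb|bk] := leP k b.
    have [i hi] : exists i, k = l i.
      apply: contrapT => /forallNP h; case/negP: v0; apply/eqP.
      rewrite (eX v (fsE Dv Hv kb)) big1// => i _.
      by rewrite (eigen_orth (eD i) Dv (eH i) Hv) ?scale0r// eq_sym; apply/eqP; exact: h.
    by rewrite hi dx// normc_gt0// subr_eq0 -hi.
  apply: (le_trans d1); apply: le_trans (Re_le_normc _).
  have -> : Re (k%:C - a) = k - Re a by case: (a).
  by rewrite ger0_norm; move: bk; rewrite /b; lra.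
exists #|P|, u, dl; split => // f Df fu.
have [b' hb'] := fsX Df.
have [d' [e' [l' [[eD' eo' eH'] eX']]]] := finite_spectral ipP DomP H0D H0Z H0sym (@fsD b') (@fsH b').
have fE := eX' f hb'.
pose c i := ip (e' i) f.
have eproj v (k : R) : Dom v -> H0 v = k%:C *: v -> k%:C = a -> v = \sum_i ip (u i) v *: u i.
  move=> Dv Hv ka; apply/subr0_eq; apply: (zero_eig _ k) => //.
  - by apply: DomB' => //; apply: Dom_sum => i; exact: DomZ'.
  - rewrite H0B' ?H0sum//; [|by move=> i; exact: DomZ'|by apply: Dom_sum => i; exact: DomZ'].
    rewrite Hv scalerBr; congr (_ - _); rewrite scaler_sumr; apply: eq_bigr => i _.
    by rewrite H0Z// uH ka !scalerA mulrC.
  move=> i; rewrite (ipBr ipP) (ip_sumr ipP) (bigD1 i)//= (ipZr ipP) uo eqxx mulr1.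
  rewrite big1 ?addr0 ?subrr// => j ji; by rewrite (ipZr ipP) uo eq_sym (negbTE ji) mulr0.
have c0 i : (l' i)%:C = a -> c i = 0.
  move=> la; rewrite /c (eproj _ _ (eD' i) (eH' i) la) (ip_suml ipP) big1// => k _.
  by rewrite (ipZl ipP) fu mulr0.
have e'0 i : e' i != 0.
  apply/eqP => h; have := eo' i i; rewrite h (ip0r ipP) eqxx => /eqP.
  by rewrite eq_sym oner_eq0.
have HfE : H0 f - a *: f = \sum_i (((l' i)%:C - a) * c i) *: e' i.
  rewrite {1 2}fE H0sum; last by move=> i; exact: DomZ'.
  rewrite scaler_sumr -sumrB; apply: eq_bigr => i _.
  by rewrite H0Z// eH' !scalerA -scalerBl -/(c i); congr (_ *: _); ring.
split.
  rewrite -(ler_pXn2r (n := 2))// ?nnegrE ?mulr_ge0 ?ipn_ge0 ?(ltW d0)//.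
  rewrite exprMn HfE orthonormal_norm// {1}fE orthonormal_norm// mulr_sumr.
  apply: ler_sum => i _; rewrite -/(c i) normcM exprMn.
  have [ci|ci] := eqVneq (c i) 0; first by rewrite ci normc0 expr0n !mulr0.
  apply: ler_wpM2r; first by rewrite exprn_ge0// normc_ge0.
  apply: ler_exp; first exact: ltW.
  by apply: eig_gap (eD' i) (eH' i) (e'0 i) _; apply: contra_neq ci; exact: c0.
exists (\sum_i (((l' i)%:C - a)^-1 * c i) *: e' i); split.
- by apply: Dom_sum => i; exact: DomZ'.
- move=> k; rewrite (ip_sumr ipP) big1// => i _; rewrite (ipZr ipP).
  have [ci|ci] := eqVneq (c i) 0; first by rewrite ci mulr0 mul0r.
  have la : (l' i)%:C != a by apply: contra_neq ci; exact: c0.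
  have Hu : H0 (u k) = (Re a)%:C *: u k by rewrite uH {1}(areal k).
  rewrite (eigen_orth (uD k) (eD' i) Hu (eH' i)) ?mulr0//.
  by apply: contra la => /eqP <-; rewrite -(areal k).
rewrite H0sum; last by move=> i; exact: DomZ'.
rewrite scaler_sumr -sumrB [RHS]fE; apply: eq_bigr => i _.
rewrite H0Z// eH' !scalerA -scalerBl -/(c i).
have [ci|ci] := eqVneq (c i) 0; first by rewrite ci !mulr0 mul0r subrr.
have la : (l' i)%:C - a != 0 by rewrite subr_eq0; apply: contra_neq ci; exact: c0.
by congr (_ *: _); rewrite -[RHS](mulVKf la); ring.
Qed.

Definition Cl (f g : V) := exists v : nat -> V,
  [/\ forall j, Dom (v j), vcvg ip v f & vcvg ip (fun j => H0 (v j)) g].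

Lemma Cl_Dom x : Dom x -> Cl x (H0 x).
Proof. by move=> Dx; exists (fun=> x); split => //; exact: vcvg_cst. Qed.

Lemma ClD f g f' g' : Cl f g -> Cl f' g' -> Cl (f + f') (g + g').
Proof.
move=> [v [Dv vf vg]] [w [Dw wf wg]]; exists (fun j => v j + w j); split.
- by move=> j; exact: DomD'.
- exact: vcvgD.
by under eq_fun do rewrite H0D//; exact: vcvgD.
Qed.

Lemma ClZ a f g : Cl f g -> Cl (a *: f) (a *: g).
Proof.
move=> [v [Dv vf vg]]; exists (fun j => a *: v j); split.
- by move=> j; exact: DomZ'.
- exact: vcvgZ.
by under eq_fun do rewrite H0Z//; exact: vcvgZ.
Qed.

Lemma small_eq0 (z : C) : (forall e : R, 0 < e -> normc z <= e) -> z = 0.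
Proof.
move=> H; apply: eq0_normc; apply/eqP; rewrite eq_le normc_ge0 andbT.
by apply/ler_addgt0Pl => e e0; rewrite addr0; exact: H.
Qed.

Lemma Cl_sym f g f' g' : Cl f g -> Cl f' g' -> ip g f' = ip f g'.
Proof.
move=> [v [Dv vf vg]] [w [Dw wf wg]]; apply/subr0_eq/small_eq0 => e e0.
have e2 : 0 < e / 2 by lra.
have [N hN] := vcvg_ip ipP vg wf e2; have [M hM] := vcvg_ip ipP vf wg e2.
have h1 := hN _ (leq_addr M N); have h2 := hM _ (leq_addl N M).
rewrite H0sym// in h1.
have -> : ip g f' - ip f g' = (ip (v (N + M)%N) (H0 (w (N + M)%N)) - ip f g') -
   (ip (v (N + M)%N) (H0 (w (N + M)%N)) - ip g f') by ring.
by apply: (le_trans (le_normcD _ _)); rewrite normcN; lra.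
Qed.

Lemma inv_small (e : R) : 0 < e -> exists N, forall i, (N <= i)%N -> (i.+1%:R)^-1 <= e.
Proof.
move=> e0; exists (Num.truncn e^-1) => i hi.
rewrite -[leRHS]invrK lef_pV2 ?posrE ?invr_gt0//.
apply: ltW; apply: (lt_le_trans (Num.Theory.truncnS_gt _)).
by rewrite ler_nat.
Qed.

Variables (a : C) (m : nat) (u : 'I_m -> V) (dl : R).
Hypotheses (dl0 : 0 < dl) (uD : forall i, Dom (u i))
  (uo : forall i j, ip (u i) (u j) = (i == j)%:R) (uH : forall i, H0 (u i) = a *: u i)
  (gapP : forall f, Dom f -> (forall i, ip (u i) f = 0) ->
        dl * nr f <= nr (H0 f - a *: f) /\
        exists g, [/\ Dom g, forall i, ip (u i) g = 0 & H0 g - a *: g = f]).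

Definition proj v := \sum_k ip (u k) v *: u k.

Lemma proj_orth v i : ip (u i) (v - proj v) = 0.
Proof.
rewrite (ipBr ipP) (ip_sumr ipP) (bigD1 i)//= (ipZr ipP) uo eqxx mulr1.
rewrite big1 ?addr0 ?subrr// => j ji; by rewrite (ipZr ipP) uo eq_sym (negbTE ji) mulr0.
Qed.

Lemma proj0 v : (forall i, ip (u i) v = 0) -> proj v = 0.
Proof. by move=> h; rewrite /proj big1// => i _; rewrite h scale0r. Qed.

Lemma projD v w : proj (v + w) = proj v + proj w.
Proof. by rewrite -big_split; apply: eq_bigr => i _; rewrite (ipDr ipP) scalerDl. Qed.

Lemma projZ c v : proj (c *: v) = c *: proj v.
Proof. by rewrite scaler_sumr; apply: eq_bigr => i _; rewrite (ipZr ipP) scalerA. Qed.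

Lemma projB v w : proj (v - w) = proj v - proj w.
Proof. by rewrite projD -(scaleN1r w) projZ scaleN1r. Qed.

Lemma Dom_proj v : Dom (proj v).
Proof. by apply: Dom_sum => i; exact: DomZ'. Qed.

Lemma H0_proj v : H0 (proj v) = a *: proj v.
Proof.
rewrite H0sum; last by move=> i; exact: DomZ'.
by rewrite scaler_sumr; apply: eq_bigr => i _; rewrite H0Z// uH !scalerA mulrC.
Qed.

Lemma pyth v : nr v ^+ 2 = nr (proj v) ^+ 2 + nr (v - proj v) ^+ 2.
Proof.
apply: (@complexI R); rewrite rmorphD/= -!(ipxx ipP).
set w := v - proj v; have -> : v = proj v + w by rewrite addrC subrK.
have pw : ip (proj v) w = 0.
  by rewrite (ip_suml ipP) big1// => i _; rewrite (ipZl ipP) proj_orth mulr0.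
have wp : ip w (proj v) = 0 by rewrite (ipJ ipP) pw rmorph0.
have -> : proj (proj v + w) = proj v.
  by rewrite projD (proj0 (proj_orth v)) addr0 {1}/proj; apply: eq_bigr => i _;
     rewrite -[X in ip _ X](subrK v) -[X in X + v]opprB (ipDr ipP) (ipNr ipP) proj_orth oppr0 add0r.
clearbody w; move: (proj v) pw wp => q pw wp.
by rewrite (ipDr ipP) !(ipDl ipP) pw wp addr0 add0r.
Qed.

Lemma coproj_le v : nr (v - proj v) <= nr v.
Proof.
rewrite -(ler_pXn2r (n := 2))// ?nnegrE ?ipn_ge0// [leRHS]pyth lerDr.
by rewrite exprn_ge0// ipn_ge0.
Qed.

Lemma vcvg_coproj v x : vcvg ip v x -> vcvg ip (fun j => v j - proj (v j)) (x - proj x).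
Proof.
move=> h; apply: (@vcvg_op _ _ ip (fun v => v - proj v) 1) h => [y z|y].
  by rewrite projB subr_subACA.
by rewrite mul1r coproj_le.
Qed.

(** Subtracting from the approximating sequence its components in the eigenspace changes neither
    limit, because these components tend to those of [f], which are 0; the gap on the domain then
    passes to the limit. *)
Lemma Cl_gap f h : Cl f h -> (forall i, ip (u i) f = 0) -> dl * nr f <= nr (h - a *: f).
Proof.
move=> [v [Dv vf vh]] fu.
have vf' := vcvg_coproj vf; rewrite (proj0 fu) subr0 in vf'.
pose w j := v j - proj (v j).
have Dw j : Dom (w j) by apply: DomB' => //; exact: Dom_proj.
have wH : vcvg ip (fun j => H0 (w j)) h.
  have -> : h = h - a *: 0 by rewrite scaler0 subr0.
  have -> : (fun j => H0 (w j)) = (fun j => H0 (v j) - a *: (v j - w j)).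
    by apply/funext => j; rewrite /w H0B'//; [rewrite H0_proj subKr|exact: Dom_proj].
  apply: vcvgB => //; apply: vcvgZ => //.
  by rewrite -(subrr f); exact: vcvgB.
have wa : vcvg ip (fun j => H0 (w j) - a *: w j) (h - a *: f).
  by apply: vcvgB => //; exact: vcvgZ.
have := vcvg_le ipP (K := dl^-1) _ vf' wa.
rewrite -ler_pdivlMl//; apply; first by rewrite ltW// invr_gt0.
move=> j; rewrite ler_pdivlMl//.
by have [] := gapP (Dw j) (proj_orth _).
Qed.

(** Approximants of [g - proj g] are solved for inside the domain, and the gap turns a Cauchy
    sequence of right sides into a Cauchy sequence of solutions. Completeness and closedness do the
    rest. *)
Lemma resolvent g : exists f, (forall i, ip (u i) f = 0) /\ Cl f (g - proj g + a *: f).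
Proof.
have pick j : exists d, Dom d /\ nr (g - d) <= (j.+1%:R)^-1.
  by have [d Dd hd] := @Dense g ((j.+1%:R)^-1) ltac:(by rewrite invr_gt0); exists d.
have [d hd] := @choice _ _ _ pick.
have dg : vcvg ip d g.
  move=> e e0; have [N hN] := inv_small e0; exists N => i hi.
  rewrite (vnormBC nP); apply: le_trans (hN i hi); by case: (hd i).
pose w j := d j - proj (d j).
have wg := vcvg_coproj dg; rewrite -/(w _) in wg.
have Dw j : Dom (w j) by apply: DomB'; [case: (hd j)|exact: Dom_proj].
have pick2 j : exists f, [/\ Dom f, forall i, ip (u i) f = 0 & H0 f - a *: f = w j].
  by have [_] := gapP (Dw j) (proj_orth _).
have [f hf] := @choice _ _ _ pick2.
have fD j : Dom (f j) by case: (hf j).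
have fu j i : ip (u i) (f j) = 0 by case: (hf j).
have fw j : H0 (f j) - a *: f j = w j by case: (hf j).
have [x hx] : exists x, forall e : R, 0 < e -> exists N, forall i, (N <= i)%N -> nr (f i - x) <= e.
  apply: cplt => e e0.
  have [N hN] := vcvg_cauchy ipP wg (mulr_gt0 e0 dl0).
  exists N => i j hi hj.
  have [h _] := gapP (DomB' (fD i) (fD j)) (fun k => etrans (ipBr ipP _ _ _)
     (etrans (congr2 (fun y z => y - z) (fu i k) (fu j k)) (subr0 _))).
  rewrite -(ler_pM2l dl0); apply: (le_trans h); rewrite mulrC.
  rewrite H0B'// scalerBr subr_subACA !fw.
  exact: hN.
exists x; split.
  move=> i; apply: small_eq0 => e e0.
  have [N hN] := vcvg_ip ipP (vcvg_cst ipP (u i)) hx e0.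
  by have := hN N (leqnn _); rewrite fu sub0r normcN.
exists f; split => //.
have -> : (fun j => H0 (f j)) = (fun j => w j + a *: f j).
  by apply/funext => j; rewrite -fw subrK.
by apply: vcvgD => //; exact: vcvgZ.
Qed.

End operator_closure.

Lemma addl_subl (V : zmodType) (x y z : V) : (x + y) - (x + z) = y - z.
Proof. by rewrite opprD addrACA subrr add0r. Qed.

Lemma zmod_rearr1 (V : zmodType) (b c d r : V) :
  - c = b - c - d - (b - r) + (d - r).
Proof.
by rewrite opprB -addrA [r - b + _]addrC subrKA subrKA addrAC subrr add0r.
Qed.

Lemma zmod_rearr2 (V : zmodType) (a b c d e : V) :
  a - d - (e - c) = a - b - (d - c) + (b - e).
Proof.
rewrite [RHS]addrAC subrKA !opprB addrACA [RHS]addrACA; congr (_ + _); exact: addrC.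
Qed.

(** * Perturbation of an isolated eigenvalue *)

Section function_norm.
Variables (R : realType) (V : lmodType R[i]) (nr : V -> R) (m : nat).
Hypotheses (nP : is_vnorm nr) (cplt : vcomplete nr).
Local Notation E := ('I_m -> V).

Definition fnorm (x : E) : R := \sum_i nr (x i).

Lemma fnormP : is_vnorm (fnorm : (E : lmodType R[i]) -> R).
Proof.
split=> [x x0|x y|a x].
- apply/funext => i; apply: (vnorm_eq0 nP); apply/eqP; rewrite eq_le vnorm_ge0// andbT.
  rewrite -x0 /fnorm (bigD1 i)//= lerDl; apply: sumr_ge0 => j _; exact: vnorm_ge0.
- by rewrite /fnorm -big_split; apply: ler_sum => i _; exact: (vnormD nP).
- by rewrite /fnorm mulr_sumr; apply: eq_bigr => i _; exact: (vnormZ nP).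
Qed.

Lemma fnorm_entry (x : E) i : nr (x i) <= fnorm x.
Proof.
rewrite /fnorm (bigD1 i)//= lerDl; apply: sumr_ge0 => j _; exact: vnorm_ge0.
Qed.

Lemma fnorm_complete : vcomplete (fnorm : (E : lmodType R[i]) -> R).
Proof.
move=> u H.
have lim i : exists x, forall e : R, 0 < e -> exists N, forall k, (N <= k)%N -> nr (u k i - x) <= e.
  apply: (cplt (u := fun k => u k i)) => e e0.
  have [N hN] := H e e0; exists N => j k Nj Nk.
  exact: le_trans (fnorm_entry (u j - u k) i) (hN j k Nj Nk).
have [f hf] := @choice _ _ _ lim.
exists f => e e0.
have e1 : 0 < e / (m%:R + 1) by rewrite divr_gt0// ltr_wpDl.
have [N hN] := @choice _ _ _ (fun i => hf i _ e1).
exists (\sum_i N i)%N => k Nk.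
apply: (@le_trans _ _ (\sum_(i < m) e / (m%:R + 1))).
  apply: ler_sum => i _; apply: (hN i); apply: leq_trans Nk.
  by rewrite (bigD1 i)//=; exact: leq_addr.
rewrite sumr_const card_ord -[leLHS]mulr_natl mulrCA -[leRHS]mulr1.
apply: ler_wpM2l; first exact: ltW.
by rewrite ler_pdivrMr ?ltr_wpDl// mul1r lerDl.
Qed.

End function_norm.

Lemma wsum_conv_op (R : realType) (E1 E2 : lmodType R[i]) (n1 : E1 -> R) (n2 : E2 -> R)
  (F : nat -> E1 -> E2) (c : nat -> E1) (al : nat -> R) (r : R) N :
  is_vnorm n1 -> is_vnorm n2 -> 0 <= r -> (forall j, 0 <= al j) ->
  (forall i x, n2 (F i x) <= al i * n1 x) ->
  wsum r (fun j => n2 (conv F c j)) N <= wsum r al N * wsum r (fun j => n1 (c j)) N.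
Proof.
move=> n1P n2P r0 al0 H; apply: le_trans (wsum_conv _ _ _ _) => //; last first.
  by move=> j; exact: vnorm_ge0.
apply: ler_wsum => // j _; apply: (le_trans (vnorm_sum n2P _ _ _)).
by apply: ler_sum => i _; exact: H.
Qed.

(** As [F 0] vanishes, the coefficient of order N of the product sees only the earlier [c j]. This
    is the triangularity that [series_fixpoint] asks for. *)
Lemma conv_ext (R : realType) (E1 E2 : lmodType R[i]) (F F' : nat -> E1 -> E2)
    (c c' : nat -> E1) N :
  (forall j, (j <= N)%N -> F j =1 F' j) -> (forall x, F 0%N x = 0) ->
  (forall j, (j < N)%N -> c j = c' j) -> conv F c N = conv F' c' N.
Proof.
move=> FF F0 cc; apply: eq_bigr => -[[|j] jN] _ /=.
  by rewrite -FF// !F0.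
by rewrite FF// cc//; rewrite ltnS in jN; clear -jN; lia.
Qed.

Lemma anac_bilin (R : realType) (E1 E2 E3 : lmodType R[i]) (n1 : E1 -> R) (n2 : E2 -> R)
    (n3 : E3 -> R) (b : E1 -> E2 -> E3) (K : R) c f d g :
  is_vnorm n1 -> is_vnorm n2 -> is_vnorm n3 ->
  (forall y, rlin (b^~ y)) -> (forall x, rlin (b x)) ->
  (forall x y, n3 (b x y) <= K * n1 x * n2 y) ->
  anac n1 c f -> anac n2 d g -> exists e, anac n3 e (fun p => b (f p) (g p)).
Proof.
move=> n1P n2P n3P bl br bK [M [rho [M0 rho0 Hf]]] hg; exists (conv (fun j => b (c j)) d).
apply: (anac_op n2P n3P (W := fun p => b (f p))) hg => //.
exists (`|K| * M), rho; split => //; first by rewrite mulr_ge0.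
move=> p N v hp.
have -> : b (f p) v - \sum_(j < N) (p ^+ j)%:C *: b (c j) v = b (f p - pser c N p) v.
  have := bl v; set B := (fun x => b x v) => BP; rewrite -[RHS]/(B _) (rlinB _ _ BP).
  congr (_ - _); rewrite /pser (rlin_sum _ _ _ BP).
  by apply: eq_bigr => j _; rewrite BP.2.
apply: (le_trans (bK _ _)); apply: ler_wpM2r; first exact: (vnorm_ge0 n2P).
rewrite -mulrA; apply: (@le_trans _ _ (`|K| * n1 (f p - pser c N p))).
  by apply: ler_wpM2r; [exact: (vnorm_ge0 n1P)|exact: ler_norm].
by apply: ler_wpM2l => //; exact: Hf.
Qed.

(** * The perturbed eigenspace as a graph over the unperturbed one *)

Section perturbation.
Variables (R : realType) (V : lmodType R[i]) (ip : V -> V -> R[i]).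
Local Notation C := R[i].
Local Notation nr := (ipn ip).
Hypotheses (ipP : is_ip ip) (cplt : vcomplete nr).
Let nP := ipn_vnorm ipP.
Variables (Cl : V -> V -> Prop) (a : C) (m : nat) (u : 'I_m -> V) (dl : R).
Local Notation proj := (proj ip u).
Local Notation EV := ('I_m -> V).
Local Notation nE := (@fnorm R V nr m).
Let nEP : is_vnorm (nE : (EV : lmodType C) -> R) := fnormP m nP.
Hypotheses
  (ClD : forall f g f' g', Cl f g -> Cl f' g' -> Cl (f + f') (g + g'))
  (ClZ : forall c f g, Cl f g -> Cl (c *: f) (c *: g))
  (Clsym : forall f g f' g', Cl f g -> Cl f' g' -> ip g f' = ip f g')
  (Clu : forall i, Cl (u i) (a *: u i))
  (uo : forall i j, ip (u i) (u j) = (i == j)%:R)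
  (dl0 : 0 < dl)
  (gap : forall f h, Cl f h -> (forall i, ip (u i) f = 0) -> dl * nr f <= nr (h - a *: f))
  (res : forall g, exists f, (forall i, ip (u i) f = 0) /\ Cl f (g - proj g + a *: f)).
Variables (w : nat -> V -> V) (W : R -> V -> V) (omega : R -> R).
Hypotheses
  (wlin : forall j, rlin (w j)) (w0 : forall v, w 0%N v = 0)
  (WD : forall p x y, W p (x + y) = W p x + W p y)
  (WZ : forall p c x, W p (c *: x) = c *: W p x)
  (wW : opana nr nr w W)
  (Wsym : forall p x y, `|p| < 1 -> ip (W p x) y = ip x (W p y))
  (Wom : forall p v, `|p| < 1 -> nr (W p v) <= omega p * nr v)
  (om0 : forall e : R, 0 < e -> exists2 d : R, 0 < d & forall p, `|p| < d -> omega p <= e).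

Let projDp := projD ipP u.
Let projZp := projZ ipP u.
Let projBp := projB ipP u.
Let proj_orthp := proj_orth ipP uo.
Let pythp := pyth ipP uo.

Lemma ClN f g : Cl f g -> Cl (- f) (- g).
Proof. by move=> /(ClZ (-1)); rewrite !scaleN1r. Qed.
Lemma ClB' f g f' g' : Cl f g -> Cl f' g' -> Cl (f - f') (g - g').
Proof. by move=> h /ClN; exact: ClD. Qed.
Lemma Cl00 : Cl 0 0.
Proof.
have [f [_ h]] := res 0; have := ClZ 0 h; by rewrite !scale0r.
Qed.
Lemma Cl_sum' (I : Type) (r : seq I) (F G : I -> V) : (forall i, Cl (F i) (G i)) ->
  Cl (\sum_(i <- r) F i) (\sum_(i <- r) G i).
Proof.
move=> H; elim: r => [|i r IH]; last by rewrite !big_cons; exact: ClD.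
by rewrite !big_nil; exact: Cl00.
Qed.
Lemma WN p x : W p (- x) = - W p x. Proof. by rewrite -scaleN1r WZ scaleN1r. Qed.
Lemma WB p x y : W p (x - y) = W p x - W p y. Proof. by rewrite WD WN. Qed.
Lemma W_sum p (I : Type) (r : seq I) (F : I -> V) :
  W p (\sum_(i <- r) F i) = \sum_(i <- r) W p (F i).
Proof.
elim: r => [|i r IH]; last by rewrite !big_cons WD IH.
by rewrite !big_nil; have := WZ p 0 0; rewrite !scale0r.
Qed.

(** By the gap, a solution orthogonal to the eigenspace is unique, so a mere choice of solutions is
    automatically linear. The gap is also the bound. *)
Lemma reduced_resolvent : exists S : V -> V,
  [/\ forall g i, ip (u i) (S g) = 0, forall g, Cl (S g) (g - proj g + a *: S g),
      rlin S & forall g, nr (S g) <= dl^-1 * nr g].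
Proof.
have [S hS] := @choice _ _ _ res.
have Su g i : ip (u i) (S g) = 0 by case: (hS g).
have SC g : Cl (S g) (g - proj g + a *: S g) by case: (hS g).
have uniq f : (forall i, ip (u i) f = 0) -> Cl f (a *: f) -> f = 0.
  move=> fu /gap => /(_ fu); rewrite subrr (vnorm0 nP) pmulr_rle0// => h.
  by apply: (ipn_eq0 ipP); apply/eqP; rewrite eq_le h ipn_ge0.
exists S; split => //.
- split=> [x y|c x].
    apply/subr0_eq; apply: uniq => [i|].
      by rewrite (ipBr ipP) (ipDr ipP) !Su addr0 subr0.
    have h := ClB' (SC (x + y)) (ClD (SC x) (SC y)).
    rewrite (_ : a *: _ = x + y - proj (x + y) + a *: S (x + y) -
      (x - proj x + a *: S x + (y - proj y + a *: S y)))//.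
    rewrite projDp [_ + a *: S x + _]addrACA [x - _ + _]addrACA -opprD.
    by rewrite addl_subl scalerBr scalerDr.
  apply/subr0_eq; apply: uniq => [i|].
    by rewrite (ipBr ipP) (ipZr ipP) !Su mulr0 subr0.
  have h := ClB' (SC (c%:C *: x)) (ClZ c%:C (SC x)).
  rewrite (_ : a *: _ = c%:C *: x - proj (c%:C *: x) + a *: S (c%:C *: x) -
    c%:C *: (x - proj x + a *: S x))//.
  rewrite projZp -scalerBr [c%:C *: (_ + a *: _)]scalerDr addl_subl.
  by rewrite scalerBr !scalerA mulrC.
move=> g; rewrite mulrC ler_pdivlMr// mulrC.
have := gap (SC g) (Su g); rewrite addrK => /le_trans; apply.
exact: (coproj_le ipP uo).
Qed.

Lemma proj_idem v : proj (proj v) = proj v.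
Proof.
have := projDp (proj v) (v - proj v); rewrite addrC subrK => h.
by rewrite [RHS]h (proj0 (u := u) (v := v - _)) ?addr0// => k; exact: proj_orthp.
Qed.

Definition lift_op (g : V -> V) (z : EV) : EV := fun i => g (z i).
(** The quadratic term of the Riccati equation, with [z] standing for the images under [W p] of the
    graph vectors. *)
Definition bl (z x : EV) : EV := fun i => \sum_k ip (u k) (z i) *: x k.

Lemma nr_u i : nr (u i) = 1.
Proof. by rewrite /ipn uo eqxx /= sqrtr1. Qed.

Lemma ip_u_le i v : normc (ip (u i) v) <= nr v.
Proof. by apply: (le_trans (cauchy_schwarz ipP _ _)); rewrite nr_u mul1r. Qed.

Lemma bl_le z x : nE (bl z x) <= nE z * nE x.
Proof.
rewrite /fnorm mulr_suml; apply: ler_sum => i _; rewrite mulr_sumr.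
apply: (le_trans (vnorm_sum nP _ _ _)); apply: ler_sum => k _.
by rewrite (vnormZ nP); apply: ler_wpM2r; [exact: ipn_ge0|exact: ip_u_le].
Qed.

Lemma lift_le g K z : (forall v, nr (g v) <= K * nr v) -> nE (lift_op g z) <= K * nE z.
Proof. by move=> h; rewrite /fnorm mulr_sumr; apply: ler_sum => i _; exact: h. Qed.

Lemma rlin_lift g : rlin g -> rlin (lift_op g : (EV : lmodType C) -> (EV : lmodType C)).
Proof. by move=> [gD gZ]; split=> *; apply/funext => i; [exact: gD|exact: gZ]. Qed.

Lemma rlin_bl z : rlin (bl z : (EV : lmodType C) -> (EV : lmodType C)).
Proof.
split=> [x y|c x]; apply/funext => i.
  rewrite -[RHS]/(bl z x i + bl z y i) /bl -big_split; apply: eq_bigr => k _.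
  exact: scalerDr.
rewrite /bl -[RHS]/(_ *: _) scaler_sumr; apply: eq_bigr => k _.
by rewrite -[(c%:C *: x) k]/(c%:C *: x k) !scalerA mulrC.
Qed.

Lemma blB z z' x : bl (z - z') x = bl z x - bl z' x.
Proof.
apply/funext => i; rewrite /bl -[RHS]/(_ - _) -sumrB; apply: eq_bigr => k _.
by rewrite -[(z - z') i]/(z i - z' i) (ipBr ipP) scalerBl.
Qed.

Lemma bl_pser c N p x : bl (pser c N p) x = \sum_(j < N) (p ^+ j)%:C *: bl (c j) x.
Proof.
rewrite /pser; elim: N => [|N IH].
  rewrite !big_ord0; apply/funext => i; rewrite /bl big1// => k _.
  by rewrite -[(0 : EV) i]/(0 : V) (ip0r ipP) scale0r.
rewrite !big_ord_recr/= -IH; apply/funext => i.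
rewrite /bl -[RHS]/(_ + _) -[X in _ = _ + X]/(_ *: _) scaler_sumr -big_split.
apply: eq_bigr => k _; rewrite -[(_ + _) i]/(_ + _) (ipDr ipP) scalerDl.
by rewrite -[((p ^+ N)%:C *: c N) i]/(_ *: _) (ipZr ipP) scalerA.
Qed.

Lemma opana_lift : opana nE nE (fun j => lift_op (w j)) (fun p => lift_op (W p)).
Proof.
have [M [rho [M0 r0 H]]] := wW; exists M, rho; split => // p N v hp.
rewrite /fnorm mulr_sumr; apply: ler_sum => i _.
have -> : (lift_op (W p) v - \sum_(j < N) (p ^+ j)%:C *: (lift_op (w j) v : EV)) i =
   W p (v i) - \sum_(j < N) (p ^+ j)%:C *: w j (v i).
  by rewrite -[LHS]/(_ - _) fct_sumE.
exact: H.
Qed.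

Lemma opana_bl z f : anac nE z f ->
  opana nE nE (fun j => bl (z j)) (fun p => bl (f p)).
Proof.
move=> [M [rho [M0 r0 H]]]; exists M, rho; split => // p N v hp.
rewrite -bl_pser -blB; apply: (le_trans (bl_le _ _)).
by apply: ler_wpM2r; [exact: (vnorm_ge0 nEP)|exact: H].
Qed.

Lemma W0E v : W 0 v = 0.
Proof.
have [M [rho [M0 r0 H]]] := wW.
have := H 0 1%N v; rewrite big_ord1 expr0 rmorph1 scale1r w0 subr0 normr0 mulr0 expr1 mulr0 mul0r.
move=> /(_ ltac:(lra)) h; apply: (ipn_eq0 ipP); apply/eqP; by rewrite eq_le h ipn_ge0.
Qed.

(* [x_i = X p i] is the fixpoint of [x_i = - S (W (u_i + x_i) - \sum_k <u_k, W (u_i + x_i)> x_k)]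
   with [S] the reduced resolvent at [a]. *)
Lemma graph_series : exists (X : R -> EV), (exists c, anac nE c X) /\ X 0 = 0 /\
  exists2 r : R, 0 < r & forall p, `|p| < r -> forall i,
    (forall k, ip (u k) (X p i) = 0) /\
    Cl (u i + X p i) (a *: (u i + X p i) +
       \sum_k ip (u k) (W p (u i + X p i)) *: (u k + X p k) - W p (u i + X p i)).
Proof.
have [S [Su SC SL SK]] := reduced_resolvent.
have [M [rho [M0 rho0 HwW]]] := wW.
have wb j v : nr (w j v) <= 2 * M * rho ^+ j * nr v.
  apply: (le_trans (coef_bound nP (c := fun j => w j v) (f := W^~ v) (M := M * nr v) _ rho0 _ j)).
  - by rewrite mulr_ge0// ipn_ge0.
  - by move=> p N hp; rewrite mulrAC; exact: HwW.
  by rewrite le_eqVlt; apply/orP; left; apply/eqP; ring.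
pose K := 2 * M + 1; have K0 : 0 < K by rewrite /K; lra.
pose al j := if j is 0 then 0 else K * rho ^+ j.
have al0 j : 0 <= al j by case: j => // j; rewrite /al mulr_ge0 ?exprn_ge0 ?(ltW K0) ?(ltW rho0).
have wal j v : nr (w j v) <= al j * nr v.
  case: j => [|j]; first by rewrite w0 (vnorm0 nP) mul0r.
  apply: (le_trans (wb _ _)); apply: ler_wpM2r; first exact: ipn_ge0.
  by apply: ler_wpM2r; [rewrite exprn_ge0// ltW|rewrite lerDl].
(* The coefficients of [u + X]: the constant term of the fixpoint [X] will be 0, since [w 0]
   vanishes. *)
pose y (X : nat -> EV) j : EV := if j is 0 then u else X j.
pose lw j : EV -> EV := lift_op (w j).
pose Wy X : nat -> EV := conv (lw : nat -> (EV : lmodType C) -> (EV : lmodType C)) (y X).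
pose B X : nat -> EV := conv ((fun j => bl (Wy X j)) : nat -> (EV : lmodType C) -> (EV : lmodType C)) X.
pose Phi X N : EV := lift_op S (B X N - Wy X N).
have lw0 x : lw 0%N x = 0 by apply/funext => i; exact: w0.
have Wy0 X : Wy X 0%N = 0 by rewrite /Wy /conv big_ord1 lw0.
have bl0 x : bl 0 x = 0.
  by apply/funext => i; rewrite /bl big1// => k _; rewrite -[(0 : EV) i]/(0 : V) (ip0r ipP) scale0r.
have Wyext X X' N : (forall i, (i < N)%N -> X i = X' i) -> Wy X N = Wy X' N.
  move=> XX; apply: conv_ext => // -[|j]// jN; exact: XX.
have U0 : 0 <= nE u by exact: (vnorm_ge0 nEP).
have sg0 : 0 < dl^-1 by rewrite invr_gt0.
have [X [XE XK]] : exists X, (forall N, X N = Phi X N) /\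
    exists K rho : R, [/\ 0 < K, 0 < rho & forall N, nE (X N) <= K * rho ^+ N].
  (* D >= 2 gives [rho * r <= 1/2]; the 8 gives [dl^-1 * q * (1 + nE u) <= 1/4], as
     [series_fixpoint] asks. *)
  pose D := 2 + 8 * (dl^-1 * K * (1 + nE u)).
  have sKU : 0 <= dl^-1 * K * (1 + nE u) by apply: mulr_ge0; [apply: mulr_ge0; exact: ltW|exact: addr_ge0].
  have D0 : 0 < D by rewrite /D; lra.
  pose r := (rho * D)^-1.
  have r0 : 0 < r by rewrite invr_gt0 mulr_gt0.
  have rr : rho * r = D^-1 by rewrite /r invfM mulrA divff ?mul1r// gt_eqF.
  have rr2 : rho * r <= 1/2 by rewrite rr -[leLHS]mul1r ler_pdivrMr// /D; lra.
  pose q := 2 * K * (rho * r).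
  have q0 : 0 <= q by rewrite /q !mulr_ge0 ?(ltW K0) ?(ltW rho0) ?(ltW r0).
  have sq : dl^-1 * q * (1 + nE u) <= 1/4.
    rewrite /q rr (_ : _ * _ = 2 * (dl^-1 * K * (1 + nE u)) / D); last by ring.
    by rewrite ler_pdivrMr// /D; lra.
  have hal N : wsum r al N <= q by apply: wsum_geo => //; exact: ltW.
  apply: (series_fixpoint nEP (r := r)) => // [X X' N XX|X N].
    rewrite /Phi (Wyext X X')//; congr (lift_op S (_ - _)).
    rewrite /B; apply: conv_ext => [j jN x|x|//]; last by rewrite Wy0 bl0.
    by rewrite (Wyext X X')// => i ij; apply: XX; apply: leq_trans ij jN.
  pose s := wsum r (fun j => nE (X j)) N; rewrite -/s.
  have s0 : 0 <= s by apply: wsum_ge0 => [|j]; [exact: ltW|exact: (vnorm_ge0 nEP)].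
  have hy : wsum r (fun j => nE (y X j)) N <= nE u + s.
    apply: (@le_trans _ _ (wsum r (fun j => (if j is 0 then nE u else 0) + nE (X j)) N)).
      apply: ler_wsum => [|[|j] _]; [exact: ltW| |by rewrite add0r].
      by rewrite lerDl (vnorm_ge0 nEP).
    rewrite wsumD lerD2r /wsum; case: (N) => [|N']; first by rewrite big_ord0.
    rewrite big_ord_recl/= expr0 mulr1 big1 ?addr0// => i _; by rewrite mul0r.
  have hWy : wsum r (fun j => nE (Wy X j)) N <= q * (nE u + s).
    apply: (le_trans (wsum_conv_op _ _ nEP nEP (ltW r0) al0 _)).
      by move=> i x; apply: lift_le; exact: wal.
    apply: ler_pM => //.
      by apply: wsum_ge0 => [|j]; [exact: ltW|exact: al0].
    by apply: wsum_ge0 => [|j]; [exact: ltW|exact: (vnorm_ge0 nEP)].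
  have hB : wsum r (fun j => nE (B X j)) N <= q * (nE u + s) * s.
    apply: (le_trans (wsum_conv_op (al := fun j => nE (Wy X j)) _ _ nEP nEP (ltW r0) _ _)).
    - by move=> j; exact: (vnorm_ge0 nEP).
    - by move=> i x; exact: bl_le.
    exact: ler_wpM2r.
  apply: (@le_trans _ _ (wsum r (fun j => dl^-1 * (nE (B X j) + nE (Wy X j))) N)).
    apply: ler_wsum => [|j _]; first exact: ltW.
    apply: (le_trans (lift_le _ SK)); apply: ler_wpM2l; first exact: ltW.
    exact: (vnormB nEP).
  rewrite wsumZ wsumD.
  apply: (@le_trans _ _ (dl^-1 * q * (1 + nE u) * (1 + s) ^+ 2)); last first.
    by apply: ler_wpM2r => //; rewrite exprn_ge0// addr_ge0.
  rewrite (_ : _ * _ * _ * _ = dl^-1 * (q * ((1 + nE u) * (1 + s) ^+ 2))); last by ring.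
  apply: ler_wpM2l; first exact: ltW.
  apply: (@le_trans _ _ (q * ((nE u + s) * (1 + s)))).
    have -> : q * ((nE u + s) * (1 + s)) = q * (nE u + s) * s + q * (nE u + s) by ring.
    exact: lerD.
  apply: ler_wpM2l => //; rewrite expr2 mulrA; apply: ler_wpM2r; first by rewrite addr_ge0.
  have us0 : 0 <= nE u * s by rewrite mulr_ge0.
  have -> : (1 + nE u) * (1 + s) = 1 + s + nE u + nE u * s by ring.
  by lra.
have [Xf hX] := anac_exists nEP (fnorm_complete nP cplt) XK.
have X00 : X 0%N = 0.
  rewrite XE /Phi Wy0 subr0 /B /conv big_ord1 Wy0 bl0.
  by apply/funext => i; exact: (rlin0 SL).
have hy : anac nE (y X) (fun p => (u : EV) + Xf p).
  apply: eq_coef_anac; first exact: (anacD nEP (anac_cst nEP (u : EV)) hX).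
  by case=> [|j] /=; [rewrite X00 addr0|rewrite add0r].
have hWy : anac nE (Wy X) (fun p => lift_op (W p) (u + Xf p)).
  apply: (anac_op nEP nEP (w := lw) (W := fun p => lift_op (W p))) hy.
  - by move=> j; exact: rlin_lift.
  - by move=> p; apply: rlin_lift; split => *; [exact: WD|exact: WZ].
  exact: opana_lift.
have hB : anac nE (B X) (fun p => bl (lift_op (W p) (u + Xf p)) (Xf p)).
  apply: (anac_op nEP nEP (w := fun j => bl (Wy X j)) (W := fun p => bl (lift_op (W p) (u + Xf p)))) hX.
  - by move=> j; exact: rlin_bl.
  - by move=> p; exact: rlin_bl.
  exact: opana_bl.
have hPhi := anac_lin nEP (rlin_lift SL) (fun x => lift_le x SK) (anacB nEP hB hWy).
have hX' := eq_coef_anac hX XE.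
have [r r0 HX] := anac_inj nEP hX' hPhi.
exists Xf; split; first by exists X.
split; first by rewrite (anac0E nEP hX).
exists r => // p hp i.
pose yp k := u k + Xf p k.
pose A k := ip (u k) (W p (yp i)).
have XpE : Xf p i = S (\sum_k A k *: Xf p k - W p (yp i)).
  by have := congr1 (fun f : EV => f i) (HX p hp).
have Xu j k : ip (u k) (Xf p j) = 0.
  by have /(congr1 (fun f : EV => f j)) -> := HX p hp; exact: Su.
split; first exact: Xu.
(* The projection removed by the reduced resolvent contributes exactly the terms in [u k], which
   complete the [Xf p k] to the graph vectors. *)
have := SC (\sum_k A k *: Xf p k - W p (yp i)); rewrite -XpE => h.
have := ClD (Clu i) h; rewrite -/(yp i).
have -> : proj (\sum_k A k *: Xf p k - W p (yp i)) = - \sum_k A k *: u k.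
  rewrite projBp (proj0 (u := u)); first by rewrite sub0r.
  by move=> k; rewrite (ip_sumr ipP) big1// => j _; rewrite (ipZr ipP) Xu mulr0.
congr (Cl _ _).
rewrite -/(yp i).
have -> : \sum_k A k *: (u k + Xf p k) = \sum_k A k *: u k + \sum_k A k *: Xf p k.
  by rewrite -big_split; apply: eq_bigr => k _; rewrite scalerDr.
rewrite /yp scalerDr opprK; move: (a *: u i) (a *: Xf p i) (\sum_k _) (\sum_k _) (W p _) => b c d e f.
by rewrite -!addrA; congr (_ + _); rewrite [LHS]addrA [LHS]addrC [d + c]addrC -addrA.
Qed.

Definition comb (Y : EV) (c : 'cV[C]_m) : V := \sum_i c i 0 *: Y i.

Lemma comb_mul (Y : EV) (M : 'M[C]_m) (c : 'cV[C]_m) :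
  comb Y (M *m c) = \sum_l c l 0 *: \sum_i M i l *: Y i.
Proof.
rewrite /comb; under eq_bigr => i _ do rewrite mxE scaler_suml.
rewrite exchange_big; apply: eq_bigr => l _; rewrite scaler_sumr.
by apply: eq_bigr => i _; rewrite scalerA mulrC.
Qed.

Lemma comb_ip (Y : EV) (c : 'cV[C]_m) v : ip v (comb Y c) = \sum_i ip v (Y i) * c i 0.
Proof. by rewrite (ip_sumr ipP); apply: eq_bigr => i _; rewrite (ipZr ipP) mulrC. Qed.

Lemma W_comb p (Y : EV) c : W p (comb Y c) = \sum_i c i 0 *: W p (Y i).
Proof. by rewrite W_sum; apply: eq_bigr => i _; rewrite WZ. Qed.

(** * The eigenvalues and eigenvectors at a fixed small [p] *)

Section near_point.
Variables (p : R) (X : EV).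
Let y i := u i + X i.
Let A := \matrix_(k, i) ip (u k) (W p (y i)).
Let AA := a%:M + A.
Let G := \matrix_(i, j) ip (y i) (y j).
Hypotheses (p1 : `|p| < 1) (Xu : forall i k, ip (u k) (X i) = 0)
  (yCl : forall i, Cl (y i) (a *: y i + \sum_k ip (u k) (W p (y i)) *: y k - W p (y i)))
  (Xhalf : nE X <= 1/2) (Gu : G \in unitmx) (omp : omega p <= dl / 16).
Variables (Xh Dm : 'M[C]_m).
Hypotheses (Xhu : Xh \in unitmx) (Dd : is_diag_mx Dm) (AX : AA *m Xh = Xh *m Dm).
Let phi l := \sum_i Xh i l *: y i.
Hypothesis Dsmall : forall l, normc (Dm l l - a) <= dl / 2.

Lemma yCl' i : Cl (y i) (\sum_k AA k i *: y k - W p (y i)).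
Proof.
have := yCl i; congr (Cl _ (_ - _)).
under [RHS]eq_bigr => k _ do rewrite !mxE scalerDl.
rewrite big_split; congr (_ + _).
rewrite (bigD1 i)//= eqxx mulr1n big1 ?addr0// => k /negbTE ->.
by rewrite mulr0n scale0r.
Qed.

Lemma comb_Cl c : Cl (comb y c) (comb y (AA *m c) - W p (comb y c)).
Proof.
have := Cl_sum' (index_enum 'I_m) (fun i => ClZ (c i 0) (yCl' i)).
congr (Cl _ _); rewrite comb_mul W_comb -sumrB; apply: eq_bigr => i _.
by rewrite scalerBr.
Qed.

(** The operator is symmetric and preserves the span of the [y i]. This basis is not orthonormal, so
    its matrix [AA] is self-adjoint for the Gram matrix, which is the form of symmetry that
    [rellich] takes as hypothesis. *)
Lemma gram_adj : G *m AA = adj AA *m G.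
Proof.
apply/matrixP => i j; have := Clsym (yCl' i) (yCl' j).
rewrite (ipBl ipP) (ipBr ipP) (Wsym (y i))// => /addIr.
rewrite (ip_suml ipP) (ip_sumr ipP) !mxE => h.
apply/esym; move: h; congr (_ = _); apply: eq_bigr => k _.
  by rewrite (ipZl ipP) !mxE.
by rewrite (ipZr ipP) mulrC !mxE.
Qed.

Lemma phiE l : phi l = comb y (col l Xh).
Proof. by apply: eq_bigr => i _; rewrite mxE. Qed.

Lemma comb_phi c : comb y (Xh *m c) = \sum_l c l 0 *: phi l.
Proof. exact: comb_mul. Qed.

Lemma phi_Cl l : Cl (phi l) (Dm l l *: phi l - W p (phi l)).
Proof.
rewrite phiE; have := comb_Cl (col l Xh); congr (Cl _ (_ - _)).
have -> : AA *m col l Xh = Dm l l *: col l Xh.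
  rewrite !colE mulmxA AX -mulmxA -[Dm *m _]colE -[Xh *m delta_mx _ _]colE; apply/colP => i; rewrite !mxE (bigD1 l)//= [col l Dm l 0]mxE big1 ?addr0 1?mulrC// => k kl.
  by rewrite mxE; move/is_diag_mxP: Dd => ->; rewrite ?mulr0.
by rewrite /comb scaler_sumr; apply: eq_bigr => i _; rewrite mxE scalerA.
Qed.

Lemma comb_y0 c : comb y c = 0 -> c = 0.
Proof.
move=> h; apply/colP => k; rewrite mxE.
have := congr1 (ip (u k)) h; rewrite comb_ip (ip0r ipP) (bigD1 k)//= /y.
rewrite (ipDr ipP) uo eqxx Xu addr0 mul1r big1 ?addr0// => j jk.
by rewrite (ipDr ipP) uo Xu eq_sym (negbTE jk) addr0 mul0r.
Qed.

Lemma phi_indep (c : 'I_m -> C) : \sum_l c l *: phi l = 0 -> forall l, c l = 0.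
Proof.
move=> h l; have : comb y (Xh *m \col_l c l) = 0.
  by rewrite comb_phi -[RHS]h; apply: eq_bigr => i _; rewrite mxE.
move=> /comb_y0 /(congr1 (mulmx (invmx Xh))); rewrite mulmx0 mulKmx// => /colP/(_ l).
by rewrite !mxE.
Qed.

Lemma phi_neq0 l : phi l != 0.
Proof.
apply/eqP => h; have := phi_indep (c := fun k => (k == l)%:R).
rewrite (bigD1 l)//= eqxx scale1r h add0r big1; last by move=> k /negbTE ->; rewrite scale0r.
by move=> /(_ erefl l); rewrite eqxx => /eqP; rewrite oner_eq0.
Qed.

Lemma D_real l : Dm l l = (Re (Dm l l))%:C.
Proof.
have h := Clsym (phi_Cl l) (phi_Cl l); move: h.
rewrite (ipBl ipP) (ipBr ipP) Wsym// => /addIr; rewrite (ipZl ipP) (ipZr ipP).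
have n0 : ip (phi l) (phi l) != 0.
  rewrite (ipxx ipP) fmorph_eq0 expf_eq0 /=; apply: contra (phi_neq0 l) => /eqP h.
  by rewrite (ipn_eq0 ipP h).
move=> /(mulIf n0); case: (Dm l l) => b c [] h; congr (_ +i* _); lra.
Qed.

(** Write f = P + q with P in the unperturbed eigenspace. Then - W f is the orthogonal sum of (a -
    e) P and a vector of norm at least (dl - t) |q|, where t = |e - a|. As t <= dl / 2, both parts
    dominate t times the corresponding part of f, so t |f| <= |W f|. No constant is lost, and the
    radius is the bound of [W p] itself. *)
Lemma location l : normc (Dm l l - a) <= omega p.
Proof.
set e := Dm l l; set f := phi l.
set P := proj f; set q := f - P.
pose h := e *: f - W p f.
have Clf : Cl f h := phi_Cl l.
have ClP : Cl P (a *: P).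
  have := Cl_sum' (index_enum 'I_m) (fun k => ClZ (ip (u k) f) (Clu k)).
  congr (Cl _ _); rewrite /P /proj scaler_sumr; apply: eq_bigr => k _.
  by rewrite !scalerA mulrC.
have qu k : ip (u k) q = 0 by exact: proj_orthp.
have Clq : Cl q (h - a *: P) := ClB' Clf ClP.
have hq k : ip (u k) (h - a *: P) = 0.
  by rewrite -(Clsym (Clu k) Clq) (ipZl ipP) qu mulr0.
have g := gap Clq qu.
set t := normc (e - a).
have t2 : t <= dl / 2 by exact: Dsmall.
have t0 : 0 <= t by exact: normc_ge0.
have WE : - W p f = (a - e) *: P + ((h - a *: P) - e *: q).
  rewrite /h /q scalerBr scalerBl; move: (e *: f) (W p f) (a *: P) (e *: P) => b c d r.
  by rewrite [RHS]addrC; exact: zmod_rearr1.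
have pW : proj (- W p f) = (a - e) *: P.
  rewrite WE projDp projZp (proj0 (u := u) (v := _ - e *: q)); last first.
    by move=> k; rewrite (ipBr ipP) hq (ipZr ipP) qu mulr0 subrr.
  by rewrite addr0 /P proj_idem.
have lower : t * nr q <= nr ((h - a *: P) - e *: q).
  have := vnorm_tri nP (h - a *: P - a *: q) (h - a *: P - e *: q) 0.
  have := vnorm_tri nP (h - a *: P - e *: q) (h - a *: P - a *: q) 0.
  rewrite !subr0 addl_subl => h1 _.
  have e1 : nr (- (a *: q) - - (e *: q)) = t * nr q.
    rewrite -opprD (vnormN nP) -scalerBl (vnormZ nP) /t.
    by rewrite -[in RHS]normcN opprB.
  rewrite e1 in h1; have : t * nr q <= dl / 2 * nr q by apply: ler_wpM2r => //; exact: ipn_ge0.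
  by move=> h2; lra.
have nW : t * nr f <= nr (W p f).
  rewrite -(vnormN nP (W p f)) -(ler_pXn2r (n := 2))// ?nnegrE ?mulr_ge0 ?ipn_ge0//.
  have -> : nr (- W p f) ^+ 2 = nr ((a - e) *: P) ^+ 2 + nr (h - a *: P - e *: q) ^+ 2.
    by rewrite pythp pW; congr (_ + nr _ ^+ 2); rewrite WE addrAC subrr add0r.
  rewrite exprMn; have -> : nr f ^+ 2 = nr P ^+ 2 + nr q ^+ 2 by exact: pythp.
  rewrite (vnormZ nP) mulrDr.
  apply: lerD; last first.
    rewrite -!exprMn; apply: ler_exp => //; by rewrite mulr_ge0// ipn_ge0.
  by rewrite !exprMn -[a - e]opprB normcN.
have f0 : 0 < nr f.
  rewrite lt_neqAle ipn_ge0 andbT eq_sym; apply: contra (phi_neq0 l) => /eqP h1.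
  by rewrite -/f (ipn_eq0 ipP h1).
by rewrite -(ler_pM2r f0); exact: le_trans nW (Wom _ p1).
Qed.

(** The component v' of an eigenvector orthogonal to the graph is again an eigenvector, by symmetry.
    Being orthogonal to each u_k + X_k with X small, it is nearly orthogonal to the unperturbed
    eigenspace; the gap then gives dl / 2 |v'| <= 2 omega |v'|, which omega <= dl / 16 allows only
    for v' = 0. *)
Lemma spanning z v : Cl v (z *: v - W p v) -> normc (z - a) <= omega p ->
  exists c : 'I_m -> C, v = \sum_l c l *: phi l.
Proof.
move=> Clv zo.
pose b : 'cV[C]_m := \col_i ip (y i) v.
pose d := invmx G *m b.
pose v' := v - comb y d.
have v'y i : ip (y i) v' = 0.
  rewrite /v' (ipBr ipP) comb_ip.
  have -> : \sum_j ip (y i) (y j) * d j 0 = (G *m d) i 0.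
    by rewrite mxE; apply: eq_bigr => j _; rewrite !mxE.
  by rewrite /d mulKVmx// mxE subrr.
have ycomb c x : (forall i, ip (y i) x = 0) -> ip (comb y c) x = 0.
  by move=> h; rewrite (ip_suml ipP) big1// => i _; rewrite (ipZl ipP) h mulr0.
pose t := comb y (z *: d - AA *m d).
have Clv' : Cl v' (z *: v' - W p v' + t).
  have := ClB' Clv (comb_Cl d); congr (Cl _ _).
  have -> : t = z *: comb y d - comb y (AA *m d).
    rewrite /t /comb scaler_sumr -sumrB; apply: eq_bigr => i _.
    by rewrite mxE [X in X + _]mxE [X in _ + X]mxE scalerBl scalerA.
  rewrite /v' WB scalerBr; exact: zmod_rearr2.
(* [t] lies in the span of the [y i], and the symmetry of the operator makes it orthogonal to each
   of them. *)
have t0 : t = 0.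
  have ty i : ip (y i) t = 0.
    have h := Clsym (yCl' i) Clv'; move: h.
    rewrite (ipBl ipP) (ip_suml ipP) big1 ?sub0r; last by move=> k _; rewrite (ipZl ipP) v'y mulr0.
    clearbody v'; rewrite (ipDr ipP) (ipBr ipP) (ipZr ipP) v'y mulr0 sub0r Wsym//.
    by rewrite -[LHS]addr0 => /addrI ->.
  by apply: (ipn_eq0 ipP); rewrite /ipn ycomb//= sqrtr0.
rewrite t0 addr0 in Clv'.
pose P := proj v'; pose q := v' - P.
have ClP : Cl P (a *: P).
  have := Cl_sum' (index_enum 'I_m) (fun k => ClZ (ip (u k) v') (Clu k)).
  congr (Cl _ _); rewrite /P /proj scaler_sumr; apply: eq_bigr => k _.
  by rewrite !scalerA mulrC.
have qu k : ip (u k) q = 0 by exact: proj_orthp.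
have g := gap (ClB' Clv' ClP) qu.
have nv0 := ipn_ge0 ip v'.
(* Orthogonality to [u k + X k] replaces each coefficient of [v'] on [u k] by minus its coefficient
   on [X k]. *)
have nPh : nr P <= 1/2 * nr v'.
  apply: (@le_trans _ _ (nE X * nr v')); last exact: ler_wpM2r.
  rewrite /fnorm mulr_suml; apply: (le_trans (vnorm_sum nP _ _ _)); apply: ler_sum => k _.
  rewrite (vnormZ nP) nr_u mulr1.
  have -> : ip (u k) v' = - ip (X k) v'.
    by apply/eqP; rewrite -addr_eq0 -(ipDl ipP); apply/eqP; exact: v'y.
  by rewrite normcN; exact: (cauchy_schwarz ipP).
have nq : 1/2 * nr v' <= nr q.
  by have := vnormD nP q P; rewrite /q subrK; lra.
have rhs : nr (z *: v' - W p v' - a *: P - a *: q) <= 2 * omega p * nr v'.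
  have -> : z *: v' - W p v' - a *: P - a *: q = (z - a) *: v' - W p v'.
    have -> : a *: q = a *: v' - a *: P by rewrite scalerBr.
    by rewrite opprB addrA subrK scalerBl addrAC.
  apply: (le_trans (vnormB nP _ _)); rewrite (vnormZ nP).
  have := Wom v' p1; have : normc (z - a) * nr v' <= omega p * nr v' by exact: ler_wpM2r.
  lra.
have v'0 : v' = 0.
  apply: (ipn_eq0 ipP); apply/eqP; rewrite eq_le nv0 andbT.
  have h1 : dl * (1/2 * nr v') <= 2 * omega p * nr v'.
    by apply: le_trans (le_trans g rhs); apply: ler_wpM2l => //; exact: ltW.
  have h2 : omega p * nr v' <= dl / 16 * nr v' by exact: ler_wpM2r.
  have h3 : dl * nr v' <= 0 by lra.
  by rewrite -(pmulr_rle0 _ dl0).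
exists (fun l => (invmx Xh *m d) l 0).
by rewrite -comb_phi mulKVmx//; apply/eqP; rewrite -subr_eq0 -/v' v'0.
Qed.

Lemma near_point : [/\ forall l, Cl (phi l) (Dm l l *: phi l - W p (phi l)),
  forall l, Dm l l = (Re (Dm l l))%:C,
  forall l, normc (Dm l l - a) <= omega p,
  forall c : 'I_m -> C, \sum_l c l *: phi l = 0 -> forall l, c l = 0 &
  forall z v, Cl v (z *: v - W p v) -> normc (z - a) <= omega p ->
    exists c : 'I_m -> C, v = \sum_l c l *: phi l].
Proof.
split; [exact: phi_Cl|exact: D_real|exact: location|exact: phi_indep|exact: spanning].
Qed.

End near_point.

Definition gram (x y : EV) : 'M[C]_m := \matrix_(i, j) ip (x i) (y j).

Lemma gram_le x y : mxn (gram x y) <= nE x * nE y.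
Proof.
rewrite /mxn /fnorm mulr_suml; apply: ler_sum => i _; rewrite mulr_sumr.
by apply: ler_sum => j _; rewrite mxE; exact: (cauchy_schwarz ipP).
Qed.

Lemma rlin_gramr x : rlin (gram x : (EV : lmodType C) -> 'M[C]_m).
Proof.
split=> [y z|c z]; apply/matrixP => i j; rewrite !mxE.
  by rewrite -[(y + z) j]/(y j + z j) (ipDr ipP).
by rewrite -[(c%:C *: z) j]/(c%:C *: z j) (ipZr ipP).
Qed.

Lemma rlin_graml y : rlin (gram^~ y : (EV : lmodType C) -> 'M[C]_m).
Proof.
split=> [x z|c z]; apply/matrixP => i j; rewrite !mxE.
  by rewrite -[(x + z) i]/(x i + z i) (ipDl ipP).
by rewrite -[(c%:C *: z) i]/(c%:C *: z i) (ipZl ipP) conjc_real.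
Qed.

Definition mix (M : 'M[C]_m) (y : EV) : EV := fun l => \sum_i M i l *: y i.

Lemma mix_le M y : nE (mix M y) <= mxn M * nE y.
Proof.
apply: (@le_trans _ _ (\sum_l \sum_i normc (M i l) * nr (y i))).
  apply: ler_sum => l _; apply: (le_trans (vnorm_sum nP _ _ _)).
  by apply: ler_sum => i _; rewrite (vnormZ nP).
rewrite exchange_big /mxn mulr_suml; apply: ler_sum => i _.
rewrite -mulr_suml; apply: ler_wpM2l; last exact: fnorm_entry.
by apply: sumr_ge0 => j _; exact: normc_ge0.
Qed.

Lemma rlin_mixr M : rlin (mix M : (EV : lmodType C) -> (EV : lmodType C)).
Proof.
split=> [x y|c x]; apply/funext => i.
  rewrite -[RHS]/(mix M x i + mix M y i) /mix -big_split; apply: eq_bigr => k _.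
  exact: scalerDr.
rewrite /mix -[RHS]/(_ *: _) scaler_sumr; apply: eq_bigr => k _.
by rewrite -[(c%:C *: x) k]/(c%:C *: x k) !scalerA mulrC.
Qed.

Lemma rlin_mixl y : rlin (mix^~ y : _ -> (EV : lmodType C)).
Proof.
split=> [A B|c A]; apply/funext => i.
  rewrite -[RHS]/(mix A y i + mix B y i) /mix -big_split; apply: eq_bigr => k _.
  by rewrite mxE scalerDl.
rewrite /mix -[RHS]/(_ *: _) scaler_sumr; apply: eq_bigr => k _.
by rewrite mxE scalerA.
Qed.

(** Analyticity at every point of the interval, whereas [anac] speaks of 0 only. The ratio 1/2 is
    the one that [anac_recenter] delivers. *)
Definition locpow (E : lmodType R[i]) (n : E -> R) (r : R) (f : R -> E) :=
  forall p : R, `|p| < r -> exists (d : nat -> E) (e : R), 0 < e /\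
    forall q, `|q - p| < e -> exists2 K : R, 0 < K & forall N,
    n (f q - \sum_(j < N) ((q - p) ^+ j)%:C *: d j) <= K * (1/2) ^+ N.

Theorem analytic_perturbation : exists (r : R) (E : 'I_m -> R -> R) (phi : 'I_m -> R -> V),
  [/\ 0 < r <= 1,
      forall l, locpow (E := C^o) (@normc R) r (fun p => (E l p)%:C),
      forall l, locpow nr r (phi l) &
      forall p, `|p| < r ->
      [/\ forall l, Cl (phi l p) ((E l p)%:C *: phi l p - W p (phi l p)),
      forall l, normc ((E l p)%:C - a) <= omega p,
      forall c : 'I_m -> C, \sum_l c l *: phi l p = 0 -> forall l, c l = 0 &
      forall z v, Cl v (z *: v - W p v) -> normc (z - a) <= omega p ->
        exists c : 'I_m -> C, v = \sum_l c l *: phi l p]].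
Proof.
have [X [[c hX] [X0 [r1 r10 HX]]]] := graph_series.
pose y p : EV := (u : EV) + X p.
have [cy hy] : exists c, anac nE c y by eexists; exact: (anacD nEP (anac_cst nEP (u : EV)) hX).
have [cW hW] : exists c, anac nE c (fun p => lift_op (W p) (y p)).
  eexists; apply: (anac_op nEP nEP (w := fun j => lift_op (w j)) (W := fun p => lift_op (W p))) hy.
  - by move=> j; exact: rlin_lift.
  - by move=> p; apply: rlin_lift; split => *; [exact: WD|exact: WZ].
  exact: opana_lift.
have MP := @mxnP R m m.
have bil1 x z : mxn (gram x z) <= 1 * nE x * nE z by rewrite mul1r; exact: gram_le.
have bil2 x z : nE (mix x z) <= 1 * mxn x * nE z by rewrite mul1r; exact: mix_le.
have hG : manac (fun p => gram (y p) (y p)).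
  exact: (anac_bilin nEP nEP MP rlin_graml rlin_gramr bil1 hy hy).
have hA : manac (fun p => gram u (lift_op (W p) (y p))).
  exact: (anac_bilin nEP nEP MP rlin_graml rlin_gramr bil1 (anac_cst nEP (u : EV)) hW).
pose AA p := a%:M + gram u (lift_op (W p) (y p)).
have hAA : manac AA by apply: manacD; [exact: manac_cst|].
have y0 : y 0 = u by rewrite /y X0 addr0.
have G0 : gram (y 0) (y 0) = 1%:M.
  by rewrite y0; apply/matrixP => i j; rewrite !mxE uo.
have AA0 : AA 0 = a%:M.
  apply/matrixP => i j; rewrite !mxE /lift_op W0E (ip0r ipP) addr0 //.
pose r2 := Num.min r1 1.
have r20 : 0 < r2 by rewrite lt_min r10 ltr01.
have lt12 (p : R) : `|p| < r2 -> `|p| < r1 /\ `|p| < 1 by rewrite lt_min => /andP[].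
have sa : exists2 r : R, 0 < r & forall p, `|p| < r ->
    gram (y p) (y p) *m AA p = adj (AA p) *m gram (y p) (y p).
  exists r2 => // p /lt12 [p1 p2].
  apply: gram_adj => // i; by case: (HX p p1 i).
have [Xh [Dm [hXh hD [r3 r30 HD]]]] := rellich hAA hG G0 sa.
(* At p = 0 the matrix is the scalar [a], so every analytic eigenvalue starts at [a]; by continuity
   it satisfies the a priori bound [dl / 2] from which [location] starts. *)
have D0 : Dm 0 = a%:M.
  have [] := HD 0; first by rewrite normr0.
  rewrite AA0 mul_scalar_mx => Xu _ /(congr1 (mulmx (invmx (Xh 0)))).
  by rewrite mulKmx// -scalemxAr mulVmx// => <-; rewrite scalemx1.
have [r4 r40 HG] := manac_unit hG G0.
have [K5 [r5 [K50 r50 H5]]] := anac_lip hX.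
have cX0 : c 0%N = 0 by rewrite -(anac0E nEP hX) X0.
have [cD hcD] := hD; have [K6 [r6 [K60 r60 H6]]] := anac_lip hcD.
have cD0 : cD 0%N = a%:M by rewrite -(anac0E MP hcD) D0.
have [r7 r70 H7] := om0 (e := dl / 16) ltac:(by rewrite divr_gt0).
have [cXh hcXh] := hXh.
have [cp hcp] : exists c, anac nE c (fun p => mix (Xh p) (y p)).
  exact: (anac_bilin MP nEP nEP rlin_mixl rlin_mixr bil2 hcXh hy).
have [r8 r80 H8] := anac_recenter MP (@mxn_complete R m m) hcD.
have [r9 r90 H9] := anac_recenter nEP (fnorm_complete nP cplt) hcp.
pose rs : seq R := [:: r2; r3; r4; r5; 1 / 2 / K5; r6; dl / 2 / K6; r7; r8; r9].
have [r r0 Hr] : exists2 r : R, 0 < r & forall x, x \in rs -> r <= x.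
  have : all (fun x => 0 < x) rs by rewrite /= r20 r30 r40 r50 r60 r70 r80 r90 !divr_gt0.
  elim: rs => [_|x s IH /= /andP[x0 /IH[r r0 H]]]; first by exists 1.
  exists (Num.min x r); first by rewrite lt_min x0.
  move=> z; rewrite inE => /predU1P[->|/H h]; rewrite ge_min ?lexx//.
  by rewrite h orbT.
have inrs x (p : R) : x \in rs -> `|p| < r -> `|p| < x by move=> /Hr h1 h2; exact: lt_le_trans h2 h1.
exists r, (fun l p => Re (Dm p l l)), (fun l p => mix (Xh p) (y p) l).
split.
- rewrite r0 (le_trans (Hr r2 _))// ?inE ?eqxx// ge_min lexx orbT //.
- move=> l p pr; have [d Hd] := H8 p ltac:(by apply: inrs pr; rewrite !inE eqxx !orbT).
  exists (fun j => (Re (d j l l))%:C), r8; split => // q hq.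
  have [K K0 hK] := Hd q hq; exists K => // N; apply: le_trans (hK N).
  apply: le_trans (mxn_entry _ l l).
  have -> : (Re (Dm q l l))%:C - \sum_(j < N) ((q - p) ^+ j)%:C *: ((Re (d j l l))%:C : C^o) =
     (Re ((Dm q - \sum_(j < N) ((q - p) ^+ j)%:C *: d j) l l))%:C.
    have -> (M M' : 'M[C]_m) : (M - M') l l = M l l - M' l l by rewrite !mxE.
    rewrite summxE raddfB rmorphB; congr (_ - _).
    rewrite raddf_sum rmorph_sum; apply: eq_bigr => j _.
    by rewrite mxE -[LHS]/(_ * _) -rmorphM; congr (_%:C); case: (d j l l) => s t /=; rewrite mul0r subr0.
  rewrite normc_real; exact: Re_le_normc.
- move=> l p pr; have [d Hd] := H9 p ltac:(by apply: inrs pr; rewrite !inE eqxx !orbT).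
  exists (fun j => d j l), r9; split => // q hq.
  have [K K0 hK] := Hd q hq; exists K => // N; apply: le_trans (hK N).
  apply: le_trans (fnorm_entry nP _ l); rewrite le_eqVlt; apply/orP; left; apply/eqP.
  by congr nr; rewrite -[RHS]/(_ - _) fct_sumE.
move=> p pr.
have [p1 p2] := lt12 p ltac:(by apply: inrs pr; rewrite !inE eqxx).
have [Xu Dd AX] := HD p ltac:(by apply: inrs pr; rewrite !inE eqxx !orbT).
have Xh2 : nE (X p) <= 1 / 2.
  have := H5 p ltac:(by apply: inrs pr; rewrite !inE eqxx !orbT); rewrite cX0 subr0 => /le_trans; apply.
  rewrite mulrC -ler_pdivlMr//; apply/ltW; by apply: inrs pr; rewrite !inE eqxx !orbT.
have Ds l : normc (Dm p l l - a) <= dl / 2.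
  apply: (@le_trans _ _ (K6 * `|p|)); last first.
    rewrite mulrC -ler_pdivlMr//; apply/ltW; by apply: inrs pr; rewrite !inE eqxx !orbT.
  have := H6 p ltac:(by apply: inrs pr; rewrite !inE eqxx !orbT); apply: le_trans.
  apply: le_trans (mxn_entry _ l l); rewrite cD0.
  by have -> : (Dm p - a%:M) l l = Dm p l l - a by rewrite !mxE eqxx mulr1n.
have Gu := HG p ltac:(by apply: inrs pr; rewrite !inE eqxx !orbT).
have op := H7 p ltac:(by apply: inrs pr; rewrite !inE eqxx !orbT).
have [h1 h2 h3 h4 h5] := near_point p2 (fun i k => (HX p p1 i).1 k) (fun i => (HX p p1 i).2)
  Xh2 Gu op Xu Dd AX Ds.
split=> // l; rewrite -h2; [exact: h1|exact: h3].
Qed.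

End perturbation.

(** * Square integrable functions *)

Section subquotient.
Context {K : pzRingType} {F : lmodType K}.

Record subquot_spec := SubquotSpec {
  sq_sub : set F;
  sq_null : set F;
  sq_sub0 : sq_sub 0;
  sq_subD : forall f g, sq_sub f -> sq_sub g -> sq_sub (f + g);
  sq_subZ : forall c f, sq_sub f -> sq_sub (c *: f);
  sq_null0 : sq_null 0;
  sq_nullD : forall f g, sq_null f -> sq_null g -> sq_null (f + g);
  sq_nullZ : forall c f, sq_null f -> sq_null (c *: f)
}.

Variable d : subquot_spec.
Local Notation L := (sq_sub d).
Local Notation N := (sq_null d).

Lemma sq_nullN f : N f -> N (- f).
Proof. by move=> /(sq_nullZ (-1)); rewrite scaleN1r. Qed.

Lemma sq_nullB f g : N f -> N g -> N (f - g).
Proof. by move=> nf /sq_nullN; exact: sq_nullD. Qed.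

(* Elements of [L / N] are canonical representatives, so that no quotient type is needed. *)
Definition sq_choose (f : F) : F := xget 0 [set g | L g /\ N (g - f)].

Lemma sq_chooseP f : L f -> L (sq_choose f) /\ N (sq_choose f - f).
Proof.
move=> Lf; apply: (xgetPex 0 (P := [set g | L g /\ N (g - f)])).
by exists f; split=> //; rewrite subrr; exact: sq_null0.
Qed.

Lemma sq_choose_eq f g : N (f - g) -> sq_choose f = sq_choose g.
Proof.
move=> nfg; rewrite /sq_choose; congr xget; apply/seteqP; split=> h /= [Lh nh]; split => //.
  by rewrite -(subrKA f h); exact: sq_nullD.
by rewrite -(subrKA g h) -[g - f]opprB; apply: sq_nullD => //; exact: sq_nullN.
Qed.

Definition subquot := {f : F | `[< L f /\ sq_choose f = f >]}.
HB.instance Definition _ := Choice.on subquot.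

Definition sq_rep (x : subquot) : F := sval x.

Lemma sq_repP x : L (sq_rep x).
Proof. by have /asboolP[] := svalP x. Qed.

Lemma sq_class_subproof f : `[< L (sq_choose (if `[< L f >] then f else 0)) /\
  sq_choose (sq_choose (if `[< L f >] then f else 0)) = sq_choose (if `[< L f >] then f else 0) >].
Proof.
set g := if _ then _ else _; have Lg : L g.
  by rewrite /g; case: asboolP => // _; exact: sq_sub0.
have [h1 h2] := sq_chooseP Lg; apply/asboolP; split=> //; exact: sq_choose_eq.
Qed.

(** Total on the ambient space: a function outside the subspace is sent to the class of 0. *)
Definition sq_class f : subquot := exist (fun f : F => `[< L f /\ sq_choose f = f >]) _ (sq_class_subproof f).

Lemma sq_classK f : L f -> N (sq_rep (sq_class f) - f).
Proof.
by move=> Lf; rewrite /sq_rep /= asboolT//; have [] := sq_chooseP Lf.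
Qed.

Lemma sq_class_eq f g : L f -> L g -> N (f - g) -> sq_class f = sq_class g.
Proof.
move=> Lf Lg nfg; apply: val_inj => /=; rewrite !asboolT//; exact: sq_choose_eq.
Qed.

Lemma sq_repK x : sq_class (sq_rep x) = x.
Proof.
apply: val_inj => /=; have /asboolP[h1 h2] := svalP x.
by rewrite asboolT.
Qed.

Lemma sq_class_inj f g : L f -> L g -> sq_class f = sq_class g -> N (f - g).
Proof.
move=> Lf Lg fg; have := sq_classK Lg; rewrite -fg => h.
by rewrite -(subrKA (sq_rep (sq_class f)) f) -[f - _]opprB addrC;
  apply: sq_nullB => //; exact: sq_classK.
Qed.

Definition sq_add x y := sq_class (sq_rep x + sq_rep y).
Definition sq_scale c x := sq_class (c *: sq_rep x).
Definition sq_opp x := sq_scale (-1) x.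
Definition sq_zero := sq_class 0.

Lemma sq_addE f g : L f -> L g -> sq_add (sq_class f) (sq_class g) = sq_class (f + g).
Proof.
move=> Lf Lg; apply: sq_class_eq; first by apply: sq_subD; exact: sq_repP.
  exact: sq_subD.
by rewrite opprD addrACA; apply: sq_nullD; exact: sq_classK.
Qed.

Lemma sq_scaleE c f : L f -> sq_scale c (sq_class f) = sq_class (c *: f).
Proof.
move=> Lf; apply: sq_class_eq; [by apply: sq_subZ; exact: sq_repP|exact: sq_subZ|].
by rewrite -scalerBr; apply: sq_nullZ; exact: sq_classK.
Qed.

Lemma sq_ind (P : subquot -> Prop) : (forall f, L f -> P (sq_class f)) -> forall x, P x.
Proof. by move=> H x; rewrite -(sq_repK x); apply: H; exact: sq_repP. Qed.

Lemma sq_addA : associative sq_add.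
Proof.
elim/sq_ind=> f Lf; elim/sq_ind=> g Lg; elim/sq_ind=> h Lh.
have ? := sq_subD Lf Lg; have ? := sq_subD Lg Lh.
by rewrite !sq_addE// addrA.
Qed.
Lemma sq_addC : commutative sq_add.
Proof. by move=> x y; rewrite /sq_add addrC. Qed.
Lemma sq_add0 : left_id sq_zero sq_add.
Proof.
by elim/sq_ind=> f Lf; have ? := sq_sub0 d; rewrite sq_addE// add0r.
Qed.
Lemma sq_addN : left_inverse sq_zero sq_opp sq_add.
Proof.
elim/sq_ind=> f Lf; have ? := sq_subZ (-1) Lf.
by rewrite /sq_opp sq_scaleE// sq_addE// scaleN1r addNr.
Qed.
HB.instance Definition _ := GRing.isZmodule.Build subquot sq_addA sq_addC sq_add0 sq_addN.

Lemma sq_scaleA a b x : sq_scale a (sq_scale b x) = sq_scale (a * b) x.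
Proof.
elim/sq_ind: x => f Lf; have ? := sq_subZ b Lf.
by rewrite !sq_scaleE// scalerA.
Qed.
Lemma sq_scale1 : left_id 1 sq_scale.
Proof. by elim/sq_ind=> f Lf; rewrite sq_scaleE// scale1r. Qed.
Lemma sq_scaleDr : right_distributive sq_scale +%R.
Proof.
move=> c; elim/sq_ind=> f Lf; elim/sq_ind=> g Lg.
have ? := sq_subZ c Lf; have ? := sq_subZ c Lg; have ? := sq_subD Lf Lg.
by rewrite -![_ + _]/(sq_add _ _) sq_addE// !sq_scaleE// sq_addE// scalerDr.
Qed.
Lemma sq_scaleDl x : {morph sq_scale^~ x : a b / a + b}.
Proof.
move=> a b; elim/sq_ind: x => f Lf; have ? := sq_subZ a Lf; have ? := sq_subZ b Lf.
by rewrite -![_ + _ in RHS]/(sq_add _ _) !sq_scaleE// sq_addE// scalerDl.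
Qed.
HB.instance Definition _ := GRing.Zmodule_isLmodule.Build K subquot
  sq_scaleA sq_scale1 sq_scaleDr sq_scaleDl.

Lemma sq_classD f g : L f -> L g -> sq_class (f + g) = sq_class f + sq_class g.
Proof. by move=> Lf Lg; rewrite -[RHS]/(sq_add _ _) sq_addE. Qed.
Lemma sq_classZ c f : L f -> sq_class (c *: f) = c *: sq_class f.
Proof. by move=> Lf; rewrite -[RHS]/(sq_scale _ _) sq_scaleE. Qed.
Lemma sq_class0 : sq_class 0 = 0. Proof. by []. Qed.
Lemma sq_subN f : L f -> L (- f).
Proof. by move=> /(sq_subZ (-1)); rewrite scaleN1r. Qed.
Lemma sq_subB f g : L f -> L g -> L (f - g).
Proof. by move=> Lf Lg; apply: sq_subD => //; exact: sq_subN. Qed.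
Lemma sq_classB f g : L f -> L g -> sq_class (f - g) = sq_class f - sq_class g.
Proof.
by move=> Lf Lg; rewrite sq_classD//; [rewrite -scaleN1r sq_classZ// scaleN1r|exact: sq_subN].
Qed.
Lemma sq_sub_sum (I : Type) (r : seq I) (f : I -> F) : (forall i, L (f i)) -> L (\sum_(i <- r) f i).
Proof. by move=> Lf; elim/big_rec: _ => [|i x _ Lx]; [exact: sq_sub0|exact: sq_subD]. Qed.
Lemma sq_class_sum (I : Type) (r : seq I) (f : I -> F) : (forall i, L (f i)) ->
  sq_class (\sum_(i <- r) f i) = \sum_(i <- r) sq_class (f i).
Proof.
move=> Lf; elim: r => [|i r IH]; first by rewrite !big_nil sq_class0.
by rewrite !big_cons sq_classD ?IH//; exact: sq_sub_sum.
Qed.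

End subquotient.

(** * Measurability and integrals of complex functions *)

Section complex_integration.
Context d (T : measurableType d) (R : realType).
Local Notation C := R[i].
Implicit Types (F H : T -> C).

Definition cmeas F := measurable_fun [set: T] (fun x => Re (F x)) /\
  measurable_fun [set: T] (fun x => Im (F x)).

Lemma cmeas_cst z : cmeas (fun=> z).
Proof. by split; exact: measurable_cst. Qed.

Lemma cmeas_real (f : T -> R) : measurable_fun [set: T] f -> cmeas (fun x => (f x)%:C).
Proof. by move=> mf; split => //; exact: measurable_cst. Qed.

Lemma cmeasD F H : cmeas F -> cmeas H -> cmeas (fun x => F x + H x).
Proof.
move=> [F1 F2] [H1 H2]; split.
  by under eq_fun do rewrite raddfD; exact: measurable_funD.
by under eq_fun do rewrite raddfD; exact: measurable_funD.
Qed.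

Lemma cmeasM F H : cmeas F -> cmeas H -> cmeas (fun x => F x * H x).
Proof.
move=> [F1 F2] [H1 H2].
have ReM (z w : C) : Re (z * w) = Re z * Re w - Im z * Im w.
  by case: z => ? ?; case: w.
have ImM (z w : C) : Im (z * w) = Re z * Im w + Im z * Re w.
  by case: z => ? ?; case: w.
split.
  by under eq_fun do rewrite ReM; apply: measurable_funB; exact: measurable_funM.
by under eq_fun do rewrite ImM; apply: measurable_funD; exact: measurable_funM.
Qed.

Lemma cmeasN F : cmeas F -> cmeas (fun x => - F x).
Proof.
move=> h; have -> : (fun x => - F x) = (fun x => (-1) * F x) by apply/funext => x; rewrite mulN1r.
by apply: cmeasM => //; exact: cmeas_cst.
Qed.

Lemma cmeasB F H : cmeas F -> cmeas H -> cmeas (fun x => F x - H x).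
Proof. by move=> hF hH; apply: cmeasD => //; exact: cmeasN. Qed.

Lemma cmeas_conj F : cmeas F -> cmeas (fun x => conjc (F x)).
Proof.
move=> [F1 F2]; split.
  by have -> : (fun x => Re (conjc (F x))) = (fun x => Re (F x))
     by apply/funext => x; case: (F x).
have -> : (fun x => Im (conjc (F x))) = (fun x => - Im (F x))
  by apply/funext => x; case: (F x).
exact: measurable_funN.
Qed.

Lemma cmeas_sum (I : Type) (r : seq I) (F : I -> T -> C) : (forall i, cmeas (F i)) ->
  cmeas (fun x => \sum_(i <- r) F i x).
Proof.
move=> H; elim: r => [|i r IH].
  by under eq_fun do rewrite big_nil; exact: cmeas_cst.
by under eq_fun do rewrite big_cons; exact: cmeasD.
Qed.

Lemma normcE (z : C) : normc z = Num.sqrt (Re z ^+ 2 + Im z ^+ 2).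
Proof. by case: z. Qed.

Lemma Im_le_normc (z : C) : `|Im z| <= normc z.
Proof. by rewrite normcE -sqrtr_sqr ler_wsqrtr// lerDr sqr_ge0. Qed.

Lemma cmeas_normc F : cmeas F -> measurable_fun [set: T] (fun x => normc (F x)).
Proof.
move=> [F1 F2]; under eq_fun do rewrite normcE.
apply: (measurableT_comp (f := @Num.sqrt R)); first exact: (continuous_measurable_fun (@sqrt_continuous R)).
by apply: measurable_funD; exact: measurable_funX.
Qed.

Lemma cmeas_cvg (u : nat -> T -> C) F : (forall n, cmeas (u n)) ->
  (forall x (e : R), 0 < e -> exists N, forall i, (N <= i)%N -> normc (u i x - F x) <= e) ->
  cmeas F.
Proof.
move=> mu uF; split.
  apply: (measurable_fun_cvg (h := fun n x => Re (u n x))) => [n|x _]; first by case: (mu n).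
  apply/cvgrPdist_le => e e0; have [N hN] := uF x e e0; exists N => // i /= Ni.
  rewrite distrC -raddfB; apply: le_trans (hN i Ni); exact: Re_le_normc.
apply: (measurable_fun_cvg (h := fun n x => Im (u n x))) => [n|x _]; first by case: (mu n).
apply/cvgrPdist_le => e e0; have [N hN] := uF x e e0; exists N => // i /= Ni.
rewrite distrC -raddfB; apply: le_trans (hN i Ni).
exact: Im_le_normc.
Qed.

Variable mu : {measure set T -> \bar R}.

Definition nrm1 F : \bar R := (\int[mu]_x (normc (F x))%:E)%E.
Definition sqint F : \bar R := (\int[mu]_x (normc (F x) ^+ 2)%:E)%E.

Lemma cmeas_sqE F : cmeas F -> measurable_fun [set: T] (fun x => (normc (F x) ^+ 2)%:E).
Proof. by move=> mF; apply/measurable_EFinP; apply: measurable_funX; exact: cmeas_normc. Qed.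

Lemma cmeas_1E F : cmeas F -> measurable_fun [set: T] (fun x => (normc (F x))%:E).
Proof. by move=> mF; apply/measurable_EFinP; exact: cmeas_normc. Qed.

Lemma sqint_ge0 F : (0 <= sqint F)%E.
Proof. by apply: integral_ge0 => x _; rewrite lee_fin sqr_ge0. Qed.

Lemma ge0_le_int (f g : T -> R) : measurable_fun setT f -> measurable_fun setT g ->
  (forall x, 0 <= f x) -> (forall x, f x <= g x) ->
  (\int[mu]_x (f x)%:E <= \int[mu]_x (g x)%:E)%E.
Proof.
move=> mf mg f0 fg; apply: ge0_le_integral => //.
- by move=> x _; rewrite lee_fin.
- exact/measurable_EFinP.
- exact/measurable_EFinP.
- by move=> x _; rewrite lee_fin.
Qed.

Lemma ge0_intZ (k : R) (f : T -> R) : 0 <= k -> measurable_fun setT f -> (forall x, 0 <= f x) ->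
  (\int[mu]_x (k * f x)%:E = k%:E * \int[mu]_x (f x)%:E)%E.
Proof.
move=> k0 mf f0; rewrite -ge0_integralZl//.
- exact/measurable_EFinP.
- by move=> x _; rewrite lee_fin.
Qed.

Lemma ge0_intD (f g : T -> R) : measurable_fun setT f -> measurable_fun setT g ->
  (forall x, 0 <= f x) -> (forall x, 0 <= g x) ->
  (\int[mu]_x (f x + g x)%:E = \int[mu]_x (f x)%:E + \int[mu]_x (g x)%:E)%E.
Proof.
move=> mf mg f0 g0; rewrite -ge0_integralD//.
- by move=> x _; rewrite lee_fin.
- exact/measurable_EFinP.
- by move=> x _; rewrite lee_fin.
- exact/measurable_EFinP.
Qed.

Lemma cmeas_sq F : cmeas F -> measurable_fun setT (fun x => normc (F x) ^+ 2).
Proof. by move=> mF; apply: measurable_funX; exact: cmeas_normc. Qed.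

Lemma le_sqint F H (K : R) : cmeas F -> cmeas H -> 0 <= K ->
  (forall x, normc (F x) <= K * normc (H x)) ->
  (sqint F <= (K ^+ 2)%:E * sqint H)%E.
Proof.
move=> mF mH K0 FH; rewrite /sqint -ge0_intZ; last 3 first.
- by rewrite exprn_ge0.
- exact: cmeas_sq.
- by move=> x; rewrite sqr_ge0.
apply: ge0_le_int.
- exact: cmeas_sq.
- by apply: measurable_funM; [exact: measurable_cst|exact: cmeas_sq].
- by move=> x; rewrite sqr_ge0.
- by move=> x; rewrite -exprMn; apply: ler_exp => //; exact: normc_ge0.
Qed.

Lemma sqintD F H : cmeas F -> cmeas H ->
  (sqint (fun x => (F x + H x)%R) <= 2%:E * (sqint F + sqint H))%E.
Proof.
move=> mF mH; rewrite /sqint -ge0_intD; last 4 first.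
- exact: cmeas_sq.
- exact: cmeas_sq.
- by move=> x; rewrite sqr_ge0.
- by move=> x; rewrite sqr_ge0.
rewrite -ge0_intZ//; last 2 first.
- by apply: measurable_funD; exact: cmeas_sq.
- by move=> x; rewrite addr_ge0// sqr_ge0.
apply: ge0_le_int.
- by apply: cmeas_sq; exact: cmeasD.
- by apply: measurable_funM; [exact: measurable_cst|apply: measurable_funD; exact: cmeas_sq].
- by move=> x; rewrite sqr_ge0.
move=> x.
have h := le_normcD (F x) (H x).
have h0 := normc_ge0 (F x + H x).
apply: (@le_trans _ _ ((normc (F x) + normc (H x)) ^+ 2)); first exact: ler_exp.
rewrite -subr_ge0 (_ : _ - _ = (normc (F x) - normc (H x)) ^+ 2); last by ring.
exact: sqr_ge0.
Qed.

Lemma sqint_eq F H : (forall x, normc (F x) = normc (H x)) -> sqint F = sqint H.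
Proof. by move=> FH; apply: eq_integral => x _; rewrite FH. Qed.

Lemma sqint0 F : (forall x, F x = 0) -> sqint F = 0%E.
Proof.
move=> F0; rewrite /sqint; under eq_integral do rewrite F0 normc0 expr0n/=.
exact: integral0.
Qed.

Lemma le_sqint1 F H : cmeas F -> cmeas H ->
  (forall x, normc (F x) <= normc (H x)) -> (sqint F <= sqint H)%E.
Proof.
move=> mF mH FH; have := le_sqint mF mH ler01; rewrite expr1n mul1e; apply.
by move=> x; rewrite mul1r.
Qed.

Hypothesis mufin : (mu setT < +oo)%E.

Lemma bounded_int (f : T -> R) (K : R) : measurable_fun [set: T] f -> (forall x, `|f x| <= K) ->
  mu.-integrable [set: T] (EFin \o f).
Proof.
move=> mf fK; apply: measurable_bounded_integrable => //.
by exists K; split; [exact: num_real|move=> M KM x _ /=; apply: le_trans (fK x) (ltW KM)].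
Qed.

Lemma nrm1_dct (u : nat -> T -> C) F (K : R) : (forall n, cmeas (u n)) ->
  (forall n x, normc (u n x) <= K) ->
  (forall x (e : R), 0 < e -> exists N, forall i, (N <= i)%N -> normc (u i x - F x) <= e) ->
  forall e : R, 0 < e -> exists N, forall i, (N <= i)%N -> (nrm1 (fun x => (u i x - F x)%R) <= e%:E)%E.
Proof.
move=> mu' uK uF e e0; have mF := cmeas_cvg mu' uF.
have FK x : normc (F x) <= K.
  apply/ler_addgt0Pr => e' e'0; have [N hN] := uF x e' e'0.
  have -> : F x = u N x - (u N x - F x) by rewrite opprB addrC subrK.
  by apply: (le_trans (le_normcD _ _)); rewrite normcN; apply: lerD => //; exact: hN.
have md n : cmeas (fun x => u n x - F x) by exact: cmeasB.
have := @dominated_convergence _ T R mu setT measurableT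
  (fun n x => (normc (u n x - F x))%:E) (fun=> 0%E) (fun=> (2 * K)%:E).
case=> //.
- by move=> n; exact: cmeas_1E.
- apply: aeW => x _; apply/fine_cvgP; split; first by near=> n.
  apply/cvgrPdist_le => e' e'0; have [N hN] := uF x e' e'0; exists N => // i /= Ni.
  by rewrite sub0r normrN ger0_norm ?normc_ge0//; exact: hN.
- by have := bounded_int (K := `|2 * K|) (measurable_cst _) (fun=> lexx _).
- apply: aeW => x n _; rewrite gee0_abs ?lee_fin ?normc_ge0//.
  by apply: (le_trans (le_normcD _ _)); rewrite normcN; have := uK n x; have := FK x; lra.
move=> _ _; rewrite integral0 => /fine_cvgP[fin]/cvgrPdist_le/(_ e e0) c.
have [N _ hN] := filterI fin c; exists N => i Ni; have [/= h1 h2] := hN i Ni.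
move: h2; rewrite sub0r normrN => h2.
by rewrite /nrm1 -(fineK h1) lee_fin; exact: le_trans (ler_norm _) h2.
Unshelve. all: by end_near.
Qed.

Definition cint F : C := (\int[mu]_x Re (F x))%R +i* (\int[mu]_x Im (F x))%R.

Definition cintg F := mu.-integrable [set: T] (fun x => (Re (F x))%:E) /\
  mu.-integrable [set: T] (fun x => (Im (F x))%:E).

Lemma cintg_meas F : cintg F -> cmeas F.
Proof. by move=> [/integrableP[/measurable_EFinP ? _] /integrableP[/measurable_EFinP ? _]]. Qed.

Lemma cintgD F H : cintg F -> cintg H -> cintg (fun x => F x + H x).
Proof.
move=> [F1 F2] [H1 H2]; split.
  by under eq_fun do rewrite raddfD EFinD; exact: integrableD.
by under eq_fun do rewrite raddfD EFinD; exact: integrableD.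
Qed.

Lemma cintD F H : cintg F -> cintg H -> cint (fun x => F x + H x) = cint F + cint H.
Proof.
move=> [F1 F2] [H1 H2]; rewrite /cint; congr (_ +i* _).
  by under eq_Rintegral do rewrite raddfD; rewrite RintegralD.
by under eq_Rintegral do rewrite raddfD; rewrite RintegralD.
Qed.

Lemma cintgZ z F : cintg F -> cintg (fun x => z * F x).
Proof.
move=> [F1 F2]; case: z => a b; split.
  rewrite (_ : (fun x => _) = (fun x => a%:E * (Re (F x))%:E - b%:E * (Im (F x))%:E)%E).
    by apply: integrableB => //; exact: integrableZl.
  by apply/funext => x; case: (F x) => ? ? /=; rewrite -!EFinM -EFinB.
rewrite (_ : (fun x => _) = (fun x => a%:E * (Im (F x))%:E + b%:E * (Re (F x))%:E)%E).
  by apply: integrableD => //; exact: integrableZl.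
by apply/funext => x; case: (F x) => ? ? /=; rewrite -!EFinM -EFinD.
Qed.

Lemma cintZ z F : cintg F -> cint (fun x => z * F x) = z * cint F.
Proof.
move=> [F1 F2]; case: z => a b.
have E1 : (fun x => Re (a +i* b * F x)) =
   (fun x => a * Re (F x) - b * Im (F x)) by apply/funext => x; case: (F x).
have E2 : (fun x => Im (a +i* b * F x)) =
   (fun x => a * Im (F x) + b * Re (F x)) by apply/funext => x; case: (F x).
have Z (c : R) (f : T -> R) : mu.-integrable setT (fun x => (f x)%:E) ->
    mu.-integrable setT (EFin \o (fun x => c * f x)) by exact: integrableZl.
by rewrite /cint E1 E2 RintegralB// ?RintegralD// ?RintegralZl//; exact: Z.
Qed.

Lemma cintg_bounded F (K : R) : cmeas F -> (forall x, normc (F x) <= K) -> cintg F.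
Proof.
move=> [F1 F2] FK; split; apply: (bounded_int (K := K)) => // x; apply: le_trans (FK x).
  exact: Re_le_normc.
exact: Im_le_normc.
Qed.

Lemma cintg_le F (f : T -> R) : cmeas F -> mu.-integrable [set: T] (EFin \o f) ->
  (forall x, normc (F x) <= f x) -> cintg F.
Proof.
move=> [F1 F2] fi Ff; split; apply: le_integrable fi => //; do ?exact/measurable_EFinP.
  move=> x _; rewrite /= lee_fin; apply: le_trans (Re_le_normc _) _.
  exact: le_trans (Ff x) (ler_norm _).
move=> x _; rewrite /= lee_fin; apply: (@le_trans _ _ (normc (F x))).
  exact: Im_le_normc.
exact: le_trans (Ff x) (ler_norm _).
Qed.

(** Real and imaginary parts are bounded by [e] separately; the factor 2 is a coarse square root of
    2. *)
Lemma cint_le F (e : R) : cintg F -> (nrm1 F <= e%:E)%E -> normc (cint F) <= 2 * e.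
Proof.
move=> iF Fe; have [F1 F2] := iF; have mF := cintg_meas iF.
have aux (f : T -> R) : mu.-integrable [set: T] (EFin \o f) ->
    (forall x, `|f x| <= normc (F x)) -> `|\int[mu]_x f x| <= e.
  move=> fi fF; have mf : measurable_fun setT f by have /integrableP[/measurable_EFinP] := fi.
  rewrite -lee_fin EFin_normr_Rintegral//; apply: le_trans Fe.
  apply: (le_trans (le_abse_integral _ _ _)) => //; first exact/measurable_EFinP.
  apply: ge0_le_int => //; [exact: measurableT_comp|exact: cmeas_normc].
have h1 := aux _ F1 (fun x => Re_le_normc _).
have h2 : `|\int[mu]_x Im (F x)| <= e.
  by apply: (aux _ F2) => x; exact: Im_le_normc.
have e0 : 0 <= e by exact: le_trans (normr_ge0 _) h1.
rewrite normcE -(ger0_norm (x := 2 * e)) ?mulr_ge0// -sqrtr_sqr ler_wsqrtr//= .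
rewrite -[X in X + _]real_normK ?num_real// -[X in _ + X]real_normK ?num_real//.
have := ler_exp 2 (normr_ge0 _) h1; have := ler_exp 2 (normr_ge0 _) h2.
by rewrite exprMn; have := sqr_ge0 e; lra.
Qed.

Lemma cint_dct (u : nat -> T -> C) F (K : R) : (forall n, cmeas (u n)) ->
  (forall n x, normc (u n x) <= K) ->
  (forall x (e : R), 0 < e -> exists N, forall i, (N <= i)%N -> normc (u i x - F x) <= e) ->
  forall e : R, 0 < e -> exists N, forall i, (N <= i)%N -> normc (cint (u i) - cint F) <= e.
Proof.
move=> mu' uK uF e e0; have mF := cmeas_cvg mu' uF.
have FK x : normc (F x) <= K.
  apply/ler_addgt0Pr => e' e'0; have [N hN] := uF x e' e'0.
  have -> : F x = u N x - (u N x - F x) by rewrite opprB addrC subrK.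
  by apply: (le_trans (le_normcD _ _)); rewrite normcN; apply: lerD => //; exact: hN.
have e2 : 0 < e / 2 by lra.
have [N hN] := nrm1_dct mu' uK uF e2; exists N => i /hN h.
have iF := cintg_bounded mF FK; have iu n := cintg_bounded (mu' n) (uK n).
have iNF := cintgZ (-1) iF.
have E : cint (u i) - cint F = cint (fun x => u i x + (-1) * F x).
  by rewrite cintD// cintZ// mulN1r.
rewrite E (_ : e = 2 * (e / 2)); last by lra.
apply: cint_le; first exact: cintgD.
by apply: le_trans h; rewrite /nrm1; under eq_integral do rewrite mulN1r.
Qed.

End complex_integration.

(** * Square integrability and completeness *)

Section l2.
Context d (T : measurableType d) (R : realType).
Local Notation C := R[i].
Variable mu : {measure set T -> \bar R}.
Implicit Types (F H : T -> C).
Local Notation sqint := (sqint mu).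

Lemma sqint_fatou (v : nat -> T -> C) F (e : R) : (forall n, cmeas (v n)) ->
  (forall x (e : R), 0 < e -> exists N, forall i, (N <= i)%N -> normc (v i x - F x) <= e) ->
  (exists N, forall i, (N <= i)%N -> (sqint (v i) <= e%:E)%E) -> (sqint F <= e%:E)%E.
Proof.
move=> mv vF [N hN].
have mf n : measurable_fun setT (fun x => (normc (v n x) ^+ 2)%:E).
  by apply/measurable_EFinP; exact: cmeas_sq.
have := fatou mu measurableT mf (fun n x _ => ltac:(by rewrite lee_fin sqr_ge0)).
have -> : (\int[mu]_x limn_einf (fun n => (normc (v n x) ^+ 2)%:E) = sqint F)%E.
  apply: eq_integral => x _.
  have c : ((normc (v n x) ^+ 2)%:E @[n --> \oo] --> (normc (F x) ^+ 2)%:E)%classic.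
    apply/fine_cvgP; split; first by near=> n.
    rewrite /comp /= !expr2; apply: cvgM; apply/cvgrPdist_le => e' e'0;
      have [M hM] := vF x e' e'0; exists M => // i /= /hM; apply: le_trans;
      rewrite distrC ler_norml; have := le_normcD (v i x - F x) (F x);
      have := le_normcD (F x - v i x) (v i x); rewrite !subrK -[F x - v i x]opprB normcN; lra.
  by rewrite is_cvg_limn_einfE; [exact/cvg_lim|apply/cvg_ex; eexists; exact: c].
move=> /le_trans; apply; rewrite limn_einf_lim; apply: lime_le; first exact: is_cvg_einfs.
exists N => // i /= Ni; apply: le_trans (hN i Ni).
by apply: ereal_inf_lbound; exists i => /=.
Unshelve. all: by end_near.
Qed.

Definition cL2 F := cmeas F /\ (sqint F < +oo)%E.

Lemma cL2D F H : cL2 F -> cL2 H -> cL2 (fun x => F x + H x).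
Proof.
move=> [mF F2] [mH H2]; split; first exact: cmeasD.
apply: (le_lt_trans (sqintD mu mF mH)).
by apply: lte_mul_pinfty => //; exact: lte_add_pinfty.
Qed.

Lemma cL2_bdd F H (K : R) : cL2 H -> cmeas F -> 0 <= K ->
  (forall x, normc (F x) <= K * normc (H x)) -> cL2 F.
Proof.
move=> [mH H2] mF K0 FH; split => //; apply: (le_lt_trans (le_sqint mu mF mH K0 FH)).
by apply: lte_mul_pinfty => //; rewrite lee_fin sqr_ge0.
Qed.

Lemma cL2Z z F : cL2 F -> cL2 (fun x => z * F x).
Proof.
move=> hF; apply: (cL2_bdd (K := normc z) hF).
- by apply: cmeasM; [exact: cmeas_cst|case: hF].
- exact: normc_ge0.
- by move=> x; rewrite normcM.
Qed.

Lemma cL2_int F : cL2 F -> mu.-integrable setT (EFin \o (fun x => normc (F x) ^+ 2)).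
Proof.
move=> [mF F2]; apply/integrableP; split; first by apply/measurable_EFinP; exact: cmeas_sq.
apply: le_lt_trans F2; rewrite le_eqVlt; apply/orP; left; apply/eqP.
by apply: eq_integral => x _; rewrite gee0_abs// lee_fin sqr_ge0.
Qed.

Lemma cL2M F H : cL2 F -> cL2 H -> cintg mu (fun x => conjc (F x) * H x).
Proof.
move=> hF hH.
have i : mu.-integrable setT (EFin \o (fun x => normc (F x) ^+ 2 + normc (H x) ^+ 2)).
  have := integrableD measurableT (cL2_int hF) (cL2_int hH); exact.
apply: (cintg_le _ i).
  by apply: cmeasM; [apply: cmeas_conj; case: hF|case: hH].
move=> x; rewrite normcM normcJ_real.
have := sqr_ge0 (normc (F x) - normc (H x)).
have := sqr_ge0 (normc (F x)); have := sqr_ge0 (normc (H x)).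
nra.
Qed.

Definition ipc F H := cint mu (fun x => conjc (F x) * H x).

Lemma ipcDr F H K : cL2 F -> cL2 H -> cL2 K ->
  ipc F (fun x => H x + K x) = ipc F H + ipc F K.
Proof.
move=> hF hH hK; rewrite /ipc -cintD; [|exact: cL2M..].
by congr cint; apply/funext => x; rewrite mulrDr.
Qed.

Lemma ipcZr F z H : cL2 F -> cL2 H -> ipc F (fun x => z * H x) = z * ipc F H.
Proof.
move=> hF hH; rewrite /ipc -cintZ; last exact: cL2M.
by congr cint; apply/funext => x; rewrite mulrCA.
Qed.

Lemma cint_conj F : cintg mu F -> cint mu (fun x => conjc (F x)) = conjc (cint mu F).
Proof.
move=> [F1 F2]; rewrite /cint /=.
have -> : (fun x => Re (conjc (F x))) = (fun x => Re (F x))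
  by apply/funext => x; case: (F x).
have -> : (fun x => Im (conjc (F x))) = (fun x => -1 * Im (F x))
  by apply/funext => x; case: (F x) => ? ? /=; rewrite mulN1r.
by rewrite RintegralZl// mulN1r.
Qed.

Lemma ipcJ F H : cL2 F -> cL2 H -> ipc H F = conjc (ipc F H).
Proof.
move=> hF hH; rewrite /ipc -cint_conj; last exact: cL2M.
by congr cint; apply/funext => x; rewrite rmorphM/= conjcK mulrC.
Qed.

Lemma ipc_sq F : cL2 F -> sqint F = (Re (ipc F F))%:E.
Proof.
move=> hF; have h := cL2_int hF.
rewrite /ipc /cint /= .
have -> : (fun x => Re (conjc (F x) * F x)) = (fun x => normc (F x) ^+ 2).
  apply/funext => x; rewrite normcE sqr_sqrtr ?addr_ge0 ?sqr_ge0//.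
  by case: (F x) => a b /=; ring.
rewrite /Rintegral fineK//; exact: integrable_fin_num.
Qed.

Hypothesis mufin : (mu setT < +oo)%E.

(** The bound is a natural number, which makes the set of points where a sequence of measurable
    functions has this property a countable union of countable intersections, hence measurable. *)
Definition bounded_variation (v : nat -> C) :=
  exists M : nat, forall N, \sum_(k < N) normc (v k.+1 - v k) <= M%:R.

(* Pointwise limits are taken along a fast Cauchy subsequence, and set to 0 off the
   (invariant, conull) set where it has bounded variation, so that the limit remains
   periodic and [W]-invariant everywhere. *)
Definition clim (v : nat -> C) : C := xget 0 [set z | bounded_variation v /\
  forall e : R, 0 < e -> exists N, forall i, (N <= i)%N -> normc (v i - z) <= e].

Lemma clim0 v : ~ bounded_variation v -> clim v = 0.
Proof.
move=> h; rewrite /clim; case: xgetP => // z _ [] //.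
Qed.

Lemma climP v : bounded_variation v ->
  forall e : R, 0 < e -> exists N, forall i, (N <= i)%N -> normc (v i - clim v) <= e.
Proof.
move=> bv; suff : exists z, forall e : R, 0 < e -> exists N, forall i, (N <= i)%N -> normc (v i - z) <= e.
  by move=> [z hz]; have [] := xgetPex 0 (P := [set z | bounded_variation v /\
  forall e : R, 0 < e -> exists N, forall i, (N <= i)%N -> normc (v i - z) <= e]) (ex_intro _ z (conj bv hz)).
apply: (@vcomplete_normc R) => e e0; have [M hM] := bv.
pose s N := \sum_(k < N) normc (v k.+1 - v k).
have snd : nondecreasing_seq s.
  by apply/nondecreasing_seqP => N; rewrite /s big_ord_recr lerDl normc_ge0.
have sc : cvgn s by apply: nondecreasing_is_cvgn => //; exists M%:R => _ [N _ <-]; exact: hM.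
have e2 : 0 < e / 2 by lra.
have /cvgrPdist_le /(_ _ e2) [N _ hN] := sc.
have vs i j : (i <= j)%N -> normc (v j - v i) <= s j - s i.
  elim: j => [|j IH]; first by rewrite leqn0 => /eqP ->; rewrite !subrr normc0.
  rewrite leq_eqVlt => /orP[/eqP ->|]; first by rewrite !subrr normc0.
  rewrite ltnS => /IH h; rewrite /s big_ord_recr /= -/(s j).
  have -> : v j.+1 - v i = (v j.+1 - v j) + (v j - v i) by rewrite addrA subrK.
  apply: (le_trans (le_normcD _ _)); rewrite /s in h; rewrite /s.
  by move: (\sum_(k < i) _) h => si h; lra.
exists N => i j Ni Nj.
have hi := hN i Ni; have hj := hN j Nj; rewrite ler_norml in hi; rewrite ler_norml in hj.
case: (leqP i j) => ij.
  by rewrite -[v i - v j]opprB normcN; apply: (le_trans (vs _ _ ij)); lra.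
by apply: (le_trans (vs _ _ (ltnW ij))); lra.
Qed.

(** Here [q] is a squared distance: the rate 1/8 leaves room for the factor 2^k lost when the square
    is removed. *)
Lemma fast_subseq (q : nat -> nat -> \bar R) :
  (forall e : R, 0 < e -> exists N, forall i j, (N <= i)%N -> (N <= j)%N -> (q i j <= e%:E)%E) ->
  exists s : nat -> nat, (forall k, (k <= s k)%N) /\
    (forall k, (q (s k.+1) (s k) <= ((1/8) ^+ k)%:E)%E).
Proof.
move=> H; have [N hN] := @choice _ _ (fun k N => forall i j, (N <= i)%N -> (N <= j)%N ->
    (q i j <= ((1/8) ^+ k)%:E)%E) (fun k => H ((1/8) ^+ k) ltac:(by rewrite exprn_gt0)).
exists (fun k => k + \sum_(j < k.+1) N j)%N; split=> k; first exact: leq_addr.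
apply: hN; first by rewrite !big_ord_recr /=; lia.
by rewrite big_ord_recr /=; lia.
Qed.

(** The weight is kept apart from the functions, because the limit has to be formed from the
    unweighted values: these carry the periodicity and the invariance. *)
Theorem riesz_fischer (w : T -> R) (u : nat -> T -> C) :
  measurable_fun setT w -> (forall x, 0 <= w x) -> (forall n, cmeas (u n)) ->
  (forall e : R, 0 < e -> exists N, forall i j, (N <= i)%N -> (N <= j)%N ->
    (sqint (fun x => ((w x)%:C * (u i x - u j x))%R) <= e%:E)%E) ->
  exists s : nat -> nat, let f := fun x => clim (fun k => u (s k) x) in
    cmeas f /\ forall e : R, 0 < e -> exists N, forall i, (N <= i)%N ->
      (sqint (fun x => ((w x)%:C * (u i x - f x))%R) <= e%:E)%E.
Proof.
move=> mw w0 mu' Hc; have [s [sk sq]] := fast_subseq Hc.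
exists s => f.
have mwc : cmeas (fun x => (w x)%:C) by exact: cmeas_real.
pose D k x := normc (u (s k.+1) x - u (s k) x).
have mD k : measurable_fun setT (D k) by apply: cmeas_normc; exact: cmeasB.
pose A := [set x | bounded_variation (fun k => u (s k) x)].
have mA : measurable A.
  have -> : A = \bigcup_M \bigcap_N ([set: T] `&` [set x | ((\sum_(k < N) D k x)%:E <= (M%:R)%:E)%E]).
    apply/seteqP; split=> x /=.
      by move=> [M hM]; exists M => // N _; split => //=; rewrite lee_fin; exact: hM.
    by move=> [M _ hM]; exists M => N; have [_ /=] := hM N I; rewrite lee_fin.
  apply: bigcup_measurable => M _; apply: bigcap_measurableType => N _.
  apply: emeasurable_fun_infty_c => //; apply/measurable_EFinP.
  by apply: measurable_sum => k.
pose I x : R := \1_A x.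
have mI : measurable_fun setT I by exact: measurable_indic.
have IE x : I x = 1 /\ A x \/ I x = 0 /\ ~ A x.
  rewrite /I indicE; case: (boolP (x \in A)) => xA; first by left; rewrite inE in xA.
  by right; split => // h; move/negP: xA; apply; rewrite inE.
pose v k x := (I x)%:C * u (s k) x.
have mv k : cmeas (v k) by apply: cmeasM => //; exact: cmeas_real.
have vf x (e : R) : 0 < e -> exists N, forall i, (N <= i)%N -> normc (v i x - f x) <= e.
  move=> e0; rewrite /v; case: (IE x) => [[-> Ax]|[-> nAx]].
    have [N hN] := climP Ax e0; exists N => i Ni; rewrite mul1r; exact: hN.
  by exists 0%N => i _; rewrite mul0r /f clim0// subr0 normc0 ltW.
have mf : cmeas f by exact: cmeas_cvg vf.
split=> // e e0.
(* The weighted sum of the increments is integrable, hence finite almost everywhere. Where the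
   weight vanishes the increments are not controlled, but there the weighted integrand is 0. *)
have aeA : {ae mu, forall x, setT x -> A x \/ w x = 0}.
  pose S x : \bar R := (\sum_(k <oo) (w x * D k x)%:E)%E.
  have mS k : measurable_fun setT (fun x => (w x * D k x)%:E).
    by apply/measurable_EFinP; exact: measurable_funM.
  have S0 x k : (0 <= (w x * D k x)%:E)%E by rewrite lee_fin mulr_ge0// normc_ge0.
  have iS : mu.-integrable setT S.
    apply/integrableP; split; first by apply: ge0_emeasurable_sum => // *.
    under eq_integral do rewrite gee0_abs ?nneseries_ge0//.
    rewrite integral_nneseries//.
    pose m := fine (mu setT); have mE : mu setT = m%:E.
      by rewrite fineK// ge0_fin_numE.
    have m0 : 0 <= m by rewrite -lee_fin -mE.
    apply: (@le_lt_trans _ _ (\sum_(k <oo) ((m + 1) * (1/2) ^+ k)%:E)%E).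
      apply: lee_nneseries => [k _ _|k _]; first exact: integral_ge0.
      (* The inequality t <= 2^-k + 2^k t^2 takes the place of the Cauchy-Schwarz inequality on a
         space of finite measure. *)
      apply: (@le_trans _ _ (\int[mu]_x ((1/2) ^+ k + 2 ^+ k * (normc ((w x)%:C * (u (s k.+1) x - u (s k) x))) ^+ 2)%:E)%E).
        have mm : measurable_fun setT (fun x => (normc ((w x)%:C * (u (s k.+1) x - u (s k) x))) ^+ 2).
          by apply: cmeas_sq; apply: cmeasM => //; exact: cmeasB.
        apply: ge0_le_int => //.
        - exact: measurable_funM.
        - by apply: measurable_funD => //; apply: measurable_funM.
        - by move=> x; rewrite mulr_ge0// normc_ge0.
        move=> x; rewrite normcM normc_real ger0_norm// -/(D k x).
        set t := w x * D k x; have k2 : 0 < 2 ^+ k :> R by rewrite exprn_gt0.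
        have -> : (1/2) ^+ k = (2 ^+ k)^-1 :> R by rewrite expr_div_n expr1n mul1r.
        rewrite -subr_ge0; have -> : (2 ^+ k)^-1 + 2 ^+ k * t ^+ 2 - t =
          (2 ^+ k)^-1 * ((2 ^+ k * t - 1 / 2) ^+ 2 + 3 / 4) by field; rewrite gt_eqF.
        by apply: mulr_ge0; [rewrite invr_ge0 ltW|rewrite addr_ge0 ?sqr_ge0//].
      rewrite ge0_intD//; last 2 first.
      - apply: measurable_funM => //; apply: cmeas_sq; apply: cmeasM => //; exact: cmeasB.
      - by move=> x; rewrite mulr_ge0 ?sqr_ge0 ?exprn_ge0.
      rewrite ge0_intZ//; last 2 first.
      - by apply: cmeas_sq; apply: cmeasM => //; exact: cmeasB.
      - by move=> x; rewrite sqr_ge0.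
      rewrite integral_cst// mE -EFinM mulrDl EFinD mul1r [(_ * m)%R]mulrC; apply: leeD => //.
      apply: (@le_trans _ _ ((2 ^+ k)%:E * ((1/8) ^+ k)%:E)%E).
        by apply: lee_wpmul2l; [rewrite lee_fin exprn_ge0|exact: sq].
      rewrite -EFinM lee_fin -exprMn [leRHS]mul1r; apply: ler_exp; lra.
    have := @cvg_geometric_series R (m + 1) (1/2) ltac:(by rewrite ger0_norm; lra).
    move=> c; have -> : (\sum_(k <oo) ((m + 1) * (1/2) ^+ k)%:E = ((m + 1) * (1 - 1/2)^-1)%:E)%E.
      apply/cvg_lim => //; apply/fine_cvgP; split.
        by near=> n; rewrite /= sumEFin.
      by under eq_fun do rewrite /= sumEFin /=; exact: c.
    exact: ltry.
  have := integrable_ae measurableT iS; apply: filterS => x h _.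
  case: (eqVneq (w x) 0) => [->|wx]; first by right.
  left; have wp : 0 < w x by rewrite lt_neqAle eq_sym wx w0.
  have Sx := h Logic.I; pose M := fine (S x) / w x.
  exists (Num.truncn M).+1 => N.
  apply: (@le_trans _ _ M); last by apply: ltW; exact: truncnS_gt.
  rewrite /M ler_pdivlMr// mulrC mulr_sumr -lee_fin fineK//.
  have := @nneseries_lim_ge R (fun k => (w x * D k x)%:E) xpredT 0 N (fun k _ _ => S0 x k).
  by rewrite big_mkord sumEFin.
have [N hN] := Hc e e0; exists N => i Ni.
have mwd F : cmeas F -> cmeas (fun x => (w x)%:C * F x) by move=> mF; exact: cmeasM.
have -> : sqint (fun x => (w x)%:C * (u i x - f x)) =
    sqint (fun x => (w x)%:C * ((I x)%:C * u i x - f x)).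
  apply: ge0_ae_eq_integral => //.
  - by apply: cmeas_sqE; apply: mwd; exact: cmeasB.
  - by apply: cmeas_sqE; apply: mwd; apply: cmeasB => //; apply: cmeasM => //; exact: cmeas_real.
  - by move=> x _; rewrite lee_fin sqr_ge0.
  - by move=> x _; rewrite lee_fin sqr_ge0.
  apply: filterS aeA => x h _; case: (h Logic.I) => [Ax|->]; last by rewrite !mul0r.
  by case: (IE x) => [[-> _]|[_ /(_ Ax)]//]; rewrite mul1r.
(* Fatou's lemma in j for fixed i: the Cauchy estimate between [u i] and [u (s j)] passes to the
   limit. *)
apply: (sqint_fatou (v := fun j x => (w x)%:C * ((I x)%:C * u i x - v j x))).
- by move=> j; apply: mwd; apply: cmeasB => //; apply: cmeasM => //; exact: cmeas_real.
- move=> x e' e'0; pose c := w x + 1; have c0 : 0 < c by rewrite /c ltr_wpDl.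
  have [M hM] := vf x (e' / c) ltac:(by rewrite divr_gt0); exists M => j /hM h.
  rewrite -mulrBr (_ : _ - _ - (_ - _) = - (v j x - f x)); last by ring.
  rewrite mulrN normcN normcM normc_real ger0_norm//.
  apply: (@le_trans _ _ (c * (e' / c))); last by rewrite mulrC divfK// gt_eqF.
  by apply: ler_pM => //; rewrite ?normc_ge0// /c ?lerDl.
exists N => j Nj; apply: le_trans (hN i (s j) Ni (leq_trans Nj (sk j))).
apply: le_sqint1.
- by apply: mwd; apply: cmeasB => //; apply: cmeasM => //; exact: cmeas_real.
- by apply: mwd; exact: cmeasB.
move=> x; rewrite /v -mulrBr !normcM !normc_real.
apply: ler_wpM2l => //; case: (IE x) => [[-> _]|[-> _]]; first by rewrite normr1 mul1r.
by rewrite normr0 mul0r normc_ge0.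
Unshelve. all: by end_near.
Qed.

End l2.

(** * The unit circle *)

Section cis.
Context {R : realType}.
Local Notation C := R[i].

Definition cis (t : R) : C := cos t +i* sin t.

Lemma cisD a b : cis (a + b) = cis a * cis b.
Proof.
rewrite /cis cosD sinD; apply/eqP; rewrite eq_complex /=; apply/andP; split; apply/eqP => //.
by rewrite addrC.
Qed.

Lemma cis0 : cis 0 = 1. Proof. by rewrite /cis cos0 sin0. Qed.

Lemma cisN a : cis (- a) = conjc (cis a).
Proof. by rewrite /cis cosN sinN. Qed.

Lemma normc_cis a : normc (cis a) = 1.
Proof. by rewrite normcE /= cos2Dsin2 sqrtr1. Qed.

Lemma cis_int (z : int) : cis (2 * pi * z%:~R) = 1.
Proof.
have n1 (n : nat) : cis (2 * pi * n%:R) = 1.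
  elim: n => [|n IH]; first by rewrite mulr0 cis0.
  rewrite -[n.+1%:R]natr1 mulrDr [_ * 1]mulr1 cisD IH mul1r mulr_natl.
  by rewrite /cis cos2pi sin2pi.
case: z => n; first exact: n1.
by rewrite NegzE mulrNz mulrN cisN n1 conjc1.
Qed.

Lemma cmeas_cis d (T : measurableType d) (f : T -> R) : measurable_fun setT f ->
  cmeas (fun x => cis (f x)).
Proof.
move=> mf; split; apply: (measurableT_comp _ mf); apply: continuous_measurable_fun.
  exact: continuous_cos.
exact: continuous_sin.
Qed.

End cis.

(** * Orthogonality of the characters of the cube *)

Section cube_integral.
Context {R : realType}.
Local Notation C := R[i].
Local Notation mR := (measurableTypeR R).
Local Notation unif := (uniform_prob (@ltr01 R)).

Lemma prob_fin d (T : measurableType d) (P : probability T R) : (P setT < +oo)%E.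
Proof. by rewrite probability_setT ltry. Qed.

Lemma cint_cst1 d (T : measurableType d) (P : probability T R) : cint P (fun=> 1) = 1.
Proof. by rewrite /cint !Rintegral_cst//= probability_setT /= mulr1 mul0r. Qed.

Lemma Rint_cst1 d (T : measurableType d) (P : probability T R) : \int[P]_x 1 = 1 :> R.
Proof. by rewrite Rintegral_cst//= probability_setT /= mulr1. Qed.

Lemma prodT d (T : measurableType d) (U : probability mR R) (P : probability T R) :
  ((U \x P)%E setT < +oo)%E.
Proof. exact: prob_fin. Qed.

Lemma unif_integral0 (f F : R -> R) : continuous f -> (forall x, `|f x| <= 1) ->
  (forall x, is_derive x (1 : R) F (f x)) -> F 1 = F 0 -> \int[unif]_x f x = 0.
Proof.
move=> cf f1 dF F10; have mf : measurable_fun [set: mR] f by exact: continuous_measurable_fun.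
have uf := prob_fin unif.
have if1 : unif.-integrable setT (EFin \o f) by exact: bounded_int mf f1.
have i1 : unif.-integrable setT (EFin \o (fun=> 1)).
  by apply: (bounded_int uf (K := 1)) => // x; rewrite normr1.
(* Adding 1 makes the integrand nonnegative, as the integral formula for the uniform law
   requires. *)
suff h : \int[unif]_x (1 + f x) = 1.
  by move: h; rewrite RintegralD// (Rint_cst1 unif) => /eqP; rewrite -subr_eq0 addrAC subrr add0r => /eqP.
pose G x := x + F x.
have dG (x : R) : is_derive x (1 : R) G (1 + f x) by apply: is_deriveD.
have cG : continuous G.
  by move=> x; apply: differentiable_continuous; apply/derivable1_diffP; case: (dG x).
rewrite /Rintegral integral_uniform; last 2 first.
- by apply/measurable_EFinP; apply: measurable_funD.
- by move=> x; rewrite lee_fin; have := f1 x; rewrite ler_norml; lra.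
rewrite (continuous_FTC2 (F := G)) //.
- by rewrite subr0 invr1 -EFinB -EFinM /= /G F10; lra.
- apply: continuous_subspaceT => x; apply: cvgD; [exact: cvg_cst|exact: cf].
- split => [x _| |]; first by case: (dG x).
    exact: cvg_at_right_filter (cG 0).
  exact: cvg_at_left_filter (cG 1).
- by move=> x _; rewrite derive1E derive_val.
Qed.

Lemma unif_cis (m : int) : cint unif (fun x => cis (2 * pi * (m%:~R * x))) = (m == 0)%:R.
Proof.
have [->|m0] := eqVneq m 0.
  have -> : (fun x => cis (2 * pi * (0%:~R * x))) = (fun=> 1 : C).
    by apply/funext => x; rewrite mul0r mulr0 cis0.
  exact: cint_cst1.
pose c : R := 2 * pi * m%:~R.
have c0 : c != 0.
  by rewrite /c mulf_neq0// ?intr_eq0// mulf_neq0// gt_eqF// pi_gt0.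
have dl (x : R) : is_derive x (1 : R) (fun y => c * y) c.
  by have := is_deriveZ c (is_derive_id x (1 : R)); rewrite scaler1 /= => h; exact: h.
have cl : continuous (fun y : R => c * y).
  by move=> x; apply: differentiable_continuous; apply/derivable1_diffP; case: (dl x).
have -> : (fun x => cis (2 * pi * (m%:~R * x))) = (fun x => cis (c * x)).
  by apply/funext => x; rewrite mulrA.
have c1 : cis c = 1 by exact: cis_int.
have E1 : \int[unif]_x cos (c * x) = 0.
  apply: (@unif_integral0 _ (fun x => c^-1 * sin (c * x))).
  - move=> x; apply: continuous_comp; [exact: cl|exact: continuous_cos].
  - by move=> x; exact: cos_max.
  - move=> x; have h := is_derive1_comp (is_derive_sin (c * x)) (dl x).
    have := is_deriveZ c^-1 h; rewrite /GRing.scale /= mulrCA mulVf// mulr1 => H; exact: H.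
  - by rewrite mulr1 mulr0 sin0; have := congr1 (@Im R) c1 => /= ->.
have E2 : \int[unif]_x sin (c * x) = 0.
  apply: (@unif_integral0 _ (fun x => - c^-1 * cos (c * x))).
  - move=> x; apply: continuous_comp; [exact: cl|exact: continuous_sin].
  - by move=> x; exact: sin_max.
  - move=> x; have h := is_derive1_comp (is_derive_cos (c * x)) (dl x).
    by apply: is_derive_eq (is_deriveZ (- c^-1) h) _; rewrite /GRing.scale /=; field.
  - by rewrite mulr1 mulr0 cos0; have := congr1 (@Re R) c1 => /= ->.
by rewrite /cint E1 E2.
Qed.

Lemma Rint_prod d (T : measurableType d) (P : probability T R) (f : mR -> R) (g : T -> R) (K L : R) :
  measurable_fun setT f -> measurable_fun setT g -> (forall x, `|f x| <= K) -> (forall x, `|g x| <= L) ->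
  \int[(unif \x P)%E]_x (f x.1 * g x.2) = (\int[unif]_x f x) * \int[P]_x g x.
Proof.
move=> mf mg fK gL.
have uf := prob_fin unif.
have pf := prob_fin P.
have mfg : measurable_fun setT (fun x : mR * T => f x.1 * g x.2).
  by apply: measurable_funM; [exact: (measurableT_comp mf)|exact: (measurableT_comp mg)].
have upf := prodT unif P.
have ifg : (unif \x P)%E.-integrable setT (EFin \o (fun x : mR * T => f x.1 * g x.2)).
  apply: (bounded_int upf (K := K * L) mfg) => x; rewrite normrM; exact: ler_pM.
have ig : P.-integrable setT (EFin \o g) by exact: bounded_int gL.
have iff : unif.-integrable setT (EFin \o f) by exact: bounded_int fK.
rewrite [LHS]/Rintegral -integral12_prod_meas1//.
under eq_integral => x _.
  rewrite /fubini_F /= (_ : (\int[P]_y _ = (f x * \int[P]_y g y)%:E)%E); last first.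
    under eq_integral do rewrite EFinM.
    by rewrite integralZl// EFinM /Rintegral fineK//; exact: integrable_fin_num.
  over.
by rewrite -/(Rintegral _ _ _) RintegralZr.
Qed.

Lemma cint_prod d (T : measurableType d) (P : probability T R) (f : mR -> C) (g : T -> C) :
  cmeas f -> cmeas g -> (forall x, normc (f x) <= 1) -> (forall x, normc (g x) <= 1) ->
  cint (unif \x P)%E (fun x => f x.1 * g x.2) = cint unif f * cint P g.
Proof.
move=> [f1 f2] [g1 g2] fK gL.
have R1 x : `|Re (f x)| <= 1 by exact: le_trans (Re_le_normc _) (fK x).
have R2 x : `|Im (f x)| <= 1 by exact: le_trans (Im_le_normc _) (fK x).
have R3 x : `|Re (g x)| <= 1 by exact: le_trans (Re_le_normc _) (gL x).
have R4 x : `|Im (g x)| <= 1 by exact: le_trans (Im_le_normc _) (gL x).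
have upf := prodT unif P.
have I (a : mR -> R) (b : T -> R) : measurable_fun setT a -> measurable_fun setT b ->
    (forall x, `|a x| <= 1) -> (forall x, `|b x| <= 1) ->
    (unif \x P)%E.-integrable setT (EFin \o (fun x : mR * T => a x.1 * b x.2)).
  move=> ma mb a1 b1; apply: (bounded_int upf (K := 1)).
    by apply: measurable_funM; [exact: (measurableT_comp ma)|exact: (measurableT_comp mb)].
  by move=> x; rewrite normrM -[leRHS]mulr1; apply: ler_pM.
have E1 : (fun x : mR * T => Re (f x.1 * g x.2)) = (fun x =>
  (Re (f x.1) * Re (g x.2)) - (Im (f x.1) * Im (g x.2))).
  by apply/funext => x; case: (f x.1) => ? ?; case: (g x.2).
have E2 : (fun x : mR * T => Im (f x.1 * g x.2)) = (fun x =>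
  (Re (f x.1) * Im (g x.2)) + (Im (f x.1) * Re (g x.2))).
  by apply/funext => x; case: (f x.1) => ? ?; case: (g x.2).
have I1 := I _ _ f1 g1 R1 R3; have I2 := I _ _ f2 g2 R2 R4.
have I3 := I _ _ f1 g2 R1 R4; have I4 := I _ _ f2 g1 R2 R3.
rewrite /cint E1 E2 (RintegralB measurableT I1 I2) (RintegralD measurableT I3 I4).
by rewrite (Rint_prod P f1 g1 R1 R3) (Rint_prod P f2 g2 R2 R4) (Rint_prod P f1 g2 R1 R4)
  (Rint_prod P f2 g1 R2 R3).
Qed.

Lemma measurable_tuple_sum n (c : 'I_n -> R) :
  measurable_fun [set: n.-tuple mR] (fun x => \sum_i c i * tnth x i).
Proof.
apply: measurable_sum => i; apply: measurable_funM => //; exact: measurable_tnth.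
Qed.

Lemma cube_fin n : (cube R n setT < +oo)%E.
Proof. exact: prob_fin. Qed.

Lemma cube_cis n (m : 'I_n -> int) :
  cint (cube R n) (fun x => cis (2 * pi * \sum_i (m i)%:~R * tnth x i)) = [forall i, m i == 0]%:R.
Proof.
elim: n m => [|n IH] m.
  have -> : [forall i, m i == 0] by apply/forallP => -[].
  under [X in cint _ X]eq_fun do rewrite big_ord0 mulr0 cis0.
  exact: cint_cst1.
pose g x : C := cis (2 * pi * \sum_i (m i)%:~R * tnth x i).
have mg : cmeas g.
  apply: cmeas_cis; apply: measurable_funM => //; exact: (measurable_tuple_sum (fun i => (m i)%:~R)).
have cg := cintg_bounded (@cube_fin n.+1) mg (fun x => ltac:(by rewrite normc_cis)).
have mgt : cmeas (fun x => g (tcons x)).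
  by case: mg => m1 m2; split; [apply: (measurableT_comp m1)|apply: (measurableT_comp m2)]; exact: measurable_tcons.
have upf := prodT unif (cube R n).
have [i1 i2] := cintg_bounded upf mgt (fun x => ltac:(by rewrite normc_cis)).
have -> : cint (cube R n.+1) g = cint (unif \x cube R n)%E (fun x => g (tcons x)).
  have [/measurable_EFinP m1 /measurable_EFinP m2] := mg.
  rewrite /cint /Rintegral /=; congr (fine _ +i* fine _).
    by rewrite integral_distribution.
  by rewrite integral_distribution.
have -> : (fun x => g (tcons x)) = (fun x : mR * n.-tuple mR => cis (2 * pi * ((m ord0)%:~R * x.1)) *
    cis (2 * pi * \sum_i (m (lift ord0 i))%:~R * tnth x.2 i)).
  apply/funext => x; rewrite /g -cisD -mulrDr big_ord_recl; congr (cis (_ * (_ * _ + _))).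
  by apply: eq_bigr => i _; congr (_ * _); rewrite !(tnth_nth 0).
have m1 : cmeas (fun x : mR => cis (2 * pi * ((m ord0)%:~R * x))).
  by apply: cmeas_cis; apply: measurable_funM => //; apply: measurable_funM.
have m2 : cmeas (fun x : n.-tuple mR => cis (2 * pi * \sum_i (m (lift ord0 i))%:~R * tnth x i)).
  by apply: cmeas_cis; apply: measurable_funM => //; exact: (measurable_tuple_sum (fun i => (m (lift ord0 i))%:~R)).
apply: etrans (cint_prod (cube R n) m1 m2 _ _) _; try by move=> x; rewrite normc_cis.
rewrite unif_cis IH -natrM mulnb; congr (nat_of_bool _)%:R.
apply/andP/forallP => [[/eqP m0 /forallP h] i|h]; last by split => //; apply/forallP => i.
by case: (unliftP ord0 i) => [j|] ->; [exact: h|apply/eqP].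
Qed.

End cube_integral.

(** * The inner product, the pairing and the reflections *)

Section bilinear_form.
Context {R : realType} {n : nat} (G : 'M[R]_n).
Hypothesis GP : inner_product G.
Implicit Types (l m a b : 'rV[R]_n) (h q : 'cV[R]_n).
Local Notation dot := (dotp G).

Lemma dotpDl l m a : dot (l + m) a = dot l a + dot m a.
Proof. by rewrite /dotp !mulmxDl mxE. Qed.
Lemma dotpZl c l a : dot (c *: l) a = c * dot l a.
Proof. by rewrite /dotp -!scalemxAl mxE. Qed.
Lemma dotpC l m : dot l m = dot m l.
Proof.
rewrite /dotp; transitivity ((l *m G *m m^T)^T 0 0); first by rewrite [RHS]mxE.
by rewrite !trmx_mul trmxK (proj1 GP) mulmxA.
Qed.
Lemma dotpDr l m a : dot a (l + m) = dot a l + dot a m.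
Proof. by rewrite dotpC dotpDl !(dotpC a). Qed.
Lemma dotpZr c l a : dot a (c *: l) = c * dot a l.
Proof. by rewrite dotpC dotpZl dotpC. Qed.
Lemma dotpNl l a : dot (- l) a = - dot l a.
Proof. by rewrite -scaleN1r dotpZl mulN1r. Qed.
Lemma dotpNr l a : dot a (- l) = - dot a l.
Proof. by rewrite dotpC dotpNl dotpC. Qed.
Lemma dotpBl l m a : dot (l - m) a = dot l a - dot m a.
Proof. by rewrite dotpDl dotpNl. Qed.
Lemma dotpBr l m a : dot a (l - m) = dot a l - dot a m.
Proof. by rewrite dotpDr dotpNr. Qed.
Lemma dotp0l a : dot 0 a = 0.
Proof. by rewrite -(scale0r 0) dotpZl mul0r. Qed.
Lemma dotp_gt0 l : l != 0 -> 0 < dot l l. Proof. exact: (proj2 GP). Qed.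
Lemma dotp_ge0 l : 0 <= dot l l.
Proof. by have [->|/dotp_gt0/ltW//] := eqVneq l 0; rewrite dotp0l. Qed.

Lemma pairingDl l m h : pairing (l + m) h = pairing l h + pairing m h.
Proof. by rewrite /pairing mulmxDl mxE. Qed.
Lemma pairingZl c l h : pairing (c *: l) h = c * pairing l h.
Proof. by rewrite /pairing -scalemxAl mxE. Qed.
Lemma pairingNl l h : pairing (- l) h = - pairing l h.
Proof. by rewrite -scaleN1r pairingZl mulN1r. Qed.
Lemma pairingBl l m h : pairing (l - m) h = pairing l h - pairing m h.
Proof. by rewrite pairingDl pairingNl. Qed.
Lemma pairing0l h : pairing 0 h = 0.
Proof. by rewrite /pairing mul0mx mxE. Qed.
Lemma pairingDr l h q : pairing l (h + q) = pairing l h + pairing l q.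
Proof. by rewrite /pairing mulmxDr mxE. Qed.
Lemma pairingZr c l h : pairing l (c *: h) = c * pairing l h.
Proof. by rewrite /pairing -scalemxAr mxE. Qed.
Lemma pairingM l (w : 'M[R]_n) h : pairing l (w *m h) = pairing (l *m w) h.
Proof. by rewrite /pairing mulmxA. Qed.
Lemma pairing_sumr (I : Type) (r : seq I) l (f : I -> 'cV[R]_n) :
  pairing l (\sum_(i <- r) f i) = \sum_(i <- r) pairing l (f i).
Proof. by rewrite /pairing mulmx_sumr summxE. Qed.

Lemma pairing_coroot l a : pairing l (coroot G a) = 2 * dot l a / dot a a.
Proof.
rewrite /coroot pairingZr /pairing mulmxA mulrAC; congr (_ * _); exact: mulrC.
Qed.

Lemma mul_reflection l a : l *m reflection G a = l - pairing l (coroot G a) *: a.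
Proof.
rewrite /reflection mulmxBr mulmx1 mulmxA; congr (_ - _).
by rewrite [l *m _]mx11_scalar mul_scalar_mx.
Qed.

Lemma reflection_self a : a != 0 -> a *m reflection G a = - a.
Proof.
move=> a0; rewrite mul_reflection pairing_coroot mulfK; last by rewrite gt_eqF ?dotp_gt0.
by rewrite scaler_nat mulr2n opprD addrA subrr add0r.
Qed.

Lemma reflection_dotp a l m : a != 0 -> dot (l *m reflection G a) (m *m reflection G a) = dot l m.
Proof.
move=> a0; have d0 : dot a a != 0 by rewrite gt_eqF ?dotp_gt0.
rewrite !mul_reflection !pairing_coroot !dotpBl !dotpBr !dotpZl !dotpZr (dotpC a m).
by field.
Qed.

Lemma reflectionK a : a != 0 -> reflection G a *m reflection G a = 1%:M.
Proof.
move=> a0; have d0 : dot a a != 0 by rewrite gt_eqF ?dotp_gt0.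
apply/row_matrixP => i; rewrite !rowE mulmx1 mulmxA !mul_reflection.
rewrite pairingBl pairingZl !pairing_coroot -addrA -opprD -scalerDl.
by rewrite (_ : 2 * _ / _ + _ = 0 :> R) ?scale0r ?subr0//; field.
Qed.

Lemma cauchy_schwarz_dotp l m : dot l m ^+ 2 <= dot l l * dot m m.
Proof.
have [->|m0] := eqVneq m 0.
  by rewrite [dot l 0]dotpC !dotp0l expr0n mulr0.
have d0 := dotp_gt0 m0; have := dotp_ge0 (l - (dot l m / dot m m) *: m).
rewrite dotpBl !dotpBr !dotpZl !dotpZr (dotpC m l) => h.
rewrite -ler_pdivrMr//; apply: le_trans (_ : dot l m ^+ 2 / dot m m <= _) _ => //.
rewrite -subr_ge0; apply: le_trans h _; rewrite le_eqVlt; apply/orP; left; apply/eqP.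
by field; rewrite gt_eqF.
Qed.

End bilinear_form.

(** * Calculus of directional derivatives *)

Section directional_derivatives.
Context {R : realType} {V : normedModType R}.
Implicit Types (f g : V -> R) (x v : V).

(** Restriction to the line through [x] reduces the chain rule with an outer scalar function to the
    one-variable rule, without differentiability in all directions. *)
Lemma is_derive_line f x v (d : R) :
  is_derive x v f d <-> is_derive (0 : R) (1 : R) (fun t : R => f (t *: v + x)) d.
Proof.
have E : (fun t : R => t^-1 *: ((f \o shift x) (t *: v) - f x)) =
    (fun t : R => t^-1 *: (((fun t : R => f (t *: v + x)) \o shift 0) (t *: (1 : R)) - f (0 *: v + x))).
  by apply/funext => t /=; rewrite addr0 scale0r add0r [_%:A]mulr1.
by split=> [] [h1 h2]; apply: DeriveDef; move: h1 h2; rewrite /derivable /derive E.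
Qed.

Lemma is_derive_mul f g x v (a b : R) : is_derive x v f a -> is_derive x v g b ->
  is_derive x v (fun y => f y * g y) (a * g x + f x * b).
Proof.
by move=> df dg; apply: is_derive_eq (is_deriveM df dg) _; rewrite addrC [g x *: a]mulrC.
Qed.

Lemma is_derive_add f g x v (a b : R) : is_derive x v f a -> is_derive x v g b ->
  is_derive x v (fun y => f y + g y) (a + b).
Proof. by move=> df dg; exact: is_deriveD. Qed.

Lemma is_derive_scal f x v (c a : R) : is_derive x v f a ->
  is_derive x v (fun y => c * f y) (c * a).
Proof. by move=> df; exact: (is_deriveZ c df). Qed.

Lemma is_derive_const (c : R) x v : is_derive x v (fun=> c) (0 : R).
Proof. exact: is_derive_cst. Qed.

Lemma is_derive_bigsum (I : eqType) (r : seq I) (F : I -> V -> R) (dF : I -> R) x v :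
  (forall i, i \in r -> is_derive x v (F i) (dF i)) ->
  is_derive x v (fun y => \sum_(i <- r) F i y) (\sum_(i <- r) dF i).
Proof.
elim: r => [|i r IH] h.
  by rewrite big_nil; under eq_fun do rewrite big_nil; exact: is_derive_const.
rewrite big_cons; under eq_fun do rewrite big_cons.
apply: is_derive_add; first by apply: h; rewrite inE eqxx.
by apply: IH => j jr; apply: h; rewrite inE jr orbT.
Qed.

Lemma is_derive_chain (g : R -> R) f x v (a b : R) : is_derive (f x) (1 : R) g a ->
  is_derive x v f b -> is_derive x v (fun y => g (f y)) (a * b).
Proof.
move=> dg /is_derive_line df; apply/is_derive_line.
apply: (@is_derive1_comp _ g (fun t : R => f (t *: v + x))) => //.
by rewrite scale0r add0r.
Qed.

Lemma is_derive_inv (x : R) : x != 0 -> is_derive x (1 : R) (fun t : R => t^-1) (- (x ^- 2)).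
Proof.
move=> x0; apply: is_derive_eq (is_deriveV (f := id) x0 (is_derive_id x 1)) _.
by rewrite [_ *: _]mulr1.
Qed.

End directional_derivatives.

(** * Partial sums of the logarithm and real powers *)

Section log_series.
Context {R : realType}.
Implicit Types (t x : R).

Definition logs N t : R := \sum_(j <- iota 0 N) t ^+ j.+1 / j.+1%:R.

Lemma is_derive_pow j t : is_derive t (1 : R) (fun x : R => x ^+ j.+1) (j.+1%:R * t ^+ j).
Proof.
elim: j => [|j IH].
  by rewrite mulr1; under eq_fun do rewrite expr1; exact: is_derive_id.
under eq_fun do rewrite exprS.
rewrite (_ : _ * _ = 1 * t ^+ j.+1 + t * (j.+1%:R * t ^+ j)); last by rewrite exprS -[j.+2%:R]natr1; ring.
exact: (is_derive_mul (is_derive_id t 1) IH).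
Qed.

Lemma is_derive_logs N t : is_derive t (1 : R) (logs N) (\sum_(j <- iota 0 N) t ^+ j).
Proof.
apply: is_derive_bigsum => j _.
rewrite (_ : t ^+ j = j.+1%:R^-1 * (j.+1%:R * t ^+ j)); last by rewrite mulKf// pnatr_eq0.
by under eq_fun do rewrite mulrC; exact: (is_derive_scal _ (is_derive_pow j t)).
Qed.

Lemma logs_ge0 N t : 0 <= t -> 0 <= logs N t.
Proof. by move=> t0; apply: sumr_ge0 => j _; rewrite divr_ge0// exprn_ge0. Qed.

(** The derivative of (1 - t) exp(logs N t) telescopes to - t^N exp(logs N t), and the mean value
    theorem turns this into both bounds. *)
Lemma logs_expR N t : 0 <= t < 1 ->
  1 - t ^+ N / (1 - t) <= (1 - t) * expR (logs N t) <= 1.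
Proof.
pose f x := (1 - x) * expR (logs N x); pose df x := - (x ^+ N * expR (logs N x)).
have fd x : is_derive x (1 : R) f (df x).
  have h1 := is_derive_add (is_derive_const 1 x 1) (is_derive_scal (-1) (is_derive_id x 1)).
  have h2 := is_derive_chain (is_derive_expR _) (is_derive_logs N x).
  have := is_derive_mul h1 h2; rewrite add0r mulr1.
  rewrite (_ : _ + _ = df x); last first.
    have g : (1 + -1 * x) * \sum_(j <- iota 0 N) x ^+ j = 1 - x ^+ N.
      rewrite -[N in iota _ N]subn0 -/(index_iota 0 N) big_mkord.
      by rewrite mulN1r -opprB mulNr -subrX1 opprB.
    by rewrite mulrCA g /df; ring.
  by move=> h; rewrite /f; under eq_fun do rewrite -mulN1r; exact: h.
have fc t' : {within `[0, t'], continuous f}.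
  apply: continuous_subspaceT => x.
  by apply/differentiable_continuous/derivable1_diffP; have [] := fd x.
have f0 : f 0 = 1.
  rewrite /f subr0 mul1r /logs big1 ?expR0// => j _; by rewrite exprS mul0r mul0r.
have mv t' : 0 <= t' -> exists2 c, 0 <= c <= t' & f t' = 1 - c ^+ N * expR (logs N c) * t'.
  move=> t0; have [c ct E] := MVT_segment t0 (fun x _ => fd x) (fc t').
  exists c; first by move: ct; rewrite in_itv.
  by move: E; rewrite f0 subr0 => /eqP; rewrite subr_eq => /eqP ->; rewrite /df; ring.
have fle t' : 0 <= t' -> f t' <= 1.
  move=> t0; have [c /andP[c0 _] ->] := mv t' t0.
  by rewrite gerBl mulr_ge0// mulr_ge0 ?exprn_ge0// expR_ge0.
move=> /andP[t0 t1]; apply/andP; split; last exact: fle.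
have [c /andP[c0 ct]] := mv t t0; rewrite -/(f t) => ->.
rewrite lerB//; have t1' : 0 < 1 - t by rewrite subr_gt0.
apply: (@le_trans _ _ (t ^+ N * (1 - t)^-1 * 1)); last by rewrite mulr1.
apply: ler_pM => //; [by rewrite mulr_ge0 ?exprn_ge0 ?expR_ge0| |exact: ltW].
apply: ler_pM; rewrite ?exprn_ge0 ?expR_ge0// ?lerXn2r ?nnegrE//.
rewrite -[leRHS]mul1r ler_pdivlMr// mulrC; apply: le_trans (fle c c0).
by rewrite ler_wpM2r ?expR_ge0// lerB.
Qed.

Lemma cvg_expR_logs t : 0 <= t < 1 -> expR (- logs N t) @[N --> \oo] --> 1 - t.
Proof.
move=> t01; have /andP[t0 t1] := t01; have t1' : 0 < 1 - t by rewrite subr_gt0.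
apply: (@squeeze_cvgr _ _ _ _ (fun=> 1 - t) (fun N => (1 - t) + t ^+ N * (1 - t)^-1)).
- apply: nearW => N; have /andP[h1 h2] := logs_expR N t01.
  have e0 := expR_gt0 (logs N t); have E : expR (- logs N t) = (expR (logs N t))^-1 by rewrite expRN.
  have e1 : expR (- logs N t) <= 1 by rewrite -[leRHS]expR0 ler_expR oppr_le0 logs_ge0.
  apply/andP; split; first by rewrite E -[leRHS]mul1r ler_pdivlMr.
  have h3 : expR (- logs N t) * (1 - t ^+ N / (1 - t)) <= 1 - t.
    by rewrite E mulrC ler_pdivrMr.
  have q0 : 0 <= t ^+ N / (1 - t) by rewrite divr_ge0 ?exprn_ge0// ltW.
  have h4 : expR (- logs N t) * (t ^+ N / (1 - t)) <= t ^+ N / (1 - t) by rewrite ler_piMl.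
  move: h3; rewrite mulrBr mulr1 lerBlDr => /le_trans; apply; rewrite lerD2l //.
- exact: cvg_cst.
- have h : ((1 - t) + t ^+ N * (1 - t)^-1) @[N --> \oo] --> (1 - t) + 0 * (1 - t)^-1.
    apply: cvgD; first exact: cvg_cst.
    by apply: cvgM; [apply: cvg_expr; rewrite ger0_norm|exact: cvg_cst].
  by rewrite mul0r addr0 in h.
Qed.

(** The endpoint t = 1, which occurs on the walls, is where the harmonic series diverges, in
    agreement with the value 0 of the power of 0. *)
Lemma cvg_logs_powR t (c : R) : 0 <= t <= 1 -> 0 < c ->
  expR (- (c * logs N t)) @[N --> \oo] --> (1 - t) `^ c.
Proof.
move=> /andP[t0]; rewrite le_eqVlt => /orP[/eqP ->|t1] c0.
  rewrite subrr powR0 ?gt_eqF//.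
  have h : logs N (1 : R) @[N --> \oo] --> +oo.
    have -> : (fun N => logs N (1 : R)) = series (@harmonic R).
      apply/funext => N; rewrite /logs /series /= /index_iota subn0.
      by apply: eq_bigr => j _; rewrite expr1n mul1r.
    apply: nondecreasing_dvgn_lt; last exact: dvg_harmonic.
    by apply/nondecreasing_seqP => m; rewrite /series /= big_nat_recr//= lerDl invr_ge0.
  have h2 : (c * logs N (1 : R)) @[N --> \oo] --> +oo 
    by apply/cvgryPge => A; move/cvgryPge: h => /(_ (A / c)); apply: filterS => N; rewrite ler_pdivrMr// mulrC.
  exact: (cvg_comp _ _ h2 (@cvgr_expR R)).
have t1' : 0 < 1 - t by rewrite subr_gt0.
rewrite /powR gt_eqF//.
have t01 : 0 <= t < 1 by rewrite t0.
have h : (- logs N t) @[N --> \oo] --> ln (1 - t).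
  under eq_fun do rewrite -[- logs _ _]expRK.
  exact: (cvg_comp _ _ (cvg_expR_logs t01) (continuous_ln t1')).
have h2 : (- (c * logs N t)) @[N --> \oo] --> c * ln (1 - t).
  by under eq_fun do rewrite -mulrN; apply: cvgM => //; exact: cvg_cst.
exact: (cvg_comp _ (@expR R) h2 (@continuous_expR R _)).
Qed.

End log_series.

(** * Limits of complex sequences *)

Section complex_sequences.
Context {R : realType}.
Local Notation C := R[i].

Definition ccvg (u : nat -> C) (l : C) := forall e : R, 0 < e ->
  exists N, forall i, (N <= i)%N -> normc (u i - l) <= e.

Lemma ccvg_real (u : nat -> R) (l : R) : u @ \oo --> l -> ccvg (fun i => (u i)%:C) l%:C.
Proof.
move=> /cvgrPdist_le h e e0; have [N _ hN] := h e e0; exists N => i Ni.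
by rewrite -rmorphB normc_real distrC; exact: hN.
Qed.

Lemma ccvgD u v l m : ccvg u l -> ccvg v m -> ccvg (fun i => u i + v i) (l + m).
Proof.
move=> hu hv e e0; have e2 : 0 < e / 2 by lra.
have [N1 h1] := hu _ e2; have [N2 h2] := hv _ e2; exists (maxn N1 N2) => i.
rewrite geq_max => /andP[/h1 a1 /h2 a2].
rewrite opprD addrACA; apply: (le_trans (le_normcD _ _)); lra.
Qed.

Lemma ccvgZ u l z : ccvg u l -> ccvg (fun i => u i * z) (l * z).
Proof.
move=> hu e e0; have z0 : 0 < 1 + normc z by rewrite ltr_pwDl// normc_ge0.
have [N hN] := hu _ (divr_gt0 e0 z0); exists N => i /hN h.
rewrite -mulrBl normcM; apply: (@le_trans _ _ (e / (1 + normc z) * (1 + normc z))).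
  by apply: ler_pM; rewrite ?normc_ge0// lerDr.
by rewrite divfK// gt_eqF.
Qed.

End complex_sequences.

(** * Lambert series *)

Section lambert_series.
Context {R : realType}.
Implicit Types (p : R) (c : nat -> R).

(** The coefficient of p^i once each p^j / (1 - p^j) is expanded as a geometric series: a sum over
    the divisors of i. *)
Definition lcoef c i : R := \sum_(1 <= j < i.+1 | (j %| i)%N) j%:R * c j.
Definition lpart p c L : R := \sum_(1 <= j < L) j%:R * p ^+ j / (1 - p ^+ j) * c j.

(** The remainder of the geometric series in p^j after degree N starts at the first positive
    multiple e of j that is at least N, which is the invariant carried by the induction. *)
Lemma lam_rem p j N : 1 - p ^+ j != 0 -> (0 < j)%N -> exists e, [/\ (N <= e)%N, (j <= e)%N &
  p ^+ j / (1 - p ^+ j) - \sum_(0 <= i < N) ((0 < i)%N && (j %| i)%N)%:R * p ^+ i = p ^+ e / (1 - p ^+ j)].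
Proof.
move=> pj j0.
suff [e [h1 [h2 h3 _ ->]]] : exists e, (N <= e)%N /\ [/\ (0 < e)%N, (j %| e)%N,
    (forall m, (0 < m)%N -> (j %| m)%N -> (N <= m)%N -> (e <= m)%N) &
    p ^+ j / (1 - p ^+ j) - \sum_(0 <= i < N) ((0 < i)%N && (j %| i)%N)%:R * p ^+ i = p ^+ e / (1 - p ^+ j)].
  by exists e; split => //; exact: dvdn_leq.
elim: N => [|N [e [h1 [h2 h3 h4 E]]]].
  exists j; split => //; split => //; first by move=> m m0 jm _; exact: dvdn_leq.
  by rewrite big_geq// subr0.
have [/andP[N0 jN]|nj] := boolP ((0 < N)%N && (j %| N)%N).
  have eN : e = N by apply/eqP; rewrite eqn_leq h1 andbT h4.
  exists (N + j)%N; split; first by rewrite -addn1 leq_add2l.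
  split; [by rewrite addn_gt0 N0|by rewrite dvdn_addr|move=> m m0 jm Nm|].
    by have := dvdn_sub jm jN => /dvdn_leq; rewrite subn_gt0 => /(_ Nm); rewrite leq_subRL// ltnW.
  rewrite big_nat_recr//= N0 jN mul1r opprD addrA E eN exprD; field; exact: pj.
exists e; split.
  rewrite ltn_neqAle h1 andbT; apply: contra nj => /eqP ->; by rewrite h2.
split => //; first by move=> m m0 jm /ltnW; exact: h4.
by rewrite big_nat_recr//= (negbTE nj) mul0r addr0.
Qed.

Lemma half_sum L : \sum_(1 <= j < L) (1/2) ^+ j <= 1 :> R.
Proof.
case: L => [|L]; first by rewrite big_geq.
suff -> : \sum_(1 <= j < L.+1) (1/2) ^+ j = 1 - (1/2) ^+ L :> R by rewrite gerBl exprn_ge0.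
elim: L => [|L IH]; first by rewrite big_geq// expr0 subrr.
by rewrite big_nat_recr//= IH exprS; field.
Qed.

Section bounded_coefficients.
Variables (p : R) (c : nat -> R).
Hypotheses (p16 : `|p| <= 1/16) (c2 : forall j, `|c j| <= 2).

Lemma pow16 j : (0 < j)%N -> `|p| ^+ j <= 1/16.
Proof.
case: j => // j _; rewrite exprS -[leRHS]mulr1 ler_pM ?exprn_ge0//.
by rewrite exprn_ile1//; have := p16; lra.
Qed.

Lemma inv_bound j : (0 < j)%N -> 1 - p ^+ j != 0 /\ `|(1 - p ^+ j)^-1| <= 2.
Proof.
move=> j0; have h : `|p ^+ j| <= 1/16 by rewrite normrX; exact: pow16.
have h2 : 1/2 <= 1 - p ^+ j by have := ler_norm (p ^+ j); lra.
have h0 : 0 < 1 - p ^+ j by lra.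
split; first by rewrite gt_eqF.
by rewrite ger0_norm ?invr_ge0 ?(ltW h0)// -[leRHS]invrK lef_pV2 ?posrE//; lra.
Qed.

Lemma nat_half j : j%:R * (1/4) ^+ j <= (1/2) ^+ j :> R.
Proof.
have -> : (1/4 : R) ^+ j = (1/2) ^+ j * (1/2) ^+ j by rewrite -exprMn; congr (_ ^+ _); lra.
rewrite mulrA ler_piMl ?exprn_ge0// div1r exprVn ler_pdivrMr ?exprn_gt0// mul1r.
by rewrite -natrX ler_nat ltnW// ltn_expl.
Qed.

Lemma lterm_bound j : (0 < j)%N -> `|j%:R * p ^+ j / (1 - p ^+ j) * c j| <= 4 * (1/2) ^+ j.
Proof.
move=> j0; have [_ hi] := inv_bound j0.
rewrite !normrM normr_nat normrX.
apply: (@le_trans _ _ (j%:R * (1/4) ^+ j * 2 * 2)); last by have := nat_half j; lra.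
have j1 : j%:R * `|p| ^+ j <= j%:R * (1/4) ^+ j.
  by rewrite ler_wpM2l//; apply: ler_exp => //; have := p16; lra.
have j2 : 0 <= j%:R * `|p| ^+ j by rewrite mulr_ge0 ?exprn_ge0.
apply: ler_pM; rewrite ?mulr_ge0//; exact: ler_pM.
Qed.

Lemma lpart_cvg : cvgn (lpart p c).
Proof.
pose t j := j%:R * p ^+ j / (1 - p ^+ j) * c j.
have E : lpart p c = series t.
  apply/funext => -[|L]; first by rewrite /lpart /series /= !big_geq.
  by rewrite /series /= big_nat_recl// /lpart big_add1 /= {1}/t !mul0r add0r.
rewrite E; apply: normed_cvg.
apply: (@series_le_cvg _ _ (geometric 4 (1/2))).
- by move=> j; exact: normr_ge0.
- by move=> j; rewrite /geometric /= mulr_ge0// exprn_ge0.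
- move=> [|j]; last exact: lterm_bound.
  by rewrite /t /= !mul0r normr0 mulr_ge0.
- by apply: is_cvg_geometric_series; rewrite ger0_norm; lra.
Qed.

(** With L >= N every divisor of an i < N is counted. The remainder of the j-th term has exponent at
    least max(N, j), hence is at most (4 |p|)^N 4^-j up to constants, and j 4^-j <= 2^-j is
    summable. The 4 is 2 from [c] times 2 from the denominator. *)
Lemma lpart_close N L : (N <= L)%N ->
  `|lpart p c L - \sum_(0 <= i < N) p ^+ i * lcoef c i| <= 4 * (4 * `|p|) ^+ N.
Proof.
move=> NL; have s4 : 0 <= 4 * `|p| <= 1.
  by apply/andP; split; [rewrite mulr_ge0|have := p16; lra].
have -> : \sum_(0 <= i < N) p ^+ i * lcoef c i =
    \sum_(1 <= j < L) (j%:R * c j) * \sum_(0 <= i < N) ((0 < i)%N && (j %| i)%N)%:R * p ^+ i.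
  under [RHS]eq_bigr do rewrite mulr_sumr.
  rewrite exchange_big_nat /=; apply: eq_big_nat => i iN.
  rewrite /lcoef mulr_sumr.
  case: i iN => [|i] iN.
    by rewrite [LHS]big_geq// [RHS]big1// => j _; rewrite mul0r mulr0.
  rewrite [RHS](@big_cat_nat _ _ _ i.+2)//=; last by case/andP: iN => _ h; exact: leq_trans NL.
  rewrite [X in _ = _ + X]big_nat [X in _ = _ + X]big1 ?addr0; last first.
    move=> j /andP[ij _]; rewrite (_ : (j %| i.+1)%N = false) ?mul0r ?mulr0//.
    by apply: negbTE; apply: contraL ij => /dvdn_leq; rewrite -ltnNge ltnS; apply.
  rewrite big_mkcond /=; apply: eq_bigr => j _.
  by case: ifP => _; rewrite ?mul1r ?mul0r ?mulr0// mulrC.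
rewrite /lpart -sumrB; apply: (le_trans (ler_norm_sum _ _ _)).
apply: (@le_trans _ _ (\sum_(1 <= j < L) 4 * (4 * `|p|) ^+ N * (1/2) ^+ j)); last first.
  by rewrite -mulr_sumr ler_piMr ?half_sum// mulr_ge0// exprn_ge0//; case/andP: s4.
rewrite big_nat [leRHS]big_nat; apply: ler_sum => j /andP[j0 _].
have [pj hi] := inv_bound j0; have [e [e1 e2 E]] := lam_rem N pj j0.
have -> : j%:R * p ^+ j / (1 - p ^+ j) * c j - j%:R * c j * \sum_(0 <= i < N) ((0 < i)%N && (j %| i)%N)%:R * p ^+ i =
  j%:R * c j * (p ^+ e / (1 - p ^+ j)) by rewrite -E; ring.
rewrite !normrM normr_nat normrX.
have se : `|p| ^+ e <= (4 * `|p|) ^+ N * (1/4) ^+ j.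
  have [jN|/ltnW Nj] := leqP j N.
    apply: (@le_trans _ _ (`|p| ^+ N)); first by apply: ler_wiXn2l => //; have := p16; lra.
    rewrite exprMn mulrAC -[leLHS]mul1r ler_wpM2r ?exprn_ge0//.
    rewrite div1r exprVn ler_pdivlMr ?exprn_gt0// mul1r; apply: ler_weXn2l => //; lra.
  apply: (@le_trans _ _ (`|p| ^+ j)); first by apply: ler_wiXn2l => //; have := p16; lra.
  have -> : `|p| ^+ j = (4 * `|p|) ^+ j * (1/4) ^+ j by rewrite -exprMn; congr (_ ^+ _); field.
  rewrite ler_wpM2r ?exprn_ge0//; apply: ler_wiXn2l => //; by case/andP: s4.
apply: (@le_trans _ _ (j%:R * 2 * ((4 * `|p|) ^+ N * (1/4) ^+ j * 2))).
  apply: ler_pM; rewrite ?mulr_ge0 ?exprn_ge0//; first by apply: ler_pM.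
  by apply: ler_pM; rewrite ?exprn_ge0.
have s0 : 0 <= (4 * `|p|) ^+ N by rewrite exprn_ge0//; case/andP: s4.
have := ler_wpM2l s0 (nat_half j); move: ((1/4) ^+ j) ((1/2) ^+ j) => x y; lra.
Qed.

Lemma llim_close N : `|limn (lpart p c) - \sum_(0 <= i < N) p ^+ i * lcoef c i| <= 4 * (4 * `|p|) ^+ N.
Proof.
have /cvgrPdist_le h := lpart_cvg; apply/ler_addgt0Pl => e e1.
have [M _ hM] := h e e1.
have h1 := hM (M + N)%N (leq_addr _ _); have h2 := lpart_close (leq_addl M N).
rewrite -(subrK (lpart p c (M + N)) (limn _)) -addrA; apply: (le_trans (ler_normD _ _)).
by rewrite lerD.
Qed.

End bounded_coefficients.

(** Term by term, |1 - p^j| >= 1 - |p|^j, so the series at [|p|] that defines [W_max] is a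
    majorant. *)
Lemma llim_norm p c : `|p| <= 1/16 -> (forall j, `|c j| <= 2) ->
  `|limn (lpart p c)| <= 2 * limn (lpart `|p| (fun=> 1)).
Proof.
move=> p16 c2; have c1 (j : nat) : `|1 : R| <= 2 by rewrite normr1; lra.
have p16' : `| `|p| | <= 1/16 by rewrite normr_id.
have h1 : `|lpart p c L| @[L --> \oo] --> `|limn (lpart p c)| by apply: cvg_norm; exact: lpart_cvg.
have h2 := lpart_cvg p16' c1.
have h3 : (2 * lpart `|p| (fun=> 1) L) @[L --> \oo] --> 2 * limn (lpart `|p| (fun=> 1)).
  by apply: cvgM; [exact: cvg_cst|exact: h2].
apply: (ler_cvg_to h1 h3); apply: nearW => L.
rewrite /lpart mulr_sumr; apply: (le_trans (ler_norm_sum _ _ _)).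
rewrite big_nat [leRHS]big_nat; apply: ler_sum => j /andP[j0 _].
have [_ i1] := inv_bound p16 j0; have [i2 _] := inv_bound p16' j0.
have pj := pow16 p16 j0.
have q0 : 0 < 1 - `|p| ^+ j.
  by rewrite subr_gt0; apply: le_lt_trans pj _; rewrite ltr_pdivrMr ?mul1r ?ltr1n.
have q1 : `|(1 - p ^+ j)^-1| <= (1 - `|p| ^+ j)^-1.
  have hB : 1 - `|p| ^+ j <= `|1 - p ^+ j| by have := lerB_dist 1 (p ^+ j); rewrite normrX normr1.
  by rewrite normfV lef_pV2 ?posrE//; exact: lt_le_trans q0 hB.
rewrite !normrM normr_nat normrX mulr1 mulrC; apply: ler_pM; rewrite ?mulr_ge0 ?exprn_ge0//.
by rewrite ler_wpM2l// mulr_ge0 ?exprn_ge0.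
Qed.

End lambert_series.
Lemma sqrt_sqr_powR (R : realType) (x y : R) : 0 <= x -> (x `^ y) ^+ 2 = (x ^+ 2) `^ y.
Proof. by move=> x0; rewrite !expr2 powRM. Qed.

Lemma eq_vcvg (R : realType) (V : lmodType R[i]) (ip : V -> V -> R[i]) (u v : nat -> V) x :
  (forall j, u j = v j) -> vcvg ip u x -> vcvg ip v x.
Proof. by move=> E h e e0; have [N hN] := h e e0; exists N => i /hN; rewrite E. Qed.

(** * The torus of a root system *)

Section torus.
Context {R : realType} {n : nat} (D : cm_data R n).
Local Notation C := R[i].
Local Notation hR := 'cV[R]_n.
Local Notation G := (cm_gram D).
Local Notation GP := (cm_gramP D).
Local Notation dot := (dotp G).
Local Notation Phi := (cm_roots D).
Local Notation Phi_plus := (cm_pos_roots D).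
Local Notation k := (cm_coupling D).
Local Notation cor := (coroot G).
Local Notation refl := (reflection G).
Local Notation Wg := (weyl_group G Phi).
Local Notation P := (weight_lattice G Phi).
Local Notation Q := (coroot_lattice G Phi).
Local Notation B := (cm_basis D).
Local Notation mR := (measurableTypeR R).
Local Notation T := (n.-tuple mR).
Local Notation tp := (torus_pt D).
Local Notation mu := (cube R n).
Local Notation Delta := (Delta D).
Hypothesis kpos : forall a : 'rV[R]_n, a \in Phi -> 0 < k a.

(** * Roots, weights and the Weyl group *)

Section root_data.
Implicit Types (l m a b : 'rV[R]_n) (h q : 'cV[R]_n) (w : 'M[R]_n).

Lemma root_neq0 a : a \in Phi -> a != 0.
Proof. by case: (cm_rootsP D) => h _ _ _ _; apply: contraTneq => ->. Qed.
Lemma root_norm_gt0 a : a \in Phi -> 0 < dot a a.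
Proof. by move=> /root_neq0 /(dotp_gt0 GP). Qed.
Lemma root_refl a b : a \in Phi -> b \in Phi -> a *m refl b \in Phi.
Proof. by case: (cm_rootsP D) => _ _ h _ _; exact: h. Qed.
Lemma root_opp a : a \in Phi -> - a \in Phi.
Proof. by move=> aP; rewrite -(reflection_self GP (root_neq0 aP)); exact: root_refl. Qed.
Lemma root_weight a : a \in Phi -> P a.
Proof. by move=> aP b bP; case: (cm_rootsP D) => _ _ _ h _; exact: h. Qed.
Lemma pos_root a : a \in Phi_plus -> a \in Phi.
Proof. by have [h [_ ->]] := cm_pos_rootsP D => /andP[]. Qed.

Lemma weightD l m : P l -> P m -> P (l + m).
Proof. by move=> hl hm a aP; rewrite pairingDl rpredD ?hl ?hm. Qed.
Lemma weight0 : P 0.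
Proof. by move=> a aP; rewrite pairing0l rpred0. Qed.
Lemma weightN l : P l -> P (- l).
Proof. by move=> hl a aP; rewrite pairingNl rpredN hl. Qed.
Lemma weightB l m : P l -> P m -> P (l - m).
Proof. by move=> hl /weightN; exact: weightD. Qed.
Lemma weightMn l k : P l -> P (l *+ k).
Proof. by move=> hl; elim: k => [|k IH]; [exact: weight0|rewrite mulrS; exact: weightD]. Qed.

Lemma weight_coroot_int l q : P l -> Q q -> pairing l q \is a Num.int.
Proof.
move=> hl [c ->]; rewrite pairing_sumr big_seq; apply: rpred_sum => a aP.
by rewrite pairingZr rpredM ?rpred_int ?hl.
Qed.

Lemma weyl_ind (T : 'M[R]_n -> Prop) : T 1%:M ->
  (forall a w, a \in Phi -> Wg w -> T w -> T (refl a *m w)) -> forall w, Wg w -> T w.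
Proof.
move=> T1 TM w [s + ->]; elim: s => [|a s IH] sP; first by rewrite big_nil.
rewrite big_cons; have sP' : {subset s <= Phi} by move=> b bs; apply: sP; rewrite inE bs orbT.
by apply: TM; [apply: sP; rewrite inE eqxx|exists s|exact: IH].
Qed.

Lemma weyl1 : Wg 1%:M. Proof. by exists [::]; rewrite ?big_nil. Qed.
Lemma weyl_refl a : a \in Phi -> Wg (refl a).
Proof.
by move=> aP; exists [:: a]; [move=> b; rewrite inE => /eqP ->|rewrite big_cons big_nil mulmx1].
Qed.
Lemma weylM w w' : Wg w -> Wg w' -> Wg (w *m w').
Proof.
move=> [s sP ->] [t tP ->]; exists (s ++ t); last first.
  elim: s {sP} => [|a s IH] /=; first by rewrite big_nil mul1mx.
  by rewrite !big_cons -mulmxA IH.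
by move=> a; rewrite mem_cat => /orP[/sP|/tP].
Qed.

Lemma weyl_inv w : Wg w -> exists2 w', Wg w' & w *m w' = 1%:M /\ w' *m w = 1%:M.
Proof.
move: w; apply: weyl_ind => [|a w aP hw [w' hw' [E1 E2]]].
  by exists 1%:M; [exact: weyl1|rewrite mulmx1].
exists (w' *m refl a); first by apply: weylM => //; exact: weyl_refl.
have K := reflectionK GP (root_neq0 aP); split.
  by rewrite mulmxA -[_ *m w *m w']mulmxA E1 mulmx1.
by rewrite mulmxA -[_ *m refl a *m refl a]mulmxA K mulmx1.
Qed.

Lemma weyl_root a w : Wg w -> a \in Phi -> a *m w \in Phi.
Proof.
move=> hw; move: w hw a; apply: weyl_ind => [a|b w bP _ IH a aP]; first by rewrite mulmx1.
by rewrite mulmxA; apply: IH; exact: root_refl.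
Qed.

Lemma weyl_dotp w l m : Wg w -> dot (l *m w) (m *m w) = dot l m.
Proof.
move=> hw; move: w hw l m; apply: weyl_ind => [l m|a w aP _ IH l m]; first by rewrite !mulmx1.
by rewrite !mulmxA IH (reflection_dotp GP)// root_neq0.
Qed.

Lemma weyl_weight w l : Wg w -> P l -> P (l *m w).
Proof.
move=> hw hl; move: w hw l hl; apply: weyl_ind => [l|a w aP _ IH l hl]; first by rewrite mulmx1.
rewrite mulmxA; apply: IH; rewrite mul_reflection => b bP.
rewrite pairingBl pairingZl rpredB ?hl// rpredM ?hl//; exact: root_weight.
Qed.

Lemma basis_unit : B \in unitmx. Proof. by case: (cm_basisP D). Qed.

Lemma weight_basis_int l i : P l -> (l *m B) 0 i \is a Num.int.
Proof.
move=> hl; have -> : (l *m B) 0 i = pairing l (B *m map_mx intr (delta_mx i 0 : 'cV[int]_n)).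
  rewrite pairingM /pairing (_ : map_mx intr _ = delta_mx i 0); last first.
    by apply/colP => j; rewrite !mxE; case: (_ && _).
  by rewrite -colE [RHS]mxE.
apply: weight_coroot_int => //; case: (cm_basisP D) => _ h; apply/h; by exists (delta_mx i 0).
Qed.

(** The roots span, so a group element is determined by its action on them; this maps the group
    injectively to the self-maps of the finite set of roots. *)
Lemma weyl_finite : exists s : seq 'M[R]_n, uniq s /\ forall w, Wg w <-> w \in s.
Proof.
have fin : finite_set Wg.
  pose F (g : {ffun Phi -> Phi}) : 'M[R]_n :=
    xget 0 [set w | Wg w /\ forall a : Phi, val a *m w = val (g a)].
  apply: (@sub_finite_set _ _ (range F)); last by apply: finite_image; exact: finite_finset.
  move=> w hw; exists [ffun a : Phi => [` weyl_root hw (valP a)]%fset] => //.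
  rewrite /F; have : [set w' | Wg w' /\ forall a : Phi, val a *m w' =
     val ([ffun a : Phi => [` weyl_root hw (valP a)]%fset] a)] w.
    by split => // a; rewrite ffunE.
  move=> /xgetI -/(_ 0) [_]; set w' := xget _ _ => h.
  apply/row_matrixP => i; rewrite !rowE.
  case: (cm_rootsP D) => _ /(_ (delta_mx 0 i)) [c ->] _ _ _.
  rewrite !mulmx_suml big_seq [RHS]big_seq; apply: eq_bigr => a aP.
  by rewrite -!scalemxAl; congr (_ *: _); have := h [` aP]%fset; rewrite ffunE.
have [s sE] := (finite_seqP _).1 fin; exists (undup s); split; first exact: undup_uniq.
move=> w; rewrite mem_undup; split => [hw|ws]; last by rewrite sE.
by have : [set` s] w by rewrite -sE.
Qed.

Lemma pos_perm : perm_eq Phi (Phi_plus ++ [seq - a | a <- Phi_plus]).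
Proof.
have [h [h0 hp]] := cm_pos_rootsP D.
apply: uniq_perm; first exact: fset_uniq.
  rewrite cat_uniq fset_uniq map_inj_uniq ?fset_uniq ?andbT; last exact: oppr_inj.
  apply/hasPn => _ /mapP[a + ->]; rewrite /= !hp => /andP[_ a0].
  by rewrite pairingNl oppr_gt0 negb_and -leNgt (ltW a0) orbT.
move=> a; rewrite mem_cat; apply/idP/orP => [aP|].
  have := h0 a aP; rewrite neq_lt => /orP[a0|a0]; last by left; rewrite hp aP.
  by right; apply/mapP; exists (- a); rewrite ?opprK// hp root_opp//= pairingNl oppr_gt0.
case=> [/pos_root//|/mapP[b /pos_root bP ->]]; exact: root_opp.
Qed.

Lemma big_pos (T : Type) (idx : T) (op : Monoid.com_law idx) (f : 'rV[R]_n -> T) :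
  (forall a, a \in Phi -> f (- a) = f a) ->
  \big[op/idx]_(a <- Phi) f a = op (\big[op/idx]_(a <- Phi_plus) f a) (\big[op/idx]_(a <- Phi_plus) f a).
Proof.
move=> fN; rewrite (perm_big _ pos_perm) big_cat big_map; congr (op _ _).
by apply: eq_big_seq => a /pos_root; exact: fN.
Qed.

Lemma big_weyl (T : Type) (idx : T) (op : Monoid.com_law idx) (f : 'rV[R]_n -> T) w : Wg w ->
  \big[op/idx]_(a <- Phi) f (a *m w) = \big[op/idx]_(a <- Phi) f a.
Proof.
move=> hw; have [w' hw' [E1 E2]] := weyl_inv hw.
rewrite -(big_map (fun a => a *m w) xpredT f); apply: perm_big; apply: uniq_perm.
- rewrite map_inj_uniq ?fset_uniq// => a b /(congr1 (mulmx^~ w')).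
  by rewrite -!mulmxA E1 !mulmx1.
- exact: fset_uniq.
move=> a; apply/mapP/idP => [[b bP ->]|aP]; first exact: weyl_root.
by exists (a *m w'); [exact: weyl_root|rewrite -mulmxA E2 mulmx1].
Qed.

Lemma coupling_opp a : a \in Phi -> cm_coupling D (- a) = cm_coupling D a.
Proof.
move=> aP; rewrite -(reflection_self GP (root_neq0 aP)); apply: cm_couplingP => //.
exact: weyl_refl.
Qed.

End root_data.

(** * Trigonometric polynomials and their Fourier coefficients *)

Section trig_polynomials.
Implicit Types (l m a b : 'rV[R]_n) (h q : hR) (w : 'M[R]_n) (s t : seq (C * 'rV[R]_n)).

(** A trigonometric polynomial is handled through a list of terms, in which a weight may occur
    several times: sums, products and derivatives are then list operations. Independence of the list
    is restored by [tval_linear]. *)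
Definition tval s h : C := \sum_(x <- s) x.1 * expw x.2 h.
Definition wts s := forall x, x \in s -> P x.2.

Lemma expwE l h : expw l h = cis (pairing l h). Proof. by []. Qed.
Lemma expwD l m h : expw (l + m) h = expw l h * expw m h.
Proof. by rewrite !expwE pairingDl cisD. Qed.
Lemma expw0 h : expw (0 : 'rV[R]_n) h = 1.
Proof. by rewrite expwE pairing0l cis0. Qed.
Lemma expwN l h : expw (- l) h = conjc (expw l h).
Proof. by rewrite !expwE pairingNl cisN. Qed.
Lemma expwM l w h : expw l (w *m h) = expw (l *m w) h.
Proof. by rewrite !expwE pairingM. Qed.
Lemma expw_torus l : P l -> torus_fun D (expw l).
Proof.
move=> hl h q hq; rewrite !expwE pairingDr pairingZr cisD.
by have /intrP[z ->] := weight_coroot_int hl hq; rewrite cis_int mulr1.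
Qed.

Lemma expw_tp l (x : T) : expw l (tp x) = cis (2 * pi * \sum_i (l *m B) 0 i * tnth x i).
Proof.
rewrite expwE pairingZr pairingM; congr (cis (_ * _)).
by rewrite /pairing [LHS]mxE; apply: eq_bigr => i _; rewrite [X in _ * X]mxE.
Qed.

Lemma cmeas_expw l : cmeas (fun x : T => expw l (tp x)).
Proof.
under eq_fun do rewrite expw_tp; apply: cmeas_cis; apply: measurable_funM => //.
exact: (measurable_tuple_sum (fun i => (l *m B) 0 i)).
Qed.

Lemma cint_expw l : P l -> cint mu (fun x => expw l (tp x)) = (l == 0)%:R.
Proof.
move=> hl; have zex i : exists z : int, (l *m B) 0 i = z%:~R.
  by have /intrP[k ->] := weight_basis_int i hl; exists k.
have [z zE] := @choice _ _ _ zex.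
under [X in cint _ X]eq_fun do rewrite expw_tp.
under [X in cint _ X]eq_fun => x do under eq_bigr do rewrite zE.
rewrite cube_cis; congr (nat_of_bool _)%:R; apply/forallP/eqP => [z0|l0 i].
  have : l *m B = 0 by apply/rowP => i; rewrite zE (eqP (z0 i)) mxE.
  by move=> /(congr1 (mulmx^~ (invmx B))); rewrite mulmxK ?basis_unit// mul0mx => ->.
by have := zE i; rewrite l0 mul0mx mxE => /esym/eqP; rewrite intr_eq0.
Qed.

Lemma tval_cat s t h : tval (s ++ t) h = tval s h + tval t h.
Proof. by rewrite /tval big_cat. Qed.
Lemma wts_cat s t : wts s -> wts t -> wts (s ++ t).
Proof. by move=> hs ht x; rewrite mem_cat => /orP[/hs|/ht]. Qed.

Definition tscale (c : C) s := [seq (c * x.1, x.2) | x <- s].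
Lemma tval_scale c s h : tval (tscale c s) h = c * tval s h.
Proof. by rewrite /tval big_map mulr_sumr; apply: eq_bigr => x _; rewrite mulrA. Qed.
Lemma wts_scale c s : wts s -> wts (tscale c s).
Proof. by move=> hs _ /mapP[x /hs hx ->]. Qed.

Definition tmul s t := [seq (x.1 * y.1, x.2 + y.2) | x <- s, y <- t].
Lemma tval_mul s t h : tval (tmul s t) h = tval s h * tval t h.
Proof.
rewrite /tval /tmul; elim: s => [|x s IH]; first by rewrite !big_nil mul0r.
rewrite allpairs_cons big_cat big_map /= IH big_cons mulrDl; congr (_ + _).
by rewrite mulr_sumr; apply: eq_bigr => y _; rewrite expwD mulrACA.
Qed.
Lemma wts_mul s t : wts s -> wts t -> wts (tmul s t).
Proof. by move=> hs ht _ /allpairsP[[x y] [/hs hx /ht hy ->]] /=; exact: weightD. Qed.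

Lemma tval_torus s : wts s -> torus_fun D (tval s).
Proof.
move=> hs h q hq; rewrite /tval big_seq [RHS]big_seq; apply: eq_bigr => x /hs hx.
by rewrite expw_torus.
Qed.

Lemma normc_expw l h : normc (expw l h) = 1. Proof. exact: normc_cis. Qed.

Lemma tval_bound s : exists2 K : R, 0 <= K & forall h, normc (tval s h) <= K.
Proof.
exists (\sum_(x <- s) normc x.1); first by apply: sumr_ge0 => x _; exact: normc_ge0.
move=> h; apply: (le_trans (normc_sum _ _ _)); apply: ler_sum => x _.
by rewrite normcM normc_expw mulr1.
Qed.

Lemma cmeas_tval s : cmeas (fun x : T => tval s (tp x)).
Proof.
apply: cmeas_sum => x; apply: cmeasM; [exact: cmeas_cst|exact: cmeas_expw].
Qed.

Lemma cintg_tval s : cintg mu (fun x => tval s (tp x)).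
Proof.
have [K _ hK] := tval_bound s.
exact: (cintg_bounded (cube_fin _) (cmeas_tval s) (fun x => hK (tp x))).
Qed.

Lemma cint_tval s : wts s -> cint mu (fun x => tval s (tp x)) = \sum_(x <- s) x.1 * (x.2 == 0)%:R.
Proof.
elim: s => [|x s IH] hs.
  rewrite big_nil; have := cintZ 0 (cintg_tval [::]).
  by rewrite mul0r => <-; congr cint; apply/funext => y; rewrite mul0r /tval big_nil.
have hs' : wts s by move=> y ys; apply: hs; rewrite inE ys orbT.
have hx : P x.2 by apply: hs; rewrite inE eqxx.
have ie : cintg mu (fun y => expw x.2 (tp y)).
  exact: (cintg_bounded (cube_fin _) (cmeas_expw _) (fun y => ltac:(by rewrite normc_expw))).
rewrite big_cons -IH// -(cint_expw hx) -cintZ// -cintD//; last first.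
- exact: cintg_tval.
- exact: cintgZ.
by congr cint; apply/funext => y; rewrite /tval big_cons.
Qed.

Definition coef l (f : hR -> C) : C := cint mu (fun x => expw (- l) (tp x) * f (tp x)).

Lemma coef_tval l s : P l -> wts s -> coef l (tval s) = \sum_(x <- s) x.1 * (x.2 == l)%:R.
Proof.
move=> hl hs; have hl' : wts [:: (1, - l)] by move=> x; rewrite inE => /eqP ->; exact: weightN.
have := cint_tval (wts_mul hl' hs).
rewrite /tmul /= cats0 big_map /= => h.
rewrite /coef; transitivity (cint mu (fun x : T => tval (tmul [:: (1, - l)] s) (tp x))).
  by congr cint; apply/funext => x; rewrite tval_mul /tval big_seq1 mul1r.
rewrite /tmul /= cats0 h; apply: eq_bigr => x _; rewrite mul1r; congr (_ * (nat_of_bool _)%:R).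
by rewrite addrC subr_eq0.
Qed.

End trig_polynomials.

(** * The weight Delta and the weighted square norm *)

Section weighted_torus.
Implicit Types (l m a b : 'rV[R]_n) (h q : hR) (w : 'M[R]_n) (f g : hR -> C).

(** This is sin^2 of the half angle, see [sinsqE], in the form of a trigonometric polynomial with
    exponents 0, [a] and [- a]. *)
Definition sinsq a h : R := (1 - cos (pairing a h)) / 2.

Lemma sinsqE a h : sin (pairing a h / 2) ^+ 2 = sinsq a h.
Proof.
have -> : sinsq a h = (1 - cos ((pairing a h / 2) *+ 2)) / 2.
  by rewrite /sinsq; congr ((1 - cos _) / 2); rewrite mulr2n; lra.
rewrite cos_mulr2n sin2cos2; move: (cos _ ^+ 2) => c; rewrite mulr2n; lra.
Qed.

Lemma sinsq_ge0 a h : 0 <= sinsq a h.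
Proof. by rewrite -sinsqE sqr_ge0. Qed.
Lemma sinsq_le1 a h : sinsq a h <= 1.
Proof. by rewrite /sinsq; have := cos_geN1 (pairing a h); lra. Qed.
Lemma sinsqN a h : sinsq (- a) h = sinsq a h.
Proof. by rewrite /sinsq pairingNl cosN. Qed.
Lemma Delta_sq h : Delta h ^+ 2 = \prod_(a <- Phi_plus) sinsq a h `^ k a.
Proof.
rewrite /Delta -prodrXl; apply: eq_bigr => a _.
by rewrite sqrt_sqr_powR// real_normK ?num_real// sinsqE.
Qed.

Lemma Delta_ge0 h : 0 <= Delta h.
Proof. by apply: prodr_ge0 => a _; exact: powR_ge0. Qed.

Lemma Delta_sqrt h : Delta h = Num.sqrt (\prod_(a <- Phi_plus) sinsq a h `^ k a).
Proof. by rewrite -Delta_sq sqrtr_sqr ger0_norm// Delta_ge0. Qed.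

Lemma Delta_le1 h : Delta h <= 1.
Proof.
rewrite Delta_sqrt -[leRHS]sqrtr1 ler_wsqrtr// big_seq.
suff : 0 <= \prod_(a <- Phi_plus | a \in Phi_plus) sinsq a h `^ k a <= 1 by move=> /andP[].
elim/big_rec: _ => [|a x ap /andP[x0 x1]]; first by rewrite ler01 lexx.
have k0 := kpos (pos_root ap).
have h1 : sinsq a h `^ k a <= 1.
  have := ge0_ler_powR (ltW k0) (sinsq_ge0 a h) ler01 (sinsq_le1 a h).
  by rewrite powR1; apply.
by rewrite mulr_ge0 ?powR_ge0//= -[leRHS]mulr1 ler_pM ?powR_ge0.
Qed.

Lemma cmeas_cosw a : measurable_fun [set: T] (fun x => cos (pairing a (tp x))).
Proof. by case: (cmeas_expw a). Qed.

Lemma measurable_Delta : measurable_fun [set: T] (fun x => Delta (tp x)).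
Proof.
under eq_fun do rewrite Delta_sqrt.
apply: (measurableT_comp (f := @Num.sqrt R)); first exact: (continuous_measurable_fun (@sqrt_continuous R)).
elim: (enum_fset Phi_plus) => [|a r IH]; first by under eq_fun do rewrite big_nil; exact: measurable_cst.
under eq_fun do rewrite big_cons; apply: measurable_funM => //.
apply: (measurableT_comp (f := @powR R ^~ (k a))); first exact: measurable_powR.
apply: measurable_funM => //; apply: measurable_funB => //; exact: cmeas_cosw.
Qed.

Lemma Delta_gt0 h : (0 < Delta h) = (all (fun a => sinsq a h != 0) Phi_plus).
Proof.
rewrite Delta_sqrt sqrtr_gt0; apply/idP/allP => [d0 a ap|H].
  apply: contraTneq d0 => s0; rewrite (big_rem a)//= s0 powR0 ?mul0r ?ltxx//.
  by rewrite gt_eqF// kpos// pos_root.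
rewrite big_seq; apply: prodr_gt0 => a ap; apply: powR_gt0.
by rewrite lt_neqAle eq_sym H// sinsq_ge0.
Qed.

Definition wt f (x : T) : C := (Delta (tp x))%:C * f (tp x).

Lemma L2_sqnormE f : L2_sqnorm D f = sqint mu (wt f).
Proof.
apply: eq_integral => x _; congr (_%:E).
by rewrite /wt normcM normc_real exprMn real_normK ?num_real// mulrC.
Qed.

Lemma wtD f g : wt (f + g) = fun x => wt f x + wt g x.
Proof. by apply/funext => x; rewrite /wt -mulrDr. Qed.
Lemma wtB f g : wt (f - g) = fun x => wt f x - wt g x.
Proof. by apply/funext => x; rewrite /wt -mulrBr. Qed.
Lemma wtZ c f : wt (fun h => c * f h) = fun x => c * wt f x.
Proof. by apply/funext => x; rewrite /wt mulrCA. Qed.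

Definition Delta_meas := cmeas_real measurable_Delta.

Lemma cmeas_wt f : cmeas (fun x => f (tp x)) -> cmeas (wt f).
Proof. by move=> mf; apply: cmeasM => //; exact: Delta_meas. Qed.

Lemma L2W_P f : L2W D f <-> [/\ torus_fun D f, weyl_invariant D f,
   cmeas (fun x => f (tp x)) & (sqint mu (wt f) < +oo)%E].
Proof.
rewrite -L2_sqnormE; split=> [[h1 h2 h3 h4 h5]|[h1 h2 [h3 h4] h5]]; by split.
Qed.

Lemma L2W_cL2 f : L2W D f -> cL2 mu (wt f).
Proof. by move=> /L2W_P[_ _ mf f2]; split => //; exact: cmeas_wt. Qed.

Lemma L2W_D f g : L2W D f -> L2W D g -> L2W D (f + g).
Proof.
move=> Lf Lg; have [_ h] := cL2D (L2W_cL2 Lf) (L2W_cL2 Lg).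
move/L2W_P: Lf => [f1 f2 f3 _]; move/L2W_P: Lg => [g1 g2 g3 _].
apply/L2W_P; split.
- by move=> x q hq; rewrite -[LHS]/(f _ + g _) f1 ?g1.
- by move=> w x hw; rewrite -[LHS]/(f _ + g _) f2 ?g2.
- exact: cmeasD f3 g3.
- by rewrite wtD.
Qed.

Lemma L2W_Z c f : L2W D f -> L2W D (fun h => c * f h).
Proof.
move=> Lf; have [_ h] := cL2Z c (L2W_cL2 Lf); move/L2W_P: Lf => [f1 f2 f3 _].
apply/L2W_P; split.
- by move=> x q hq; rewrite f1.
- by move=> w x hw; rewrite f2.
- by apply: cmeasM => //; exact: cmeas_cst.
- by rewrite wtZ.
Qed.

Lemma sqint_Z0 c (F : T -> C) : cmeas F -> sqint mu F = 0%E -> sqint mu (fun x => c * F x) = 0%E.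
Proof.
move=> mF F0; apply/eqP; rewrite eq_le sqint_ge0 andbT.
have := le_sqint mu (K := normc c) (cmeasM (cmeas_cst _ c) mF) mF (normc_ge0 _)
  (fun x => ltac:(by rewrite normcM)).
by rewrite F0 mule0.
Qed.

Lemma sqint_D0 (F H : T -> C) : cmeas F -> cmeas H -> sqint mu F = 0%E -> sqint mu H = 0%E ->
  sqint mu (fun x => F x + H x) = 0%E.
Proof.
move=> mF mH F0 H0; apply/eqP; rewrite eq_le sqint_ge0 andbT.
by have := sqintD mu mF mH; rewrite F0 H0 adde0 mule0.
Qed.

Local Notation fct := (hR -> C^o : lmodType C).

Lemma L2W_B f g : L2W D f -> L2W D g -> L2W D (f - g).
Proof.
move=> Lf /(L2W_Z (-1)) /(L2W_D Lf); congr L2W.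
by apply/funext => h; rewrite -[LHS]/(f h + -1 * g h) mulN1r.
Qed.

Lemma L2_sqnorm_tri f g v : L2W D f -> L2W D g -> L2W D v ->
  (L2_sqnorm D (f - v)%R <= 2%:E * (L2_sqnorm D (f - g)%R + L2_sqnorm D (g - v)%R))%E.
Proof.
move=> Lf Lg Lv; have [m1 _] := L2W_cL2 (L2W_B Lf Lg); have [m2 _] := L2W_cL2 (L2W_B Lg Lv).
rewrite !L2_sqnormE; apply: le_trans (sqintD mu m1 m2); rewrite le_eqVlt; apply/orP; left; apply/eqP.
by congr sqint; apply/funext => x; rewrite !wtB addrA subrK.
Qed.

Lemma L2_sqnormBC f g : L2_sqnorm D (f - g) = L2_sqnorm D (g - f).
Proof. by rewrite !L2_sqnormE; apply: sqint_eq => x; rewrite !wtB -[RHS]normcN opprB. Qed.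

(** Pointwise |F| |N| <= d |F|^2 + d^-1 |N|^2 for every d > 0. The second term integrates to 0 and
    the first is made small through d. *)
Lemma ipc_null F N : cL2 mu F -> cL2 mu N -> sqint mu N = 0%E -> ipc mu F N = 0.
Proof.
move=> hF hN N0; have iFN := cL2M hF hN; apply: small_eq0 => e e0.
have [mF F2] := hF; have [mN _] := hN.
pose c := fine (sqint mu F); have cE : sqint mu F = c%:E.
  by rewrite fineK// ge0_fin_numE// sqint_ge0.
have c0 : 0 <= c by rewrite -lee_fin -cE sqint_ge0.
pose d := e / 2 / (c + 1); have d0 : 0 < d by rewrite !divr_gt0// ltr_wpDl.
rewrite (_ : e = 2 * (e / 2)); last by lra.
apply: cint_le => //.
apply: (@le_trans _ _ (\int[mu]_x (d * normc (F x) ^+ 2 + d^-1 * normc (N x) ^+ 2)%:E)%E).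
  apply: ge0_le_int.
  - by apply: cmeas_normc; apply: cmeasM => //; exact: cmeas_conj.
  - by apply: measurable_funD; apply: measurable_funM => //; exact: cmeas_sq.
  - by move=> x; exact: normc_ge0.
  move=> x; rewrite normcM normcJ_real; move: (normc _) (normc _) => s t.
  have -> : d * t ^+ 2 + d^-1 * s ^+ 2 = t * s + d^-1 * ((d * t - s / 2) ^+ 2 + 3 / 4 * s ^+ 2).
    by field; rewrite gt_eqF.
  rewrite lerDl; apply: mulr_ge0; first by rewrite invr_ge0 ltW.
  by apply: addr_ge0; [exact: sqr_ge0|rewrite mulr_ge0// sqr_ge0].
rewrite ge0_intD; last 4 first.
- by apply: measurable_funM => //; exact: cmeas_sq.
- by apply: measurable_funM => //; exact: cmeas_sq.
- by move=> x; rewrite mulr_ge0 ?sqr_ge0// ltW.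
- by move=> x; rewrite mulr_ge0 ?sqr_ge0// invr_ge0 ltW.
rewrite !ge0_intZ; last 6 first.
- by rewrite invr_ge0 ltW.
- exact: cmeas_sq.
- by move=> x; exact: sqr_ge0.
- exact: ltW.
- exact: cmeas_sq.
- by move=> x; exact: sqr_ge0.
rewrite -![(\int[mu]_x _)%E]/(sqint mu _) N0 mule0 adde0 cE -EFinM lee_fin /d.
rewrite mulrAC ler_pdivrMr ?ltr_wpDl// ler_wpM2l//; lra.
Qed.

End weighted_torus.

(** * Invariant polynomials and the Hilbert space they generate *)

Section weyl_invariant_polynomials.
Implicit Types (l m a b : 'rV[R]_n) (h q : hR) (w : 'M[R]_n) (f g : hR -> C)
  (s t : seq (C * 'rV[R]_n)).

Definition scoef l s : C := \sum_(x <- s | x.2 == l) x.1.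

Lemma sum_scoef s (F : 'rV[R]_n -> C) :
  \sum_(x <- s) x.1 * F x.2 = \sum_(l <- undup [seq x.2 | x <- s]) scoef l s * F l.
Proof.
under [RHS]eq_bigr => l _ do rewrite /scoef big_mkcond mulr_suml.
rewrite exchange_big /= big_seq [RHS]big_seq; apply: eq_bigr => x xs.
have xl : x.2 \in undup [seq x.2 | x <- s] by rewrite mem_undup; apply/mapP; exists x.
rewrite (bigD1_seq x.2)//= ?undup_uniq// eqxx big1 ?addr0// => l lx.
by rewrite eq_sym (negbTE lx) mul0r.
Qed.

Lemma coef_scoef l s : P l -> wts s -> coef l (tval s) = scoef l s.
Proof.
move=> hl hs; rewrite coef_tval// /scoef [RHS]big_mkcond; apply: eq_bigr => x _.
by case: eqP; rewrite ?mulr1 ?mulr0.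
Qed.

(** Linear independence of the exponentials, in the form in which it is used: an expression that is
    linear in the terms of the list depends on the function [tval s] only. *)
Lemma tval_linear s (F : 'rV[R]_n -> C) : wts s ->
  (forall l, P l -> coef l (tval s) = 0) -> \sum_(x <- s) x.1 * F x.2 = 0.
Proof.
move=> hs h; rewrite sum_scoef big_seq big1// => l.
rewrite mem_undup => /mapP[x xs ->]; rewrite -coef_scoef ?h ?mul0r//; exact: hs.
Qed.

Lemma expwMn a j h : expw (a *+ j) h = expw a h ^+ j.
Proof.
elim: j => [|j IH]; first by rewrite mulr0n expw0 expr0.
by rewrite mulrS expwD IH exprS.
Qed.

(* Bessel's inequality: on the wall the sum of [N] characters [expw (a *+ j)] equals [N]. *)
Lemma wall_null a : a \in Phi -> {ae mu, forall x, sinsq a (tp x) != 0}.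
Proof.
move=> aP; pose Z := [set x : T | sinsq a (tp x) = 0].
have mZ : measurable Z.
  have -> : Z = [set: T] `&` (fun x => sinsq a (tp x)) @^-1` [set 0].
    by apply/seteqP; split=> x /=; [|case].
  have ms : measurable_fun [set: T] (fun x => sinsq a (tp x)).
    by apply: measurable_funM => //; apply: measurable_funB => //; exact: cmeas_cosw.
  exact: ms.
suff Z0 : mu Z = 0%E.
  by exists Z; split => // x /= /negP; rewrite negbK => /eqP.
pose s N := [seq ((N.+1%:R^-1)%:C, a *+ j) | j <- iota 0 N.+1] : seq (C * 'rV[R]_n).
have hs N : wts (s N) by move=> _ /mapP[j _ ->]; apply: weightMn; exact: root_weight.
have sE N h : tval (s N) h = (N.+1%:R^-1)%:C * \sum_(j < N.+1) expw a h ^+ j.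
  rewrite /tval big_map (_ : iota 0 N.+1 = index_iota 0 N.+1) // big_mkord mulr_sumr.
  by apply: eq_bigr => j _; rewrite expwMn.
have nz N : 0 < N.+1%:R^-1 :> R by rewrite invr_gt0.
have a0 := root_neq0 aP.
have cs N : cint mu (fun x => tval (s N) (tp x)) = (N.+1%:R^-1)%:C.
  rewrite cint_tval// big_map /= big_cons eqxx mulr1 big_seq big1 ?addr0// => j.
  rewrite mem_iota => /andP[j0 _]; rewrite (_ : (a *+ j == 0) = false) ?mulr0//.
  by rewrite -[a *+ j]scaler_nat scaler_eq0 (negbTE a0) orbF pnatr_eq0 eqn0Ngt j0.
have sb N h : normc (tval (s N) h) <= 1.
  rewrite sE normcM normc_real gtr0_norm// mulrC ler_pdivrMr// mul1r.
  apply: (le_trans (normc_sum _ _ _)); apply: (@le_trans _ _ (\sum_(j < N.+1) 1)).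
    by apply: ler_sum => j _; rewrite -expwMn normc_expw.
  by rewrite sumr_const card_ord.
(* The averages converge to the indicator of the wall: on it each is 1, and off it the geometric sum
   is at most 2 / |z - 1| for all lengths. *)
have lim x (e : R) : 0 < e -> exists N, forall i, (N <= i)%N ->
    normc (tval (s i) (tp x) - (\1_Z x)%:C) <= e.
  move=> e0; set z := expw a (tp x); have [z1|z1] := eqVneq z 1.
    exists 0%N => i _; rewrite sE -/z z1 indicE mem_set; last first.
      have := congr1 (@Re R) z1; rewrite /z expwE /= => c1.
      by rewrite /Z /= /sinsq c1 subrr mul0r.
    under eq_bigr do rewrite expr1n.
    rewrite sumr_const card_ord -[1 *+ _]/(i.+1%:R) -(rmorph_nat (@real_complex R)) -rmorphM.
    by rewrite mulVf ?pnatr_eq0// rmorph1 subrr normc0 ltW.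
  have d0 : 0 < normc (z - 1).
    rewrite lt_neqAle eq_sym normc_ge0 andbT; apply: contra z1 => /eqP/eq0_normc/eqP.
    by rewrite subr_eq0.
  have ed : 0 < e * normc (z - 1) / 2 by rewrite divr_gt0// mulr_gt0.
  exists (Num.truncn (e * normc (z - 1) / 2)^-1).+1 => i hi.
  rewrite indicE memNset /= ?subr0; last first.
    rewrite /Z /= /sinsq => /eqP; rewrite mulf_eq0 invr_eq0 (negbTE (_ : 2 != 0 :> R)) ?orbF// subr_eq0.
    move=> /eqP c1; have s0 : sin (pairing a (tp x)) = 0.
      by apply/eqP; rewrite -sqrf_eq0 sin2cos2 -c1 expr1n subrr.
    by move/eqP: z1; apply; rewrite /z expwE /cis -c1 s0.
  rewrite sE -/z normcM normc_real gtr0_norm//.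
  rewrite -(ler_pM2r d0) -mulrA -normcM mulrC [_ * (z - 1)]mulrC -subrX1.
  apply: (@le_trans _ _ (2 * i.+1%:R^-1)).
    apply: ler_wpM2r; first exact: ltW.
    apply: (le_trans (le_normcD _ _)); rewrite normcN -expwMn normc_expw.
    by rewrite (_ : normc 1 = 1) ?normc1//; lra.
  rewrite mulrC -ler_pdivlMr// -[leRHS]invrK lef_pV2 ?posrE ?invr_gt0//.
  apply/ltW; apply: (lt_trans (truncnS_gt _)); rewrite ltr_nat.
  by rewrite ltnS; apply: leq_trans hi _.
have c0 : cint mu (fun x => (\1_Z x)%:C) = 0.
  apply: small_eq0 => e e0; have e2 : 0 < e / 2 by lra.
  have [N hN] := cint_dct (cube_fin n) (fun N => cmeas_tval (s N)) (fun N x => sb N (tp x)) lim e2.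
  pose M := (N + (Num.truncn (e / 2)^-1).+1)%N.
  have h1 := hN M (leq_addr _ _); rewrite cs in h1.
  have -> : cint mu (fun x : T => (\1_Z x)%:C) = (M.+1%:R^-1)%:C - ((M.+1%:R^-1)%:C - cint mu (fun x : T => (\1_Z x)%:C)).
    by rewrite opprB addrC subrK.
  apply: (le_trans (le_normcD _ _)); rewrite normcN.
  rewrite (_ : e = e / 2 + e / 2); last by lra.
  apply: lerD => //; rewrite normc_real gtr0_norm// -[leRHS]invrK lef_pV2 ?posrE ?invr_gt0//.
  apply/ltW; apply: (lt_trans (truncnS_gt _)); rewrite ltr_nat ltnS /M; exact: leq_addl.
have := congr1 (@Re R) c0; rewrite /cint /= /Rintegral integral_indic// setIT => f0.
have h (rho : probability T R) : rho Z = (fine (rho Z))%:E by rewrite fineK// fin_num_measure.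
by rewrite (h mu); congr (_%:E).
Qed.

Lemma Delta_ae : {ae mu, forall x, 0 < Delta (tp x)}.
Proof.
have H : {ae mu, forall x, all (fun a => sinsq a (tp x) != 0) Phi_plus}.
  have Hr (r : seq 'rV[R]_n) : {subset r <= Phi} -> {ae mu, forall x, all (fun a => sinsq a (tp x) != 0) r}.
    elim: r => [|a r IH] sP; first exact: aeW.
    have h1 := wall_null (sP a (mem_head _ _)).
    have h2 : {ae mu, forall x, all (fun a => sinsq a (tp x) != 0) r}.
      by apply: IH => b br; apply: sP; rewrite inE br orbT.
    by apply: filterS2 h1 h2 => x h1 h2 /=; rewrite h1.
  by apply: Hr => a /pos_root.
by apply: filterS H => x; rewrite Delta_gt0.
Qed.

Lemma null_tval s l : P l -> wts s -> sqint mu (wt (tval s)) = 0%E -> coef l (tval s) = 0.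
Proof.
move=> hl hs s0; have mt := cmeas_tval s.
have t0 : sqint mu (fun x => tval s (tp x)) = 0%E.
  have ae0 : ae_eq mu setT (fun x => (normc (wt (tval s) x) ^+ 2)%:E) (cst 0%E).
    apply/ae_eq_integral_abs => //; first by apply: cmeas_sqE; exact: cmeas_wt.
    by rewrite -[RHS]s0; apply: eq_integral => x _; rewrite gee0_abs// lee_fin sqr_ge0.
  rewrite -(integral0 mu setT); apply: ge0_ae_eq_integral => //.
  - exact: cmeas_sqE.
  - by move=> x _; rewrite lee_fin sqr_ge0.
  apply: filterS2 Delta_ae ae0 => x d0 /(_ Logic.I) [] /eqP.
  rewrite sqrf_eq0 normcM mulf_eq0 normc_real normr_eq0 (gt_eqF d0) /= => /eqP -> _.
  by rewrite expr0n.
have [K K0 hK] := tval_bound s.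
have c1 : cL2 mu (fun x => expw l (tp x)).
  split; first exact: cmeas_expw.
  apply: (@le_lt_trans _ _ (\int[mu]_x 1%:E)%E).
    apply: ge0_le_int => // [|x|x]; [apply: cmeas_sq; exact: cmeas_expw|exact: sqr_ge0|].
    by rewrite normc_expw expr1n.
  by rewrite integral_cst// mul1e cube_fin.
have c2 : cL2 mu (fun x => tval s (tp x)) by split => //; rewrite t0.
have := ipc_null c1 c2 t0; rewrite /ipc /coef => <-; congr cint; apply/funext => x.
by rewrite expwN.
Qed.

Lemma CPW_tval f : CPW D f <-> weyl_invariant D f /\ exists s, wts s /\ f = tval s.
Proof.
split=> [[fw [s [c [hs fE]]]]|[fw [s [hs fE]]]].
  split => //; exists [seq (c l, l) | l <- s]; split; first by move=> _ /mapP[l ls ->]; exact: hs.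
  by rewrite fE; apply/funext => h; rewrite /tval big_map.
split; first exact: fw.
exists (undup [seq x.2 | x <- s]), (scoef^~ s); split.
  by move=> l; rewrite mem_undup => /mapP[x /hs hx ->].
by rewrite fE; apply/funext => h; rewrite /tval (sum_scoef s (fun l => expw l h)).
Qed.

Lemma tval_L2 s : cL2 mu (wt (tval s)).
Proof.
have mt := cmeas_wt (cmeas_tval s); split => //; have [K K0 hK] := tval_bound s.
apply: (@le_lt_trans _ _ (\int[mu]_x (K ^+ 2)%:E)%E).
  apply: ge0_le_int => // [|x|x]; [exact: cmeas_sq|exact: sqr_ge0|].
  apply: ler_exp; first exact: normc_ge0.
  rewrite /wt normcM normc_real ger0_norm ?Delta_ge0// -[leRHS]mul1r.
  by apply: ler_pM; rewrite ?Delta_ge0 ?normc_ge0 ?Delta_le1.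
by rewrite integral_cst//; apply: lte_mul_pinfty; rewrite ?lee_fin ?exprn_ge0// cube_fin.
Qed.

Lemma CPW_L2W f : CPW D f -> L2W D f.
Proof.
move=> /CPW_tval[fw [s [hs fE]]]; apply/L2W_P; split => //.
- by rewrite fE; exact: tval_torus.
- by rewrite fE; exact: cmeas_tval.
- by rewrite fE; case: (tval_L2 s).
Qed.

Lemma CPW_add f g : CPW D f -> CPW D g -> CPW D (f + g).
Proof.
move=> /CPW_tval[fw [s [hs fE]]] /CPW_tval[gw [t [ht gE]]]; apply/CPW_tval; split.
  by move=> w h hw; rewrite -[LHS]/(f _ + g _) fw// gw.
exists (s ++ t); split; first exact: wts_cat.
by rewrite fE gE; apply/funext => h; rewrite tval_cat.
Qed.

Lemma CPW_scale c f : CPW D f -> CPW D (fun h => c * f h).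
Proof.
move=> /CPW_tval[fw [s [hs fE]]]; apply/CPW_tval; split.
  by move=> w h hw; rewrite fw.
exists (tscale c s); split; first exact: wts_scale.
by rewrite fE; apply/funext => h; rewrite tval_scale.
Qed.

Lemma CPW0 : CPW D 0.
Proof.
by apply/CPW_tval; split => //; exists [::]; split => //; apply/funext => h; rewrite /tval big_nil.
Qed.

Local Notation fct := (hR -> C^o : lmodType C).

(* Only the closure of [CPW] in L^2 is needed: it contains the graphs of all the [T_closure D p]. *)
Definition L2P : set fct := [set f | L2W D f /\
  forall e : R, 0 < e -> exists2 u, CPW D u & (L2_sqnorm D (f - u)%R <= e%:E)%E].

Lemma L2P_lim f : L2W D f ->
  (forall e : R, 0 < e -> exists2 g, L2P g & (L2_sqnorm D (f - g)%R <= e%:E)%E) -> L2P f.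
Proof.
move=> Lf H; split=> // e e0; have e4 : 0 < e / 4 by lra.
have [g [Lg Pg] fg] := H _ e4; have [u Cu gu] := Pg _ e4.
exists u => //; apply: (le_trans (L2_sqnorm_tri Lf Lg (CPW_L2W Cu))).
apply: (@le_trans _ _ (2%:E * ((e / 4)%:E + (e / 4)%:E))%E); first by apply: lee_wpmul2l => //; exact: leeD.
by rewrite -EFinD -EFinM lee_fin; lra.
Qed.

Lemma L2P_L2W f : L2P f -> L2W D f. Proof. by case. Qed.

Lemma L2P_cL2 f : L2P f -> cL2 mu (wt f). Proof. by move=> /L2P_L2W/L2W_cL2. Qed.

Lemma CPW_L2P f : CPW D f -> L2P f.
Proof.
move=> Cf; split=> [|e e0]; first exact: CPW_L2W.
by exists f => //; rewrite L2_sqnormE sqint0 ?lee_fin ?ltW// => x; rewrite wtB subrr.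
Qed.

Lemma L2P_0 : L2P 0. Proof. exact/CPW_L2P/CPW0. Qed.

Lemma L2P_D f g : L2P f -> L2P g -> L2P (f + g).
Proof.
move=> [Lf Pf] [Lg Pg]; split=> [|e e0]; first exact: L2W_D.
have e4 : 0 < e / 4 by lra.
have [u Cu fu] := Pf _ e4; have [v Cv gv] := Pg _ e4; exists (u + v); first exact: CPW_add.
have [m1 _] := L2W_cL2 (L2W_B Lf (CPW_L2W Cu)); have [m2 _] := L2W_cL2 (L2W_B Lg (CPW_L2W Cv)).
rewrite opprD addrACA L2_sqnormE wtD; apply: (le_trans (sqintD mu m1 m2)); rewrite -!L2_sqnormE.
apply: (@le_trans _ _ (2%:E * ((e / 4)%:E + (e / 4)%:E))%E); first by apply: lee_wpmul2l => //; exact: leeD.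
by rewrite -EFinD -EFinM lee_fin; lra.
Qed.

Lemma L2P_Z c f : L2P f -> L2P (fun h => c * f h).
Proof.
move=> [Lf Pf]; split=> [|e e0]; first exact: L2W_Z.
pose K := normc c ^+ 2 + 1; have K0 : 0 < K by rewrite ltr_wpDl// sqr_ge0.
have [u Cu fu] := Pf (e / K) ltac:(by rewrite divr_gt0).
exists (fun h => c * u h); first exact: CPW_scale.
have [m1 _] := L2W_cL2 (L2W_B Lf (CPW_L2W Cu)).
have -> : L2_sqnorm D ((fun h => c * f h) - (fun h => c * u h)) = sqint mu (fun x => c * wt (f - u) x).
  by rewrite L2_sqnormE; congr sqint; apply/funext => x; rewrite !wtB !wtZ mulrBr.
apply: (le_trans (le_sqint mu (K := normc c) (cmeasM (cmeas_cst _ c) m1) m1 (normc_ge0 _) _)).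
  by move=> x; rewrite normcM.
apply: (@le_trans _ _ (K%:E * (e / K)%:E)%E); last by rewrite -EFinM lee_fin mulrC divfK// gt_eqF.
by rewrite -L2_sqnormE; apply: lee_pmul; rewrite ?lee_fin ?sqr_ge0 ?lerDl// L2_sqnormE sqint_ge0.
Qed.

Definition null_set : set fct := [set f | L2P f /\ L2_sqnorm D f = 0%E].

Lemma null_set0 : null_set 0.
Proof.
split; first exact: L2P_0.
by rewrite L2_sqnormE; apply: sqint0 => x; rewrite /wt mulr0.
Qed.

Lemma null_setD f g : null_set f -> null_set g -> null_set (f + g).
Proof.
move=> [Lf f0] [Lg g0]; split; first exact: L2P_D.
rewrite L2_sqnormE in f0; rewrite L2_sqnormE in g0; rewrite L2_sqnormE wtD.
by apply: sqint_D0 => //; [case: (L2P_cL2 Lf)|case: (L2P_cL2 Lg)].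
Qed.

Lemma null_setZ c f : null_set f -> null_set (fun h => c * f h).
Proof.
move=> [Lf f0]; split; first exact: L2P_Z.
rewrite L2_sqnormE in f0; rewrite L2_sqnormE wtZ.
by apply: sqint_Z0 => //; case: (L2P_cL2 Lf).
Qed.

Definition torus_spec : @subquot_spec C fct :=
  @SubquotSpec C fct L2P null_set L2P_0 L2P_D L2P_Z null_set0 null_setD null_setZ.

Definition HV : lmodType C := subquot torus_spec.
Definition cls f : HV := @sq_class C fct torus_spec f.
Definition rep (v : HV) : hR -> C := sq_rep v.

Lemma repP v : L2P (rep v). Proof. exact: (sq_repP v). Qed.
Lemma repK v : cls (rep v) = v. Proof. exact: sq_repK. Qed.
Lemma cls_ind (Pr : HV -> Prop) : (forall f, L2P f -> Pr (cls f)) -> forall v, Pr v.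
Proof. exact: (@sq_ind _ _ torus_spec Pr). Qed.
Lemma clsD f g : L2P f -> L2P g -> cls (f + g) = cls f + cls g.
Proof. exact: (@sq_classD _ _ torus_spec). Qed.
Lemma clsB f g : L2P f -> L2P g -> cls (f - g) = cls f - cls g.
Proof. exact: (@sq_classB _ _ torus_spec). Qed.
Lemma clsZ c f : L2P f -> cls (fun h => c * f h) = c *: cls f.
Proof. exact: (@sq_classZ _ _ torus_spec). Qed.
Lemma cls_sum (I : Type) (r : seq I) (f : I -> hR -> C) : (forall i, L2P (f i)) ->
  cls (fun h => \sum_(i <- r) f i h) = \sum_(i <- r) cls (f i).
Proof.
move=> Lf; rewrite -(@sq_class_sum _ _ torus_spec _ r f Lf); congr sq_class.
by apply/funext => h; rewrite fct_sumE.
Qed.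
Lemma L2P_sum (I : Type) (r : seq I) (f : I -> hR -> C) : (forall i, L2P (f i)) ->
  L2P (fun h => \sum_(i <- r) f i h).
Proof.
move=> Lf; have := @sq_sub_sum _ _ torus_spec _ r f Lf; congr L2P.
by apply/funext => h; rewrite fct_sumE.
Qed.
Lemma L2P_B f g : L2P f -> L2P g -> L2P (f - g).
Proof. exact: (@sq_subB _ _ torus_spec). Qed.
Lemma cls_eq f g : L2P f -> L2P g -> L2_sqnorm D (f - g) = 0%E -> cls f = cls g.
Proof.
move=> Lf Lg fg; apply: (@sq_class_eq _ _ torus_spec) => //; split => //.
exact: L2P_B.
Qed.
Lemma cls_inj f g : L2P f -> L2P g -> cls f = cls g -> L2_sqnorm D (f - g) = 0%E.
Proof. by move=> Lf Lg /(@sq_class_inj _ _ torus_spec) -/(_ Lf Lg) []. Qed.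

Definition hip (v u : HV) : C := ipc mu (wt (rep v)) (wt (rep u)).

Lemma hipE f g : L2P f -> L2P g -> hip (cls f) (cls g) = ipc mu (wt f) (wt g).
Proof.
move=> Lf Lg; rewrite /hip.
have key f' g' : L2P f' -> L2P g' -> ipc mu (wt f') (wt (rep (cls g'))) = ipc mu (wt f') (wt g').
  move=> Lf' Lg'; have Lr := repP (cls g').
  have [_] := @sq_classK _ _ torus_spec _ Lg'; rewrite -/(cls g') -/(rep _) L2_sqnormE => n0.
  have hN := L2P_cL2 (L2P_B Lr Lg').
  have -> : rep (cls g') = g' + (rep (cls g') - g') by rewrite addrC subrK.
  rewrite wtD ipcDr//; try exact: L2P_cL2.
  by rewrite (ipc_null (L2P_cL2 Lf') hN n0) addr0.
rewrite key//; last exact: repP.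
have Lr := L2P_cL2 (repP (cls f)); have Lf' := L2P_cL2 Lf; have Lg' := L2P_cL2 Lg.
by rewrite (ipcJ Lg' Lr) key// -(ipcJ Lg' Lf').
Qed.

Lemma hip_ip : is_ip hip.
Proof.
split.
- elim/cls_ind=> f Lf; elim/cls_ind=> g Lg; elim/cls_ind=> h Lh.
  rewrite -clsD// !hipE//; last exact: L2P_D.
  by rewrite wtD ipcDr//; exact: L2P_cL2.
- elim/cls_ind=> f Lf c; elim/cls_ind=> g Lg.
  rewrite -clsZ// !hipE//; last exact: L2P_Z.
  by rewrite wtZ ipcZr//; exact: L2P_cL2.
- elim/cls_ind=> f Lf; elim/cls_ind=> g Lg; rewrite !hipE// ipcJ//; exact: L2P_cL2.
- elim/cls_ind=> f Lf; rewrite hipE// -lee_fin -ipc_sq; last exact: L2P_cL2.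
  exact: sqint_ge0.
- elim/cls_ind=> f Lf; rewrite hipE// => h.
  apply: cls_eq => //; first exact: L2P_0.
  by rewrite subr0 L2_sqnormE ipc_sq ?h//; exact: L2P_cL2.
Qed.

Lemma L2_sqnorm_ipn f : L2P f -> L2_sqnorm D f = (ipn hip (cls f) ^+ 2)%:E.
Proof.
move=> Lf; rewrite (ipn_sqr hip_ip) hipE// L2_sqnormE ipc_sq//; exact: L2P_cL2.
Qed.

Lemma HV_complete : vcomplete (ipn hip).
Proof.
move=> u Hu; pose U j := rep (u j).
have LU j : L2P (U j) by exact: repP.
have sqU i j : sqint mu (fun x => (Delta (tp x))%:C * (U i (tp x) - U j (tp x))) = (ipn hip (u i - u j) ^+ 2)%:E.
  have := clsB (LU i) (LU j); rewrite /U !repK => <-.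
  by rewrite -L2_sqnorm_ipn; [rewrite L2_sqnormE wtB; by congr sqint; apply/funext => x; rewrite /wt mulrBr|exact: (L2P_B (repP _) (repP _))].
have mU j : cmeas (fun x : T => U j (tp x)) by have /L2P_L2W/L2W_P[] := LU j.
have [s [mf hf]] : exists s : nat -> nat, let f := fun x => clim (fun k => U (s k) (tp x)) in
    cmeas f /\ forall e : R, 0 < e -> exists N, forall i, (N <= i)%N ->
      (sqint mu (fun x : T => ((Delta (tp x))%:C * (U i (tp x) - f x))%R) <= e%:E)%E.
  apply: (riesz_fischer (cube_fin n) measurable_Delta _ mU); first by move=> x; exact: Delta_ge0.
  (* With a distance at most min(e, 1), its square is at most e. *)
  move=> e e0; have [N hN] := Hu (Num.min e 1) ltac:(by rewrite lt_min e0 ltr01).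
  exists N => i j Ni Nj; rewrite sqU lee_fin; have h := hN i j Ni Nj.
  have h0 := ipn_ge0 hip (u i - u j); rewrite le_min in h; have /andP[h1 h2] := h.
  by rewrite expr2 -[leRHS]mulr1; apply: ler_pM.
pose f h := clim (fun k => U (s k) h).
have sqf i : sqint mu (wt (U i - f)) = sqint mu (fun x : T => ((Delta (tp x))%:C * (U i (tp x) - clim (fun k => U (s k) (tp x))))%R) by [].
have Lf : L2W D f.
  apply/L2W_P; split => //.
  - move=> h q hq; congr clim; apply/funext => j; have /L2P_L2W/L2W_P[h1 _ _ _] := LU (s j); exact: h1.
  - move=> w h hw; congr clim; apply/funext => j; have /L2P_L2W/L2W_P[_ h1 _ _] := LU (s j); exact: h1.
  have [N hN] := hf 1 ltr01; have h1 := hN N (leqnn N).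
  have mUf : cmeas (wt (U N - f)) by apply: cmeas_wt; exact: (cmeasB (mU N) mf).
  have hUf : cL2 mu (wt (U N - f)) by split => //; rewrite sqf; apply: le_lt_trans h1 (ltry _).
  have [_] := cL2D (L2P_cL2 (LU N)) (cL2Z (-1) hUf); congr (sqint _ _ < _)%E; apply/funext => x.
  by rewrite wtB mulN1r opprB addrC subrK.
have {}Lf : L2P f.
  apply: L2P_lim => // e e0; have [N hN] := hf e e0; exists (U N) => //.
  by rewrite L2_sqnormBC L2_sqnormE sqf; exact: hN.
exists (cls f) => e e0; have [N hN] := hf (e ^+ 2) ltac:(by rewrite exprn_gt0).
exists N => i /hN; rewrite -sqf -L2_sqnormE L2_sqnorm_ipn; last exact: L2P_B.
rewrite clsB// repK lee_fin => h.
by rewrite -(ler_pXn2r (n := 2))// nnegrE ?ipn_ge0// ltW.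
Qed.

(** Delta is positive almost everywhere, so the weighted norm is definite on polynomials. A class
    contains at most one of them, which allows operators to be defined on classes through
    polynomials. *)
Lemma CPW_cls_inj f g : CPW D f -> CPW D g -> cls f = cls g -> f = g.
Proof.
move=> Cf Cg /cls_inj -/(_ (CPW_L2P Cf) (CPW_L2P Cg)); rewrite L2_sqnormE => h0.
move/CPW_tval: Cf => [_ [s [hs fE]]]; move/CPW_tval: Cg => [_ [t [ht gE]]].
have hst : wts (s ++ tscale (-1) t) by apply: wts_cat => //; exact: wts_scale.
have E : f - g = tval (s ++ tscale (-1) t).
  by apply/funext => h; rewrite tval_cat tval_scale mulN1r fE gE.
rewrite E in h0; apply/funext => h; apply/eqP; rewrite -subr_eq0; apply/eqP.
rewrite -[LHS]/((f - g) h) E /tval; apply: (@tval_linear _ (fun l => expw l h)) => // l hl.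
exact: null_tval.
Qed.

Section average.
Variable Ws : seq 'M[R]_n.
Hypotheses (Wsu : uniq Ws) (WsP : forall w, Wg w <-> w \in Ws).

Let N := size Ws.
Let N0 : (N%:R : C) != 0.
Proof.
rewrite pnatr_eq0 /N -lt0n; have : 1%:M \in Ws by apply/WsP; exact: weyl1.
by case: (Ws).
Qed.

Definition wavg f h : C := N%:R^-1 * \sum_(w <- Ws) f (w *m h).

Lemma wavg_invariant f : weyl_invariant D (wavg f).
Proof.
move=> w h hw; rewrite /wavg; congr (_ * _).
have [w' hw' [E1 E2]] := weyl_inv hw.
under eq_bigr do rewrite mulmxA.
rewrite -(big_map (fun v => v *m w) xpredT (fun v => f (v *m h))).
apply: perm_big; apply: uniq_perm => //.
  by rewrite map_inj_uniq// => a b /(congr1 (mulmx^~ w')); rewrite -!mulmxA E1 !mulmx1.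
move=> v; apply/mapP/idP => [[u /WsP hu ->]|/WsP hv]; first by apply/WsP; exact: weylM.
by exists (v *m w'); [apply/WsP; exact: weylM|rewrite -mulmxA E2 mulmx1].
Qed.

Lemma wavg_id f : weyl_invariant D f -> wavg f = f.
Proof.
move=> fw; apply/funext => h; rewrite /wavg.
rewrite (eq_big_seq (fun=> f h)); last by move=> w /WsP hw; rewrite fw.
by rewrite big_const_seq count_predT iter_addr_0 -/N -[X in _ * X = _]mulr_natl mulrA mulVf ?mul1r.
Qed.

End average.

End weyl_invariant_polynomials.

Local Notation ip := hip.
Local Notation nr := (ipn ip).

(** * The operator H_0 on trigonometric polynomials *)

Section gauge_transform.
Local Notation e_ := (fun i : 'I_n => delta_mx i 0 : hR).
Implicit Types (l m a b : 'rV[R]_n) (h q y v : hR) (s t : seq (C * 'rV[R]_n)).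

(** The cotangent of the half angle [pairing a h / 2], see [ct_half]. *)
Definition ct a h : R := sin (pairing a h) / (1 - cos (pairing a h)).

Definition offwall h := all (fun a => sinsq a h != 0) Phi_plus.

Lemma offwall_cos h a : offwall h -> a \in Phi_plus -> 1 - cos (pairing a h) != 0.
Proof. by move=> /allP H /H; rewrite /sinsq mulf_eq0 negb_or => /andP[]. Qed.

Lemma is_derive_pairing a y v : is_derive y v (fun z => pairing a z) (pairing a v).
Proof.
apply/is_derive_line; under eq_fun do rewrite pairingDr pairingZr.
have h : is_derive (0 : R) (1 : R) (fun t : R => pairing a v * t + pairing a y) (pairing a v * 1 + 0).
  exact: (is_derive_add (is_derive_scal _ (is_derive_id _ _)) (is_derive_const _ _ _)).
apply: (is_derive_eq _ (_ : pairing a v * 1 + 0 = _)); last by rewrite mulr1 addr0.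
by under eq_fun do rewrite mulrC; exact: h.
Qed.

Lemma is_derive_cosp a y v :
  is_derive y v (fun z => cos (pairing a z)) (- sin (pairing a y) * pairing a v).
Proof. exact: (is_derive_chain (is_derive_cos _) (is_derive_pairing a y v)). Qed.

Lemma is_derive_sinp a y v :
  is_derive y v (fun z => sin (pairing a z)) (cos (pairing a y) * pairing a v).
Proof. exact: (is_derive_chain (is_derive_sin _) (is_derive_pairing a y v)). Qed.

Definition dtr v s := [seq (x.1 * (0 +i* pairing x.2 v), x.2) | x <- s].

Lemma is_derive_tval s y v :
  is_derive y v (fun z => Re (tval s z)) (Re (tval (dtr v s) y)).
Proof.
have ReE (r : seq (C * 'rV[R]_n)) z :
    Re (tval r z) = \sum_(x <- r) (Re x.1 * cos (pairing x.2 z) - Im x.1 * sin (pairing x.2 z)).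
  rewrite /tval raddf_sum; apply: eq_bigr => -[[p q] l] _ /=.
  by rewrite /expw /=.
under eq_fun do rewrite ReE.
rewrite ReE big_map; apply: is_derive_bigsum => -[[p q] l] _ /=.
have := is_derive_add (is_derive_scal p (is_derive_cosp l y v)) (is_derive_scal (- q) (is_derive_sinp l y v)).
move=> H; rewrite (_ : _ - _ = p * (- sin (pairing l y) * pairing l v) +
    - q * (cos (pairing l y) * pairing l v)); last by ring.
by under eq_fun do rewrite -mulNr; exact: H.
Qed.

Lemma pairing_continuous a : continuous (fun y : hR => pairing a y).
Proof.
have H (r : seq 'I_n) : continuous (fun y : hR => \sum_(i <- r) a 0 i * y i 0).
  elim: r => [|i r IH].
    have -> : (fun y : hR => \sum_(i <- [::]) a 0 i * y i 0) = cst 0 by apply/funext => y; rewrite big_nil.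
    exact: cst_continuous.
  have -> : (fun y : hR => \sum_(j <- i :: r) a 0 j * y j 0) =
      (fun y => a 0 i * y i 0 + \sum_(j <- r) a 0 j * y j 0) by apply/funext => y; rewrite big_cons.
  by move=> y; exact: (cvgD (cvgM (cvg_cst _) (@coord_continuous _ _ _ i 0 y)) (IH y)).
move=> y; rewrite (_ : (fun y : hR => pairing a y) = (fun z : hR => \sum_i a 0 i * z i 0)); first exact: H.
by apply/funext => z; rewrite /pairing mxE.
Qed.

Lemma offwall_nbhs h : offwall h -> \forall y \near h, offwall y.
Proof.
rewrite /offwall; elim: (enum_fset Phi_plus) => [|a r IH] /=; first by move=> _; near=> y.
move=> /andP[ha /IH hr]; near=> y; apply/andP; split; last by near: y.
near: y; have c : {for h, continuous (fun y : hR => sinsq a y)}.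
  have cc : {for h, continuous (fun y : hR => cos (pairing a y))}.
    apply: (@continuous_comp _ _ _ (fun y : hR => pairing a y) (@cos R)); first exact: pairing_continuous.
    exact: continuous_cos.
  exact: (cvgM (cvgB (cvg_cst _) cc) (cvg_cst _)).
exact: (cvgr_neq0 _ c ha).
Unshelve. all: by end_near. Qed.

Lemma Delta_exp y : offwall y -> Delta y = expR (2^-1 * \sum_(a <- Phi_plus) k a * ln (sinsq a y)).
Proof.
move=> /allP oy; rewrite /Delta mulr_sumr expR_sum; apply: eq_big_seq => a ap.
have s0 : sin (pairing a y / 2) != 0 by have := oy a ap; rewrite -sinsqE sqrf_eq0.
have n0 : 0 < `|sin (pairing a y / 2)| by rewrite normr_gt0.
rewrite /powR gt_eqF//; congr expR.
have -> : ln (sinsq a y) = ln `|sin (pairing a y / 2)| *+ 2.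
  by rewrite -sinsqE -[X in ln X]real_normK ?num_real// lnXn.
by rewrite mulr2n; field.
Qed.

(** The gradient of log Delta off the walls, see [is_derive_Delta]. *)
Definition gv y : 'rV[R]_n := 2^-1 *: \sum_(a <- Phi_plus) (k a * ct a y) *: a.

Definition Gam v y : R := pairing (gv y) v.

Lemma GamE v y : Gam v y = 2^-1 * \sum_(a <- Phi_plus) k a * (ct a y * pairing a v).
Proof.
rewrite /Gam /gv pairingZl /pairing mulmx_suml summxE; congr (_ * _).
by apply: eq_bigr => a _; rewrite -scalemxAl mxE mulrA.
Qed.

Lemma is_derive_Delta y v : offwall y -> is_derive y v Delta (Delta y * Gam v y).
Proof.
move=> oy; apply: (@near_eq_is_derive _ _ _ (fun z => expR (2^-1 * \sum_(a <- Phi_plus) k a * ln (sinsq a z)))).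
  by have := offwall_nbhs oy; apply: filterS => z /Delta_exp ->.
rewrite (Delta_exp oy) GamE; apply: (is_derive_chain (is_derive_expR _)).
apply: (is_derive_scal 2^-1); apply: is_derive_bigsum => a ap; apply: (is_derive_scal (k a)).
have c0 := offwall_cos oy ap.
have s0 : 0 < sinsq a y by rewrite lt_neqAle eq_sym sinsq_ge0 andbT; move/allP: oy; exact.
have ds : is_derive y v (fun z => sinsq a z) (2^-1 * (0 + -1 * (- sin (pairing a y) * pairing a v))).
  have h := is_derive_scal 2^-1 (is_derive_add (is_derive_const 1 y v) (is_derive_scal (-1) (is_derive_cosp a y v))).
  by under eq_fun => z do rewrite /sinsq mulrC -[- cos _]mulN1r; exact: h.
apply: is_derive_eq (is_derive_chain (is_derive1_ln s0) ds) _.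
by rewrite /ct /sinsq; field.
Qed.

Lemma is_derive_ct y v a : offwall y -> a \in Phi_plus ->
  is_derive y v (fun z => ct a z) (- pairing a v / (1 - cos (pairing a y))).
Proof.
move=> oy ap; have c0 := offwall_cos oy ap.
have dc : is_derive y v (fun z => 1 - cos (pairing a z)) (0 + -1 * (- sin (pairing a y) * pairing a v)).
  have h := is_derive_add (is_derive_const 1 y v) (is_derive_scal (-1) (is_derive_cosp a y v)).
  by under eq_fun do rewrite -[- cos _]mulN1r; exact: h.
have H := is_derive_mul (is_derive_sinp a y v) (is_derive_chain (f := fun z => 1 - cos (pairing a z)) (is_derive_inv c0) dc).
rewrite /ct (_ : - _ / _ = cos (pairing a y) * pairing a v * (1 - cos (pairing a y))^-1 +
   sin (pairing a y) * (- (1 - cos (pairing a y)) ^- 2 * (0 + -1 * (- sin (pairing a y) * pairing a v)))) //.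
have := cos2Dsin2 (pairing a y); move: c0; move: (cos _) (sin _) (pairing a v) => c t p c0 sE.
rewrite (_ : t * _ = - (t ^+ 2 * p) / (1 - c) ^+ 2); last by field.
rewrite (_ : t ^+ 2 = (1 - c) * (1 + c)); last by rewrite -[LHS](addKr (c ^+ 2)) sE; ring.
by field.
Qed.

Lemma gram_sum (x y : 'rV[R]_n) : \sum_i \sum_j G i j * (x 0 i * y 0 j) = dot x y.
Proof.
rewrite /dotp mxE exchange_big; apply: eq_bigr => j _; rewrite !mxE mulr_suml.
by apply: eq_bigr => i _; ring.
Qed.

Lemma pairing_e a i : pairing a (e_ i) = a 0 i.
Proof.
rewrite /pairing mxE (bigD1 i)//= mxE !eqxx mulr1 big1 ?addr0// => j /negbTE ji.
by rewrite mxE ji mulr0.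
Qed.

Lemma gram_sumZ (c : R) (x y : 'rV[R]_n) : \sum_i \sum_j G i j * (c * (x 0 i * y 0 j)) = c * dot x y.
Proof.
rewrite -gram_sum mulr_sumr; apply: eq_bigr => i _; rewrite mulr_sumr.
by apply: eq_bigr => j _; rewrite mulrCA.
Qed.

Definition dGam i j h : R := 2^-1 * \sum_(a <- Phi_plus) k a * (- a 0 i / (1 - cos (pairing a h)) * a 0 j).

Lemma is_derive_Gam i j h : offwall h -> is_derive h (e_ i) (Gam (e_ j)) (dGam i j h).
Proof.
move=> oh; rewrite (_ : Gam (e_ j) = fun y => 2^-1 * \sum_(a <- Phi_plus) k a * (ct a y * a 0 j)); last first.
  by apply/funext => y; rewrite GamE; under eq_bigr do rewrite pairing_e.
apply: (is_derive_scal 2^-1); apply: is_derive_bigsum => a ap; apply: (is_derive_scal (k a)).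
have H := is_derive_mul (is_derive_ct (e_ i) oh ap) (is_derive_const (a 0 j) h (e_ i)).
by rewrite mulr0 addr0 pairing_e in H.
Qed.

Definition rtval s y : R := Re (tval s y).

(** Differentiating Delta F twice always leaves the factor Delta: the brackets collect |grad log
    Delta|^2, the divergence of grad log Delta, the cross term and the Laplacian of F. *)
Lemma laplacian_offwall s h : offwall h ->
  laplacian_re D (fun y => Delta y * rtval s y) h = Delta h * \sum_(x <- s)
   ((dot (gv h) (gv h) - 2^-1 * \sum_(a <- Phi_plus) k a * (dot a a / (1 - cos (pairing a h))) - dot x.2 x.2)
      * Re (x.1 * expw x.2 h)
    + 2 * dot (gv h) x.2 * Re (x.1 * 'i * expw x.2 h)).
Proof.
move=> oh; pose u (i : 'I_n) := rtval (dtr (e_ i) s).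
pose w (j : 'I_n) y := Gam (e_ j) y * rtval s y + u j y.
have d1 (j : 'I_n) y : offwall y -> is_derive y (e_ j) (fun y => Delta y * rtval s y) (Delta y * w j y).
  move=> oy; have H := is_derive_mul (is_derive_Delta (e_ j) oy) (is_derive_tval s y (e_ j)).
  by rewrite /w mulrDr mulrA.
pose w2 (i j : 'I_n) := Gam (e_ i) h * w j h + (dGam i j h * rtval s h + Gam (e_ j) h * u i h
   + rtval (dtr (e_ i) (dtr (e_ j) s)) h).
have d2 i j : 'D_(e_ i) (fun y => 'D_(e_ j) (fun y => Delta y * rtval s y) y) h = Delta h * w2 i j.
  rewrite (@near_eq_derive _ _ _ _ (fun y => Delta y * w j y)); last first.
    by have := offwall_nbhs oh; apply: filterS => y oy; have [_ ->] := d1 j y oy.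
  have H1 := is_derive_mul (is_derive_Gam i j oh) (is_derive_tval s h (e_ i)).
  have H2 := is_derive_add H1 (is_derive_tval (dtr (e_ j) s) h (e_ i)).
  have [_ ->] := is_derive_mul (is_derive_Delta (e_ i) oh) H2.
  by rewrite /w2 [in RHS]mulrDr mulrA.
rewrite /laplacian_re.
under eq_bigr => i _ do under eq_bigr => j _ do rewrite d2 mulrCA.
under eq_bigr => i _ do rewrite -mulr_sumr.
rewrite -mulr_sumr; congr (_ * _).
pose U x := Re (x.1 * expw x.2 h); pose V x := Re (x.1 * 'i * expw x.2 h).
have uE : rtval s h = \sum_(x <- s) U x by rewrite /rtval /tval raddf_sum.
have ujE j : u j h = \sum_(x <- s) x.2 0 j * V x.
  rewrite /u /rtval /tval big_map raddf_sum; apply: eq_bigr => -[[p q] l] _ /=.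
  by rewrite /V /= pairing_e; ring.
have uijE i j : rtval (dtr (e_ i) (dtr (e_ j) s)) h = \sum_(x <- s) - (x.2 0 i * x.2 0 j * U x).
  rewrite /rtval /tval !big_map raddf_sum; apply: eq_bigr => -[[p q] l] _ /=.
  by rewrite /U /= !pairing_e; ring.
transitivity (\sum_(x <- s) \sum_i \sum_j (G i j * (U x * (gv h 0 i * gv h 0 j))
   + G i j * (V x * (gv h 0 i * x.2 0 j)) + U x * (G i j * dGam i j h) + G i j * (V x * (x.2 0 i * gv h 0 j))
   + G i j * (- U x * (x.2 0 i * x.2 0 j)))).
  rewrite [RHS]exchange_big; apply: eq_bigr => i _ /=; rewrite [RHS]exchange_big.
  apply: eq_bigr => j _ /=; rewrite /w2 /w uE !ujE uijE /Gam !pairing_e.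
  rewrite !(mulr_sumr, mulr_suml, mulrDr) -!big_split /=.
  by apply: eq_bigr => x _; ring.
apply: eq_bigr => x _; rewrite -/(U x) -/(V x).
have -> : \sum_i \sum_j (G i j * (U x * (gv h 0 i * gv h 0 j))
   + G i j * (V x * (gv h 0 i * x.2 0 j)) + U x * (G i j * dGam i j h) + G i j * (V x * (x.2 0 i * gv h 0 j))
   + G i j * (- U x * (x.2 0 i * x.2 0 j))) = 
   U x * dot (gv h) (gv h) + V x * dot (gv h) x.2 + U x * (\sum_i \sum_j G i j * dGam i j h)
   + V x * dot x.2 (gv h) + - U x * dot x.2 x.2.
  rewrite -!gram_sumZ !mulr_sumr -!big_split /=; apply: eq_bigr => i _.
  by rewrite !mulr_sumr -!big_split.
rewrite (dotpC (cm_gramP D) x.2).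
have -> : \sum_i \sum_j G i j * dGam i j h = - 2^-1 * \sum_(a <- Phi_plus) k a * (dot a a / (1 - cos (pairing a h))).
  transitivity (\sum_i \sum_j \sum_(a <- Phi_plus) G i j * (- 2^-1 * k a / (1 - cos (pairing a h)) * (a 0 i * a 0 j))).
    apply: eq_bigr => i _; apply: eq_bigr => j _; rewrite /dGam !mulr_sumr.
    by apply: eq_bigr => a _; ring.
  under eq_bigr do rewrite exchange_big /=.
  rewrite exchange_big mulr_sumr /=; apply: eq_bigr => a _; rewrite gram_sumZ; ring.
ring.
Qed.

End gauge_transform.

(** * A cotangent identity for root systems *)

Section cot_orbits.
Local Notation rV := ('rV[R]_n).
Implicit Types (a b x y : rV) (z : rV * rV).

(* The two relations satisfied by [a |-> cot (<a, h> / 2)]. *)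
Definition cot_like (c : rV -> R) :=
  (forall a, a \in Phi -> c (- a) = - c a) /\
  forall a b, a \in Phi -> b \in Phi -> a + b \in Phi -> c (a + b) * (c a + c b) = c a * c b - 1.

(* The orbits of [turn] on pairs of roots are the rotations by the angle of the pair; the
   cotangent products telescope to a constant along each orbit. *)
Definition turn z : rV * rV := (z.2, pairing z.1 (cor z.2) *: z.2 - z.1).

Definition root_pair z := (z.1 \in Phi) && (z.2 \in Phi).

Lemma turn_refl z : (turn z).2 = - (z.1 *m refl z.2).
Proof. by rewrite /turn /= mul_reflection opprB. Qed.

Lemma turn_root z : root_pair z -> root_pair (turn z).
Proof. by move=> /andP[h1 h2]; rewrite /root_pair turn_refl /turn /= h2 root_opp// root_refl. Qed.

Lemma big_opp (V : nmodType) (f : rV -> V) : \sum_(a <- Phi) f (- a) = \sum_(a <- Phi) f a.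
Proof.
rewrite -(big_map -%R xpredT f); apply: perm_big; apply: uniq_perm.
- by rewrite map_inj_uniq ?fset_uniq//; exact: oppr_inj.
- exact: fset_uniq.
move=> a; apply/mapP/idP => [[b bP ->]|aP]; first exact: root_opp.
by exists (- a); rewrite ?root_opp ?opprK.
Qed.

Lemma sum_turn (f : rV * rV -> R) :
  \sum_(a <- Phi) \sum_(b <- Phi) f (turn (a, b)) = \sum_(a <- Phi) \sum_(b <- Phi) f (a, b).
Proof.
rewrite exchange_big; apply: eq_big_seq => b bP /=.
transitivity (\sum_(a <- Phi) f (b, - (a *m refl b))).
  by apply: eq_bigr => a _; congr (f (_, _)); exact: (turn_refl (a, b)).
by rewrite (big_weyl _ (fun a => f (b, - a)) (weyl_refl bP)) (big_opp (fun a => f (b, a))).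
Qed.

(** Only pairs at an acute angle are kept: an obtuse pair becomes acute when one root changes sign,
    and an orthogonal pair carries no weight. *)
Definition pair_weight z : R :=
  if (0 < dot z.1 z.2) && (z.1 != z.2) then k z.1 * k z.2 * dot z.1 z.2 else 0.

Lemma turn_dot z : root_pair z -> dot (turn z).1 (turn z).2 = dot z.1 z.2.
Proof.
move=> /andP[h1 h2]; have y0 := root_neq0 h2.
rewrite turn_refl /= (dotpNr GP) -(reflection_dotp GP z.1 z.2 y0) (reflection_self GP y0).
by rewrite (dotpNr GP) (dotpC GP).
Qed.

Lemma turn_weight z : root_pair z -> pair_weight (turn z) = pair_weight z.
Proof.
move=> /[dup] hz /andP[h1 h2]; rewrite /pair_weight (turn_dot hz).
have -> : k (turn z).2 = k z.1.
  rewrite turn_refl coupling_opp ?root_refl//; apply: cm_couplingP => //; exact: weyl_refl.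
have -> : ((turn z).1 != (turn z).2) = (z.1 != z.2).
  congr (~~ _); rewrite turn_refl /=; have y0 := root_neq0 h2.
  apply/eqP/eqP => [E|->]; last by rewrite (reflection_self GP y0) opprK.
  have := congr1 (mulmx^~ (refl z.2)) E; rewrite (reflection_self GP y0) mulNmx -mulmxA (reflectionK GP y0) mulmx1.
  by move=> /oppr_inj.
by rewrite [k (turn z).1 * _]mulrC.
Qed.

Lemma turn_cartan z : root_pair z ->
  pairing (turn z).1 (cor (turn z).2) = pairing z.2 (cor z.1) /\
  pairing (turn z).2 (cor (turn z).1) = pairing z.1 (cor z.2).
Proof.
move=> /[dup] hz /andP[h1 h2]; have y0 := root_neq0 h2.
have nE : dot (turn z).2 (turn z).2 = dot z.1 z.1.
  by rewrite turn_refl (dotpNr GP) (dotpNl) opprK (reflection_dotp GP).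
split; rewrite !pairing_coroot.
  by rewrite nE (turn_dot hz) (dotpC GP z.2).
by rewrite (dotpC GP (turn z).2) (turn_dot hz) /=.
Qed.

Lemma turnN z : turn (- z.1, - z.2) = (- (turn z).1, - (turn z).2).
Proof.
rewrite /turn /=; congr (_, _).
have -> : pairing (- z.1) (cor (- z.2)) = pairing z.1 (cor z.2).
  by rewrite !pairing_coroot dotpNl !(dotpNr GP) dotpNl !opprK.
by rewrite scalerN opprB opprK addrC.
Qed.

Section cot_sum.
Variable c : rV -> R.
Hypothesis cP : cot_like c.

Definition cprod z : R := c z.1 * c z.2.

Lemma iter_turn_root j z : root_pair z -> root_pair (iter j turn z).
Proof. by move=> hz; elim: j => //= j IH; exact: turn_root. Qed.

Lemma cprod_period r z : root_pair z -> iter r turn z = (- z.1, - z.2) ->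
  forall j, cprod (iter (j + r) turn z) = cprod (iter j turn z).
Proof.
move=> hz E j; rewrite iterD E.
have -> : iter j turn (- z.1, - z.2) = (- (iter j turn z).1, - (iter j turn z).2).
  by elim: j => //= j ->; rewrite turnN.
have /andP[h1 h2] := iter_turn_root j hz.
by case: cP => co _; rewrite /cprod /= !co// mulrNN.
Qed.

Lemma crel a b x : a \in Phi -> b \in Phi -> x \in Phi -> x = a + b -> c x * (c a + c b) = c a * c b - 1.
Proof. by move=> aP bP xP E; rewrite E in xP *; case: cP => _; apply. Qed.

End cot_sum.

Lemma turn_step (p q : R) x y : root_pair (x, y) -> pairing x (cor y) = p -> pairing y (cor x) = q ->
  turn (x, y) = (y, p *: y - x) /\
  [/\ root_pair (y, p *: y - x), pairing y (cor (p *: y - x)) = q & pairing (p *: y - x) (cor y) = p].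
Proof.
move=> hz hp hq; have E : turn (x, y) = (y, p *: y - x) by rewrite /turn /= hp.
have := turn_root hz; have := turn_cartan hz; rewrite E /= => -[-> ->] h; by split.
Qed.

Lemma cartan_nat a b : a \in Phi -> b \in Phi -> 0 < dot a b -> exists2 p : nat, (0 < p)%N & pairing a (cor b) = p%:R.
Proof.
move=> aP bP ab0; have : 0 < pairing a (cor b).
  by rewrite pairing_coroot divr_gt0 ?mulr_gt0// (root_norm_gt0 bP).
have [_ _ _ h _] := cm_rootsP D.
have /intrP[z ->] := h a b aP bP; rewrite ltr0z; case: z => // p p0.
by exists p.
Qed.

Lemma cartan_lt4 a b : a \in Phi -> b \in Phi -> 0 < dot a b -> a != b ->
  pairing a (cor b) * pairing b (cor a) < 4.
Proof.
move=> aP bP ab0 ab; have a0 := root_norm_gt0 aP; have b0 := root_norm_gt0 bP.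
rewrite !pairing_coroot (dotpC GP b a).
rewrite (_ : _ * _ = 4 * (dot a b ^+ 2 / (dot a a * dot b b))); last by field; rewrite !gt_eqF.
rewrite gtr_pMr// ltr_pdivrMr ?mulr_gt0// mul1r.
pose t := dot a b / dot b b; have t0 : 0 < t by rewrite divr_gt0.
have x0 : a - t *: b != 0.
  rewrite subr_eq0; apply: contra ab => /eqP E.
  have [_ _ _ _ h] := cm_rootsP D; have := aP; rewrite E => /(h b t bP)[->|t1].
    by rewrite scale1r.
  by move: t0; rewrite t1 ltr0N1.
have := dotp_gt0 GP x0.
rewrite dotpBl !(dotpBr GP) !dotpZl !(dotpZr GP) (dotpC GP b a).
rewrite (_ : _ - _ = (dot a a * dot b b - dot a b ^+ 2) / dot b b); last by rewrite /t; field; rewrite gt_eqF.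
by rewrite pmulr_lgt0 ?invr_gt0// subr_gt0.
Qed.

(** [turn] together with the two Cartan numbers, which it exchanges: after j steps the pair is an
    explicit combination of the initial roots, found by reduction. *)
Definition gst_step (s : rV * rV * R * R) := let: (x, y, p, q) := s in (y, p *: y - x, q, p).
Definition gst a b (p q : R) j := iter j gst_step (a, b, p, q).

Lemma gstP a b (p q : R) : root_pair (a, b) -> pairing a (cor b) = p -> pairing b (cor a) = q ->
  forall j, iter j turn (a, b) = (gst a b p q j).1.1 /\ root_pair (gst a b p q j).1.1.
Proof.
move=> hz hp hq j.
suff : let: (x, y, p', q') := gst a b p q j in
  [/\ iter j turn (a, b) = (x, y), root_pair (x, y), pairing x (cor y) = p' & pairing y (cor x) = q'].
  by case: (gst _ _ _ _ _) => [[[x y] p'] q'] [].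
elim: j => //= j; rewrite -/(gst a b p q j); case: (gst _ _ _ _ _) => [[[x y] p'] q'] [-> h1 h2 h3] /=.
by have [-> []] := turn_step h1 h2 h3.
Qed.

(** Such a pair has Cartan numbers (1, 1), (1, 2) or (1, 3) up to order, the types A_2, B_2 and G_2,
    for which 3, 4 or 6 turns give minus the pair. The product of two cotangents is even, so it has
    that period, and 12 is a common multiple. On one period the addition relations among the roots
    met make the sum constant. *)
Lemma orbit_sum a b : a \in Phi -> b \in Phi -> 0 < dot a b -> a != b ->
  exists q : R, forall c, cot_like c -> \sum_(j < 12) cprod c (iter j turn (a, b)) = q.
Proof.
move=> aP bP ab0 ab; have hz : root_pair (a, b) by rewrite /root_pair aP.
have := cartan_lt4 aP bP ab0 ab.
have [p p0 pE] := cartan_nat aP bP ab0.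
have [q q0 qE] : exists2 q : nat, (0 < q)%N & pairing b (cor a) = q%:R.
  by apply: cartan_nat => //; rewrite (dotpC GP).
rewrite pE qE -natrM ltr_nat => pq4.
have H := gstP hz pE qE.
have mem j : (gst a b p%:R q%:R j).1.1.1 \in Phi by have [_ /andP[]] := H j.
have it j : iter j turn (a, b) = (gst a b p%:R q%:R j).1.1 by have [] := H j.
pose g j : rV := (gst a b p%:R q%:R j).1.1.1.
have TE c j : cprod c (iter j turn (a, b)) = c (g j) * c (g j.+1).
  by rewrite it /cprod /g /gst /=; case: (iter _ _ _) => [[[x y] p'] q'].
have sumE (c : rV -> R) r d : cot_like c -> (gst a b p%:R q%:R r).1.1 = (- a, - b) -> (12 = d * r)%N ->
    \sum_(j < 12) cprod c (iter j turn (a, b)) = d%:R * \sum_(j < r) c (g j) * c (g j.+1).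
  move=> cP E r12; have per := cprod_period cP hz (etrans (it r) E).
  have perM i j : cprod c (iter (j + i * r) turn (a, b)) = cprod c (iter j turn (a, b)).
    by elim: i => [|i IH]; rewrite ?mul0n ?addn0// mulSn addnCA addnC per.
  rewrite r12; elim: d {r12} => [|i IH]; first by rewrite mul0n big_ord0 mul0r.
  rewrite mulSn addnC -(big_mkord xpredT (fun j => cprod c (iter j turn (a, b)))).
  rewrite (big_cat_nat (leq0n _) (leq_addr _ _)) /= big_mkord IH -natr1 mulrDl mul1r; congr (_ + _).
  rewrite -{1}[(i * r)%N]add0n big_addn addKn big_mkord; apply: eq_bigr => j _.
  by rewrite perM TE.
have memg j : g j \in Phi := mem j.
have : ((p, q) == (1, 1) \/ (p, q) == (1, 2) \/ (p, q) == (2, 1) \/ (p, q) == (1, 3) \/ (p, q) == (3, 1))%N.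
  case: p p0 pq4 {pE H mem it g TE sumE memg} => [|[|[|[|p]]]]// _; case: q q0 {qE} => [|[|[|[|q]]]]//; intuition; exfalso; lia.
have v x y : (forall i, (x : rV) 0 i = (y : rV) 0 i) -> x = y by move=> h; apply/rowP.
have cN c j : cot_like c -> g j = - a -> c (g j) = - c (g 0%N) by move=> [co _] ->; rewrite co.
case=> [|[|[|[|]]]] /eqP [pe qe]; subst p q.
- exists (- 4) => c cP; have rel i j l (E : g l = g i + g j) := crel cP (memg i) (memg j) (memg l) E.
  rewrite (sumE c 3%N 4%N cP)//; last by congr (_, _); apply: v => i /=; rewrite !mxE; ring.
  rewrite !big_ord_recr big_ord0 /= (cN c 3%N)//; last by apply: v => i /=; rewrite !mxE; ring.
  have := rel 0%N 2%N 1%N ltac:(by apply: v => i /=; rewrite !mxE; ring).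
  lra.
- exists (- 6) => c cP; have rel i j l (E : g l = g i + g j) := crel cP (memg i) (memg j) (memg l) E.
  rewrite (sumE c 4%N 3%N cP)//; last by congr (_, _); apply: v => i /=; rewrite !mxE; ring.
  rewrite !big_ord_recr big_ord0 /= (cN c 4%N)//; last by apply: v => i /=; rewrite !mxE; ring.
  have := rel 0%N 2%N 1%N ltac:(by apply: v => i /=; rewrite !mxE; ring).
  have := rel 3%N 0%N 2%N ltac:(by apply: v => i /=; rewrite !mxE; ring).
  lra.
- exists (- 6) => c cP; have rel i j l (E : g l = g i + g j) := crel cP (memg i) (memg j) (memg l) E.
  rewrite (sumE c 4%N 3%N cP)//; last by congr (_, _); apply: v => i /=; rewrite !mxE; ring.
  rewrite !big_ord_recr big_ord0 /= (cN c 4%N)//; last by apply: v => i /=; rewrite !mxE; ring.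
  have := rel 0%N 3%N 1%N ltac:(by apply: v => i /=; rewrite !mxE; ring).
  have := rel 1%N 3%N 2%N ltac:(by apply: v => i /=; rewrite !mxE; ring).
  lra.
- exists (- 8) => c cP; have rel i j l (E : g l = g i + g j) := crel cP (memg i) (memg j) (memg l) E.
  rewrite (sumE c 6%N 2%N cP)//; last by congr (_, _); apply: v => i /=; rewrite !mxE; ring.
  rewrite !big_ord_recr big_ord0 /= (cN c 6%N)//; last by apply: v => i /=; rewrite !mxE; ring.
  have := rel 0%N 2%N 1%N ltac:(by apply: v => i /=; rewrite !mxE; ring).
  have := rel 0%N 4%N 2%N ltac:(by apply: v => i /=; rewrite !mxE; ring).
  have := rel 0%N 5%N 4%N ltac:(by apply: v => i /=; rewrite !mxE; ring).
  have := rel 2%N 4%N 3%N ltac:(by apply: v => i /=; rewrite !mxE; ring).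
  lra.
exists (- 8) => c cP; have rel i j l (E : g l = g i + g j) := crel cP (memg i) (memg j) (memg l) E.
rewrite (sumE c 6%N 2%N cP)//; last by congr (_, _); apply: v => i /=; rewrite !mxE; ring.
rewrite !big_ord_recr big_ord0 /= (cN c 6%N)//; last by apply: v => i /=; rewrite !mxE; ring.
have := rel 0%N 5%N 1%N ltac:(by apply: v => i /=; rewrite !mxE; ring).
have := rel 1%N 3%N 2%N ltac:(by apply: v => i /=; rewrite !mxE; ring).
have := rel 1%N 5%N 3%N ltac:(by apply: v => i /=; rewrite !mxE; ring).
have := rel 3%N 5%N 4%N ltac:(by apply: v => i /=; rewrite !mxE; ring).
lra.
Qed.

Lemma sum_turn_iter (f : rV * rV -> R) j :
  \sum_(a <- Phi) \sum_(b <- Phi) f (iter j turn (a, b)) = \sum_(a <- Phi) \sum_(b <- Phi) f (a, b).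
Proof.
elim: j f => // j IH f; rewrite -[RHS]sum_turn -(IH (fun z => f (turn z))).
by apply: eq_bigr => a _; apply: eq_bigr => b _; rewrite iterS.
Qed.

(** The 12 iterates of [turn] permute the pairs of roots and preserve the weight, so averaging over
    them replaces each summand by a constant orbit sum. *)
Lemma weighted_cot_sum : exists q : R, forall c, cot_like c ->
  \sum_(a <- Phi) \sum_(b <- Phi) pair_weight (a, b) * cprod c (a, b) = q.
Proof.
have H (z : rV * rV) : exists q : R, root_pair z -> forall c, cot_like c ->
    pair_weight z * \sum_(j < 12) cprod c (iter j turn z) = q.
  case: z => a b; have [/andP[/= aP bP]|] := boolP (root_pair (a, b)); last by exists 0.
  rewrite /pair_weight /=; case: ifP => [/andP[ab0 ab]|_]; last by exists 0 => _ c _; rewrite mul0r.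
  have [q hq] := orbit_sum aP bP ab0 ab.
  by exists (k a * k b * dot a b * q) => _ c cP; rewrite hq.
have [q hq] := @choice _ _ _ H.
exists (12^-1 * \sum_(a <- Phi) \sum_(b <- Phi) q (a, b)) => c cP.
apply: (@mulfI _ 12) => //; rewrite mulVKf//.
transitivity (\sum_(j < 12) \sum_(a <- Phi) \sum_(b <- Phi)
    pair_weight (iter j turn (a, b)) * cprod c (iter j turn (a, b))).
  under [RHS]eq_bigr => j _ do rewrite (sum_turn_iter (fun z => pair_weight z * cprod c z)).
  by rewrite sumr_const card_ord mulr_natl.
rewrite exchange_big; apply: eq_big_seq => a aP; rewrite exchange_big; apply: eq_big_seq => b bP /=.
have hz : root_pair (a, b) by rewrite /root_pair aP.
rewrite -(hq (a, b) hz c cP) mulr_sumr; apply: eq_bigr => j _; congr (_ * _).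
elim: (val j) => //= i IH; rewrite turn_weight//; exact: iter_turn_root.
Qed.

(** The summand [F] is unchanged when either root changes sign. The sum over all roots is thus 4
    times the one over positive roots, and 2 times the one over acute pairs, constant by
    [weighted_cot_sum]. *)
Lemma cot_const : exists q : R, forall c, cot_like c ->
  \sum_(a <- Phi_plus) \sum_(b <- Phi_plus | a != b) k a * k b * dot a b * (c a * c b) = q.
Proof.
have [q hq] := weighted_cot_sum.
exists (2^-1 * q) => c cP; have [co _] := cP.
pose F a b := if (a == b) || (a == - b) then 0 else k a * k b * dot a b * (c a * c b).
have FN a b : a \in Phi -> b \in Phi -> F a (- b) = F a b.
  move=> aP bP; rewrite /F opprK orbC; case: ifP => // _.
  by rewrite coupling_opp// (dotpNr GP) co//; ring.
have NF a b : a \in Phi -> b \in Phi -> F (- a) b = F a b.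
  move=> aP bP; rewrite /F eqr_oppLR eqr_opp orbC; case: ifP => // _.
  by rewrite coupling_opp// dotpNl co//; ring.
have E1 : \sum_(a <- Phi) \sum_(b <- Phi) F a b = 4 * \sum_(a <- Phi_plus) \sum_(b <- Phi_plus) F a b.
  rewrite big_pos; last by move=> a aP; apply: eq_big_seq => b bP; exact: NF.
  rewrite (eq_big_seq (fun a => 2 * \sum_(b <- Phi_plus) F a b)); last first.
    move=> a /pos_root aP; rewrite big_pos; last by move=> b bP; exact: FN.
    by rewrite mulr_natl mulr2n.
  by rewrite /= -mulr_sumr; ring.
have E2 : \sum_(a <- Phi) \sum_(b <- Phi) F a b =
    2 * \sum_(a <- Phi) \sum_(b <- Phi) pair_weight (a, b) * cprod c (a, b).
  rewrite mulr_natl mulr2n -big_split; apply: eq_big_seq => a aP /=.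
  rewrite -{2}(big_opp (fun b => pair_weight (a, b) * cprod c (a, b))) -big_split.
  apply: eq_big_seq => b bP /=.
  rewrite /pair_weight /cprod /= coupling_opp// (dotpNr GP) co// /F oppr_gt0.
  have [ab0|ab0|ab0] := ltgtP 0 (dot a b).
  - have -> : (a == - b) = false.
      apply/eqP => E; move: ab0; rewrite E dotpNl oppr_gt0 ltNge.
      by have /ltW -> := root_norm_gt0 bP.
    by rewrite orbF /=; case: eqP => _ /=; rewrite ?mul0r addr0.
  - have -> : (a == b) = false.
      apply/eqP => E; move: ab0; rewrite E ltNge.
      by have /ltW -> := root_norm_gt0 bP.
    by case: eqP => _ /=; ring.
  - by rewrite -ab0 /= !mulr0 !mul0r addr0; case: ifP.
have -> : \sum_(a <- Phi_plus) \sum_(b <- Phi_plus | a != b) k a * k b * dot a b * (c a * c b) =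
   \sum_(a <- Phi_plus) \sum_(b <- Phi_plus) F a b.
  apply: eq_big_seq => a ap; rewrite big_mkcond; apply: eq_big_seq => b bp; rewrite /F.
  have -> : (a == - b) = false.
    apply/eqP => E; have [h [_ hp]] := cm_pos_rootsP D.
    move: ap bp; rewrite E !hp => /andP[_ +] /andP[_ +]; rewrite pairingNl; lra.
  by rewrite orbF; case: eqP.
apply: (@mulfI _ 4) => //; rewrite -E1 E2 (hq c cP); by field.
Qed.

End cot_orbits.

(** * The potential after the gauge transformation *)

Section hamiltonian.
Implicit Types (l m a b : 'rV[R]_n) (h q y v : hR) (s t : seq (C * 'rV[R]_n)) (w : 'M[R]_n).

Lemma big_pos_opp (V : nmodType) (f : 'rV[R]_n -> V) :
  \sum_(a <- Phi) f a = \sum_(a <- Phi_plus) (f a + f (- a)).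
Proof. by rewrite (perm_big _ pos_perm) big_cat big_map big_split. Qed.

Lemma offwall_half h a : offwall h -> a \in Phi -> sin (pairing a h / 2) != 0.
Proof.
move=> /allP oh aP; rewrite -sqrf_eq0 sinsqE.
have := aP; rewrite (perm_mem pos_perm) mem_cat => /orP[/oh//|/mapP[b /oh bo ->]].
by rewrite sinsqN.
Qed.

Lemma ct_half a h : ct a h = cos (pairing a h / 2) / sin (pairing a h / 2).
Proof.
rewrite /ct; set x := pairing a h / 2.
have -> : pairing a h = x *+ 2 by rewrite /x mulr2n; field.
have [s0|s0] := eqVneq (sin x) 0.
  by rewrite sin_mulr2n s0 !mulr0 mul0rn mul0r invr0 mulr0.
rewrite sin_mulr2n cos_mulr2n.
have -> : 1 - (cos x ^+ 2 *+ 2 - 1) = sin x ^+ 2 *+ 2.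
  by rewrite sin2cos2 !mulr2n; ring.
by apply/eqP; rewrite eqr_div ?mulrn_eq0 ?expf_eq0 ?s0//; apply/eqP; rewrite !mulr2n; ring.
Qed.

Lemma ct_cot_like h : offwall h -> cot_like (ct^~ h).
Proof.
move=> oh; split=> [a aP|a b aP bP abP]; first by rewrite /ct pairingNl sinN cosN mulNr.
have := offwall_half oh abP; have := offwall_half oh bP; have := offwall_half oh aP.
rewrite !ct_half pairingDl mulrDl sinD cosD.
by move: (sin _) (cos _) (sin _) (cos _) => s c s' c' s0 s0' ss; field; rewrite s0 s0' ss.
Qed.

(* The potential left by the gauge transformation, constant off the walls; this replaces
   the explicit value (rho(k)|rho(k)) - e_0. *)
Definition Kpot h : R := trig_potential D h - (dot (gv h) (gv h)
  - 2^-1 * \sum_(a <- Phi_plus) k a * (dot a a / (1 - cos (pairing a h)))).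

(** For each single root, the squared cotangent and the term in 1 / (1 - cos) cancel the
    trigonometric potential up to a constant; the cross terms of |grad log Delta|^2 are constant by
    [cot_const]. *)
Lemma potential_const : exists e0 : R, forall h, offwall h -> Kpot h = e0.
Proof.
have [q hq] := cot_const.
exists (\sum_(a <- Phi_plus) (k a ^+ 2 / 4 - k a * (k a - 1) / 12) * dot a a - 4^-1 * q) => h oh.
have gE : dot (gv h) (gv h) = 4^-1 * \sum_(a <- Phi_plus) k a ^+ 2 * dot a a * ct a h ^+ 2 + 4^-1 * q.
  have dl (r : seq 'rV[R]_n) (c : 'rV[R]_n -> R) (y : 'rV[R]_n) :
      dot (\sum_(a <- r) c a *: a) y = \sum_(a <- r) c a * dot a y.
    elim: r => [|a r IH]; first by rewrite !big_nil dotp0l.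
    by rewrite !big_cons dotpDl dotpZl IH.
  rewrite -(hq _ (ct_cot_like oh)) -mulrDr -big_split.
  rewrite /gv dotpZl (dotpZr GP) mulrA (_ : 2^-1 * 2^-1 = 4^-1 :> R); last by field.
  congr (_ * _); rewrite dl; apply: eq_big_seq => a ap /=.
  rewrite (dotpC GP) dl (bigD1_seq a)//= ?fset_uniq// mulrDr; congr (_ + _); first by ring.
  under [RHS]eq_bigl do rewrite eq_sym.
  by rewrite mulr_sumr; apply: eq_bigr => b _; rewrite (dotpC GP b); ring.
rewrite /Kpot gE /trig_potential.
set A := (\sum_(a <- _) k a * _).
suff -> : \sum_(a <- Phi_plus) (k a ^+ 2 / 4 - k a * (k a - 1) / 12) * dot a a =
   \sum_(a <- Phi_plus) strength D a * ((4 * sin (pairing a h / 2) ^+ 2)^-1 - 12^-1) + 2^-1 * A -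
   4^-1 * (\sum_(a <- Phi_plus) k a ^+ 2 * dot a a * ct a h ^+ 2) by ring.
rewrite /A !mulr_sumr -sumrN -!big_split; apply: eq_big_seq => a ap /=.
have c0 := offwall_cos oh ap; rewrite sinsqE /sinsq /strength /ct expr_div_n sin2cos2.
by move: (cos _) c0 => c c0; field.
Qed.

End hamiltonian.

Variable kc : R.
Hypothesis kcP : forall h, offwall h -> Kpot h = kc.

(** * H_0 as an operator on lists of exponentials *)

Section jacobi_operator.
Implicit Types (l m a b : 'rV[R]_n) (h q y v : hR) (s t : seq (C * 'rV[R]_n)) (w : 'M[R]_n).

Lemma gv_dot h l : dot (gv h) l = 2^-1 * \sum_(a <- Phi_plus) k a * (ct a h * dot a l).
Proof.
rewrite /gv dotpZl; congr (_ * _); elim: (enum_fset Phi_plus) => [|a r IH]; first by rewrite !big_nil dotp0l.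
by rewrite !big_cons dotpDl dotpZl IH mulrA.
Qed.

Lemma H0_offwall s h : offwall h -> H_0 D (tval s) h = \sum_(x <- s) x.1 *
  (((dot x.2 x.2 + kc)%:C - 'i * (\sum_(a <- Phi_plus) k a * (ct a h * dot a x.2))%:C) * expw x.2 h).
Proof.
move=> oh; have d0 : Delta h != 0 by rewrite gt_eqF// Delta_gt0.
pose U x := x.1 * expw x.2 h.
have reE (r : seq (C * 'rV[R]_n)) : laplacian_re D (fun y => Delta y * rtval r y) h =
    Delta h * Re (\sum_(x <- r) ((trig_potential D h - kc - dot x.2 x.2)%:C * U x
      + (\sum_(a <- Phi_plus) k a * (ct a h * dot a x.2))%:C * ('i * U x))).
  rewrite laplacian_offwall// raddf_sum; congr (_ * _); apply: eq_bigr => -[[p q] l] _.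
  have -> : 2 * dot (gv h) (p +i* q, l).2 = \sum_(a <- Phi_plus) k a * (ct a h * dot a l).
    by rewrite gv_dot mulrA mulfV// mul1r.
  rewrite -(kcP oh) /Kpot /U /=; ring.
have imE y : Im (tval s y) = rtval (tscale (- 'i) s) y.
  by rewrite /rtval tval_scale; case: (tval s y) => p q /=; ring.
rewrite /H_0 /H_T.
have -> : laplacian D (fun y => (Delta y)%:C * tval s y) h = (Delta h)%:C *
   \sum_(x <- s) ((trig_potential D h - kc - dot x.2 x.2)%:C * U x
      + (\sum_(a <- Phi_plus) k a * (ct a h * dot a x.2))%:C * ('i * U x)).
  rewrite /laplacian.
  have -> : (fun y => Re ((Delta y)%:C * tval s y)) = (fun y => Delta y * rtval s y).
    by apply/funext => y; rewrite /rtval; case: (tval s y) => p q /=; ring.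
  have -> : (fun y => Im ((Delta y)%:C * tval s y)) = (fun y => Delta y * rtval (tscale (- 'i) s) y).
    by apply/funext => y; rewrite -imE; case: (tval s y) => p q /=; ring.
  rewrite !reE big_map.
  have -> : \sum_(x <- s) ((trig_potential D h - kc - dot (- 'i * x.1, x.2).2 (- 'i * x.1, x.2).2)%:C * U (- 'i * x.1, x.2)
      + (\sum_(a <- Phi_plus) k a * (ct a h * dot a (- 'i * x.1, x.2).2))%:C * ('i * U (- 'i * x.1, x.2))) =
     - 'i * \sum_(x <- s) ((trig_potential D h - kc - dot x.2 x.2)%:C * U x
      + (\sum_(a <- Phi_plus) k a * (ct a h * dot a x.2))%:C * ('i * U x)).
    rewrite mulr_sumr; apply: eq_bigr => -[z l] _; rewrite /U /=; ring.
  move: (\sum_(x <- s) _) => -[p q] /=.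
  by apply/eqP; rewrite eq_complex /=; apply/andP; split; apply/eqP; ring.
rewrite fmorphV; have d1 : (Delta h)%:C != 0 :> C by rewrite fmorph_eq0.
rewrite mulrDr mulrN mulKf// [X in - _ + X]mulrCA mulKf// /tval mulr_sumr -sumrN -big_split.
by apply: eq_bigr => x _; rewrite /U /=; ring.
Qed.

(* [cot(a/2) d_a] maps a polynomial invariant under [s_a] to a polynomial whose exponents lie
   on the [a]-strings from [l] to [s_a l]. *)
Definition strip a l : seq (C * 'rV[R]_n) := let m := Num.truncn (pairing l (cor a)) in
  if 0 < dot a l then [seq ((dot a l / 2)%:C, l - a *+ i) | i <- iota 0 m.+1 ++ iota 1 m.-1] else [::].

Lemma strip_wts a l : a \in Phi -> P l -> wts (strip a l).
Proof.
move=> aP hl x; rewrite /strip; case: ifP => // _ /mapP[i _ ->] /=.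
by apply: weightB => //; apply: weightMn; exact: root_weight.
Qed.

Lemma stripM a l w h : Wg w -> tval (strip (a *m w) (l *m w)) h = tval (strip a l) (w *m h).
Proof.
move=> hw; rewrite /strip !pairing_coroot !(weyl_dotp _ _ hw); case: ifP => _; last by rewrite /tval !big_nil.
rewrite /tval !big_map; apply: eq_bigr => i _; rewrite expwM; congr (_ * expw _ _) => /=.
rewrite mulmxBl; congr (_ - _).
by elim: i => [|i IH]; rewrite ?mulr0n ?mul0mx// !mulrS mulmxDl IH.
Qed.

(** With z = e^(-a), the quotient (1 + z) (1 - z^m) / (1 - z) is the sum of the z^i for 0 <= i <= m
    plus that for 0 < i < m: this is why [strip] lists the inner exponents twice and the two ends
    once. *)
Lemma strip_pos a l h : a \in Phi -> P l -> 0 < dot a l ->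
  (expw a h - 1) * tval (strip a l) h = (dot a l / 2)%:C * ((expw a h + 1) * (expw l h - expw (l *m refl a) h)).
Proof.
move=> aP hl al0; rewrite /strip al0 mul_reflection.
have : 0 < pairing l (cor a) by rewrite pairing_coroot (dotpC GP) divr_gt0 ?mulr_gt0// (root_norm_gt0 aP).
have /intrP[z zE] := hl a aP; rewrite zE ltr0z; case: z zE => // m _ m0 {hl}.
rewrite -[m%:Z%:~R]/(m%:R : R) natrK /tval big_map -mulr_sumr mulrCA; congr (_ * _).
set x := expw a h; set z := expw (- a) h.
have xz : x * z = 1 by rewrite /x /z -expwD subrr expw0.
have E i : expw (l - a *+ i) h = expw l h * z ^+ i.
  by rewrite expwD -mulNrn expwMn.
rewrite (eq_bigr (fun i => expw l h * z ^+ i)) => [|i _]; last exact: E.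
rewrite scaler_nat E -mulr_sumr mulrCA.
rewrite (_ : _ * (_ - _) = expw l h * ((x + 1) * (1 - z ^+ m))); last by ring.
congr (_ * _); rewrite big_cat mulrDr /=.
have geo r : (x - 1) * \sum_(0 <= i < r) z ^+ i = x - x * z ^+ r.
  have -> : x - 1 = x * (1 - z) by rewrite mulrBr mulr1 xz.
  by rewrite -mulrA big_mkord -[1 - z]opprB mulNr -subrX1 opprB mulrBr mulr1.
case: m m0 => // m _ /=.
have -> : \sum_(i <- 0 :: iota 1 m.+1) z ^+ i = \sum_(0 <= i < m.+2) z ^+ i by rewrite /index_iota subn0.
have -> : \sum_(i <- iota 1 m) z ^+ i = z * \sum_(0 <= i < m) z ^+ i.
  have -> : iota 1 m = [seq i.+1 | i <- index_iota 0 m] by rewrite /index_iota subn0 -(iotaDl 1 0).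
  by rewrite big_map mulr_sumr; apply: eq_bigr => i _; rewrite exprS.
rewrite mulrCA; have g1 := geo m.+2; have g2 := geo m.
rewrite [X in X + _]g1 [X in z * X]g2 !exprS.
have -> : z * (x - x * z ^+ m) = x * z - x * z * z ^+ m by ring.
have -> : x * (z * (z * z ^+ m)) = x * z * (z * z ^+ m) by ring.
have -> : (x + 1) * (1 - z * z ^+ m) = x - x * z * z ^+ m + 1 - z * z ^+ m by ring.
by rewrite xz; ring.
Qed.

(** At most one of the two strips is nonempty, according to the sign of (a|l); the case of a
    negative sign is the positive one for [- a], which has the same reflection. *)
Lemma strip_rel a l h : a \in Phi -> P l ->
  (expw a h - 1) * (tval (strip a l) h + tval (strip (- a) l) h) =
  (dot a l / 2)%:C * ((expw a h + 1) * (expw l h - expw (l *m refl a) h)).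
Proof.
move=> aP hl; have rN : refl (- a) = refl a.
  have tN : (- a)^T = - a^T by rewrite linearN.
  by rewrite /reflection /coroot dotpNl (dotpNr GP) opprK tN !(mulmxN, mulNmx, scalerN, opprK).
have nilE b : ~~ (0 < dot b l) -> tval (strip b l) h = 0.
  by rewrite /strip => /negbTE ->; rewrite /tval big_nil.
have [al0|al0|al0] := ltgtP 0 (dot a l).
- by rewrite (nilE (- a)) ?addr0 ?strip_pos// dotpNl oppr_gt0 -leNgt ltW.
- rewrite (nilE a) ?add0r -?leNgt ?(ltW al0)//.
  have := strip_pos h (root_opp aP) hl; rewrite dotpNl oppr_gt0 => /(_ al0).
  rewrite rN; set x := expw a h; set z := expw (- a) h.
  have xz : x * z = 1 by rewrite /x /z -expwD subrr expw0.
  move=> E; have -> : x - 1 = - x * (z - 1) by rewrite mulrBr mulNr xz; ring.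
  rewrite -mulrA E; have -> : x + 1 = x * (z + 1) by rewrite mulrDr xz; ring.
  by rewrite mulNr rmorphM rmorphN; ring.
by rewrite !nilE ?dotpNl -?al0 ?oppr0 ?ltxx// addr0 mulr0 mul0r mul0r.
Qed.

(** The contribution of one exponential to H_0. It is meaningful on invariant sums only, where the
    part of e^l symmetric under a reflection drops out. *)
Definition tau l h : C :=
  (dot l l + kc)%:C * expw l h + \sum_(a <- Phi) (k a)%:C * tval (strip a l) h.

Definition A0 s := flatten [seq (x.1 * (dot x.2 x.2 + kc)%:C, x.2) ::
  flatten [seq tscale (x.1 * (k a)%:C) (strip a x.2) | a <- Phi] | x <- s].

Lemma tval_A0 s h : tval (A0 s) h = \sum_(x <- s) x.1 * tau x.2 h.
Proof.
rewrite /A0 [LHS]/tval big_flatten big_map; apply: eq_bigr => x _.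
rewrite big_cons big_flatten big_map /tau mulrDr mulr_sumr mulrA; congr (_ + _).
by apply: eq_bigr => a _; rewrite -/(tval _ _) tval_scale mulrA.
Qed.

Lemma wts_A0 s : wts s -> wts (A0 s).
Proof.
move=> hs y /flatten_mapP[x /hs hx]; rewrite inE => /orP[/eqP ->//|/flatten_mapP[a aP]].
by apply: wts_scale; exact: strip_wts.
Qed.

Lemma A0_eq s t : wts s -> wts t -> tval s = tval t -> tval (A0 s) = tval (A0 t).
Proof.
move=> hs ht st; apply/funext => h; apply/eqP; rewrite -subr_eq0; apply/eqP.
have hst : wts (s ++ tscale (-1) t) by apply: wts_cat => //; exact: wts_scale.
have := tval_linear (fun l => tau l h) hst.
rewrite big_cat big_map /= !tval_A0.
under [X in _ + X]eq_bigr do rewrite mulN1r mulNr.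
rewrite sumrN; apply => l hl.
have -> : tval (s ++ tscale (-1) t) = tval [::].
  by apply/funext => y; rewrite tval_cat tval_scale mulN1r st subrr /tval big_nil.
by rewrite coef_tval ?big_nil.
Qed.

Lemma tauM w l h : Wg w -> tau (l *m w) h = tau l (w *m h).
Proof.
move=> hw; rewrite /tau (weyl_dotp _ _ hw) expwM; congr (_ + _).
rewrite -(big_weyl _ _ hw); apply: eq_big_seq => a aP.
by rewrite stripM// cm_couplingP.
Qed.

Lemma A0_invariant s : wts s -> weyl_invariant D (tval s) -> weyl_invariant D (tval (A0 s)).
Proof.
move=> hs sw w h hw; pose t := [seq (x.1, x.2 *m w) | x <- s].
have ht : wts t by move=> _ /mapP[x xs ->]; apply: weyl_weight => //; exact: hs.
have E : tval s = tval t.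
  apply/funext => y; rewrite -(sw w y hw) /tval big_map.
  by apply: eq_bigr => x _; rewrite expwM.
rewrite [RHS](congr1 (fun f => f h) (A0_eq hs ht E)) !tval_A0 big_map.
by apply: eq_bigr => x _ /=; rewrite tauM.
Qed.

Lemma reflect_sum s a h : a \in Phi -> wts s -> weyl_invariant D (tval s) ->
  \sum_(x <- s) x.1 * ((dot a x.2)%:C * expw (x.2 *m refl a) h) =
  - \sum_(x <- s) x.1 * ((dot a x.2)%:C * expw x.2 h).
Proof.
move=> aP hs sw; pose t := [seq (x.1, x.2 *m refl a) | x <- s]; have hw := weyl_refl aP.
have ht : wts t by move=> _ /mapP[x xs ->]; apply: weyl_weight => //; exact: hs.
have hst : wts (s ++ tscale (-1) t) by apply: wts_cat => //; exact: wts_scale.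
have := tval_linear (fun l => (dot a l)%:C * expw l h) hst.
rewrite big_cat !big_map /= => E.
have {E} : \sum_(i <- s) i.1 * ((dot a i.2)%:C * expw i.2 h) +
   \sum_(j <- s) -1 * j.1 * ((dot a (j.2 *m refl a))%:C * expw (j.2 *m refl a) h) = 0.
  apply: E => l hl.
  have -> : tval (s ++ tscale (-1) t) = tval [::].
    apply/funext => y; rewrite tval_cat tval_scale mulN1r /tval big_map big_nil.
    rewrite -[X in X - _](sw _ y hw) /tval -sumrB big1// => x _ /=.
    by rewrite expwM subrr.
  by rewrite coef_tval ?big_nil.
have a0 := root_neq0 aP.
have dE l : dot a (l *m refl a) = - dot a l.
  by rewrite -(reflection_dotp GP a _ a0) (reflection_self GP a0) -mulmxA (reflectionK GP a0) mulmx1 dotpNl.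
under [X in _ + X]eq_bigr => x _ do rewrite dE mulN1r rmorphN !mulNr mulrN opprK.
by move/eqP; rewrite addrC addr_eq0 => /eqP.
Qed.

(** By [reflect_sum] the difference e^l - e^(s_a l) counts e^l twice in the sum, which cancels the
    1/2 in the coefficients of [strip]. *)
Lemma strip_sum s a h : a \in Phi -> wts s -> weyl_invariant D (tval s) ->
  (expw a h - 1) * \sum_(x <- s) x.1 * (tval (strip a x.2) h + tval (strip (- a) x.2) h) =
  (expw a h + 1) * \sum_(x <- s) x.1 * ((dot a x.2)%:C * expw x.2 h).
Proof.
move=> aP hs sw; have E := reflect_sum h aP hs sw.
have half (S : C) : S = (2^-1)%:C * (S - - S).
  by case: S => p q; apply/eqP; rewrite eq_complex /=; apply/andP; split; apply/eqP; field.
have -> : \sum_(x <- s) x.1 * ((dot a x.2)%:C * expw x.2 h) = (2^-1)%:C *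
   (\sum_(x <- s) x.1 * ((dot a x.2)%:C * expw x.2 h) - \sum_(x <- s) x.1 * ((dot a x.2)%:C * expw (x.2 *m refl a) h)).
  by rewrite E -half.
rewrite -sumrB !mulr_sumr; apply: eq_big_seq => x /hs hx.
rewrite mulrCA (strip_rel h aP hx) rmorphM /=; ring.
Qed.

Lemma strip_ct s a h : a \in Phi_plus -> offwall h -> wts s -> weyl_invariant D (tval s) ->
  \sum_(x <- s) x.1 * (tval (strip a x.2) h + tval (strip (- a) x.2) h) =
  - ('i * (ct a h)%:C) * \sum_(x <- s) x.1 * ((dot a x.2)%:C * expw x.2 h).
Proof.
move=> ap oh hs sw; have aP := pos_root ap; have c0 := offwall_cos oh ap.
have x0 : expw a h - 1 != 0.
  apply: contra c0 => /eqP /(congr1 (@Re R)) /= E.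
  by rewrite -oppr_eq0 opprB; apply/eqP; move: E; rewrite /expw.
apply: (mulfI x0); rewrite strip_sum// mulrA; congr (_ * _).
apply/eqP; rewrite eq_complex /ct /=; move: c0 (cos2Dsin2 (pairing a h)).
move: (cos _) (sin _) => c t c0 E.
have tE : t * t = (1 - c) * (1 + c) by rewrite -expr2 -[LHS](addKr (c ^+ 2)) E; ring.
have tE2 : t * (t / (1 - c)) = 1 + c by rewrite mulrA tE mulrC mulrA mulVf// mul1r.
by apply/andP; split; apply/eqP; [transitivity (t * (t / (1 - c)));[rewrite tE2|]|]; field.
Qed.

(** The cotangent terms of [H0_offwall] are rewritten as polynomials by [strip_ct]. On the walls the
    two sides may differ, as H_0 is computed there by division by 0. *)
Lemma H0_A0 s h : wts s -> weyl_invariant D (tval s) -> offwall h -> H_0 D (tval s) h = tval (A0 s) h.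
Proof.
move=> hs sw oh; rewrite H0_offwall// tval_A0.
have -> : \sum_(x <- s) x.1 * tau x.2 h = \sum_(x <- s) x.1 * ((dot x.2 x.2 + kc)%:C * expw x.2 h)
   + \sum_(a <- Phi_plus) (k a)%:C * \sum_(x <- s) x.1 * (tval (strip a x.2) h + tval (strip (- a) x.2) h).
  under [X in _ + X]eq_bigr do rewrite mulr_sumr.
  rewrite exchange_big -big_split; apply: eq_bigr => x _ /=.
  rewrite /tau mulrDr big_pos_opp mulr_sumr; congr (_ + _); apply: eq_big_seq => a ap.
  by rewrite coupling_opp ?pos_root// -mulrDr mulrCA.
rewrite [X in _ + X](eq_big_seq (fun a => (k a)%:C * (- ('i * (ct a h)%:C) *
    \sum_(x <- s) x.1 * ((dot a x.2)%:C * expw x.2 h)))); last by move=> a ap; rewrite strip_ct.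
under [X in _ + X]eq_bigr do rewrite !mulr_sumr.
rewrite exchange_big -big_split; apply: eq_bigr => x _ /=.
rewrite mulrBl mulrBr; congr (_ + _); rewrite rmorph_sum mulr_sumr mulr_suml mulr_sumr -sumrN.
by apply: eq_bigr => a _; rewrite !rmorphM; ring.
Qed.

End jacobi_operator.

(** * Green's formula with the weight Delta^2 *)

Section green_formula.
Implicit Types (l m a b : 'rV[R]_n) (h : hR) (s t r : seq (C * 'rV[R]_n)).

Section fixed_function.
Variable s : seq (C * 'rV[R]_n).
Hypothesis hs : wts s.

(* [gdot t] is the scalar product of the gradients of [tval s] and [tval t]. *)
Definition dlt m h : C := - \sum_(x <- s) x.1 * ((dot x.2 m)%:C * expw x.2 h).
Definition gdot t h : C := \sum_(y <- t) y.1 * (expw y.2 h * dlt y.2 h).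
Definition lap h : C := - \sum_(x <- s) x.1 * ((dot x.2 x.2)%:C * expw x.2 h).

(* [du] is the derivative of [u] along the gradient of [tval s]. *)
Definition TD (u du : hR -> C) := exists t, [/\ wts t, u = tval t & du = gdot t].

Lemma dltD l m h : dlt (l + m) h = dlt l h + dlt m h.
Proof.
rewrite /dlt -opprD -big_split; congr (- _); apply: eq_bigr => x _ /=.
by rewrite (dotpDr GP) rmorphD mulrDl mulrDr.
Qed.

Lemma dltN m h : dlt (- m) h = - dlt m h.
Proof.
rewrite /dlt; congr (- _); rewrite -sumrN; apply: eq_bigr => x _ /=.
by rewrite (dotpNr GP) rmorphN mulNr mulrN.
Qed.

Lemma gdot_tval t : wts t -> exists2 r, wts r & gdot t = tval r.
Proof.
move=> ht; exists (flatten [seq [seq (- (y.1 * x.1 * (dot x.2 y.2)%:C), y.2 + x.2) | x <- s] | y <- t]).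
  move=> _ /flatten_mapP[y /ht hy /mapP[x /hs hx ->]]; exact: weightD.
apply/funext => h; rewrite /gdot /tval big_flatten big_map; apply: eq_bigr => y _.
rewrite big_map /dlt mulrN mulrN !mulr_sumr -sumrN; apply: eq_bigr => x _ /=.
by rewrite expwD; ring.
Qed.

Lemma lap_tval : exists2 r, wts r & lap = tval r.
Proof.
exists [seq (- (x.1 * (dot x.2 x.2)%:C), x.2) | x <- s]; first by move=> _ /mapP[x /hs hx ->].
apply/funext => h; rewrite /lap /tval big_map -sumrN; apply: eq_bigr => x _ /=.
by rewrite mulrA mulNr.
Qed.

Lemma TD_cst c : TD (fun=> c) (fun=> 0).
Proof.
exists [:: (c, 0)]; split; first by move=> x; rewrite inE => /eqP ->; exact: weight0.
  by apply/funext => h; rewrite /tval big_seq1 expw0 mulr1.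
apply/funext => h; rewrite /gdot big_seq1 /dlt big1 ?oppr0 ?mulr0// => x _.
by rewrite (dotpC GP) dotp0l mul0r mulr0.
Qed.

Lemma TD_add u du v dv : TD u du -> TD v dv -> TD (fun h => u h + v h) (fun h => du h + dv h).
Proof.
move=> [t [ht -> ->]] [r [hr -> ->]]; exists (t ++ r); split; first exact: wts_cat.
  by apply/funext => h; rewrite tval_cat.
by apply/funext => h; rewrite /gdot big_cat.
Qed.

Lemma TD_scale c u du : TD u du -> TD (fun h => c * u h) (fun h => c * du h).
Proof.
move=> [t [ht -> ->]]; exists (tscale c t); split; first exact: wts_scale.
  by apply/funext => h; rewrite tval_scale.
by apply/funext => h; rewrite /gdot big_map mulr_sumr; apply: eq_bigr => x _; rewrite mulrA.
Qed.

Lemma TD_mul u du v dv : TD u du -> TD v dv ->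
  TD (fun h => u h * v h) (fun h => u h * dv h + du h * v h).
Proof.
move=> [t [ht -> ->]] [r [hr -> ->]]; exists (tmul t r); split; first exact: wts_mul.
  by apply/funext => h; rewrite tval_mul.
apply/funext => h; rewrite /gdot /tmul /tval big_allpairs_dep !mulr_suml -big_split.
apply: eq_bigr => y _; rewrite /= !mulr_sumr -big_split; apply: eq_bigr => z _ /=.
by rewrite expwD dltD; ring.
Qed.

Lemma TD_sum (I : eqType) (r : seq I) (u du : I -> hR -> C) :
  (forall i, i \in r -> TD (u i) (du i)) -> TD (fun h => \sum_(i <- r) u i h) (fun h => \sum_(i <- r) du i h).
Proof.
elim: r => [|i r IH] H.
  by under eq_fun do rewrite big_nil; under [X in TD _ X]eq_fun do rewrite big_nil; exact: TD_cst.
under eq_fun do rewrite big_cons; under [X in TD _ X]eq_fun do rewrite big_cons.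
by apply: TD_add; [apply: H; rewrite inE eqxx|apply: IH => j jr; apply: H; rewrite inE jr orbT].
Qed.

Lemma TD_eq u du v dv : TD u du -> u =1 v -> du =1 dv -> TD v dv.
Proof. by move=> H /funext <- /funext <-. Qed.

(** The integrand is the divergence of [u] times the gradient of [tval s]. As a sum of derivatives
    of exponentials, its coefficient at the weight 0 vanishes. *)
Lemma TD_green u du : TD u du -> cint mu (fun x => du (tp x) + u (tp x) * lap (tp x)) = 0.
Proof.
move=> [t [ht -> ->]].
pose L := flatten [seq dtr (G *m x.2^T) (tmul [:: (x.1 * (0 +i* 1), x.2)] t) | x <- s].
have hL : wts L.
  move=> _ /flatten_mapP[x /hs hx /mapP[y yt ->]] /=.
  apply: (wts_mul _ ht yt) => z; by rewrite inE => /eqP ->.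
have -> : (fun x => gdot t (tp x) + tval t (tp x) * lap (tp x)) = (fun x : T => tval L (tp x)).
  apply/funext => z; move: (tp z) => h.
  rewrite /L /tval big_flatten big_map /gdot /lap mulrN mulr_sumr -sumrN.
  have dE (y : C * 'rV[R]_n) : y.1 * (expw y.2 h * dlt y.2 h) =
      \sum_(x <- s) - (y.1 * (expw y.2 h * (x.1 * ((dot x.2 y.2)%:C * expw x.2 h)))).
    by rewrite /dlt !mulrN sumrN -!mulr_sumr.
  rewrite [X in X + _](eq_bigr _ (fun y _ => dE y)).
  rewrite exchange_big -big_split; apply: eq_bigr => x _ /=.
  rewrite /dtr big_map big_allpairs_dep big_seq1 mulr_suml -sumrN -big_split; apply: eq_bigr => y _ /=.
  rewrite expwD pairingDl !/(pairing _ (_ *m _)) !mulmxA -!/(dot _ _) (dotpC GP y.2).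
  rewrite (_ : 0 +i* (_ + _) = (0 +i* 1) * ((dot x.2 x.2)%:C + (dot x.2 y.2)%:C)); last first.
    by rewrite -rmorphD; apply/eqP; rewrite eq_complex /=; apply/andP; split; apply/eqP; ring.
  have j2 : (0 +i* 1) * (0 +i* 1) = -1 :> C.
    by apply/eqP; rewrite eq_complex /=; apply/andP; split; apply/eqP; ring.
  move: (0 +i* 1 : C) j2 (expw x.2 h) (expw y.2 h) (dot x.2 x.2)%:C (dot x.2 y.2)%:C => j j2 X Y A B.
  rewrite (_ : x.1 * j * y.1 * (j * _) * _ = j * j * (x.1 * y.1 * (A + B) * (X * Y))); last by ring.
  by rewrite j2; ring.
rewrite cint_tval// big_seq big1// => _ /flatten_mapP[x _ /mapP[y _ ->]] /=.
by have [->|] := eqVneq y.2 0; rewrite ?pairing0l ?mulr0 ?mul0r.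
Qed.

Lemma TD_bounded u du : TD u du -> exists2 K : R, 0 <= K &
  forall h, normc (u h) <= K /\ normc (du h) <= K.
Proof.
move=> [t [ht -> ->]]; have [r hr ->] := gdot_tval ht.
have [K1 K10 h1] := tval_bound t; have [K2 K20 h2] := tval_bound r.
exists (K1 + K2) => [|h]; first exact: addr_ge0.
by split; [apply: le_trans (h1 h) _; rewrite lerDl|apply: le_trans (h2 h) _; rewrite lerDr].
Qed.

Lemma TD_meas u du : TD u du -> cmeas (fun x : T => u (tp x)) /\ cmeas (fun x : T => du (tp x)).
Proof. by move=> [t [ht -> ->]]; have [r hr ->] := gdot_tval ht; split; exact: cmeas_tval. Qed.

Section exponential.
Variables (g : hR -> R) (dg : hR -> C).
Hypothesis gP : TD (fun h => (g h)%:C) dg.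

Lemma TD_pow j : TD (fun h => (g h ^+ j.+1 / j.+1%:R)%:C) (fun h => (g h ^+ j)%:C * dg h).
Proof.
have H : TD (fun h => (g h ^+ j.+1)%:C) (fun h => (j.+1%:R * g h ^+ j)%:C * dg h).
  elim: j => [|j IH].
    by apply: TD_eq gP _ _ => h; rewrite ?expr1// mulr1 mul1r.
  apply: TD_eq (TD_mul gP IH) _ _ => h /=; first by rewrite -rmorphM -exprS.
  rewrite mulrA -rmorphM [dg h * _]mulrC -mulrDl -rmorphD; congr (_%:C * _).
  by rewrite -[j.+2%:R]natr1 !exprS; ring.
apply: TD_eq (TD_scale (j.+1%:R^-1)%:C H) _ _ => h /=; first by rewrite -rmorphM mulrC.
by rewrite mulrA -rmorphM mulKf// pnatr_eq0.
Qed.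

Definition exps M x : R := \sum_(j <- iota 0 M) x ^+ j / j`!%:R.

Lemma TD_exps M : TD (fun h => (exps M.+1 (g h))%:C) (fun h => (exps M (g h))%:C * dg h).
Proof.
have E j : TD (fun h => (g h ^+ j.+1 / j.+1`!%:R)%:C) (fun h => (g h ^+ j / j`!%:R)%:C * dg h).
  apply: TD_eq (TD_scale (j`!%:R^-1)%:C (TD_pow j)) _ _ => h /=.
    by rewrite -rmorphM factS natrM invfM; congr (_%:C); ring.
  by rewrite mulrA -rmorphM [_^-1 * _]mulrC.
have H : TD (fun h => \sum_(j <- iota 0 M) (g h ^+ j.+1 / j.+1`!%:R)%:C)
    (fun h => \sum_(j <- iota 0 M) (g h ^+ j / j`!%:R)%:C * dg h) by apply: TD_sum.
apply: TD_eq (TD_add (TD_cst 1) H) _ _ => h /=.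
  rewrite /exps /= big_cons fact0 expr0 divr1 -(addn0 1%N) iotaDl big_map rmorphD rmorph1 rmorph_sum.
  by [].
by rewrite add0r -mulr_suml /exps rmorph_sum.
Qed.

Lemma exps_cvg x : exps M x @[M --> \oo] --> expR x.
Proof.
have -> : (fun M => exps M x) = series (exp_coeff x).
  by apply/funext => M; rewrite /exps /series /= /index_iota subn0.
exact: is_cvg_series_exp_coeff.
Qed.

Lemma exps_le M x (K : R) : `|x| <= K -> `|exps M x| <= expR K.
Proof.
move=> xK; have K0 : 0 <= K by exact: le_trans xK.
apply: (@le_trans _ _ (exps M K)).
  apply: (le_trans (ler_norm_sum _ _ _)); apply: ler_sum => j _.
  have j0 : 0 <= (j`!%:R : R)^-1 by rewrite invr_ge0.
  rewrite normrM normrX (ger0_norm j0) ler_wpM2r//.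
  by apply: lerXn2r; rewrite ?nnegrE.
have c := @exps_cvg K; rewrite -(cvg_lim (@Rhausdorff R) c).
apply: nondecreasing_cvgn_le; last by apply/cvg_ex; exists (expR K).
apply/nondecreasing_seqP => m; rewrite /exps -addn1 iotaD big_cat big_seq1 /= add0n lerDl.
by rewrite divr_ge0// exprn_ge0.
Qed.

Lemma cint_lim0 (u : nat -> T -> C) F (K : R) : (forall i, cmeas (u i)) ->
  (forall i x, normc (u i x) <= K) -> (forall x, ccvg (u^~ x) (F x)) ->
  (forall i, cint mu (u i) = 0) -> cint mu F = 0.
Proof.
move=> mu' uK uF u0; apply: small_eq0 => e e0'.
have [N hN] := cint_dct (cube_fin n) mu' uK uF e0'.
by have := hN N (leqnn N); rewrite u0 sub0r normcN.
Qed.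

(** [TD_green] is applied to the polynomials exps(g) u. The derivative of a partial exponential sum
    is the preceding one times [dg], so dominated convergence gives the formula with the weight
    exp(g). *)
Lemma green_exp u du : TD u du ->
  cint mu (fun x => (expR (g (tp x)))%:C * (du (tp x) + u (tp x) * lap (tp x)) +
     (expR (g (tp x)))%:C * (dg (tp x) * u (tp x))) = 0.
Proof.
move=> hu; have [r hr rE] := lap_tval.
have [Kl Kl0 hl] := tval_bound r; have [Ku Ku0 bu] := TD_bounded hu; have [Kg Kg0 bg] := TD_bounded gP.
have [mg mdg] := TD_meas gP; have [mu1 mdu] := TD_meas hu.
have ml : cmeas (fun x : T => lap (tp x)) by rewrite rE; exact: cmeas_tval.
pose F i (x : T) := (exps i.+1 (g (tp x)))%:C * (du (tp x) + u (tp x) * lap (tp x)) +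
     (exps i (g (tp x)))%:C * (dg (tp x) * u (tp x)).
have me i : cmeas (fun x : T => (exps i (g (tp x)))%:C).
  have -> : (fun x : T => (exps i (g (tp x)))%:C) = (fun x : T => \sum_(j <- iota 0 i) (j`!%:R^-1)%:C * (g (tp x))%:C ^+ j).
    by apply/funext => x; rewrite /exps rmorph_sum; apply: eq_bigr => j _; rewrite -rmorphXn -rmorphM mulrC.
  apply: cmeas_sum => j; apply: cmeasM; first exact: cmeas_cst.
  elim: j => [|j IH]; first by under eq_fun do rewrite expr0; exact: cmeas_cst.
  by under eq_fun do rewrite exprS; apply: cmeasM.
apply: (@cint_lim0 F _ (expR Kg * (Ku + Ku * Kl) + expR Kg * (Kg * Ku))).
- by move=> i; apply: cmeasD; apply: cmeasM => //; [apply: cmeasD => //|]; apply: cmeasM.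
- move=> i x; have be j : normc (exps j (g (tp x)))%:C <= expR Kg.
    by rewrite normc_real; apply: exps_le; rewrite -normc_real; case: (bg (tp x)).
  have [b1 b2] := bu (tp x); have [_ b3] := bg (tp x).
  apply: (le_trans (le_normcD _ _)); rewrite !normcM; apply: lerD.
    apply: ler_pM; rewrite ?normc_ge0//; apply: (le_trans (le_normcD _ _)); apply: lerD => //.
    by rewrite normcM; apply: ler_pM; rewrite ?normc_ge0// rE.
  by apply: ler_pM; rewrite ?mulr_ge0 ?normc_ge0//; apply: ler_pM; rewrite ?normc_ge0.
- move=> x; apply: ccvgD; apply: ccvgZ; apply: ccvg_real; last exact: exps_cvg.
  have := @exps_cvg (g (tp x)); by rewrite -(cvg_shiftS (fun M => exps M (g (tp x)))).
- move=> i; rewrite -[RHS](TD_green (TD_mul (TD_exps i) hu)); congr cint; apply/funext => x.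
  by rewrite /F; ring.
Qed.

End exponential.

End fixed_function.

Lemma ccvg0 (u : nat -> R) (z : C) : u @ \oo --> 0 -> ccvg (fun i => (u i)%:C * z) 0.
Proof. by move=> h; rewrite -(mul0r z); apply: ccvgZ; exact: ccvg_real. Qed.

Section invariant.
Variable s : seq (C * 'rV[R]_n).
Hypotheses (hs : wts s) (sw : weyl_invariant D (tval s)).

Definition Qf a h : C := \sum_(x <- s) x.1 * (tval (strip a x.2) h + tval (strip (- a) x.2) h).
Definition ta a h : R := 1 - sinsq a h.

Lemma ta_itv a h : 0 <= ta a h <= 1.
Proof. by rewrite /ta subr_ge0 sinsq_le1 gerBl sinsq_ge0. Qed.

(** The derivative of cos^2 of the half angle along the gradient of an invariant function is
    divisible by sin^2 of the half angle, by [strip_sum]. Hence the derivative of [logs N (ta a h)]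
    is (1 - ta^N) times the polynomial [Qf]: no singularity at the walls survives, uniformly in
    N. *)
Lemma TD_ta a : a \in Phi -> TD s (fun h => (ta a h)%:C) (fun h => (sinsq a h)%:C * Qf a h).
Proof.
move=> aP; pose t : seq (C * 'rV[R]_n) := [:: ((2^-1)%:C, 0); ((4^-1)%:C, a); ((4^-1)%:C, - a)].
have cosE h : (cos (pairing a h))%:C = (2^-1)%:C * (expw a h + expw (- a) h).
  by rewrite expwN /expw; apply/eqP; rewrite eq_complex /=; apply/andP; split; apply/eqP; field.
exists t; split.
- move=> x; rewrite !inE => /or3P[] /eqP -> /=; first exact: weight0.
    exact: root_weight.
  by apply: weightN; exact: root_weight.
- apply/funext => h; rewrite /tval !big_cons big_nil expw0 addr0 /= -mulrDr /ta /sinsq.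
  have -> : (4^-1)%:C * (expw a h + expw (- a) h) = (2^-1)%:C * (cos (pairing a h))%:C.
    by rewrite cosE mulrA -rmorphM; congr (_%:C * _); field.
  by rewrite mulr1 -rmorphM -rmorphD; congr (_%:C); field.
apply/funext => h; rewrite /gdot !big_cons big_nil /= addr0.
have z0 : dlt s 0 h = 0.
  by rewrite /dlt big1 ?oppr0// => x _; rewrite (dotpC GP) dotp0l mul0r mulr0.
rewrite z0 !mulr0 add0r dltN.
have := strip_sum h aP hs sw; rewrite -/(Qf a h).
have -> : \sum_(x <- s) x.1 * ((dot a x.2)%:C * expw x.2 h) = - dlt s a h.
  by rewrite /dlt opprK; apply: eq_bigr => x _; rewrite (dotpC GP).
have -> : (sinsq a h)%:C = (4^-1)%:C * (1 + 1 - expw a h - expw (- a) h).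
  by rewrite expwN /expw /sinsq; apply/eqP; rewrite eq_complex /=; apply/andP; split; apply/eqP; field.
have xz : expw a h * expw (- a) h = 1 by rewrite -expwD subrr expw0.
move: (expw a h) (expw (- a) h) xz (Qf a h) (dlt s a h) ((4^-1)%:C : C) => x z xz Q d c E.
have -> : 1 + 1 - x - z = - z * (x - 1) * (x - 1).
  rewrite (_ : - z * (x - 1) * (x - 1) = (x * z) * (1 + 1 - x) - z); last by ring.
  by rewrite xz mul1r.
rewrite (_ : c * (- z * (x - 1) * (x - 1)) * Q = - (c * z * (x - 1)) * ((x - 1) * Q)); last by ring.
rewrite E (_ : - (c * z * (x - 1)) * ((x + 1) * - d) = c * (x * z * x - z) * d); last by ring.
by rewrite xz; ring.
Qed.

(* A trigonometric polynomial with [expR (gN N)] tending to [Delta ^+ 2], the product of the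
   [(1 - ta a) `^ k a]: [logs N] is a partial sum of the series of [- ln (1 - t)]. *)
Definition gN N h : R := - \sum_(a <- Phi_plus) k a * logs N (ta a h).
Definition dgN N h : C := - \sum_(a <- Phi_plus) (k a)%:C * ((1 - ta a h ^+ N)%:C * Qf a h).

Lemma TD_gN N : TD s (fun h => (gN N h)%:C) (dgN N).
Proof.
have H1 a : a \in Phi_plus -> TD s (fun h => (k a)%:C * \sum_(j <- iota 0 N) (ta a h ^+ j.+1 / j.+1%:R)%:C)
   (fun h => (k a)%:C * \sum_(j <- iota 0 N) (ta a h ^+ j)%:C * ((sinsq a h)%:C * Qf a h)).
  move=> /pos_root aP; apply: TD_scale; apply: TD_sum => j _; exact: (TD_pow (TD_ta aP)).
apply: TD_eq (TD_scale (-1) (TD_sum H1)) _ _ => h /=.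
  rewrite mulN1r /gN rmorphN rmorph_sum; congr (- _); apply: eq_bigr => a _.
  by rewrite rmorphM /logs rmorph_sum.
rewrite mulN1r /dgN; congr (- _); apply: eq_bigr => a _; congr (_ * _).
rewrite -mulr_suml mulrA -rmorph_sum -rmorphM; congr (_%:C * _).
rewrite -[N in iota _ N]subn0 -/(index_iota 0 N) big_mkord /ta.
by rewrite -[X in _ * X](subKr 1) mulrC -opprB mulNr -subrX1 opprB.
Qed.

Lemma Qf_tval a : a \in Phi -> exists2 q, wts q & Qf a = tval q.
Proof.
move=> aP; exists (flatten [seq tscale x.1 (strip a x.2 ++ strip (- a) x.2) | x <- s]).
  move=> y /flatten_mapP[x /hs hx]; apply: wts_scale.
  by apply: wts_cat; apply: strip_wts => //; exact: root_opp.
apply/funext => h; rewrite [RHS]/tval big_flatten big_map; apply: eq_bigr => x _.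
by rewrite -/(tval _ _) tval_scale tval_cat.
Qed.

(** Off the walls, - Delta^-2 div(Delta^2 grad) applied to [tval s]: the operator H_0 without its
    constant, see [tval_A0_JA]. *)
Definition JA h : C := - lap s h + \sum_(a <- Phi_plus) (k a)%:C * Qf a h.

Lemma expR_gN N h : expR (gN N h) = \prod_(a <- Phi_plus) expR (- (k a * logs N (ta a h))).
Proof. by rewrite /gN -sumrN expR_sum. Qed.

Lemma expR_gN_le1 N h : expR (gN N h) <= 1.
Proof.
rewrite -[leRHS]expR0 ler_expR /gN oppr_le0 big_seq; apply: sumr_ge0 => a /pos_root aP.
by apply: mulr_ge0; [exact/ltW/kpos|apply: logs_ge0; case/andP: (ta_itv a h)].
Qed.

Lemma cvg_gN h : expR (gN N h) @[N --> \oo] --> Delta h ^+ 2.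
Proof.
rewrite Delta_sq; under eq_fun do rewrite expR_gN.
suff H (r : seq 'rV[R]_n) : {subset r <= Phi} -> (\prod_(a <- r) expR (- (k a * logs N (ta a h))) @[N --> \oo] -->
    \prod_(a <- r) sinsq a h `^ k a) by apply: H => a /pos_root.
elim: r => [|a r IH] sP.
  by under eq_fun do rewrite big_nil; rewrite big_nil; exact: cvg_cst.
under eq_fun do rewrite big_cons; rewrite big_cons; apply: cvgM; last first.
  by apply: IH => b br; apply: sP; rewrite inE br orbT.
have -> : sinsq a h = 1 - ta a h by rewrite /ta subKr.
apply: cvg_logs_powR; first exact: ta_itv.
by apply: kpos; apply: sP; rewrite inE eqxx.
Qed.

(** Off the wall of [a] the power tends to 0; on it the power stays 1, but the weight tends to
    Delta^2 = 0 since [k a > 0]. *)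
Lemma cvg_gN_pow a h : a \in Phi_plus -> expR (gN N h) * ta a h ^+ N @[N --> \oo] --> 0.
Proof.
move=> ap; have /andP[t0] := ta_itv a h; rewrite le_eqVlt => /orP[/eqP t1|t1].
  rewrite t1; under eq_fun do rewrite expr1n mulr1.
  have := @cvg_gN h; rewrite Delta_sq (big_rem a)//=.
  have -> : sinsq a h = 0 by move: t1; rewrite /ta => t1; lra.
  by rewrite powR0 ?mul0r// gt_eqF// kpos// pos_root.
rewrite -(mulr0 (Delta h ^+ 2)); apply: cvgM; first exact: cvg_gN.
by apply: cvg_expr; rewrite ger0_norm.
Qed.

(** [green_exp] for g = gN differs from the claim by terms with the factor ta^N; they tend to 0
    pointwise by [cvg_gN_pow], and everything is bounded independently of N because the weights are
    at most 1. *)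
Lemma green_weighted t : wts t -> cint mu (fun x => ((Delta (tp x)) ^+ 2)%:C *
   (gdot s t (tp x) - tval t (tp x) * JA (tp x))) = 0.
Proof.
move=> ht; have TDt : TD s (tval t) (gdot s t) by exists t.
pose F N (x : T) := (expR (gN N (tp x)))%:C * (gdot s t (tp x) + tval t (tp x) * lap s (tp x)) +
     (expR (gN N (tp x)))%:C * (dgN N (tp x) * tval t (tp x)).
have F0 N : cint mu (F N) = 0 by exact: (green_exp hs (TD_gN N) TDt).
have FE N (x : T) : F N x = (expR (gN N (tp x)))%:C * (gdot s t (tp x) - tval t (tp x) * JA (tp x)) +
   \sum_(a <- Phi_plus) (expR (gN N (tp x)) * ta a (tp x) ^+ N)%:C * ((k a)%:C * (Qf a (tp x) * tval t (tp x))).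
  rewrite /F /dgN /JA -mulrDr; move: (tp x) => h.
  have -> : \sum_(a <- Phi_plus) (expR (gN N h) * ta a h ^+ N)%:C * ((k a)%:C * (Qf a h * tval t h)) =
      (expR (gN N h))%:C * \sum_(a <- Phi_plus) (ta a h ^+ N)%:C * ((k a)%:C * (Qf a h * tval t h)).
    by rewrite mulr_sumr; apply: eq_bigr => a _; rewrite [RHS]mulrA -rmorphM.
  rewrite -mulrDr; congr (_ * _).
  have -> : \sum_(a <- Phi_plus) (k a)%:C * ((1 - ta a h ^+ N)%:C * Qf a h) =
     \sum_(a <- Phi_plus) (k a)%:C * Qf a h - \sum_(a <- Phi_plus) (ta a h ^+ N)%:C * ((k a)%:C * Qf a h).
    by rewrite -sumrB; apply: eq_bigr => a _; rewrite rmorphB rmorph1; ring.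
  have -> : \sum_(a <- Phi_plus) (ta a h ^+ N)%:C * ((k a)%:C * (Qf a h * tval t h)) =
     (\sum_(a <- Phi_plus) (ta a h ^+ N)%:C * ((k a)%:C * Qf a h)) * tval t h.
    by rewrite mulr_suml; apply: eq_bigr => a _; ring.
  ring.
have [r hr rE] := lap_tval hs; have [Kl Kl0 hl] := tval_bound r.
have [Kt Kt0 bt] := TD_bounded hs TDt; have [mt mdt] := TD_meas hs TDt.
have [KQ hKQ] : exists K : 'rV[R]_n -> R, forall a, a \in Phi_plus -> forall h, normc (Qf a h) <= K a.
  have H a : exists K : R, a \in Phi_plus -> forall h, normc (Qf a h) <= K.
    have [/pos_root aP|_] := boolP (a \in Phi_plus); last by exists 0.
    by have [q _ ->] := Qf_tval aP; have [K _ hK] := tval_bound q; exists K => _.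
  by have [K hK] := @choice _ _ _ H; exists K.
have ml : cmeas (fun x : T => lap s (tp x)) by rewrite rE; exact: cmeas_tval.
have mF N : cmeas (F N).
  have [mg mdg] := TD_meas hs (TD_gN N).
  have me : cmeas (fun x : T => (expR (gN N (tp x)))%:C).
    by apply: cmeas_real; case: mg => /= m1 _; exact: measurableT_comp.
  by apply: cmeasD; apply: cmeasM => //; [apply: cmeasD => //|]; apply: cmeasM.
have bE N (x : T) : 0 <= expR (gN N (tp x)) <= 1 by rewrite expR_ge0 expR_gN_le1.
have bJ h : normc (JA h) <= Kl + \sum_(a <- Phi_plus) k a * KQ a.
  rewrite /JA; apply: (le_trans (le_normcD _ _)); rewrite normcN; apply: lerD; first by rewrite rE.
  apply: (le_trans (normc_sum _ _ _)); rewrite big_seq [leRHS]big_seq; apply: ler_sum => a ap.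
  have k0 := kpos (pos_root ap).
  by rewrite normcM normc_real gtr0_norm// ler_wpM2l ?(ltW k0)// hKQ.
pose KJ := Kl + \sum_(a <- Phi_plus) k a * KQ a.
apply: (cint_lim0 (u := F) (K := Kt + Kt * KJ + \sum_(a <- Phi_plus) k a * (KQ a * Kt))) => //.
- move=> N x; rewrite FE; have /andP[E0 E1] := bE N x; have [b1 b2] := bt (tp x).
  have KJ0 : 0 <= KJ by apply: le_trans (bJ (tp x)); exact: normc_ge0.
  apply: (le_trans (le_normcD _ _)); apply: lerD.
    rewrite normcM normc_real ger0_norm// -[leRHS]mul1r.
    apply: ler_pM => //; rewrite ?normc_ge0//.
    apply: (le_trans (le_normcD _ _)); rewrite normcN normcM; apply: lerD => //.
    by apply: ler_pM; rewrite ?normc_ge0// bJ.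
  apply: (le_trans (normc_sum _ _ _)); rewrite big_seq [leRHS]big_seq; apply: ler_sum => a ap.
  have k0 := kpos (pos_root ap); have /andP[t0 t1] := ta_itv a (tp x).
  rewrite !normcM !normc_real (gtr0_norm k0) ger0_norm ?mulr_ge0 ?exprn_ge0// -[leRHS]mul1r.
  apply: ler_pM; rewrite ?mulr_ge0 ?normc_ge0 ?exprn_ge0 ?(ltW k0)//.
    by rewrite -[leRHS]mul1r; apply: ler_pM; rewrite ?exprn_ge0 ?exprn_ile1.
  rewrite ler_wpM2l ?(ltW k0)//; apply: ler_pM; rewrite ?normc_ge0//; exact: hKQ.
- move=> x; rewrite (_ : F^~ x = fun N => (expR (gN N (tp x)))%:C * (gdot s t (tp x) - tval t (tp x) * JA (tp x)) +
   \sum_(a <- Phi_plus) (expR (gN N (tp x)) * ta a (tp x) ^+ N)%:C * ((k a)%:C * (Qf a (tp x) * tval t (tp x)))); last first.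
    by apply/funext => N; exact: FE.
  rewrite -[X in ccvg _ X]addr0; apply: ccvgD; first by apply: ccvgZ; apply: ccvg_real; exact: cvg_gN.
  rewrite [X in ccvg _ X](_ : 0 = \sum_(a <- Phi_plus) (0 : C)); last by rewrite big1_eq.
  have H (rr : seq 'rV[R]_n) : {subset rr <= Phi_plus} -> ccvg (fun N => \sum_(a <- rr)
     (expR (gN N (tp x)) * ta a (tp x) ^+ N)%:C * ((k a)%:C * (Qf a (tp x) * tval t (tp x)))) (\sum_(a <- rr) 0).
    elim: rr => [|a rr IH] sub.
      by move=> e e0'; exists 0%N => j _; rewrite !big_nil subrr normc0 ltW.
    under eq_fun do rewrite big_cons; rewrite big_cons; apply: ccvgD.
      by apply: ccvg0; apply: cvg_gN_pow; apply: sub; rewrite inE eqxx.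
    by apply: IH => b br; apply: sub; rewrite inE br orbT.
  exact: H.
Qed.

End invariant.

Lemma gdotC s t h : gdot s t h = gdot t s h.
Proof.
rewrite /gdot /dlt.
have H (y : C * 'rV[R]_n) (r : seq (C * 'rV[R]_n)) : y.1 * (expw y.2 h * - \sum_(x <- r) x.1 * ((dot x.2 y.2)%:C * expw x.2 h)) =
   \sum_(x <- r) - (y.1 * (expw y.2 h * (x.1 * ((dot x.2 y.2)%:C * expw x.2 h)))).
  by rewrite !mulrN sumrN -!mulr_sumr.
rewrite (eq_bigr _ (fun y _ => H y s)) [RHS](eq_bigr _ (fun y _ => H y t)) exchange_big.
by apply: eq_bigr => x _; apply: eq_bigr => y _; rewrite (dotpC GP); ring.
Qed.

Lemma tval_A0_JA s h : tval (A0 s) h = JA s h + kc%:C * tval s h.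
Proof.
rewrite tval_A0 /JA /lap opprK /Qf /tval mulr_sumr.
have -> : \sum_(a <- Phi_plus) (k a)%:C * (\sum_(x <- s) x.1 * (tval (strip a x.2) h + tval (strip (- a) x.2) h)) =
   \sum_(x <- s) x.1 * \sum_(a <- Phi) (k a)%:C * tval (strip a x.2) h.
  under [RHS]eq_bigr => x _ do rewrite big_pos_opp.
  under [LHS]eq_bigr => a _ do rewrite mulr_sumr.
  under [RHS]eq_bigr => x _ do rewrite mulr_sumr.
  rewrite exchange_big; apply: eq_bigr => x _; apply: eq_big_seq => a ap /=.
  by rewrite coupling_opp ?pos_root//; ring.
rewrite -!big_split; apply: eq_bigr => x _ /=.
by rewrite /tau rmorphD; ring.
Qed.

(** By [green_weighted] either side is the weighted integral of the scalar product of the gradients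
    plus [kc] times the product, which is symmetric. There is no conjugation here; [H0v_sym] inserts
    it afterwards. *)
Lemma A0_symmetric s t : wts s -> wts t -> weyl_invariant D (tval s) -> weyl_invariant D (tval t) ->
  cint mu (fun x => (Delta (tp x) ^+ 2)%:C * (tval (A0 s) (tp x) * tval t (tp x))) =
  cint mu (fun x => (Delta (tp x) ^+ 2)%:C * (tval s (tp x) * tval (A0 t) (tp x))).
Proof.
move=> hs ht sw tw.
have H r q : wts r -> wts q -> weyl_invariant D (tval r) ->
  cint mu (fun x => (Delta (tp x) ^+ 2)%:C * (tval (A0 r) (tp x) * tval q (tp x))) =
  cint mu (fun x => (Delta (tp x) ^+ 2)%:C * (gdot r q (tp x) + kc%:C * (tval r (tp x) * tval q (tp x)))).
  move=> hr hq rw; have [g hg gE] := gdot_tval hr hq.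
  have hA := wts_A0 hr.
  pose p1 := g ++ tscale kc%:C (tmul r q).
  have iP (p : seq (C * 'rV[R]_n)) : cintg mu (fun x : T => (Delta (tp x) ^+ 2)%:C * tval p (tp x)).
    have [K K0 hK] := tval_bound p.
    apply: (cintg_bounded (cube_fin n) (K := K)).
      apply: cmeasM; last exact: cmeas_tval.
      apply: cmeas_real; apply: measurable_funX; exact: measurable_Delta.
    move=> x; rewrite normcM normc_real ger0_norm ?exprn_ge0 ?Delta_ge0// -[leRHS]mul1r.
    by apply: ler_pM; rewrite ?exprn_ge0 ?Delta_ge0 ?normc_ge0// exprn_ile1 ?Delta_ge0 ?Delta_le1.
  have E1 : (fun x : T => (Delta (tp x) ^+ 2)%:C * (gdot r q (tp x) + kc%:C * (tval r (tp x) * tval q (tp x)))) =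
     (fun x => (Delta (tp x) ^+ 2)%:C * tval p1 (tp x)).
    by apply/funext => x; rewrite /p1 tval_cat tval_scale tval_mul gE.
  have E2 : (fun x : T => (Delta (tp x) ^+ 2)%:C * (tval (A0 r) (tp x) * tval q (tp x))) =
     (fun x => (Delta (tp x) ^+ 2)%:C * tval (tmul (A0 r) q) (tp x)).
    by apply/funext => x; rewrite tval_mul.
  rewrite E1 E2; apply/eqP; rewrite -subr_eq0 -mulN1r -(cintZ _ (iP _)) -cintD//; last exact: cintgZ.
  apply/eqP; transitivity (- 1 * cint mu (fun x => ((Delta (tp x)) ^+ 2)%:C * (gdot r q (tp x) - tval q (tp x) * JA r (tp x)))).
    rewrite -cintZ.
      congr cint; apply/funext => x; rewrite tval_mul /p1 tval_cat tval_scale tval_mul gE tval_A0_JA; ring.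
    have -> : (fun x : T => ((Delta (tp x)) ^+ 2)%:C * (gdot r q (tp x) - tval q (tp x) * JA r (tp x))) =
      (fun x => (Delta (tp x) ^+ 2)%:C * tval (p1 ++ tscale (-1) (tmul (A0 r) q)) (tp x)).
      apply/funext => x; rewrite !tval_cat !tval_scale !tval_mul gE tval_A0_JA; congr (_ * _); ring.
    exact: iP.
  by rewrite green_weighted// mulr0.
rewrite H//.
have -> : (fun x : T => (Delta (tp x) ^+ 2)%:C * (tval s (tp x) * tval (A0 t) (tp x))) =
    (fun x => (Delta (tp x) ^+ 2)%:C * (tval (A0 t) (tp x) * tval s (tp x))).
  by apply/funext => x; rewrite [tval s _ * _]mulrC.
rewrite H//; congr cint; apply/funext => x.
by rewrite gdotC [tval s _ * _]mulrC.
Qed.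

End green_formula.

(** * H_0 on classes: invariant finite-dimensional subspaces and lower bound *)

Section hilbert_operator.
Implicit Types (l a : 'rV[R]_n) (h : hR) (s t : seq (C * 'rV[R]_n)) (w : 'M[R]_n) (v u : HV).

(** In the basis of the coroot lattice the coordinates of a weight are integers, and they are
    combinations of its pairings with coroots, bounded by the Cauchy-Schwarz inequality. *)
Lemma weights_finite (c : R) : exists S : seq 'rV[R]_n, forall l, l \in S <-> P l /\ dot l l <= c.
Proof.
have bnd i : exists N : nat, forall l, P l -> dot l l <= c -> `|(l *m B) 0 i| <= N%:R.
  have [q hq] : exists d : 'rV[R]_n -> int, B *m (delta_mx i 0 : 'cV[R]_n) = \sum_(a <- Phi) (d a)%:~R *: cor a.
    have [_ h] := cm_basisP D; apply/(h (B *m (delta_mx i 0 : 'cV[R]_n))).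
    exists (delta_mx i 0); congr (_ *m _); apply/matrixP => x y.
    by rewrite !mxE; case: (_ && _).
  exists (Num.truncn (\sum_(a <- Phi) `|(q a)%:~R : R| * (1 + 4 * c / dot a a))).+1 => l hl lc.
  apply/ltW; apply: le_lt_trans (truncnS_gt _).
  have -> : (l *m B) 0 i = pairing l (B *m (delta_mx i 0 : 'cV[R]_n)).
    by rewrite pairingM pairing_e.
  rewrite hq pairing_sumr; apply: (le_trans (ler_norm_sum _ _ _)).
  rewrite big_seq [leRHS]big_seq; apply: ler_sum => a aP.
  rewrite pairingZr normrM ler_wpM2l// pairing_coroot; have a0 := root_norm_gt0 aP.
  (* The Cauchy-Schwarz inequality bounds the square; this avoids a square root. *)
  have sq1 (x : R) : `|x| <= 1 + x ^+ 2.
    by rewrite -[x ^+ 2]real_normK ?num_real//; have := sqr_ge0 (`|x| - 1); have := normr_ge0 x; nra.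
  apply: (le_trans (sq1 _)); rewrite lerD2l.
  rewrite (_ : (_ / _) ^+ 2 = 4 * dot l a ^+ 2 / dot a a ^+ 2); last by field; rewrite gt_eqF.
  rewrite ler_pdivrMr ?exprn_gt0// (_ : 4 * c / dot a a * dot a a ^+ 2 = 4 * (c * dot a a)); last by field; rewrite gt_eqF.
  rewrite ler_wpM2l//; apply: (le_trans (cauchy_schwarz_dotp GP l a)).
  by rewrite ler_wpM2r// ltW.
have [N hN] := @choice _ _ _ bnd.
pose M := (\sum_i N i)%N.
(* Integer vectors with entries between -M and M, enumerated by ordinals shifted by M. *)
pose f2l (f : {ffun 'I_n -> 'I_M.*2.+1}) : 'rV[R]_n :=
  map_mx intr (\row_i ((f i : nat)%:Z - M%:Z)) *m invmx B.
exists [seq l <- [seq f2l f | f <- enum [set: {ffun 'I_n -> 'I_M.*2.+1}]] | `[< P l /\ dot l l <= c >]] => l.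
rewrite mem_filter; split=> [/andP[/asboolP]//|[hl lc]].
apply/andP; split; first exact/asboolP.
have zex i : exists z : int, (l *m B) 0 i = z%:~R.
  by have /intrP[z ->] := weight_basis_int i hl; exists z.
have [z zE] := @choice _ _ _ zex.
have zM i : `|z i| <= M%:Z.
  rewrite -(ler_int R) intr_norm -zE; apply: (le_trans (hN i l hl lc)).
  rewrite -[M%:Z%:~R]/(M%:R : R) ler_nat /M (bigD1 i)//=; exact: leq_addr.
have zlt i : (absz (z i + M%:Z)%R < M.*2.+1)%N.
  have := zM i; lia.
apply/mapP; exists [ffun i => Ordinal (zlt i)]; first by rewrite mem_enum inE.
rewrite -[LHS](mulmxK basis_unit) /f2l; congr (_ *m _).
apply/rowP => i; rewrite zE !mxE ffunE /=; congr (_%:~R).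
have := zM i; lia.
Qed.

Definition weights_le (c : R) := projT1 (cid (weights_finite c)).
Lemma weights_leP c l : l \in weights_le c <-> P l /\ dot l l <= c.
Proof. exact: (projT2 (cid (weights_finite c)) l). Qed.

Definition inv_list s := wts s /\ weyl_invariant D (tval s).

Lemma inv_CPW s : inv_list s -> CPW D (tval s).
Proof. by move=> [hs sw]; apply/CPW_tval; split => //; exists s. Qed.

Lemma inv_L2P s : inv_list s -> L2P (tval s).
Proof. by move=> /inv_CPW; exact: CPW_L2P. Qed.

Lemma inv_cat s t : inv_list s -> inv_list t -> inv_list (s ++ t).
Proof.
move=> [hs sw] [ht tw]; split; first exact: wts_cat.
by move=> w h hw; rewrite !tval_cat sw// tw.
Qed.

Lemma inv_scale c s : inv_list s -> inv_list (tscale c s).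
Proof.
by move=> [hs sw]; split; [exact: wts_scale|move=> w h hw; rewrite !tval_scale sw].
Qed.

Lemma cls_cat s t : inv_list s -> inv_list t -> cls (tval (s ++ t)) = cls (tval s) + cls (tval t).
Proof.
move=> hs ht; rewrite -clsD; [|exact: inv_L2P|exact: inv_L2P].
by congr cls; apply/funext => h; rewrite tval_cat.
Qed.

Lemma cls_scale c s : inv_list s -> cls (tval (tscale c s)) = c *: cls (tval s).
Proof.
move=> hs; rewrite -clsZ; last exact: inv_L2P.
by congr cls; apply/funext => h; rewrite tval_scale.
Qed.

Lemma inv_A0 s : inv_list s -> inv_list (A0 s).
Proof. by move=> [hs sw]; split; [exact: wts_A0|exact: A0_invariant]. Qed.

Definition polyv v := exists2 s, inv_list s & v = cls (tval s).

(** Some list representing [v] is chosen; [CPW_cls_inj] and [A0_eq] make the result independent of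
    the choice, see [H0vE]. A class without such a list is treated as that of the empty list. *)
Definition H0v v := cls (tval (A0 (xget [::] [set s | inv_list s /\ v = cls (tval s)]))).

Lemma H0vE s : inv_list s -> H0v (cls (tval s)) = cls (tval (A0 s)).
Proof.
move=> hs; rewrite /H0v; case: xgetP => [t _ [ht E]|/(_ s)]; last by case.
have /= st := CPW_cls_inj (inv_CPW hs) (inv_CPW ht) E.
by rewrite (A0_eq hs.1 ht.1 st).
Qed.

Lemma polyv_subspace : subspace polyv.
Proof.
split.
- exists [::]; first by split => // w h _; rewrite /tval !big_nil.
  rewrite -(scale0r (cls (tval [::]))) -cls_scale//.
  by split => // w h _; rewrite /tval !big_nil.
- by move=> _ _ [s hs ->] [t ht ->]; exists (s ++ t); [exact: inv_cat|rewrite cls_cat].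
- by move=> c _ [s hs ->]; exists (tscale c s); [exact: inv_scale|rewrite cls_scale].
Qed.

Lemma H0vD v u : polyv v -> polyv u -> H0v (v + u) = H0v v + H0v u.
Proof.
move=> [s hs ->] [t ht ->]; rewrite -cls_cat// !H0vE//; last exact: inv_cat.
rewrite -cls_cat; [|exact: inv_A0|exact: inv_A0].
by congr cls; apply/funext => h; rewrite tval_cat !tval_A0 big_cat.
Qed.

Lemma H0vZ c v : polyv v -> H0v (c *: v) = c *: H0v v.
Proof.
move=> [s hs ->]; rewrite -cls_scale// !H0vE//; last exact: inv_scale.
rewrite -cls_scale; last exact: inv_A0.
congr cls; apply/funext => h; rewrite tval_scale !tval_A0 big_map mulr_sumr.
by apply: eq_bigr => x _; rewrite mulrA.
Qed.

Lemma conj_real (r : R) (z : C) : conjc (r%:C * z) = r%:C * conjc z.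
Proof. by case: z => p q; apply/eqP; rewrite eq_complex /=; apply/andP; split; apply/eqP; ring. Qed.

Definition cjl s := [seq (conjc x.1, - x.2) | x <- s].

Lemma tval_cjl s h : tval (cjl s) h = conjc (tval s h).
Proof.
rewrite /tval big_map rmorph_sum; apply: eq_bigr => x _ /=.
by rewrite rmorphM expwN.
Qed.

Lemma inv_cjl s : inv_list s -> inv_list (cjl s).
Proof.
move=> [hs sw]; split; first by move=> _ /mapP[x /hs hx ->]; exact: weightN.
by move=> w h hw; rewrite !tval_cjl sw.
Qed.

Lemma strip_conj a l h : tval (strip (- a) (- l)) h = conjc (tval (strip a l) h).
Proof.
rewrite /strip !pairing_coroot !dotpNl !(dotpNr GP) !opprK.
case: ifP => _; last by rewrite /tval !big_nil conjc0.
rewrite /tval !big_map rmorph_sum; apply: eq_bigr => i _.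
by rewrite -[RHS]/(conjc ((dot a l / 2)%:C * expw (l - a *+ i) h)) conj_real -expwN opprB mulNrn opprK addrC.
Qed.

Lemma tau_conj l h : tau (- l) h = conjc (tau l h).
Proof.
have cjD (x y : C) : conjc (x + y) = conjc x + conjc y := rmorphD _ x y.
rewrite /tau dotpNl (dotpNr GP) opprK expwN cjD conj_real rmorph_sum; congr (_ + _).
rewrite -(@big_opp C (fun a => (k a)%:C * tval (strip a (- l)) h)); apply: eq_big_seq => a aP.
by rewrite strip_conj coupling_opp//; exact/esym/conj_real.
Qed.

Lemma A0_conj s h : tval (A0 (cjl s)) h = conjc (tval (A0 s) h).
Proof.
rewrite !tval_A0 big_map rmorph_sum; apply: eq_bigr => x _ /=.
by rewrite tau_conj rmorphM.
Qed.

Lemma H0v_sym v u : polyv v -> polyv u -> ip (H0v v) u = ip v (H0v u).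
Proof.
move=> [s hs ->] [t ht ->].
have E1 := H0vE hs; have E2 := H0vE ht; rewrite E1 E2.
rewrite (hipE (inv_L2P (inv_A0 hs)) (inv_L2P ht)) (hipE (inv_L2P hs) (inv_L2P (inv_A0 ht))).
have hc := inv_cjl hs.
have := A0_symmetric hc.1 ht.1 hc.2 ht.2.
have E (f g f' g' : hR -> C) : (forall h, f' h = conjc (f h)) -> g = g' ->
    cint mu (fun x => (Delta (tp x) ^+ 2)%:C * (f' (tp x) * g' (tp x))) = ipc mu (wt f) (wt g).
  move=> ff -> ; congr cint; apply/funext => x; rewrite /wt conj_real ff rmorphXn /=; ring.
by rewrite (E _ _ _ _ (A0_conj s) (erefl (tval t))) (E _ _ _ _ (tval_cjl s) (erefl (tval (A0 t)))).
Qed.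

Lemma polyv_dense v (e : R) : 0 < e -> exists2 x, polyv x & nr (v - x) <= e.
Proof.
move=> e1; move: v; apply: cls_ind => f Lf; have [g Cg gE] := Lf.2 _ (exprn_gt0 2 e1).
have [gw [t [ht tE]]] := (CPW_tval g).1 Cg.
have hg : inv_list t by split => //; rewrite -tE.
exists (cls g); first by exists t; rewrite ?tE.
have Lg := CPW_L2P Cg; have E := clsB Lf Lg; rewrite -E.
move: gE; rewrite (L2_sqnorm_ipn (L2P_B Lf Lg)).
by rewrite lee_fin ler_pXn2r ?nnegrE//; [exact: sqrtr_ge0|exact: ltW].
Qed.

Lemma canonical_list s : inv_list s -> exists t, [/\ inv_list t, tval t = tval s, uniq [seq x.2 | x <- t] &
  forall x, x \in t -> x.1 = coef x.2 (tval s) /\ x.1 != 0].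
Proof.
move=> [hs sw]; pose L := [seq l <- undup [seq x.2 | x <- s] | scoef l s != 0].
have hL l : l \in L -> P l.
  by rewrite mem_filter mem_undup => /andP[_ /mapP[x /hs hx ->]].
pose t := [seq (scoef l s, l) | l <- L].
have E : tval t = tval s.
  apply/funext => h; rewrite /t [LHS]/tval big_map [RHS](sum_scoef s (fun l => expw l h)) /L big_filter.
  rewrite [RHS](bigID (fun l => scoef l s != 0)) /= [X in _ = _ + X]big1 ?addr0// => l.
  by rewrite negbK => /eqP ->; rewrite mul0r.
exists t; split => //.
- by split; [move=> _ /mapP[l /hL hl ->]|move=> w h hw; rewrite E sw].
- by rewrite -map_comp map_id filter_uniq// undup_uniq.
move=> _ /mapP[l lL ->] /=; rewrite coef_scoef//; last exact: hL.
by split => //; move: lL; rewrite mem_filter => /andP[].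
Qed.

Definition Wlist := projT1 (cid weyl_finite).
Lemma Wlist_uniq : uniq Wlist. Proof. by case: (projT2 (cid weyl_finite)). Qed.
Lemma WlistP w : Wg w <-> w \in Wlist. Proof. by case: (projT2 (cid weyl_finite)). Qed.

Definition orb l := [seq ((size Wlist)%:R^-1 : C, l *m w) | w <- Wlist].

Lemma tval_orb l : tval (orb l) = wavg Wlist (expw l).
Proof.
apply/funext => h; rewrite /tval big_map /wavg mulr_sumr.
by apply: eq_bigr => w _; rewrite expwM.
Qed.

Lemma inv_orb l : P l -> inv_list (orb l).
Proof.
move=> hl; split; first by move=> _ /mapP[w /WlistP hw ->]; exact: weyl_weight.
by rewrite tval_orb; exact: wavg_invariant Wlist_uniq WlistP _.
Qed.

(** The shift by [kc], the value of H_0 on constants, makes [b] a bound on eigenvalues, see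
    [flt_eigen]. *)
Definition flt (b : R) : seq HV := [seq cls (tval (orb l)) | l <- weights_le (b - kc)].

Lemma spnP (V : lmodType C) (r : seq V) : [/\ spn r 0, forall x y, spn r x -> spn r y -> spn r (x + y),
  forall c x, spn r x -> spn r (c *: x) & forall x, x \in r -> spn r x].
Proof.
split.
- by exists (fun=> 0); rewrite big1// => i _; rewrite scale0r.
- move=> _ _ [c ->] [d ->]; exists (fun i => c i + d i); rewrite -big_split.
  by apply: eq_bigr => i _; rewrite scalerDl.
- move=> c _ [d ->]; exists (fun i => c * d i); rewrite scaler_sumr.
  by apply: eq_bigr => i _; rewrite scalerA.
move=> x xr; exists (fun i => (i == index x r)%:R).
have ir : (index x r < size r)%N by rewrite index_mem.
rewrite (bigD1 (Ordinal ir))//= eqxx scale1r nth_index// big1 ?addr0// => i ii.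
by rewrite (_ : (i == index x r :> nat) = false) ?scale0r//; apply: negbTE; apply: contra ii => /eqP E; apply/eqP/val_inj.
Qed.

(** Averaging over the Weyl group replaces each exponential of an invariant polynomial by its
    normalized orbit sum. *)
Lemma flt_span b s : inv_list s -> (forall x, x \in s -> dot x.2 x.2 <= b - kc) -> spn (flt b) (cls (tval s)).
Proof.
move=> hs sb; have [S0 SD SZ SI] := spnP (flt b).
have -> : tval s = (fun h => \sum_(x <- s) x.1 * tval (orb x.2) h).
  rewrite -(wavg_id WlistP hs.2); apply/funext => h.
  under eq_bigr do rewrite tval_orb.
  rewrite /wavg /tval exchange_big mulr_sumr; apply: eq_bigr => x _.
  by rewrite -mulr_sumr mulrCA.
have {hs} hs := hs.1.
elim: s hs sb => [|x s IH] hs sb.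
  have -> : (fun h => \sum_(x <- [::]) x.1 * tval (orb x.2) h) = (fun h => 0 * (0 : hR -> C) h).
    by apply/funext => h; rewrite big_nil mul0r.
  by rewrite clsZ ?scale0r//; exact: L2P_0.
have hs' : wts s by move=> y ys; apply: hs; rewrite inE ys orbT.
have Lo y : wts s -> y \in s -> L2P (tval (orb y.2)).
  by move=> h ys; apply/inv_L2P/inv_orb/h.
have hx : P x.2 by apply: hs; rewrite inE eqxx.
have Ls : L2P (fun h => \sum_(y <- s) y.1 * tval (orb y.2) h).
  elim: (s) hs' => [_|y r IHr hr].
    by rewrite (_ : (fun h => _) = 0); [exact: L2P_0|apply/funext => h; rewrite big_nil].
  rewrite (_ : (fun h => _) = (fun h => y.1 * tval (orb y.2) h) + (fun h => \sum_(y <- r) y.1 * tval (orb y.2) h)); last first.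
    by apply/funext => h; rewrite big_cons.
  apply: L2P_D; last by apply: IHr => z zr; apply: hr; rewrite inE zr orbT.
  by apply/L2P_Z/inv_L2P/inv_orb/hr; rewrite inE eqxx.
have -> : (fun h => \sum_(y <- x :: s) y.1 * tval (orb y.2) h) = (fun h => x.1 * tval (orb x.2) h) +
    (fun h => \sum_(y <- s) y.1 * tval (orb y.2) h) by apply/funext => h; rewrite big_cons.
have Lx : L2P (tval (orb x.2)) by apply/inv_L2P/inv_orb.
have E := clsD (L2P_Z x.1 Lx) Ls; rewrite E; apply: SD; last first.
  by apply: IH => // y ys; apply: sb; rewrite inE ys orbT.
have E2 := clsZ x.1 Lx; rewrite E2; apply: SZ; apply: SI; apply/mapP; exists x.2 => //.
by apply/weights_leP; split => //; apply: sb; rewrite inE eqxx.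
Qed.

Lemma flt_nth b i : (i < size (flt b))%N -> exists2 l, P l /\ dot l l <= b - kc & (flt b)`_i = cls (tval (orb l)).
Proof.
rewrite size_map => ib; have hi := mem_nth 0 ib.
by exists (nth 0 (weights_le (b - kc)) i); [exact/weights_leP|rewrite (nth_map 0)].
Qed.

Lemma flt_dom b i : (i < size (flt b))%N -> polyv (flt b)`_i.
Proof. by move=> /flt_nth[l [hl _] ->]; exists (orb l) => //; exact: inv_orb. Qed.

(** Along the string, |l - i a|^2 = |l|^2 - i (m - i) |a|^2, which is strictly smaller between the
    two ends. The norm thus plays the part of the dominance order. *)
Lemma strip_norm a l x : a \in Phi -> P l -> x \in strip a l ->
  [\/ x.2 = l, x.2 = l *m refl a | dot x.2 x.2 < dot l l].
Proof.
move=> aP hl; rewrite /strip; case: ifP => // al0 /mapP[i hi ->] /=.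
have a0 := root_norm_gt0 aP.
have : 0 < pairing l (cor a) by rewrite pairing_coroot (dotpC GP) divr_gt0 ?mulr_gt0.
have /intrP[z zE] := hl a aP; rewrite zE ltr0z; case: z zE => // m mE m0.
move: hi; rewrite mE -[m%:Z%:~R]/(m%:R : R) natrK => hi.
have im : (i <= m)%N.
  by move: hi; rewrite mem_cat !mem_iota; clear -m0; lia.
have [->|i0] := eqVneq i 0%N; first by constructor 1; rewrite mulr0n subr0.
have [->|imn] := eqVneq i m.
  by constructor 2; rewrite mul_reflection mE -[m%:Z%:~R]/(m%:R : R) scaler_nat.
constructor 3; rewrite -scaler_nat dotpBl !(dotpBr GP) !dotpZl !(dotpZr GP) (dotpC GP a l).
have E : 2 * dot l a = m%:R * dot a a.
  have := mE; rewrite pairing_coroot -[m%:Z%:~R]/(m%:R : R) => <-; by rewrite divfK// gt_eqF.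
have -> : dot l l - i%:R * dot l a - (i%:R * dot l a - i%:R * (i%:R * dot a a)) =
   dot l l - i%:R * (m%:R - i%:R) * dot a a.
  have -> : dot l l - i%:R * dot l a - (i%:R * dot l a - i%:R * (i%:R * dot a a)) =
    dot l l - i%:R * (2 * dot l a) + i%:R * i%:R * dot a a by ring.
  by rewrite E; ring.
rewrite gtrBl !mulr_gt0// ?ltr0n ?lt0n// subr_gt0 ltr_nat.
by rewrite ltn_neqAle imn.
Qed.

Lemma A0_norm b s : wts s -> (forall x, x \in s -> dot x.2 x.2 <= b) ->
  forall x, x \in A0 s -> dot x.2 x.2 <= b.
Proof.
move=> hs sb y /flatten_mapP[x xs]; rewrite inE => /orP[/eqP -> /=|/flatten_mapP[a aP /mapP[z zs -> /=]]].
  exact: sb.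
have [->|->|/ltW h] := strip_norm aP (hs x xs) zs; first exact: sb.
  by rewrite (reflection_dotp GP) ?sb// (root_neq0 aP).
exact: le_trans h (sb x xs).
Qed.

Lemma flt_H0 b i : (i < size (flt b))%N -> spn (flt b) (H0v (flt b)`_i).
Proof.
move=> /flt_nth[l [hl lb] ->]; have ho := inv_orb hl.
have E := H0vE ho; rewrite E; apply: flt_span; first exact: inv_A0.
apply: A0_norm; first exact: ho.1.
by move=> _ /mapP[w /WlistP hw ->] /=; rewrite weyl_dotp.
Qed.

Lemma flt_exists v : polyv v -> exists b, spn (flt b) v.
Proof.
move=> [s hs ->]; exists (\sum_(x <- s) dot x.2 x.2 + kc); apply: flt_span => // x xs.
rewrite addrK (big_rem x)//= lerDl; apply: sumr_ge0 => y _; exact: (dotp_ge0 GP).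
Qed.

Lemma exists_max (T : eqType) (f : T -> R) (r : seq T) x0 : x0 \in r ->
  exists2 x, x \in r & forall y, y \in r -> f y <= f x.
Proof.
elim: r x0 => // x [|y r] IH x0 _.
  by exists x => [|z]; rewrite inE ?eqxx// => /eqP ->.
have [z zr hz] := IH y (mem_head _ _).
have [xz|zx] := leP (f x) (f z).
  exists z => [|t]; rewrite inE ?zr ?orbT// => /orP[/eqP ->//|]; exact: hz.
exists x => [|t]; rewrite inE ?eqxx// => /orP[/eqP ->//|/hz h]; exact: le_trans h (ltW zx).
Qed.

Definition half_dot a l : R := if 0 < dot a l then dot a l / 2 else 0.

Lemma half_dot_ge0 a l : 0 <= half_dot a l.
Proof. by rewrite /half_dot; case: ifP => // h; rewrite divr_ge0// ltW. Qed.

(** By [strip_norm], an inner exponent of the string of [l] is shorter than [m]; only the two ends,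
    [l] and its reflection, can reach [m]. *)
Lemma scoef_strip m a l : a \in Phi -> P l -> dot l l <= dot m m ->
  scoef m (strip a l) = (half_dot a l)%:C * ((l == m)%:R + (l *m refl a == m)%:R).
Proof.
move=> aP hl lm; rewrite /half_dot; have sn x := @strip_norm a l x aP hl.
move: sn; rewrite /strip; case: ifP => al0; last by rewrite /scoef big_nil mul0r.
have a0 := root_norm_gt0 aP.
have : 0 < pairing l (cor a) by rewrite pairing_coroot (dotpC GP) divr_gt0 ?mulr_gt0.
have /intrP[z zE] := hl a aP; rewrite zE ltr0z; case: z zE => // j mE j0.
rewrite -[j%:Z%:~R]/(j%:R : R) natrK => sn.
have rE : l *m refl a = l - a *+ j.
  by rewrite mul_reflection mE -[j%:Z%:~R]/(j%:R : R) scaler_nat.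
have aMn i : (a *+ i == 0) = (i == 0%N).
  by rewrite -[a *+ i]scaler_nat scaler_eq0 (negbTE (root_neq0 aP)) orbF pnatr_eq0.
have no i : (0 < i < j)%N -> (l - a *+ i == m) = false.
  move=> /andP[i0 ij]; have hin : ((dot a l / 2)%:C, l - a *+ i) \in
      [seq ((dot a l / 2)%:C : C, l - a *+ i) | i <- iota 0 j.+1 ++ iota 1 j.-1].
    by apply/mapP; exists i => //; rewrite mem_cat mem_iota /= ltnS ltnW.
  apply/negP => /eqP E; case: (sn _ hin) => /=.
  - by move=> /eqP; rewrite -subr_eq0 addrC addKr oppr_eq0 aMn => /eqP i0'; rewrite i0' in i0.
  - rewrite rE => /addrI/oppr_inj E2.
    have : a *+ (j - i) == 0 by rewrite mulrnBr ?(ltnW ij)// E2 subrr.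
    by rewrite aMn subn_eq0 leqNgt ij.
  - by rewrite E ltNge lm.
case: j {mE sn} j0 rE no => // j _ rE no.
have no1 : \sum_(i <- iota 1 j | l - a *+ i == m) (dot a l / 2)%:C = 0 :> C.
  rewrite big_seq_cond big1// => i /andP[]; rewrite mem_iota add1n => hi /eqP E.
  by have := no i hi; rewrite E eqxx.
transitivity (\sum_(i <- (0%N :: iota 1 j ++ [:: j.+1]) ++ iota 1 j | l - a *+ i == m) (dot a l / 2)%:C : C).
  have e1 : iota 1 j.+1 = iota 1 j ++ [:: j.+1] by rewrite -(iotaD 1 j 1) addn1.
  by rewrite /scoef big_map -[iota 0 j.+2]/(0%N :: iota 1 j.+1) e1.
rewrite big_cat /= no1 addr0 big_cons big_cat /= no1 add0r big_cons big_nil.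
rewrite mulr0n subr0 -rE mulrDr; case: eqP => _; case: eqP => _; rewrite ?mulr1 ?mulr0 ?addr0 ?add0r//.
Qed.

Lemma scoef_refl s m a : inv_list s -> a \in Phi -> P m -> scoef (m *m refl a) s = scoef m s.
Proof.
move=> [hs sw] aP hm; pose t := [seq (x.1, x.2 *m refl a) | x <- s]; have hw := weyl_refl aP.
have ht : wts t by move=> _ /mapP[x xs ->]; apply: weyl_weight => //; exact: hs.
have rr := reflectionK GP (root_neq0 aP).
have -> : scoef (m *m refl a) s = scoef m t.
  rewrite /scoef big_map; apply: eq_bigl => x /=.
  by apply/eqP/eqP => [->|<-]; rewrite -mulmxA rr mulmx1.
rewrite -!(coef_scoef hm)//; congr coef; apply/funext => h.
rewrite -(sw _ h hw) /tval big_map; apply: eq_bigr => x _.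
by rewrite expwM.
Qed.

(** At a weight of maximal norm only that weight and its reflections contribute, and their
    coefficients agree by invariance: H_0 acts on this coefficient as a scalar. *)
Lemma scoef_A0 m s : inv_list s -> P m -> (forall x, x \in s -> dot x.2 x.2 <= dot m m) ->
  scoef m (A0 s) = (dot m m + kc + \sum_(a <- Phi) k a * (half_dot a m + half_dot a (m *m refl a)))%:C * scoef m s.
Proof.
move=> hs hm sm; have [ws _] := hs.
have H (f : 'rV[R]_n -> C) (g : 'rV[R]_n -> 'rV[R]_n) m' : (forall l, (g l == m) = (l == m')) ->
    \sum_(x <- s) x.1 * (f x.2 * (g x.2 == m)%:R) = f m' * scoef m' s.
  move=> gm; rewrite /scoef mulr_sumr [RHS]big_mkcond; apply: eq_bigr => x _; rewrite gm.
  by case: eqP => [->|_]; rewrite ?mulr1 ?mulr0 ?mulr0// mulrC.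
rewrite /A0 {1}/scoef big_flatten big_map.
transitivity (\sum_(x <- s) (x.1 * ((dot x.2 x.2 + kc)%:C * (x.2 == m)%:R) +
   \sum_(a <- Phi) (k a)%:C * (x.1 * ((half_dot a x.2)%:C * (x.2 == m)%:R) +
      x.1 * ((half_dot a x.2)%:C * (x.2 *m refl a == m)%:R)))).
  apply: eq_big_seq => x xs; rewrite big_cons big_flatten big_map /=.
  have -> : \sum_(a <- Phi) \sum_(y <- tscale (x.1 * (k a)%:C) (strip a x.2) | y.2 == m) y.1 =
      \sum_(a <- Phi) (x.1 * (k a)%:C) * scoef m (strip a x.2).
    by apply: eq_bigr => a _; rewrite big_map /= -mulr_sumr.
  have -> : \sum_(a <- Phi) (x.1 * (k a)%:C) * scoef m (strip a x.2) =
     \sum_(a <- Phi) (k a)%:C * (x.1 * ((half_dot a x.2)%:C * (x.2 == m)%:R) +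
      x.1 * ((half_dot a x.2)%:C * (x.2 *m refl a == m)%:R)).
    apply: eq_big_seq => a aP; rewrite (scoef_strip aP (ws x xs) (sm x xs)); ring.
  by case: eqP => _; rewrite ?mulr1 ?mulr0 ?add0r.
rewrite big_split exchange_big /= (H (fun l => (dot l l + kc)%:C) id m)//.
have cD (x y : R) : (x + y)%:C = x%:C + y%:C := rmorphD _ x y.
rewrite [in RHS](cD (dot m m + kc)) mulrDl rmorph_sum mulr_suml; congr (_ + _).
apply: eq_big_seq => a aP; rewrite -mulr_sumr big_split /=.
rewrite (H (fun l => (half_dot a l)%:C) id m)// (H (fun l => (half_dot a l)%:C) (fun l => l *m refl a) (m *m refl a)).
  have cM (x y : R) : (x * y)%:C = x%:C * y%:C := rmorphM _ x y.
  by rewrite scoef_refl// cM cD; ring.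
have rr := reflectionK GP (root_neq0 aP).
by move=> l; apply/eqP/eqP => [<-|->]; rewrite -mulmxA rr mulmx1.
Qed.

(** Compare coefficients at a weight z of maximal norm in the eigenvector. By [scoef_A0] the
    eigenvalue is |z|^2 + kc plus terms that are nonnegative because k > 0, so |z|^2 <= b - kc, and
    all other weights are at most as long. *)
Lemma flt_eigen b v (x : R) : polyv v -> H0v v = x%:C *: v -> x <= b -> spn (flt b) v.
Proof.
move=> [s0 hs0 ->]; have [s [hs <- _ sc]] := canonical_list hs0.
have E1 := H0vE hs; rewrite E1 -(cls_scale x%:C hs) => E xb.
have {E} E := CPW_cls_inj (inv_CPW (inv_A0 hs)) (inv_CPW (inv_scale x%:C hs)) E.
apply: flt_span => // y ys; have [ws _] := hs.
have [z zs zmax] := exists_max (fun y : C * 'rV[R]_n => dot y.2 y.2) ys.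
apply: (le_trans (zmax y ys)); have hz := ws z zs.
have := scoef_A0 hs hz zmax; rewrite -(coef_scoef hz (inv_A0 hs).1) E (coef_scoef hz (inv_scale x%:C hs).1).
have -> : scoef z.2 (tscale x%:C s) = x%:C * scoef z.2 s by rewrite /scoef big_map mulr_sumr.
have [zE z0] := sc z zs; have c0 : scoef z.2 s != 0 by rewrite -(coef_scoef hz ws) -zE.
move=> /(mulIf c0)/(congr1 (@Re R)) /= xE.
rewrite lerBrDr; apply: le_trans xb; rewrite xE lerDl big_seq; apply: sumr_ge0 => a aP.
by rewrite mulr_ge0 ?addr_ge0 ?half_dot_ge0// ltW// kpos.
Qed.

End hilbert_operator.

(** * The elliptic potential *)

Section elliptic_potential.
Implicit Types (a : 'rV[R]_n) (h q : hR) (w : 'M[R]_n) (p : R) (f : hR -> C).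

Definition cosm a h j : R := cos (j%:R * pairing a h) - 1.

Lemma cosm_le2 a h j : `|cosm a h j| <= 2.
Proof. by rewrite /cosm ler_norml; have := cos_geN1 (j%:R * pairing a h); have := cos_le1 (j%:R * pairing a h); lra. Qed.

Definition root_sum (F : 'rV[R]_n -> hR -> R) h : R := - 2 * \sum_(a <- Phi_plus) strength D a * F a h.

Definition wfun i := root_sum (fun a h => lcoef (cosm a h) i).

Lemma W_potentialE p h : W_potential D p h = root_sum (fun a h => limn (lpart p (cosm a h))) h.
Proof. by []. Qed.

Definition invF (F : 'rV[R]_n -> hR -> R) := [/\ forall a h, F (- a) h = F a h,
  forall a w h, F a (w *m h) = F (a *m w) h &
  forall a h q, a \in Phi -> Q q -> F a (h + (2 * pi) *: q) = F a h].

Lemma cosm_inv : [/\ forall a h, cosm (- a) h = cosm a h,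
  forall a w h, cosm a (w *m h) = cosm (a *m w) h &
  forall a h q, a \in Phi -> Q q -> cosm a (h + (2 * pi) *: q) = cosm a h].
Proof.
split=> [a h|a w h|a h q aP hq]; apply/funext => j; rewrite /cosm.
- by rewrite pairingNl mulrN cosN.
- by rewrite pairingM.
have := expw_torus (weightMn j (root_weight aP)) h hq => /(congr1 (@Re R)) /=.
have E h' : pairing (a *+ j) h' = j%:R * pairing a h' by rewrite -scaler_nat pairingZl.
by rewrite !E => ->.
Qed.

Lemma root_sum_torus F h q : invF F -> Q q -> root_sum F (h + (2 * pi) *: q) = root_sum F h.
Proof.
by move=> [_ _ Fq] hq; congr (_ * _); apply: eq_big_seq => a /pos_root aP; rewrite Fq.
Qed.

Lemma root_sum_weyl F w h : invF F -> Wg w -> root_sum F (w *m h) = root_sum F h.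
Proof.
move=> [FN Fw _] hw; have sN a : a \in Phi -> strength D (- a) = strength D a.
  by move=> aP; rewrite /strength coupling_opp// dotpNl (dotpNr GP) opprK.
have E h' : root_sum F h' = - \sum_(a <- Phi) strength D a * F a h'.
  rewrite big_pos => [|a aP]; last by rewrite sN// FN.
  by rewrite /root_sum mulNr mulr_natl mulr2n.
rewrite !E -[in RHS](big_weyl _ _ hw); congr (- _); apply: eq_big_seq => a aP.
by rewrite Fw /strength cm_couplingP// (weyl_dotp _ _ hw).
Qed.

Lemma wfun_inv i : invF (fun a h => lcoef (cosm a h) i).
Proof. by have [h1 h2 h3] := cosm_inv; split=> *; rewrite ?h1 ?h2 ?h3. Qed.

Lemma W_inv p : invF (fun a h => limn (lpart p (cosm a h))).
Proof. by have [h1 h2 h3] := cosm_inv; split=> *; rewrite ?h1 ?h2 ?h3. Qed.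

Definition Sstr : R := \sum_(a <- Phi_plus) `|strength D a|.

Lemma Sstr_ge0 : 0 <= Sstr. Proof. exact: sumr_ge0. Qed.

Lemma root_sum_le F (B : R) h : (forall a, `|F a h| <= B) -> `|root_sum F h| <= 2 * Sstr * B.
Proof.
move=> hF; rewrite /root_sum mulNr normrN normrM ger0_norm// -[leRHS]mulrA ler_wpM2l//.
apply: (le_trans (ler_norm_sum _ _ _)); rewrite /Sstr mulr_suml; apply: ler_sum => a _.
by rewrite normrM ler_wpM2l.
Qed.

(** The rate is relaxed from 4 to 8 so that the disc in [opana], 8 |p| <= 1/2, is exactly the range
    |p| <= 1/16 of the Lambert estimates. *)
Lemma W_close p N h : `|p| <= 1/16 ->
  `|W_potential D p h - \sum_(0 <= i < N) p ^+ i * wfun i h| <= 8 * Sstr * (8 * `|p|) ^+ N.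
Proof.
move=> p16; rewrite W_potentialE.
have -> : \sum_(0 <= i < N) p ^+ i * wfun i h = root_sum (fun a h => \sum_(0 <= i < N) p ^+ i * lcoef (cosm a h) i) h.
  rewrite /wfun /root_sum.
  under eq_bigr do rewrite mulrCA mulr_sumr.
  rewrite -mulr_sumr; congr (_ * _); rewrite exchange_big; apply: eq_bigr => a _ /=.
  by rewrite mulr_sumr; apply: eq_bigr => i _; rewrite mulrCA.
have -> : forall F F', root_sum F h - root_sum F' h = root_sum (fun a h => F a h - F' a h) h.
  by move=> F F'; rewrite /root_sum -mulrBr -sumrB; congr (_ * _); apply: eq_bigr => a _; rewrite mulrBr.
apply: (@le_trans _ _ (2 * Sstr * (4 * (4 * `|p|) ^+ N))).
  by apply: root_sum_le => a; apply: llim_close => // j; exact: cosm_le2.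
rewrite (_ : 8 * Sstr = 2 * Sstr * 4); last by ring.
rewrite -[leRHS]mulrA ler_wpM2l ?mulr_ge0 ?Sstr_ge0// ler_wpM2l//.
by apply: ler_exp; [rewrite mulr_ge0|rewrite ler_wpM2r//; lra].
Qed.

Lemma SstrE : \sum_(a <- Phi_plus) `|k a * (k a - 1)| * dot a a = Sstr.
Proof.
by apply: eq_bigr => a _; rewrite /strength [RHS]normrM; congr (_ * _); rewrite ger0_norm//; exact: (dotp_ge0 GP).
Qed.

(** The 4 in [W_max] is the 2 in front of the Fourier expansion times the bound 2 of |cos - 1|. *)
Lemma W_bound p h : `|p| <= 1/16 -> `|W_potential D p h| <= W_max D p.
Proof.
move=> p16; rewrite W_potentialE.
apply: (@le_trans _ _ (2 * Sstr * (2 * limn (lpart `|p| (fun=> 1))))).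
  by apply: root_sum_le => a; apply: llim_norm => // j; exact: cosm_le2.
rewrite /W_max le_eqVlt; apply/orP; left; apply/eqP.
have -> : lpart `|p| (fun=> 1) = (fun N => \sum_(1 <= j < N) j%:R * `|p| ^+ j / (1 - `|p| ^+ j)).
  by apply/funext => N; rewrite /lpart; apply: eq_bigr => j _; rewrite mulr1.
rewrite -SstrE; ring.
Qed.

Lemma W_max_le p : `|p| <= 1/16 -> W_max D p <= 64 * Sstr * `|p|.
Proof.
move=> p16; have p16' : `| `|p| | <= 1/16 by rewrite normr_id.
have c1 (j : nat) : `|1 : R| <= 2 by rewrite normr1; lra.
have := llim_close p16' c1 1; rewrite big_nat1 expr0 mul1r /lcoef big_geq// subr0 expr1 normr_id.
have -> : lpart `|p| (fun=> 1) = (fun N => \sum_(1 <= j < N) j%:R * `|p| ^+ j / (1 - `|p| ^+ j)).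
  by apply/funext => N; rewrite /lpart; apply: eq_bigr => j _; rewrite mulr1.
move=> h; rewrite /W_max.
rewrite SstrE mulrAC; apply: (@le_trans _ _ (4 * Sstr * (4 * (4 * `|p|)))).
  by rewrite ler_wpM2l ?mulr_ge0 ?Sstr_ge0//; apply: le_trans h; exact: ler_norm.
by rewrite (_ : 4 * Sstr * _ = 64 * Sstr * `|p|) //; ring.
Qed.

Lemma W_max0 : W_max D 0 = 0.
Proof.
apply/eqP; rewrite eq_le; apply/andP; split.
  by have := W_max_le (p := 0); rewrite normr0 mulr0; apply.
by apply: le_trans (W_bound (p := 0) 0 _); rewrite ?normr0.
Qed.

Lemma measurable_wfun i : measurable_fun [set: T] (fun x => wfun i (tp x)).
Proof.
apply: measurable_funM => //; apply: measurable_sum => a; apply: measurable_funM => //.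
rewrite /lcoef; under eq_fun do rewrite big_mkcond /=.
apply: measurable_sum => j; case: (j %| i)%N; last exact: measurable_cst.
apply: measurable_funM => //.
apply: measurable_funB => //; have [+ _] := cmeas_expw (a *+ j).
rewrite /=; under eq_fun do rewrite -scaler_nat pairingZl.
by [].
Qed.

Lemma measurable_W p : `|p| <= 1/16 -> measurable_fun [set: T] (fun x => W_potential D p (tp x)).
Proof.
move=> p16; have [] := @cmeas_cvg _ T R (fun N x => (\sum_(0 <= i < N) p ^+ i * wfun i (tp x))%:C) (fun x => (W_potential D p (tp x))%:C) => //.
  move=> N; apply: cmeas_real; apply: measurable_sum => i; apply: measurable_funM => //; exact: measurable_wfun.
move=> x; apply: ccvg_real; apply/cvgrPdist_le => e e0.
have : (8 * Sstr * (8 * `|p|) ^+ N) @[N --> \oo] --> 8 * Sstr * 0.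
  apply: cvgM; first exact: cvg_cst.
  by apply: cvg_expr; rewrite ger0_norm ?mulr_ge0//; lra.
rewrite mulr0 => /cvgrPdist_le /(_ e e0) [N _ hN]; exists N => // i /hN /=.
rewrite sub0r normrN => h; apply: (le_trans (W_close i (tp x) p16)); apply: le_trans h; exact: ler_norm.
Qed.

Definition mulr_fun (g : hR -> R) f : hR -> C := fun h => (g h)%:C * f h.
Definition multop (g : hR -> R) (v : HV) : HV := cls (mulr_fun g (rep v)).

(* The last clause keeps multiplication by [g] inside [L2P]. *)
Definition tame (g : hR -> R) := [/\ forall h q, Q q -> g (h + (2 * pi) *: q) = g h,
  forall w h, Wg w -> g (w *m h) = g h, measurable_fun [set: T] (fun x => g (tp x)),
  exists K : R, forall h, `|g h| <= K &
  forall e : R, 0 < e -> exists2 g', CPW D (fun h => (g' h)%:C) & forall h, `|g h - g' h| <= e].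

Lemma wt_mul g f : wt (mulr_fun g f) = fun x => (g (tp x))%:C * wt f x.
Proof. by apply/funext => x; rewrite /wt /mulr_fun mulrCA. Qed.

Lemma sqint_mul (g : hR -> R) f (K : R) : measurable_fun [set: T] (fun x => g (tp x)) -> (forall h, `|g h| <= K) ->
  cmeas (fun x : T => f (tp x)) ->
  (sqint mu (wt (mulr_fun g f)) <= (K ^+ 2)%:E * sqint mu (wt f))%E.
Proof.
move=> mg gK mf; have K0 : 0 <= K by apply: le_trans (gK 0).
have mw := cmeas_wt mf; rewrite wt_mul.
apply: le_sqint => //; first by apply: cmeasM => //; exact: cmeas_real.
by move=> x; rewrite normcM normc_real ler_wpM2r// normc_ge0.
Qed.

Lemma mul_L2W g f : tame g -> L2W D f -> L2W D (mulr_fun g f).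
Proof.
move=> [gt gw mg [K gK] _] /L2W_P[ft fw mf f2]; apply/L2W_P; split.
- by move=> h q hq; rewrite /mulr_fun gt// ft.
- by move=> w h hw; rewrite /mulr_fun gw// fw.
- by apply: cmeasM => //; exact: cmeas_real.
apply: le_lt_trans (sqint_mul mg gK mf) _.
by apply: lte_mul_pinfty; rewrite ?lee_fin ?sqr_ge0.
Qed.

Lemma CPW_mul f f' : CPW D f -> CPW D f' -> CPW D (fun h => f h * f' h).
Proof.
move=> /CPW_tval[fw [s [hs fE]]] /CPW_tval[gw [t [ht gE]]]; apply/CPW_tval; split.
  by move=> w h hw; rewrite fw// gw.
exists (tmul s t); split; first exact: wts_mul.
by rewrite fE gE; apply/funext => h; rewrite tval_mul.
Qed.

(** For a polynomial [f], uniform approximation of [g] by invariant polynomials suffices, since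
    products of polynomials are polynomials. The general case follows because multiplication by [g]
    is bounded. *)
Lemma mul_L2P g f : tame g -> L2P f -> L2P (mulr_fun g f).
Proof.
move=> tg; have [_ _ mg [K gK] ga] := tg.
have A u : CPW D u -> L2P (mulr_fun g u).
  move=> Cu; have Lu := CPW_L2W Cu; split=> [|e e0]; first exact: mul_L2W.
  have /L2W_P[_ _ mu' u2] := Lu.
  pose c := fine (sqint mu (wt u)); have cE : sqint mu (wt u) = c%:E by rewrite fineK// ge0_fin_numE// sqint_ge0.
  have c0 : 0 <= c by rewrite -lee_fin -cE sqint_ge0.
  have d0 : 0 < e / (c + 1) by rewrite divr_gt0// ltr_wpDl.
  have [g' Cg' gg'] := ga (Num.sqrt (e / (c + 1))) ltac:(by rewrite sqrtr_gt0).
  exists (mulr_fun g' u); first exact: CPW_mul.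
  have /L2W_P[_ _ [mg' _] _] := CPW_L2W Cg'.
  have -> : mulr_fun g u - mulr_fun g' u = mulr_fun (fun h => g h - g' h) u.
    by apply/funext => h; rewrite /mulr_fun rmorphB mulrBl.
  rewrite L2_sqnormE; apply: le_trans (sqint_mul (measurable_funB mg mg') gg' mu') _.
  by rewrite cE -EFinM lee_fin sqr_sqrtr ?(ltW d0)// mulrAC ler_pdivrMr ?ltr_wpDl// ler_wpM2l ?(ltW e0)// lerDl.
move=> Pf; have Lf := L2P_L2W Pf; apply: L2P_lim => [|e e0]; first exact: mul_L2W.
have K0 : 0 < K ^+ 2 + 1 by rewrite ltr_wpDl// sqr_ge0.
have [u Cu fu] := Pf.2 (e / (K ^+ 2 + 1)) ltac:(by rewrite divr_gt0).
exists (mulr_fun g u); first exact: A.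
have -> : mulr_fun g f - mulr_fun g u = mulr_fun g (f - u).
  by apply/funext => h; rewrite /mulr_fun -[LHS]/(_ - _) -mulrBr.
have /L2W_P[_ _ mfu _] := L2W_B Lf (CPW_L2W Cu).
rewrite L2_sqnormE; apply: le_trans (sqint_mul mg gK mfu) _; rewrite -L2_sqnormE.
apply: (@le_trans _ _ ((K ^+ 2 + 1)%:E * (e / (K ^+ 2 + 1))%:E)%E); last by rewrite -EFinM lee_fin mulrC divfK// gt_eqF.
by apply: lee_pmul; rewrite ?lee_fin ?sqr_ge0 ?lerDl// L2_sqnormE sqint_ge0.
Qed.

Lemma nr_cls f (K : R) : L2P f -> 0 <= K -> (sqint mu (wt f) <= (K ^+ 2)%:E)%E -> nr (cls f) <= K.
Proof.
move=> Lf K0; rewrite -L2_sqnormE L2_sqnorm_ipn// lee_fin ler_pXn2r ?nnegrE//; exact: sqrtr_ge0.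
Qed.

Lemma mul_cls_le g f (K : R) : tame g -> (forall h, `|g h| <= K) -> L2P f ->
  nr (cls (mulr_fun g f)) <= K * nr (cls f).
Proof.
move=> tg gK Lf; have [_ _ mg _ _] := tg; have K0 : 0 <= K by apply: le_trans (gK 0).
apply: nr_cls; [exact: mul_L2P|by rewrite mulr_ge0// sqrtr_ge0|].
have /L2P_L2W/L2W_P[_ _ mf _] := Lf; apply: le_trans (sqint_mul mg gK mf) _.
by rewrite -L2_sqnormE L2_sqnorm_ipn// exprMn EFinM.
Qed.

Lemma multopE g f : tame g -> L2P f -> multop g (cls f) = cls (mulr_fun g f).
Proof.
move=> tg Lf; have [_ _ mg [K gK] _] := tg.
have Lr := repP (cls f); have h0 := cls_inj Lr Lf (repK _).
apply: cls_eq; [exact: mul_L2P|exact: mul_L2P|].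
have -> : mulr_fun g (rep (cls f)) - mulr_fun g f = mulr_fun g (rep (cls f) - f).
  by apply/funext => h; rewrite /mulr_fun -[LHS]/(_ - _) -mulrBr.
have LB := L2P_B Lr Lf; have /L2P_L2W/L2W_P[_ _ mB _] := LB.
apply/eqP; rewrite eq_le; apply/andP; split; last by rewrite L2_sqnormE sqint_ge0.
by rewrite L2_sqnormE; apply: le_trans (sqint_mul mg gK mB) _; rewrite -L2_sqnormE h0 mule0.
Qed.

Lemma multopD g v u : tame g -> multop g (v + u) = multop g v + multop g u.
Proof.
move=> tg; move: v; apply: cls_ind => f Lf; move: u; apply: cls_ind => f' Lf'.
have E := clsD Lf Lf'; rewrite -E (multopE tg (L2P_D Lf Lf')) (multopE tg Lf) (multopE tg Lf').
have E2 := clsD (mul_L2P tg Lf) (mul_L2P tg Lf'); rewrite -E2; congr cls.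
by apply/funext => h; rewrite /mulr_fun -[(f + f') h]/(f h + f' h) mulrDr.
Qed.

Lemma multopZ g c v : tame g -> multop g (c *: v) = c *: multop g v.
Proof.
move=> tg; move: v; apply: cls_ind => f Lf.
have E := clsZ c Lf; rewrite -E (multopE tg (L2P_Z c Lf)) (multopE tg Lf).
have E2 := clsZ c (mul_L2P tg Lf); rewrite -E2; congr cls.
by apply/funext => h; rewrite /mulr_fun mulrCA.
Qed.

Lemma multop_le g v (K : R) : tame g -> (forall h, `|g h| <= K) -> nr (multop g v) <= K * nr v.
Proof.
move=> tg gK; move: v; apply: cls_ind => f Lf; rewrite (multopE tg Lf); exact: mul_cls_le.
Qed.

Lemma multop_sym g v u : tame g -> ip (multop g v) u = ip v (multop g u).
Proof.
move=> tg; move: v; apply: cls_ind => f Lf; move: u; apply: cls_ind => f' Lf'.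
rewrite (multopE tg Lf) (multopE tg Lf') (hipE (mul_L2P tg Lf) Lf') (hipE Lf (mul_L2P tg Lf')).
rewrite /ipc; congr cint; apply/funext => x; rewrite !wt_mul.
have -> : conjc ((g (tp x))%:C * wt f x) = (g (tp x))%:C * conjc (wt f x) by rewrite conj_real.
by rewrite -mulrA mulrCA.
Qed.

Lemma tameB g g' : tame g -> tame g' -> tame (fun h => g h - g' h).
Proof.
move=> [h1 h2 h3 [K hK] ha] [h1' h2' h3' [K' hK'] ha']; split.
- by move=> h q hq; rewrite h1// h1'.
- by move=> w h hw; rewrite h2// h2'.
- exact: measurable_funB.
- by exists (K + K') => h; apply: (le_trans (ler_normB _ _)); rewrite lerD.
move=> e e0; have e2 : 0 < e / 2 by lra.
have [u Cu gu] := ha _ e2; have [u' Cu' gu'] := ha' _ e2; exists (fun h => u h - u' h).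
  have := CPW_add Cu (CPW_scale (-1) Cu'); congr CPW; apply/funext => h.
  by rewrite -[LHS]/((u h)%:C + -1 * (u' h)%:C) mulN1r rmorphB.
move=> h; have := gu h; have := gu' h; rewrite !ler_norml; lra.
Qed.

Lemma multopB g g' v : tame g -> tame g' -> multop (fun h => g h - g' h) v = multop g v - multop g' v.
Proof.
move=> tg tg'; move: v; apply: cls_ind => f Lf.
rewrite (multopE (tameB tg tg') Lf) (multopE tg Lf) (multopE tg' Lf).
have E2 := clsB (mul_L2P tg Lf) (mul_L2P tg' Lf); rewrite -E2; congr cls.
by apply/funext => h; rewrite /mulr_fun -[RHS]/(_ - _) rmorphB mulrBl.
Qed.

Definition tpol (g : hR -> R) := exists s, wts s /\ forall h, (g h)%:C = tval s h.

Lemma tpolZ c g : tpol g -> tpol (fun h => c * g h).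
Proof.
move=> [s [hs E]]; exists (tscale c%:C s); split=> [|h]; first exact: wts_scale.
by rewrite tval_scale -E rmorphM.
Qed.

Lemma tpol_sum (I : eqType) (r : seq I) (Pr : pred I) (F : I -> hR -> R) : (forall i, i \in r -> tpol (F i)) ->
  tpol (fun h => \sum_(i <- r | Pr i) F i h).
Proof.
elim: r => [|i r IH] H.
  by exists [::]; split => // h; rewrite /tval !big_nil.
have [s [hs E]] := IH (fun j jr => H j ltac:(by rewrite inE jr orbT)).
have [t [ht E']] := H i ltac:(by rewrite inE eqxx).
exists (if Pr i then t ++ s else s); split=> [|h]; first by case: ifP => // _; exact: wts_cat.
by rewrite big_cons; case: ifP => _; rewrite // tval_cat -E -E' -rmorphD.
Qed.

Lemma tpol_wfun i : tpol (wfun i).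
Proof.
apply: tpolZ; apply: tpol_sum => a /pos_root aP; apply: tpolZ; apply: tpol_sum => j _; apply: tpolZ.
exists [:: (2^-1, a *+ j); (2^-1, - (a *+ j)); (-1, 0)]; split.
  have aj := weightMn j (root_weight aP).
  by move=> x; rewrite !inE => /or3P[] /eqP ->; [exact: aj|exact: weightN|exact: weight0].
move=> h; rewrite /tval !big_cons big_nil /= expwN expw0 /cosm /expw -[a *+ j]scaler_nat pairingZl.
have -> : 2^-1 = (2^-1)%:C :> C by rewrite fmorphV rmorph_nat.
by apply/eqP; rewrite eq_complex /=; apply/andP; split; apply/eqP; field.
Qed.

Definition wpart N p h : R := \sum_(0 <= i < N) p ^+ i * wfun i h.

Lemma CPW_wpart N p : CPW D (fun h => (wpart N p h)%:C).
Proof.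
apply/CPW_tval; split.
  by move=> w h hw; rewrite /wpart; congr (_%:C); apply: eq_bigr => i _; rewrite /wfun (root_sum_weyl _ (wfun_inv i)).
have [s [hs E]] : tpol (wpart N p) by apply: tpol_sum => i _; apply/tpolZ/tpol_wfun.
by exists s; split => //; apply/funext.
Qed.

Lemma tame_wpart N p : tame (wpart N p).
Proof.
have Lw := CPW_L2W (CPW_wpart N p); have /L2W_P[ft fw [mf _] _] := Lw; split.
- by move=> h q hq; have [] := ft h q hq.
- by move=> w h hw; have [] := fw w h hw.
- exact: mf.
- have [_ [s [hs E]]] := (CPW_tval _).1 (CPW_wpart N p); have [K _ hK] := tval_bound s.
  by exists K => h; rewrite -normc_real -[_%:C]/((fun h => (wpart N p h)%:C) h) E.
by move=> e e0; exists (wpart N p) => [|h]; [exact: CPW_wpart|rewrite subrr normr0 ltW].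
Qed.

Lemma tame_wfun i : tame (wfun i).
Proof.
(* A coefficient is the difference of two consecutive partial sums at p = 1. *)
have := tameB (tame_wpart i.+1 1) (tame_wpart i 1); congr tame; apply/funext => h.
by rewrite /wpart big_nat_recr//= addrAC subrr add0r expr1n mul1r.
Qed.

Lemma multop_wpart N p v :
  multop (wpart N p) v = \sum_(i < N) (p ^+ i)%:C *: multop (wfun i) v.
Proof.
move: v; apply: cls_ind => f Lf; rewrite (multopE (tame_wpart N p) Lf).
under [RHS]eq_bigr => i _ do rewrite (multopE (tame_wfun i) Lf) -(clsZ _ (mul_L2P (tame_wfun i) Lf)).
have Lm (i : 'I_N) : L2P (fun h => (p ^+ i)%:C * mulr_fun (wfun i) f h) by exact: L2P_Z (mul_L2P (tame_wfun i) Lf).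
have E2 := cls_sum (index_enum 'I_N) Lm; rewrite -E2; congr cls.
apply/funext => h; rewrite /mulr_fun /wpart big_mkord rmorph_sum mulr_suml.
by apply: eq_bigr => i _; rewrite rmorphM mulrA.
Qed.

Lemma tame_W p : `|p| <= 1/16 -> tame (W_potential D p).
Proof.
move=> p16; split.
- by move=> h q hq; rewrite !W_potentialE; exact: root_sum_torus (W_inv p) hq.
- by move=> w h hw; rewrite !W_potentialE; exact: root_sum_weyl (W_inv p) hw.
- exact: measurable_W.
- by exists (W_max D p) => h; exact: W_bound.
move=> e e0; have [N hN] := @geometric_small _ (8 * Sstr) (8 * `|p|) e
  ltac:(by apply/andP; split; [rewrite mulr_ge0|have := p16; lra]) e0.
by exists (wpart N p) => [|h]; [exact: CPW_wpart|exact: le_trans (W_close N h p16) (hN N (leqnn N))].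
Qed.

(* The cut-off makes the series of [W(p)] converge geometrically; larger [p] are irrelevant. *)
Definition Wop p v : HV := if `|p| <= 1/16 then multop (W_potential D p) v else 0.
Definition womega p : R := if `|p| <= 1/16 then W_max D p else 0.

Lemma wfun0 v : multop (wfun 0) v = 0.
Proof.
have -> : wfun 0 = fun=> 0.
  apply/funext => h; rewrite /wfun /root_sum big1 ?mulr0// => a _.
  by rewrite /lcoef big_geq// mulr0.
have t0 : tame (fun=> 0).
  have := tameB (tame_wpart 0 0) (tame_wpart 0 0); congr tame; apply/funext => h; exact: subrr.
move: v; apply: cls_ind => f Lf; rewrite (multopE t0 Lf).
by have := clsZ 0 Lf; rewrite scale0r => <-; congr cls; apply/funext.
Qed.

Lemma Wop_opana : opana nr nr (fun i => multop (wfun i)) Wop.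
Proof.
exists (8 * Sstr), 8; split => //; first by rewrite mulr_ge0// Sstr_ge0.
move=> p N v; rewrite mulrC -ler_pdivlMr// => h; have p16 : `|p| <= 1/16 by lra.
rewrite /Wop p16 -multop_wpart -(multopB v (tame_W p16) (tame_wpart N p)).
apply: multop_le; first exact: (tameB (tame_W p16) (tame_wpart N p)).
by move=> h'; rewrite [_ * 8]mulrC; exact: W_close.
Qed.

End elliptic_potential.

(** * The closure of T(p) *)

Section transfer.
Implicit Types (f g : hR -> C) (p : R) (v : HV).

Let half : 0 <= (1/2 : R) <= 1/2. Proof. by apply/andP; split; lra. Qed.

(** The dictionary between convergence of representatives and of classes. Only the distances are
    compared, so that the functions [u j] themselves, such as [T_op D p] of a polynomial, need not
    be invariant or periodic. *)
Lemma L2_cvgP (u : nat -> hR -> C) f (V : nat -> HV) x :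
  (forall j, L2_sqnorm D (u j - f) = (nr (V j - x) ^+ 2)%:E) -> L2_cvg D u f <-> vcvg ip V x.
Proof.
move=> E; rewrite /L2_cvg (eq_cvg _ _ E).
have -> : ((nr (V j - x) ^+ 2)%:E @[j --> \oo] --> 0%E) <-> (nr (V j - x) ^+ 2 @[j --> \oo] --> 0).
  by split=> [/fine_cvgP[]//|h]; apply/fine_cvgP; split => //; exact: nearW.
split=> [/cvgrPdist_le h e e0|h].
  have [N _ hN] := h (e ^+ 2) ltac:(by rewrite exprn_gt0); exists N => i /hN /=.
  rewrite sub0r normrN ger0_norm ?sqr_ge0// ler_pXn2r ?nnegrE ?ipn_ge0//; exact: ltW.
apply/cvgrPdist_le => e e0; have [N hN] := h (Num.sqrt e) ltac:(by rewrite sqrtr_gt0).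
exists N => // i /hN hi; rewrite /= sub0r normrN ger0_norm ?sqr_ge0//.
by rewrite -(sqr_sqrtr (ltW e0)) ler_pXn2r ?nnegrE ?ipn_ge0// sqrtr_ge0.
Qed.

Lemma locpow_analytic r (E : R -> R) :
  locpow (E := C^o) (@normc R) r (fun p => (E p)%:C) -> real_analytic r E.
Proof.
move=> hE p; rewrite -ltr_norml => /hE[d [e [e0 H]]].
exists (fun j => Re (d j)), e; split => // q /H[K K0 HK].
apply/cvgrPdist_le => x x0; have [N hN] := geometric_small K half x0.
exists N => // i /hN; apply: le_trans; apply: le_trans (HK i).
have ReB (y z : C) : Re (y - z) = Re y - Re z by case: y z => ? ? [].
have ReD (y z : C) : Re (y + z) = Re y + Re z by case: y z => ? ? [].
apply: le_trans (Re_le_normc _); rewrite [Re _]ReB big_mkord.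
have -> : Re (\sum_(j < i) ((q - p) ^+ j)%:C *: (d j : C^o) : C) = \sum_(j < i) (q - p) ^+ j * Re (d j).
  rewrite (big_morph _ ReD (erefl : Re (0 : C) = 0)); apply: eq_bigr => j _.
  by rewrite -[_ *: _]/(_ * _); case: (d j) => y z /=; ring.
by [].
Qed.

Lemma locpow_L2W r (phi : R -> HV) : locpow nr r phi -> L2W_analytic D r (fun p => rep (phi p)).
Proof.
move=> hphi; split=> [p _|p]; first exact/L2P_L2W/repP.
rewrite -ltr_norml => /hphi[d [e [e0 H]]].
exists (fun j => rep (d j)), e; split => // [j|q _ /H[K K0 HK]]; first exact/L2P_L2W/repP.
have L N : L2P (fun h => \sum_(0 <= j < N) ((q - p) ^+ j)%:C * rep (d j) h).
  by apply: L2P_sum => j; apply: L2P_Z; exact: repP.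
apply/(L2_cvgP (V := fun N => \sum_(j < N) ((q - p) ^+ j)%:C *: d j) (x := phi q)).
  move=> N; rewrite L2_sqnorm_ipn; last by apply: L2P_B => //; exact: repP.
  have Lj j : L2P (fun h => ((q - p) ^+ j)%:C * rep (d j) h) by apply: L2P_Z; exact: repP.
  have E1 := clsB (L N) (repP (phi q)); have E2 := cls_sum (index_iota 0 N) Lj.
  have E3 : \sum_(0 <= j < N) cls (fun h => ((q - p) ^+ j)%:C * rep (d j) h) = \sum_(j < N) ((q - p) ^+ j)%:C *: d j.
    by rewrite big_mkord; apply: eq_bigr => j _; rewrite (clsZ _ (repP (d j))) repK.
  by rewrite E1 E2 E3 repK.
move=> x x0; have [N hN] := geometric_small K half x0.
exists N => i /hN; apply: le_trans; rewrite (vnormBC (ipn_vnorm hip_ip)); exact: HK.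
Qed.

Lemma basis_of_classes m (e : 'I_m -> HV) (S : set (hR -> C)) :
  (forall i, S (rep (e i))) ->
  (forall c : 'I_m -> C, \sum_i c i *: e i = 0 -> forall i, c i = 0) ->
  (forall f, S f -> L2P f /\ exists c : 'I_m -> C, cls f = \sum_i c i *: e i) ->
  is_basis D (fun i => rep (e i)) S.
Proof.
move=> Se ind span.
have Lc (c : 'I_m -> C) : L2P (fun h => \sum_i c i * rep (e i) h).
  by apply: L2P_sum => i; apply: L2P_Z; exact: repP.
have Ec (c : 'I_m -> C) : cls (fun h => \sum_i c i * rep (e i) h) = \sum_i c i *: e i.
  have Li i : L2P (fun h => c i * rep (e i) h) by apply: L2P_Z; exact: repP.
  by rewrite (cls_sum _ Li); apply: eq_bigr => i _; rewrite clsZ ?repK//; exact: repP.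
split=> // [c h0|f /span[Lf [c hc]]].
  apply: ind; rewrite -Ec; apply/(ipn_eq0 hip_ip)/eqP.
  by move: h0; rewrite (L2_sqnorm_ipn (Lc c)) => -[/eqP]; rewrite sqrf_eq0.
by exists c; apply: (cls_inj Lf (Lc c)); rewrite Ec.
Qed.

Local Notation Clo := (Cl ip polyv H0v).

(** H_0 and its polynomial form may differ on the walls, but there the weight Delta vanishes: after
    weighting they agree everywhere. *)
Lemma wt_T_op p s : inv_list s ->
  wt (T_op D p (tval s)) = wt (tval (A0 s) + mulr_fun (W_potential D p) (tval s)).
Proof.
move=> [hs sw]; apply/funext => x; rewrite /wt.
have := Delta_ge0 (tp x); rewrite le_eqVlt => /orP[/eqP <-|D0]; first by rewrite !mul0r.
by rewrite /T_op H0_A0// /offwall -Delta_gt0.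
Qed.

Lemma Wop_cls p f : `|p| <= 1/16 -> L2P f -> Wop p (cls f) = cls (mulr_fun (W_potential D p) f).
Proof. by move=> p16 Lf; rewrite /Wop p16 multopE//; exact: tame_W. Qed.

Lemma WopD p v v' : Wop p (v + v') = Wop p v + Wop p v'.
Proof. by rewrite /Wop; case: ifP => [/tame_W/multopD->//|_]; rewrite addr0. Qed.

Lemma WopZ p c v : Wop p (c *: v) = c *: Wop p v.
Proof. by rewrite /Wop; case: ifP => [/tame_W/multopZ->//|_]; rewrite scaler0. Qed.

Lemma Wop_le p v : nr (Wop p v) <= womega p * nr v.
Proof.
rewrite /Wop /womega; case: ifP => p16; last by rewrite mul0r (vnorm0 (ipn_vnorm hip_ip)).
by apply: multop_le; [exact: tame_W|move=> h; exact: W_bound].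
Qed.

Lemma Wop_sym p v v' : ip (Wop p v) v' = ip v (Wop p v').
Proof.
rewrite /Wop; case: ifP => [p16|_]; first by rewrite multop_sym//; exact: tame_W.
by rewrite (ip0l hip_ip) (ip0r hip_ip).
Qed.

Lemma WopB p v v' : Wop p (v - v') = Wop p v - Wop p v'.
Proof. by rewrite WopD -scaleN1r WopZ scaleN1r. Qed.

Lemma L2_sqnorm_T_op p s g : `|p| <= 1/16 -> inv_list s -> L2P g ->
  L2_sqnorm D (T_op D p (tval s) - g) = (nr (H0v (cls (tval s)) + Wop p (cls (tval s)) - cls g) ^+ 2)%:E.
Proof.
move=> p16 hs Lg; have Ls := inv_L2P hs; have LA := inv_L2P (inv_A0 hs).
have LW := mul_L2P (tame_W p16) Ls; have LAW := L2P_D LA LW.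
rewrite (H0vE hs) (Wop_cls p16 Ls) -(clsD LA LW) -(clsB LAW Lg) -(L2_sqnorm_ipn (L2P_B LAW Lg)).
by rewrite !L2_sqnormE !wtB (wt_T_op p hs).
Qed.

Lemma L2_cvg_small u f (e : R) : L2_cvg D u f -> 0 < e -> exists j, (L2_sqnorm D (f - u j)%R <= e%:E)%E.
Proof.
move=> /fine_cvgP[fin /cvgrPdist_le c] e1; have [N _ hN] := filterI fin (c e e1).
have [/= h1 h2] := hN N (leqnn N); exists N; rewrite L2_sqnormBC -(fineK h1) lee_fin.
by move: h2; rewrite sub0r normrN; apply: le_trans; exact: ler_norm.
Qed.

(** W(p) is bounded, so adding it commutes with closing the graph. From left to right, [f] and [g]
    are limits of polynomials, or of polynomials plus W(p) times polynomials, and so lie in the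
    Hilbert space [HV]. *)
Lemma T_closureP p f g : `|p| <= 1/16 ->
  T_closure D p (f, g) <-> [/\ L2P f, L2P g & Clo (cls f) (cls g - Wop p (cls f))].
Proof.
move=> p16; have Wc u x : vcvg ip u x -> vcvg ip (fun j => Wop p (u j)) (Wop p x).
  exact: vcvg_op (WopB p) (Wop_le p).
have sq s : inv_list s -> L2P f -> L2_sqnorm D (tval s - f) = (nr (cls (tval s) - cls f) ^+ 2)%:E.
  by move=> /inv_L2P Ls Lf; rewrite (L2_sqnorm_ipn (L2P_B Ls Lf)) (clsB Ls Lf).
split=> [[/= Lf Lg [u [hu uf ug]]]|[Lf Lg [V [hV Vf Vg]]]].
  have {}Lf : L2P f.
    apply: L2P_lim => // e e1; have [j hj] := L2_cvg_small uf e1.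
    by exists (u j) => //; exact: CPW_L2P.
  have /choice[s hs] j : exists s, inv_list s /\ u j = tval s.
    by have [uw [s [ws E]]] := (CPW_tval (u j)).1 (hu j); exists s; split => //; split => //; rewrite -E.
  have us : u = fun j => tval (s j) by apply/funext => j; exact: (hs j).2.
  have {}Lg : L2P g.
    apply: L2P_lim => // e e1; have [j hj] := L2_cvg_small ug e1.
    have Ls := inv_L2P (hs j).1; have LA := inv_L2P (inv_A0 (hs j).1).
    exists (tval (A0 (s j)) + mulr_fun (W_potential D p) (tval (s j))); first exact: L2P_D (mul_L2P (tame_W p16) Ls).
    by move: hj; rewrite us !L2_sqnormE !wtB (wt_T_op p (hs j).1).
  have Vf : vcvg ip (fun j => cls (tval (s j))) (cls f).
    by apply/(L2_cvgP (u := u) (f := f)) => // j; rewrite us; apply: sq => //; exact: (hs j).1.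
  have Vg : vcvg ip (fun j => H0v (cls (tval (s j))) + Wop p (cls (tval (s j)))) (cls g).
    apply/(L2_cvgP (u := fun j => T_op D p (u j)) (f := g)) => // j.
    by rewrite us; apply: L2_sqnorm_T_op => //; exact: (hs j).1.
  split; [exact: Lf|exact: Lg|exists (fun j => cls (tval (s j))); split; [|exact: Vf|]].
    by move=> j; exists (s j); [exact: (hs j).1|].
  exact: eq_vcvg (fun j => addrK _ _) (vcvgB hip_ip Vg (Wc _ _ Vf)).
have /choice[s hs] j : exists s, inv_list s /\ V j = cls (tval s) by have [s] := hV j; exists s.
have Vs : V = fun j => cls (tval (s j)) by apply/funext => j; exact: (hs j).2.
split; [exact: L2P_L2W Lf|exact: L2P_L2W Lg|exists (fun j => tval (s j)); split].
- by move=> j; apply: inv_CPW; exact: (hs j).1.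
- apply/(L2_cvgP (V := V) (x := cls f)) => // j.
  by rewrite Vs; apply: sq => //; exact: (hs j).1.
apply/(L2_cvgP (V := fun j => H0v (V j) + Wop p (V j)) (x := cls g)).
  by move=> j; rewrite Vs; apply: L2_sqnorm_T_op => //; exact: (hs j).1.
have := vcvgD hip_ip Vg (Wc _ _ Vf).
by rewrite subrK.
Qed.

Lemma eigenP p z f : `|p| <= 1/16 ->
  T_eigenspace D p z f <-> L2P f /\ Clo (cls f) (z *: cls f - Wop p (cls f)).
Proof.
move=> p16; rewrite /T_eigenspace /= T_closureP//.
split=> [[Lf _]|[Lf]]; rewrite (clsZ z Lf) => h; split => //; exact: L2P_Z.
Qed.

Lemma normc_leE (z : C) (d : R) : (`|z| <= d%:C) = (normc z <= d).
Proof. exact: lecR. Qed.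

(** Each summand of a vector of [eigenspaces_near] is an eigenvector in the disc, to which the
    spanning property applies; the coefficients are then added. *)
Lemma near_basis p a m (E : 'I_m -> R) (phi : 'I_m -> HV) : `|p| <= 1/16 ->
  (forall l, Clo (phi l) ((E l)%:C *: phi l - Wop p (phi l))) ->
  (forall l, normc ((E l)%:C - a) <= W_max D p) ->
  (forall c : 'I_m -> C, \sum_l c l *: phi l = 0 -> forall l, c l = 0) ->
  (forall z v, Clo v (z *: v - Wop p v) -> normc (z - a) <= W_max D p ->
     exists c : 'I_m -> C, v = \sum_l c l *: phi l) ->
  is_basis D (fun l => rep (phi l)) (eigenspaces_near D p a (W_max D p)).
Proof.
move=> p16 hC hE ind span; apply: basis_of_classes => // [i|f [N [z [v [hz hv ->]]]]].
  exists 1%N, (fun=> (E i)%:C), (fun=> rep (phi i)); split.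
  - by move=> _; rewrite normc_leE.
  - by move=> _; apply/(eigenP _ _ p16); rewrite repK; split; [exact: repP|exact: hC].
  by apply/funext => h; rewrite big_ord1.
have Lv i : L2P (v i) by have [] := (eigenP (z i) (v i) p16).1 (hv i).
split; first exact: L2P_sum.
have /choice[c hc] i : exists c : 'I_m -> C, cls (v i) = \sum_l c l *: phi l.
  by have [_ h] := (eigenP (z i) (v i) p16).1 (hv i); apply: span h _; rewrite -normc_leE.
exists (fun l => \sum_i c i l); rewrite (cls_sum _ Lv).
under eq_bigr do rewrite hc.
by rewrite exchange_big; apply: eq_bigr => l _; rewrite scaler_suml.
Qed.

Lemma womega_small (e : R) : 0 < e -> exists2 d : R, 0 < d & forall p, `|p| < d -> womega p <= e.
Proof.
move=> e1; have S0 := Sstr_ge0; pose B := 64 * Sstr + 1.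
have B0 : 0 < B by rewrite ltr_wpDl// mulr_ge0.
exists (e / B); first exact: divr_gt0.
move=> p; rewrite ltr_pdivlMr// mulrC => h; rewrite /womega; case: ifP => p16; last exact: ltW.
apply: (le_trans (W_max_le p16)); apply: le_trans (ltW h).
by rewrite ler_wpM2r// lerDl.
Qed.

Lemma operator_perturbation (a : C) : exists (m : nat) (r : R) (E : 'I_m -> R -> R) (phi : 'I_m -> R -> HV),
  [/\ 0 < r <= 1/16, forall l, real_analytic r (E l), forall l, locpow nr r (phi l) &
    forall p, `|p| < r -> [/\ forall l, Clo (phi l p) ((E l p)%:C *: phi l p - Wop p (phi l p)),
      forall l, normc ((E l p)%:C - a) <= W_max D p &
      is_basis D (fun l => rep (phi l p)) (eigenspaces_near D p a (W_max D p))]].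
Proof.
have ipP := hip_ip; have cplt := @HV_complete.
have SP := polyv_subspace; have HD := H0vD; have HZ := H0vZ.
have HS := H0v_sym.
have [m [u [dl [dl0 uD uo uH gp]]]] := spectral_gap ipP SP HD HZ HS
  (@flt_dom) (@flt_H0) (@flt_eigen) flt_exists a.
have uC i : Clo (u i) (a *: u i) by rewrite -uH; exact: Cl_Dom.
have wl j : rlin (multop (wfun j)).
  by split=> *; [apply: multopD|apply: multopZ]; exact: tame_wfun.
have Cg := Cl_gap ipP SP HD HZ dl0 uD uo uH gp.
have Cr := resolvent ipP cplt SP HD HZ polyv_dense dl0 uD uo gp.
have AP := analytic_perturbation ipP cplt (ClD ipP SP HD) (ClZ ipP SP HZ) (Cl_sym ipP HS) uC uo dl0 Cg Cr.
have AP1 := AP _ _ _ wl (@wfun0) WopD WopZ Wop_opana.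
have [r [E [phi [/andP[r0 _] hE hphi H]]]] := AP1 _ (fun p v v' _ => Wop_sym p v v') (fun p v _ => Wop_le p v) womega_small.
(* Below 1/16 the cut-off in [Wop] and [womega] is inactive, and they are W(p) and [W_max]. *)
exists m, (Num.min r (1/16)), E, phi.
have rr : Num.min r (1/16) <= r by rewrite ge_min lexx.
have mono (V : lmodType C) (nn : V -> R) (f : R -> V) : locpow nn r f -> locpow nn (Num.min r (1/16)) f.
  by move=> hf p hp; apply: hf; exact: lt_le_trans rr.
split; [by rewrite lt_min r0 ge_min lexx orbT; lra|by move=> l; apply/locpow_analytic/mono|by move=> l; exact: mono|].
move=> p; rewrite lt_min => /andP[pr /ltW p16]; have [h1 h2 h3 h4] := H p pr.
have om : womega p = W_max D p by rewrite /womega p16.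
rewrite om in h2 h4; split; [exact: h1|exact: h2|exact: (near_basis p16 h1 h2 h3 h4)].
Qed.

End transfer.

End torus.

Theorem theorem3p6 (R : realType) (n : nat) (D : cm_data R n)
    (coupling_gt0 : forall b : 'rV[R]_n, b \in cm_roots D -> 0 < cm_coupling D b)
    (a : R[i]) (a_spectrum : T_spectrum D 0 a) :
  exists (m : nat) (r : R),
    [/\ has_dim D (T_eigenspace D 0 a) m,
        0 < r <= 1,
        forall p : R, - r < p < r ->
          has_dim D (eigenspaces_near D p a (W_max D p)) m &
        exists (E : 'I_m -> R -> R) (phi : 'I_m -> R -> ('cV[R]_n -> R[i])),
          [/\ forall l, real_analytic r (E l),
              forall l, L2W_analytic D r (phi l),
              forall p : R, - r < p < r -> forall l,
                T_closure D p (phi l p, fun h => (E l p)%:C * phi l p h) &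
              forall p : R, - r < p < r ->
                is_basis D (phi^~ p) (eigenspaces_near D p a (W_max D p))]].
Proof.
have [e0 e0P] := potential_const D.
have [m [r [E [phi [/andP[r0 r16] hE hphi H]]]]] := operator_perturbation coupling_gt0 e0P a.
have p16 (p : R) : `|p| < r -> `|p| <= 1/16 by move=> /ltW h; exact: le_trans r16.
have eig p l : `|p| < r -> T_eigenspace D p (E l p)%:C (rep (phi l p)).
  move=> pr; apply/(eigenP coupling_gt0 e0P _ _ (p16 _ pr)); rewrite repK.
  by split; [exact: repP|have [] := H p pr].
exists m, r; split.
(* At p = 0 the radius [W_max] is 0, so the disc is the point [a] and the basis at p = 0 is one of
   the unperturbed eigenspace: [m] is its dimension. *)
- have z0 : `|0 : R| < r by rewrite normr0.
  exists (fun l => rep (phi l 0)); have [_ near0 [b1 b2 b3]] := H 0 z0; split => //.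
    move=> l; have := eig 0 l z0; congr T_eigenspace; apply/eqP; rewrite -subr_eq0; apply/eqP.
    apply: eq0_normc; apply/eqP; rewrite eq_le normc_ge0 andbT; by apply: le_trans (near0 l) _; rewrite W_max0 lexx.
  move=> f hf; apply: b3; exists 1%N, (fun=> a), (fun=> f); split => //.
    by move=> _; rewrite subrr normr0 W_max0.
  by apply/funext => h; rewrite big_ord1.
- by rewrite r0; apply: le_trans r16 _; lra.
- by move=> p; rewrite -ltr_norml => /H[_ _ b]; exists (fun l => rep (phi l p)).
exists E, (fun l p => rep (phi l p)); split => //.
- by move=> l; exact: locpow_L2W.
- by move=> p; rewrite -ltr_norml => pr l; exact: eig.
by move=> p; rewrite -ltr_norml => /H[].
Qed.
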